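(* Let $d\ge1$, $\alpha>-1$ and $\beta\ge\alpha+d+1>d$. Fix a countable dense subset $\mathcal{D}\subset\mathbb{D}_d$ and a sequence $(s_n)_{n\ge1}$ with $s_n>\beta$ such that $\sum_{n=1}^\infty(s_n-\beta)<\infty$. Let $\Pi$ be a point process on $\mathbb{D}_d$ satisfying the small variance assumption and having first intensity measure $$\frac{\lambda\,dv_d(z)}{(1-|z|^2)^{\beta+1}}$$ with $\lambda>0$ a constant. Then $\Pi$-almost any $X\in\mathrm{Conf}(\mathbb{D}_d)$ satisfies: (1) For any $n$ and any $z\in\mathcal{D}$, $$\sum_{k=0}^\infty\Big\|\sum_{x\in X,\ k\le d_B(z,x)<k+1}e^{-s_nd_B(z,x)}\left(\frac{|1-x\cdot\bar z|^2}{1-|z|^2}\right)^{\beta-d}K^\alpha_x\Big\|_{A^2_\alpha(\mathbb{D}_d)}<\infty.$$ (2) For any $z\in\mathcal{D}$, $$\lim_{n\to\infty}\left\|\frac{\sum_{k=0}^\infty\sum_{x\in X,\ k\le d_B(z,x)<k+1}e^{-s_nd_B(z,x)}\left(\frac{|1-x\cdot\bar z|^2}{1-|z|^2}\right)^{\beta-d}K^\alpha_x}{\sum_{x\in X}e^{-s_nd_B(z,x)}\left(\frac{|1-x\cdot\bar z|^2}{1-|z|^2}\right)^{\beta-d}}-K^\alpha_z\right\|_{A^2_\alpha(\mathbb{D}_d)}=0.$$ (3) The limit equality $$f(z)=\lim_{n\to\infty}\frac{\sum_{k=0}^\infty\sum_{x\in X,\ k\le d_B(z,x)<k+1}e^{-s_nd_B(z,x)}\left(\frac{|1-x\cdot\bar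 z|^2}{1-|z|^2}\right)^{\beta-d}f(x)}{\sum_{x\in X}e^{-s_nd_B(z,x)}\left(\frac{|1-x\cdot\bar z|^2}{1-|z|^2}\right)^{\beta-d}}$$ holds simultaneously for all $f\in A^2_\alpha(\mathbb{D}_d)$ and any $z\in\mathcal{D}$.
   Context: $\mathbb{D}_d=\{z\in\mathbb{C}^d:|z|<1\}$, $v_d$ is Lebesgue measure normalized so that $v_d(\mathbb{D}_d)=1$, and $z\cdot w=\sum_jz_jw_j$. For $w\in\mathbb{D}_d\setminus\{0\}$, $$\varphi_w(z)=\frac{w-\frac{z\cdot\bar w}{|w|^2}w-\sqrt{1-|w|^2}\left(z-\frac{z\cdot\bar w}{|w|^2}w\right)}{1-z\cdot\bar w},$$ and $\varphi_0(z)=-z$. The Bergman distance is $d_B(z,w)=\log\frac{1+|\varphi_w(z)|}{1-|\varphi_w(z)|}$. $A^2_\alpha(\mathbb{D}_d)$ is the space of holomorphic $f$ on $\mathbb{D}_d$ with $\int_{\mathbb{D}_d}|f(z)|^2(1-|z|^2)^\alpha dv_d(z)<\infty$; its reproducing kernel is $K^\alpha(z,w)=\frac{C_{d,\alpha}}{(1-z\cdot\bar w)^{d+1+\alpha}}$ with a constant $C_{d,\alpha}>0$, and $K^\alpha_x(y)=K^\alpha(y,x)$. A configuration on a locally compact complete separable metric space $E$ is a collection of points of $E$ (possibly with multiplicities) with finitely many points in each relatively compact set; $\mathrm{Conf}(E)$ is the space of configurations with the usual Borel structure. Sums over $x\in X$ are taken with multiplicity. A point process on $E$ is a Borel probability measure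 $\Pi$ on $\mathrm{Conf}(E)$; its first intensity measure is $B\mapsto\mathbb{E}_\Pi(\#_B(\mathscr{X}))$, with $\mathscr{X}$ the random configuration and $\#_B$ the number of points in $B$. Small variance assumption: there is a constant $C>0$ depending only on $\Pi$ such that for every $f:E\to\mathbb{C}$ with $\mathbb{E}_\Pi[\sum_{x\in\mathscr{X}}(|f(x)|+|f(x)|^2)]<\infty$, $$\mathrm{Var}_\Pi\Big(\sum_{x\in\mathscr{X}}f(x)\Big)\le C\,\mathbb{E}_\Pi\Big(\sum_{x\in\mathscr{X}}|f(x)|^2\Big).$$ *)

(* Defs.v *)
From HB Require Import structures.
From mathcomp Require Import all_boot all_order all_algebra.
From mathcomp Require Import complex lra.
From mathcomp Require Import all_classical all_reals all_analysis.
From mathcomp Require Import measurable_realfun.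

Set Implicit Arguments.
Unset Strict Implicit.
Unset Printing Implicit Defensive.

Import Order.TTheory GRing.Theory Num.Theory.
Import numFieldNormedType.Exports.

Local Open Scope classical_set_scope.
Local Open Scope ring_scope.

(* R[i] seen through numClosedFieldType inherits the norm topology of a
   numFieldType, which the bare type R[i] does not. *)
Definition C (R : realType) : numClosedFieldType := R[i].

Section ComplexNumbers.
Context {R : realType}.
Implicit Types z : C R.

Definition cRe z : R := complex.Re z.
Definition cIm z : R := complex.Im z.
Definition toC (x : R) : C R := Complex x 0.

Definition cabs z : R := cRe `|z|.

(* principal argument, in ]-pi, pi]; 0 at z = 0 *)
Definition carg z : R :=
  if z == 0 then 0
  else if 0 <= cIm z then acos (cRe z / cabs z) else - acos (cRe z / cabs z).

(* principal branch of z ^ a *)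
Definition cpow z (a : R) : C R :=
  toC (cabs z `^ a) * Complex (cos (a * carg z)) (sin (a * carg z)).

End ComplexNumbers.

Section Vectors.
Context {R : realType} {d : nat}.
Implicit Types z w : 'rV[C R]_d.

Definition cdot z w : C R := \sum_j z ord0 j * w ord0 j.
Definition conjv w : 'rV[C R]_d := \row_j (w ord0 j)^*.
Definition cnorm z : R := Num.sqrt (\sum_j cabs (z ord0 j) ^+ 2).
Definition uball : set 'rV[C R]_d := [set z | cnorm z < 1].

Definition mobius w z : 'rV[C R]_d :=
  if w == 0 then - z else
  let p := (cdot z (conjv w) / toC (cnorm w ^+ 2)) *: w in
  (1 - cdot z (conjv w))^-1 *:
    (w - p - toC (Num.sqrt (1 - cnorm w ^+ 2)) *: (z - p)).

Definition dB z w : R :=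
  ln ((1 + cnorm (mobius w z)) / (1 - cnorm (mobius w z))).

End Vectors.
Arguments uball : clear implicits.

Section LebesgueTuple.
Context {R : realType}.

Definition tcons n (p : measurableTypeR R * n.-tuple (measurableTypeR R)) :
  n.+1.-tuple (measurableTypeR R) := [tuple of p.1 :: p.2].

Lemma measurable_tcons n : measurable_fun [set: _] (@tcons n).
Proof. by apply: measurable_cons; [exact: measurable_fst|exact: measurable_snd]. Qed.

Section step.
Variables (n : nat)
  (m : {sigma_finite_measure set (n.-tuple (measurableTypeR R)) -> \bar R}).

Let leb1 : {sigma_finite_measure set (measurableTypeR R) -> \bar R} :=
  @lebesgue_measure R.

Let lebxm : {measure set _ -> \bar R} := product_measure1 leb1 m.

Definition leb_step : set (n.+1.-tuple (measurableTypeR R)) -> \bar R :=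
  pushforward lebxm (@tcons n).

HB.instance Definition _ := Measure.copy leb_step
  (measure_function_pushforward__canonical__measure_function_Measure
    lebxm (@measurable_tcons n)).

Let leb_step_sigma_finite : sigma_finite setT leb_step.
Proof.
have /sigma_finiteP[F [TF ndF Foo]] := sigma_finiteT leb1.
have /sigma_finiteP[G [TG ndG Goo]] := sigma_finiteT m.
pose u (t : n.+1.-tuple (measurableTypeR R)) := (thead t, [tuple of behead t]).
have mu : measurable_fun [set: _] u.
  apply/measurable_fun_pairP; split; last exact: measurable_behead.
  exact: measurable_tnth.
have tK p : u (@tcons n p) = p.
  by case: p => x t; congr pair; apply/val_inj.
exists (fun k => u @^-1` (F k `*` G k)).
  apply/esym; rewrite -subTset => t _.
  have : (\bigcup_k F k) (thead t) by rewrite -TF.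
  have : (\bigcup_k G k) [tuple of behead t] by rewrite -TG.
  move=> [k _ Gk] [l _ Fl]; exists (maxn l k) => //; split => /=.
    by move: Fl; exact/subsetPset/ndF/leq_maxl.
  by move: Gk; exact/subsetPset/ndG/leq_maxr.
move=> k; have [mFk Fkoo] := Foo k; have [mGk Gkoo] := Goo k; split.
  by rewrite -[X in measurable X]setTI; apply: mu => //; exact: measurableX.
rewrite /leb_step /pushforward -comp_preimage (_ : _ \o _ = id); last first.
  by apply/funext => p; exact: tK.
by rewrite preimage_id /= product_measure1E// lte_mul_pinfty// ge0_fin_numE.
Qed.

HB.instance Definition _ :=
  Measure_isSigmaFinite.Build _ _ _ leb_step leb_step_sigma_finite.

End step.

Fixpoint leb_tuple n :
    {sigma_finite_measure set (n.-tuple (measurableTypeR R)) -> \bar R} :=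
  if n is n'.+1 then leb_step (leb_tuple n')
  else \d_([tuple] : 0.-tuple (measurableTypeR R)).

End LebesgueTuple.

Section LebesgueC.
Context {R : realType} (d : nat).

Definition Cvec := g_sigma_algebraType (@open 'rV[C R]_d).

Definition of_reals (t : (d + d).-tuple (measurableTypeR R)) : 'rV[C R]_d :=
  \row_j Complex (tnth t (lshift d j)) (tnth t (rshift d j)).

Lemma measurable_of_reals : measurable_fun [set: _] (of_reals : _ -> Cvec).
Proof.
apply: (@measurability _ _ _ Cvec setT of_reals (@open 'rV[C R]_d)) => //.
move=> _ [U oU <-]; rewrite setTI.
pose box (p : {ffun 'I_(d + d) -> rat} * nat) :
    set ((d + d).-tuple (measurableTypeR R)) :=
  [set t | forall i, `|(tnth t i : R) - ratr (p.1 i)| < p.2.+1%:R^-1].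
have mbox p : measurable (box p).
  rewrite (_ : box p = \bigcap_(i in [set: 'I_(d + d)])
     ((fun t : (d + d).-tuple (measurableTypeR R) => tnth t i) @^-1`
        (ball (ratr (p.1 i) : R) p.2.+1%:R^-1))); last first.
    apply/seteqP; split => [t bt i _|t bt i]/=.
      by rewrite /ball /= distrC.
    by have := bt i I; rewrite /ball /= distrC.
  apply: fin_bigcap_measurable => // i _.
  rewrite -[X in measurable X]setTI; apply: measurable_tnth => //.
  exact: measurable_ball.
rewrite (_ : of_reals @^-1` U = \bigcup_(p in [set: _])
   (if pselect (box p `<=` of_reals @^-1` U) is left _ then box p else set0)).
  apply: countable_bigcupT_measurable; first exact: countableP.
  by move=> p; case: pselect.
apply/seteqP; split; last by move=> t [p _]; case: pselect => // bU /bU.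
move=> t /= Ut.
have /nbhs_ballP[e /= e0 be] : nbhs (of_reals t) U by exact: open_nbhs_nbhs.
have e0' : 0 < complex.Re e by move: e0; rewrite ltcE => /andP[].
have Ee : e = toC (complex.Re e).
  by move: e0; rewrite ltcE => /andP[/eqP]; case: (e) => a b /= -> _.
set r := complex.Re e in e0' Ee.
have [k kr] : exists k : nat, k.+1%:R^-1 < r / 4.
  have := @near_infty_natSinv_lt R (PosNum (divr_gt0 e0' (ltr0n _ 4))).
  by case=> k _ /(_ k) /=; rewrite leqnn => /(_ isT); exists k.
have q_ i : exists q : rat, `|(tnth t i : R) - ratr q| < k.+1%:R^-1.
  have k0 : 0 < k.+1%:R^-1 :> R by rewrite invr_gt0 ltr0n.
  have [x [/= bx [q _ qE]]] := @dense_rat R (ball (tnth t i : R) k.+1%:R^-1)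
    (ex_intro _ _ (ballxx _ k0)) (ball_open _ _).
  by exists q; rewrite qE; move: bx; rewrite /ball.
pose q := [ffun i => projT1 (cid (q_ i))].
have tq : box (q, k) t.
  by move=> i; rewrite /= ffunE; case: (cid (q_ i)).
exists (q, k) => //; case: pselect => // -[] t' t'q; apply: be.
split=> // i j; rewrite !mxE /ball /=.
have tt' l : `|(tnth t l : R) - tnth t' l| < r / 2.
  rewrite (_ : _ - _ = (tnth t l - ratr (q l)) - (tnth t' l - ratr (q l)) :> R);
    last by rewrite opprB addrA subrK.
  apply: (le_lt_trans (ler_normB _ _)).
  apply: (lt_trans (ltrD (tq l) (t'q l))) => /=.
  by rewrite (_ : r / 2 = r / 4 + r / 4); [exact: ltrD|lra].
rewrite Ee normc_def /= ltcR.
have := tt' (lshift d j); have := tt' (rshift d j).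
set u := _ - _ => /ltr_normlP[u1 u2]; set v := _ - _ => /ltr_normlP[v1 v2].
rewrite -[X in _ < X]ger0_norm ?(ltW e0')// -sqrtr_sqr ltr_sqrt ?exprn_gt0//.
by rewrite -/v -/u; nra.
Qed.

Definition leb_C : {measure set Cvec -> \bar R} :=
  measure_function_pushforward__canonical__measure_function_Measure
    (leb_tuple (d + d)) measurable_of_reals.

Let vol_inv_ge0 : 0 <= (fine (leb_C (uball R d)))^-1.
Proof. by rewrite invr_ge0 fine_ge0. Qed.

Definition v_ : {measure set Cvec -> \bar R} :=
  mscale (NngNum vol_inv_ge0) leb_C.

End LebesgueC.

Section Bergman.
Context {R : realType} {d : nat} (alpha : R).
Implicit Types f g : 'rV[C R]_d -> C R.

Definition A2norm f : \bar R :=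
  sqrte (\int[v_ d]_(z in uball R d)
    (cabs (f z) ^+ 2 * (1 - cnorm z ^+ 2) `^ alpha)%:E).

Definition A2 f : Prop :=
  (forall z, uball R d z -> differentiable f z) /\ (A2norm f < +oo)%E.

Definition A2_series (u : nat -> 'rV[C R]_d -> C R) g : Prop :=
  A2 g /\
  (fun N : nat => A2norm (fun y => \sum_(k < N) u k y - g y)) @ \oo --> 0%E.

(* Testing the reproducing formula on f = 1 at the origin forces this value of
   the constant. *)
Definition bergman_const : R :=
  (fine (\int[v_ d]_(z in uball R d) ((1 - cnorm z ^+ 2) `^ alpha)%:E))^-1.

Definition bergman_kernel (z w : 'rV[C R]_d) : C R :=
  toC bergman_const / cpow (1 - cdot z (conjv w)) (d%:R + 1 + alpha).

End Bergman.

(* A configuration is given by its multiplicity function. *)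
Record conf (E : topologicalType) := MkConf {
  mult :> E -> nat;
  mult_locally_finite : forall B : set E,
    precompact B -> finite_set (B `&` [set x | mult x != 0%N]) }.

Definition conf0 (E : topologicalType) : conf E.
Proof.
exists (fun=> 0%N) => B _.
by rewrite (_ : [set x | _] = set0) ?setI0//; apply/seteqP; split.
Defined.

HB.instance Definition _ (E : topologicalType) := gen_eqMixin (conf E).
HB.instance Definition _ (E : topologicalType) := gen_choiceMixin (conf E).
HB.instance Definition _ (E : topologicalType) :=
  isPointed.Build (conf E) (conf0 E).

Section PointProcess.
Context {E : topologicalType}.

Definition borel : set (set E) := <<s open >>.

(* The counting maps of the relatively compact Borel sets generate the Borel
   sigma-algebra of the vague topology on configurations. *)
Definition conf_generators : set (set (conf E)) :=
  [set A | exists B : set E, exists n : nat,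
    [/\ borel B, precompact B &
        A = [set X | (\sum_(x \in B) (X : conf E) x)%N = n]]].

Definition Conf := g_sigma_algebraType conf_generators.

Context {R : realType}.

Definition num_points (B : set E) (X : conf E) : \bar R :=
  \esum_(x in B) (X x)%:R%:E.

Definition first_intensity (Pi : probability Conf R) (B : set E) : \bar R :=
  \int[Pi]_X num_points B X.

Definition sum_nneg (X : conf E) (f : E -> R) : \bar R :=
  \esum_(x in [set: E]) ((X x)%:R * f x)%:E.

Definition sum_real (X : conf E) (f : E -> R) : R :=
  fine (sum_nneg X (fun x => Num.max (f x) 0)) -
  fine (sum_nneg X (fun x => Num.max (- f x) 0)).

Definition sum_complex (X : conf E) (f : E -> C R) : C R :=
  Complex (sum_real X (fun x => cRe (f x))) (sum_real X (fun x => cIm (f x))).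

Definition expectation_C (Pi : probability Conf R) (S : Conf -> C R) : C R :=
  Complex (\int[Pi]_X cRe (S X)) (\int[Pi]_X cIm (S X)).

Definition variance_C (Pi : probability Conf R) (S : Conf -> C R) : \bar R :=
  \int[Pi]_X (cabs (S X - expectation_C Pi S) ^+ 2)%:E.

Definition small_variance (Pi : probability Conf R) : Prop :=
  exists2 c : R, 0 < c & forall f : E -> C R,
    (forall U : set (C R), open U -> borel (f @^-1` U)) ->
    (\int[Pi]_X sum_nneg X (fun x => (cabs (f x) + cabs (f x) ^+ 2)%R) < +oo)%E ->
    (variance_C Pi (sum_complex ^~ f) <=
     c%:E * \int[Pi]_X sum_nneg X (fun x => (cabs (f x) ^+ 2)%R))%E.

End PointProcess.
Arguments Conf : clear implicits.

Section Averages.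
Context {R : realType} {d : nat} (beta : R) (X : conf (uball R d)).

Definition weight (s : R) (z x : 'rV[C R]_d) : R :=
  expR (- s * dB z x) *
  (cabs (1 - cdot x (conjv z)) ^+ 2 / (1 - cnorm z ^+ 2)) `^ (beta - d%:R).

Definition shell (z : uball R d) (k : nat) : set (uball R d) :=
  [set x | k%:R <= dB (\val z) (\val x) < k.+1%:R].

Definition shell_sum (s : R) (z : uball R d) (F : 'rV[C R]_d -> C R)
    (k : nat) : C R :=
  \sum_(x \in shell z k)
    (X x)%:R * (toC (weight s (\val z) (\val x)) * F (\val x)).

Definition shell_kernel_sum (alpha s : R) (z : uball R d) (k : nat)
    (y : 'rV[C R]_d) : C R :=
  shell_sum s z (fun x => bergman_kernel alpha y x) k.

(* An infinite total weight is read as 0, and division by it then yields 0. *)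
Definition total_weight (s : R) (z : uball R d) : R :=
  fine (sum_nneg X (fun x => weight s (\val z) (\val x))).

End Averages.

(* Main.v *)
Require Import Defs.
From HB Require Import structures.
From mathcomp Require Import all_boot all_order all_algebra.
From mathcomp Require Import complex ring lra.
From mathcomp Require Import all_classical all_reals all_analysis.
From mathcomp Require Import measurable_realfun.

Set Implicit Arguments.
Unset Strict Implicit.
Unset Printing Implicit Defensive.

Import Order.TTheory GRing.Theory Num.Theory.
Import numFieldNormedType.Exports.

Local Open Scope classical_set_scope.
Local Open Scope ring_scope.

(** Why averaging over the points reconstructs the function.

    Put [q = exp (- (s - beta))], which increases to [1] as [s] decreases to [beta].  Cut the
    ball into the hyperbolic shells [k <= d_B(z, x) < k + 1].  In the Moebius coordinate
    [u = mobius z x] the weights, the intensity and the Jacobian combine into a radial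
    density, and integrals over the shells can be computed: the expected weight of the
    [k]-th shell is of order [q ^ k].  The expected total weight [C_s] is therefore of order
    [1 / (1 - q)].  Moreover the expectation of the kernel sum over a shell is exactly the
    expected weight of that shell times [K_z].  This is the mean value property of
    antiholomorphic functions, transported by the Moebius map: the weight contains precisely
    the power of [|1 - x . conj z|] that the change of variables asks for.

    The small variance assumption, applied at every point [y] to the real and imaginary parts
    of the kernel sum and then integrated in [y], bounds the mean square of the [A^2]-distance
    between the kernel sum over a shell and its expectation by the integral of
    [weight ^ 2 * K(x, x)] against the intensity.  Because [beta >= alpha + d + 1] this is
    at most of order [q ^ 2k] (lemma [kernel_variance]; [weight_variance] is the scalar
    analogue).  Two consequences follow.

    For one exponent, the shell deviations divided by [q ^ k] are almost surely summable, so
    that the series of norms converges ([shell_norm_sum]), and by completeness of the Bergman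
    space the kernel sums converge in it.

    For the sequence of exponents, the variance over all shells, divided by [C_s ^ 2], is of
    order [(1 - q) ^ 2 / (1 - q ^ 2)], hence at most of order [s - beta]
    ([normalized_variance]).  These numbers are summable, so the normalized deviations tend to
    zero almost surely ([ae_kernel_deviation], [ae_weight_deviation]).  Truncations to
    finitely many shells are passed to the limit with lower limits and Fatou's lemma.
    Deterministically, closeness of the total weight to [C_s] and of the kernel sum to
    [C_s K_z] makes the quotient close to [K_z] ([average_deviation]); pairing with [f] and
    the reproducing property give the pointwise statement for all [f] at once
    ([shell_sum_cvg], [average_value]).  The dense set being countable, one null set serves
    all its points.

    The analytic ingredients are the invariant measure and the Moebius maps of the ball, the
    mean value property of holomorphic functions on balls (from Goursat's theorem), the
    reproducing property of the Bergman kernel and the completeness of the Bergman space. *)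

(** * Complex arithmetic through real and imaginary parts *)

Section ComplexBasics.
Context {R : realType}.
Implicit Types (z w : C R) (x y : R).

Lemma ceqP z w : cRe z = cRe w -> cIm z = cIm w -> z = w.
Proof. by case: z w => [a b] [c e] /= -> ->. Qed.

Lemma cReE (a b : R) : cRe (Complex a b : C R) = a. Proof. by []. Qed.
Lemma cImE (a b : R) : cIm (Complex a b : C R) = b. Proof. by []. Qed.
Lemma cReD z w : cRe (z + w) = cRe z + cRe w. Proof. by case: z w => [a b] []. Qed.
Lemma cImD z w : cIm (z + w) = cIm z + cIm w. Proof. by case: z w => [a b] []. Qed.
Lemma cReN z : cRe (- z) = - cRe z. Proof. by case: z. Qed.
Lemma cImN z : cIm (- z) = - cIm z. Proof. by case: z. Qed.
Lemma cReM z w : cRe (z * w) = cRe z * cRe w - cIm z * cIm w.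
Proof. by case: z w => [a b] []. Qed.
Lemma cImM z w : cIm (z * w) = cRe z * cIm w + cIm z * cRe w.
Proof. by case: z w => [a b] []. Qed.
Lemma cRe0 : cRe (0 : C R) = 0. Proof. by []. Qed.
Lemma cIm0 : cIm (0 : C R) = 0. Proof. by []. Qed.
Lemma cRe1 : cRe (1 : C R) = 1. Proof. by []. Qed.
Lemma cIm1 : cIm (1 : C R) = 0. Proof. by []. Qed.
Lemma cRe_toC x : cRe (toC x) = x. Proof. by []. Qed.
Lemma cIm_toC x : cIm (toC x) = 0. Proof. by []. Qed.
Lemma cReJ z : cRe (z^*) = cRe z.
Proof. by rewrite -[z^*]/(conjc z); case: z. Qed.
Lemma cImJ z : cIm (z^*) = - cIm z.
Proof. by rewrite -[z^*]/(conjc z); case: z. Qed.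

Definition cE := (cReD, cImD, cReN, cImN, cReM, cImM, cRe0, cIm0, cRe1, cIm1,
  cRe_toC, cIm_toC, cReJ, cImJ, cReE, cImE).

Lemma toC0 : toC 0 = 0 :> C R. Proof. by []. Qed.
Lemma toC1 : toC 1 = 1 :> C R. Proof. by []. Qed.
Lemma toCD x y : toC (x + y) = toC x + toC y :> C R.
Proof. by apply: ceqP; rewrite !cE ?addr0. Qed.
Lemma toCM x y : toC (x * y) = toC x * toC y :> C R.
Proof. by apply: ceqP; rewrite !cE; ring. Qed.
Lemma toCN x : toC (- x) = - toC x :> C R.
Proof. by apply: ceqP; rewrite !cE ?oppr0. Qed.
Lemma toCB x y : toC (x - y) = toC x - toC y :> C R.
Proof. by rewrite toCD toCN. Qed.
Lemma toC_eq0 x : (toC x == 0 :> C R) = (x == 0).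
Proof. by apply/eqP/eqP => [[]//|->]. Qed.
Lemma toCV x : toC x^-1 = (toC x)^-1 :> C R.
Proof.
have [->|x0] := eqVneq x 0; first by rewrite toC0 !invr0.
apply: (@mulfI _ (toC x)); first by rewrite toC_eq0.
by rewrite -toCM !divff ?toC_eq0.
Qed.
Lemma toC_div x y : toC (x / y) = toC x / toC y :> C R.
Proof. by rewrite toCM toCV. Qed.

Lemma toC_nat n : toC n%:R = n%:R :> C R.
Proof. by elim: n => // n ih; rewrite -addn1 !natrD toCD ih. Qed.
Lemma toC_conj x : (toC x)^* = toC x :> C R.
Proof. by apply: ceqP; rewrite !cE ?oppr0. Qed.

Lemma cRe_sum I (r : seq I) (P : pred I) (F : I -> C R) :
  cRe (\sum_(i <- r | P i) F i) = \sum_(i <- r | P i) cRe (F i).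
Proof. by elim/big_rec2: _ => // i a b _ <-; rewrite cReD. Qed.
Lemma cIm_sum I (r : seq I) (P : pred I) (F : I -> C R) :
  cIm (\sum_(i <- r | P i) F i) = \sum_(i <- r | P i) cIm (F i).
Proof. by elim/big_rec2: _ => // i a b _ <-; rewrite cImD. Qed.
Lemma toC_sum I (r : seq I) (P : pred I) (F : I -> R) :
  toC (\sum_(i <- r | P i) F i) = \sum_(i <- r | P i) toC (F i) :> C R.
Proof. by elim/big_rec2: _ => // i a b _ <-; rewrite toCD. Qed.

Lemma cabsE z : cabs z = Num.sqrt (cRe z ^+ 2 + cIm z ^+ 2).
Proof. by rewrite /cabs [`|z|]normc_def. Qed.
Lemma norm_toC z : `|z| = toC (cabs z).
Proof. by rewrite cabsE [`|z|]normc_def. Qed.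
Lemma cabs_ge0 z : 0 <= cabs z. Proof. by rewrite cabsE sqrtr_ge0. Qed.
Lemma sqr_cabs z : cabs z ^+ 2 = cRe z ^+ 2 + cIm z ^+ 2.
Proof. by rewrite cabsE sqr_sqrtr// addr_ge0// sqr_ge0. Qed.
Lemma cabsM z w : cabs (z * w) = cabs z * cabs w.
Proof. by rewrite /cabs normrM !norm_toC -toCM. Qed.
Lemma cabsD z w : cabs (z + w) <= cabs z + cabs w.
Proof.
have := ler_normD z w; rewrite !norm_toC -toCD.
by rewrite [toC _ <= toC _]lecR.
Qed.
Lemma cabsN z : cabs (- z) = cabs z.
Proof. by rewrite /cabs normrN. Qed.
Lemma cabsB z w : cabs (z - w) <= cabs z + cabs w.
Proof. by rewrite -(cabsN w) cabsD. Qed.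
Lemma cabsBC z w : cabs (z - w) = cabs (w - z).
Proof. by rewrite -cabsN opprB. Qed.
Lemma cabs0 : cabs (0 : C R) = 0. Proof. by rewrite /cabs normr0. Qed.
Lemma cabs1 : cabs (1 : C R) = 1. Proof. by rewrite /cabs normr1. Qed.
Lemma cabs_eq0 z : (cabs z == 0) = (z == 0).
Proof. by rewrite -[in RHS](normr_eq0 z) norm_toC toC_eq0. Qed.
Lemma cabs_gt0 z : (0 < cabs z) = (z != 0).
Proof. by rewrite lt0r cabs_eq0 cabs_ge0 andbT. Qed.
Lemma cabsV z : cabs z^-1 = (cabs z)^-1.
Proof. by rewrite /cabs normfV norm_toC -toCV. Qed.
Lemma cabs_div z w : cabs (z / w) = cabs z / cabs w.
Proof. by rewrite cabsM cabsV. Qed.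
Lemma cabsJ z : cabs (z^*) = cabs z.
Proof. by rewrite !cabsE cReJ cImJ sqrrN. Qed.
Lemma cabs_toC x : cabs (toC x) = `|x|.
Proof. by rewrite cabsE /= expr0n addr0 sqrtr_sqr. Qed.

Lemma ler_cRe z : `|cRe z| <= cabs z.
Proof. by rewrite cabsE -sqrtr_sqr ler_wsqrtr// lerDl sqr_ge0. Qed.
Lemma ler_cIm z : `|cIm z| <= cabs z.
Proof. by rewrite cabsE -sqrtr_sqr ler_wsqrtr// lerDr sqr_ge0. Qed.
Lemma cabs_le z : cabs z <= `|cRe z| + `|cIm z|.
Proof.
rewrite -(ger0_norm (cabs_ge0 z)) -ler_sqr ?nnegrE ?addr_ge0 ?normr_ge0//.
rewrite (ger0_norm (cabs_ge0 z)) sqr_cabs sqrrD !real_normK ?num_real//.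
by rewrite -addrA [X in _ <= _ + X]addrC -subr_ge0;
   have := mulr_ge0 (normr_ge0 (cRe z)) (normr_ge0 (cIm z)); lra.
Qed.
Lemma ler_cabsB z w : cabs z - cabs w <= cabs (z - w).
Proof. by rewrite lerBlDr -{1}(subrK w z) cabsD. Qed.
Lemma mul_conj z : z * z^* = toC (cabs z ^+ 2).
Proof. by apply: ceqP; rewrite !cE ?sqr_cabs; ring. Qed.
Lemma conjD z w : (z + w)^* = z^* + w^*. Proof. exact: raddfD. Qed.
Lemma conjB z w : (z - w)^* = z^* - w^*. Proof. exact: raddfB. Qed.
Lemma conjM z w : (z * w)^* = z^* * w^*. Proof. exact: rmorphM. Qed.
Lemma conjV z : (z^-1)^* = (z^*)^-1. Proof. exact: fmorphV. Qed.
Lemma conj_sum I (r : seq I) (P : pred I) (F : I -> C R) :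
  (\sum_(i <- r | P i) F i)^* = \sum_(i <- r | P i) (F i)^*.
Proof. exact: raddf_sum. Qed.
Lemma conj1 : (1 : C R)^* = 1. Proof. exact: rmorph1. Qed.

Lemma cReV z : cRe z^-1 = cRe z / cabs z ^+ 2.
Proof.
have [->|z0] := eqVneq z 0; first by rewrite invr0 mul0r.
have -> : z^-1 = z^* * toC (cabs z ^+ 2)^-1.
  rewrite toCV -mul_conj invfM [z^-1 * _]mulrC mulrA mulfV ?mul1r//.
  by rewrite -cabs_eq0 cabsJ cabs_eq0.
by rewrite !cE mulr0 subr0.
Qed.
Lemma cImV z : cIm z^-1 = - cIm z / cabs z ^+ 2.
Proof.
have [->|z0] := eqVneq z 0; first by rewrite invr0 /= oppr0 mul0r.
have -> : z^-1 = z^* * toC (cabs z ^+ 2)^-1.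
  rewrite toCV -mul_conj invfM [z^-1 * _]mulrC mulrA mulfV ?mul1r//.
  by rewrite -cabs_eq0 cabsJ cabs_eq0.
by rewrite !cE mulr0 add0r.
Qed.

(* the topology of C R has complex radii; real ones suffice *)
Lemma posC (e : C R) : 0 < e -> exists2 r : R, 0 < r & e = toC r.
Proof.
case: e => a b; rewrite ltcE /= => /andP[/eqP -> a0]; by exists a.
Qed.
Lemma toC_gt0 x : (0 < toC x :> C R) = (0 < x).
Proof. exact: ltcR. Qed.
Lemma toC_lt x y : (toC x < toC y :> C R) = (x < y).
Proof. exact: ltcR. Qed.
Lemma toC_le x y : (toC x <= toC y :> C R) = (x <= y).
Proof. exact: lecR. Qed.

Lemma nbhs_cabsP z (A : set (C R)) :
  nbhs z A <-> exists2 e : R, 0 < e & forall w, cabs (w - z) < e -> A w.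
Proof.
split=> [/nbhs_ballP[e /= /posC[r r0 ->] h]|[e e0 h]].
  exists r => // w wz; apply: h; rewrite /ball /=.
  by rewrite norm_toC toC_lt cabsBC.
apply/nbhs_ballP; exists (toC e) => /=; first by rewrite toC_gt0.
by move=> w; rewrite /ball /= norm_toC toC_lt cabsBC => /h.
Qed.

Lemma cvg_cabsP {T : Type} (F : set_system T) {FF : Filter F} (f : T -> C R)
    (l : C R) :
  f @ F --> l <-> forall e : R, 0 < e -> \forall t \near F, cabs (f t - l) < e.
Proof.
split=> [h e e0|h A /nbhs_cabsP[e e0 hA]].
  have : nbhs l [set w | cabs (w - l) < e] by apply/nbhs_cabsP; exists e.
  by move=> /h.
by have := h e e0; apply: filterS => x; exact: hA.
Qed.

Lemma cvg_cabs {T : Type} (F : set_system T) {FF : Filter F} (f : T -> C R)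
    (l : C R) : (fun t => cabs (f t - l)) @ F --> 0 <-> f @ F --> l.
Proof.
rewrite cvg_cabsP; split=> [/cvgrPdist_lt h e e0|h].
  have := h e e0; apply: filterS => x.
  by rewrite sub0r normrN ger0_norm ?cabs_ge0.
apply/cvgrPdist_lt => e e0; have := h e e0; apply: filterS => x.
by rewrite sub0r normrN ger0_norm ?cabs_ge0.
Qed.

End ComplexBasics.

Section VectorBasics.
Context {R : realType} {d : nat}.
Implicit Types (u v z w : 'rV[C R]_d).

Lemma cnorm_ge0 z : 0 <= cnorm z. Proof. exact: sqrtr_ge0. Qed.
Lemma sqr_cnorm z : cnorm z ^+ 2 = \sum_j cabs (z ord0 j) ^+ 2.
Proof. by rewrite sqr_sqrtr// sumr_ge0// => i _; rewrite sqr_ge0. Qed.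
Lemma cdot_conj z : cdot z (conjv z) = toC (cnorm z ^+ 2).
Proof.
rewrite sqr_cnorm toC_sum; apply: eq_bigr => j _.
by rewrite mxE mul_conj.
Qed.
Lemma cdotC z w : cdot z w = cdot w z.
Proof. by apply: eq_bigr => j _; rewrite mulrC. Qed.
Lemma cdotDl z w v : cdot (z + w) v = cdot z v + cdot w v.
Proof. by rewrite -big_split; apply: eq_bigr => j _; rewrite mxE mulrDl. Qed.
Lemma cdotZl a z w : cdot (a *: z) w = a * cdot z w.
Proof. by rewrite mulr_sumr; apply: eq_bigr => j _; rewrite mxE mulrA. Qed.
Lemma cdotNl z w : cdot (- z) w = - cdot z w.
Proof. by rewrite -scaleN1r cdotZl mulN1r. Qed.
Lemma cdotBl z w v : cdot (z - w) v = cdot z v - cdot w v.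
Proof. by rewrite cdotDl cdotNl. Qed.
Lemma cdot0l w : cdot 0 w = 0.
Proof. by rewrite -(scale0r 0) cdotZl mul0r. Qed.
Lemma cdotDr z w v : cdot v (z + w) = cdot v z + cdot v w.
Proof. by rewrite cdotC cdotDl !(cdotC v). Qed.
Lemma cdotBr z w v : cdot v (z - w) = cdot v z - cdot v w.
Proof. by rewrite cdotC cdotBl !(cdotC v). Qed.
Lemma cdotZr a z w : cdot w (a *: z) = a * cdot w z.
Proof. by rewrite cdotC cdotZl cdotC. Qed.
Lemma conjvD z w : conjv (z + w) = conjv z + conjv w.
Proof. by apply/rowP => j; rewrite !mxE conjD. Qed.
Lemma conjvB z w : conjv (z - w) = conjv z - conjv w.
Proof. by apply/rowP => j; rewrite !mxE conjB. Qed.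
Lemma conjvZ a z : conjv (a *: z) = a^* *: conjv z.
Proof. by apply/rowP => j; rewrite !mxE conjM. Qed.
Lemma conjv0 : conjv (0 : 'rV[C R]_d) = 0.
Proof. by apply/rowP => j; rewrite !mxE conjC0. Qed.
Lemma conj_cdot z w : (cdot z (conjv w))^* = cdot w (conjv z).
Proof.
rewrite conj_sum; apply: eq_bigr => j _.
by rewrite !mxE conjM conjCK mulrC.
Qed.

Lemma cnorm0 : cnorm (0 : 'rV[C R]_d) = 0.
Proof.
by rewrite /cnorm big1 ?sqrtr0// => j _; rewrite mxE cabs0 expr0n.
Qed.
Lemma cnormZ a z : cnorm (a *: z) = cabs a * cnorm z.
Proof.
apply/eqP; rewrite -(@eqrXn2 _ 2)// ?mulr_ge0 ?cnorm_ge0 ?cabs_ge0//.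
rewrite exprMn !sqr_cnorm mulr_sumr; apply/eqP; apply: eq_bigr => j _.
by rewrite mxE cabsM exprMn.
Qed.
Lemma cnormN z : cnorm (- z) = cnorm z.
Proof. by rewrite -scaleN1r cnormZ cabsN cabs1 mul1r. Qed.
Lemma cabs_coord z j : cabs (z ord0 j) <= cnorm z.
Proof.
rewrite -ler_sqr ?nnegrE ?cnorm_ge0 ?cabs_ge0// sqr_cnorm (bigD1 j)//= lerDl.
by rewrite sumr_ge0// => i _; rewrite sqr_ge0.
Qed.
Lemma cnorm_eq0 z : (cnorm z == 0) = (z == 0).
Proof.
apply/eqP/eqP => [z0|->]; last exact: cnorm0.
apply/rowP => j; apply/eqP; rewrite mxE -cabs_eq0 eq_le cabs_ge0 andbT -z0.
exact: cabs_coord.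
Qed.
Lemma cnorm_le z (m : R) : (forall j, cabs (z ord0 j) <= m) ->
  cnorm z <= Num.sqrt d%:R * m.
Proof.
move=> h; have [m0|m0] := leP 0 m.
  rewrite -(@ger0_norm _ m)// -sqrtr_sqr -sqrtrM ?ler0n// ler_wsqrtr//.
  rewrite -[X in X%:R]card_ord -sumr_const mulr_suml ler_sum// => j _.
  by rewrite mul1r ler_sqr ?nnegrE ?cabs_ge0.
have [d0|d0] := posnP d.
  have -> : d%:R = 0 :> R by rewrite d0.
  rewrite sqrtr0 mul0r /cnorm big1 ?sqrtr0// => -[j jd].
  by exfalso; move: jd; rewrite d0.
by have := le_lt_trans (le_trans (cabs_ge0 _) (h (Ordinal d0))) m0; rewrite ltxx.
Qed.

(** Expanding [|z|^2 |w|^2 - |z.w|^2] as a square avoids any induction. *)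
Lemma cauchy_schwarz z w : cabs (cdot z (conjv w)) <= cnorm z * cnorm w.
Proof.
have [->|w0] := eqVneq w 0; first by rewrite conjv0 cdotC cdot0l cabs0 cnorm0 mulr0.
have W0 : 0 < cnorm w ^+ 2 by rewrite exprn_gt0// lt0r cnorm_eq0 w0 cnorm_ge0.
rewrite -ler_sqr ?nnegrE ?mulr_ge0 ?cnorm_ge0 ?cabs_ge0//.
set k := cdot z (conjv w).
pose v := toC (cnorm w ^+ 2) *: z - k *: w.
have : toC (cnorm v ^+ 2) =
    toC (cnorm w ^+ 2 * (cnorm z ^+ 2 * cnorm w ^+ 2 - cabs k ^+ 2)).
  rewrite -cdot_conj /v conjvB !conjvZ toC_conj.
  rewrite !(cdotBl, cdotBr, cdotZl, cdotZr) !cdot_conj -(conj_cdot z w) -/k.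
  by rewrite toCM toCB (toCM (cnorm z ^+ 2)) -(mul_conj k); ring.
move=> /(congr1 cRe); rewrite !cRe_toC => e.
have : 0 <= cnorm w ^+ 2 * (cnorm z ^+ 2 * cnorm w ^+ 2 - cabs k ^+ 2).
  by rewrite -e sqr_ge0.
by rewrite pmulr_rge0// subr_ge0 exprMn.
Qed.

Lemma cnormD z w : cnorm (z + w) <= cnorm z + cnorm w.
Proof.
rewrite -ler_sqr ?nnegrE ?addr_ge0 ?cnorm_ge0//.
have : toC (cnorm (z + w) ^+ 2) =
  toC (cnorm z ^+ 2 + 2 * cRe (cdot z (conjv w)) + cnorm w ^+ 2).
  rewrite -cdot_conj conjvD !(cdotDl, cdotDr) !cdot_conj -(conj_cdot z w).
  by apply: ceqP; rewrite !cE; ring.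
move=> /(congr1 cRe); rewrite !cRe_toC => ->.
have := le_trans (ler_norm _) (le_trans (ler_cRe _) (cauchy_schwarz z w)).
by rewrite sqrrD; lra.
Qed.

Lemma cnormBC z w : cnorm (z - w) = cnorm (w - z).
Proof. by rewrite -cnormN opprB. Qed.
Lemma ler_cnormB z w : cnorm z - cnorm w <= cnorm (z - w).
Proof. by rewrite lerBlDr -{1}(subrK w z) cnormD. Qed.

Lemma norm_row_le z : `|z| <= toC (cnorm z).
Proof.
have [/eqP n0|n0] := eqVneq (mx_norm z) 0.
  have -> : z = 0 by apply: mx_norm_eq0; apply/eqP.
  by rewrite normr0 cnorm0.
have [[i j] /= e] := mx_norm_neq0 n0.
by rewrite -[`|z|]/(mx_norm z) e norm_toC toC_le (ord1 i) cabs_coord.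
Qed.

Lemma norm_row_ge z : toC (cnorm z) <= toC (Num.sqrt d%:R) * `|z|.
Proof.
have [m zm] : exists m : R, `|z| = toC m.
  have := normr_ge0 z; case: `|z| => a b; rewrite lecE /= => /andP[/eqP -> _].
  by exists a.
rewrite zm -toCM toC_le; apply: cnorm_le => j.
rewrite -toC_le -zm -norm_toC -[`|z|]/(mx_norm z).
rewrite mx_normE -[leLHS]nngE num_le.
exact: (le_bigmax _ (fun i : 'I_1 * 'I_d => `|z i.1 i.2|%:nng) (ord0, j)).
Qed.

Lemma nbhs_cnormP z (A : set 'rV[C R]_d) :
  nbhs z A <-> exists2 e : R, 0 < e & forall w, cnorm (w - z) < e -> A w.
Proof.
split=> [/nbhs_ballP[e /= /posC[r r0 ->] h]|[e e0 h]].
  exists r => // w wz; apply: h; split; first by rewrite toC_gt0.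
  move=> i j.
  rewrite (ord1 i) /ball /= norm_toC toC_lt cabsBC.
  by have := le_lt_trans (cabs_coord (w - z) j) wz; rewrite !mxE.
apply/nbhs_ballP.
have s0 : 0 < Num.sqrt d%:R + 1 :> R by rewrite ltr_wpDl ?sqrtr_ge0.
exists (toC (e / (Num.sqrt d%:R + 1))) => /=.
  by rewrite toC_gt0 divr_gt0.
move=> w [_ wz]; apply: h.
apply: (@le_lt_trans _ _ (Num.sqrt d%:R * (e / (Num.sqrt d%:R + 1)))).
  apply: cnorm_le => j; have := wz ord0 j.
  by rewrite /ball /= norm_toC toC_lt cabsBC !mxE => /ltW.
by rewrite mulrCA gtr_pMr// ltr_pdivrMr// mul1r ltrDl.
Qed.

End VectorBasics.

(** * Complex differentiability with real increments *)

Section CDiff.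
Context {R : realType}.

(** Fréchet differentiability over the complex field, with [D] the vector of
    partial derivatives. *)
Definition cdiff {d} (f : 'rV[C R]_d -> C R) (z D : 'rV[C R]_d) :=
  forall e : R, 0 < e -> exists2 r : R, 0 < r & forall h, cnorm h < r ->
    cabs (f (z + h) - f z - cdot h D) <= e * cnorm h.

Lemma differentiable_cdiff d (f : 'rV[C R]_d -> C R) z :
  differentiable f z -> exists D, cdiff f z D.
Proof.
move=> /diff_locallyP[_ E].
exists (\row_j 'd f z (delta_mx ord0 j)) => e e0.
have k0 : 0 < Num.sqrt d%:R + 1 :> R by rewrite ltr_wpDl ?sqrtr_ge0.
have /eqaddoP /(_ (toC e)) := E.
rewrite toC_gt0 => /(_ e0) /nbhs_cnormP[r r0 hr].
exists r => // h hh; have := hr h; rewrite subr0 => /(_ hh).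
rewrite [shift _]/shift/= !fctE /=.
rewrite opprD addrA (addrC h z) [X in f X]addrC !norm_toC /cst.
move=> H; rewrite -toC_le toCM (le_trans _ (le_trans H _))//.
- rewrite (addrC h z) (_ : cdot h _ = 'd f z h)//.
  rewrite [in RHS](row_sum_delta h) linear_sum; apply: eq_bigr => j _.
  by rewrite mxE linearZ.
- by rewrite ler_wpM2l ?norm_row_le// toC_le ltW.
Qed.

Lemma cdiff_differentiable d (f : 'rV[C R]_d -> C R) z D :
  cdiff f z D -> differentiable f z.
Proof.
move=> H; pose L (h : 'rV[C R]_d) : C R := cdot h D.
have linL : linear L by move=> a u v; rewrite /L cdotDl cdotZl.
have [lL lLE] : exists l : {linear 'rV[C R]_d -> C R}, l =1 L.
  pose LL := GRing.isLinear.Build _ _ _ _ L linL.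
  pose lL : {linear 'rV[C R]_d -> C R} := HB.pack L LL.
  by exists lL.
have cL : continuous lL.
  move=> h; apply/(@cvg_cabsP _ _ (nbhs h) (nbhs_filter h)) => e e0.
  have k0 : 0 < cnorm (conjv D) + 1 by rewrite ltr_wpDl ?cnorm_ge0.
  apply/nbhs_cnormP; exists (e / (cnorm (conjv D) + 1)); first by rewrite divr_gt0.
  move=> w wh /=; rewrite !lLE /L -cdotBl.
  have -> : D = conjv (conjv D) by apply/rowP => j; rewrite !mxE conjCK.
  apply: le_lt_trans (cauchy_schwarz _ _) _.
  apply: (@le_lt_trans _ _ (cnorm (w - h) * (cnorm (conjv D) + 1))).
    by rewrite ler_wpM2l ?cnorm_ge0// lerDl.
  by rewrite -ltr_pdivlMr.
have k0 : 0 < Num.sqrt d%:R + 1 :> R by rewrite ltr_wpDl ?sqrtr_ge0.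
apply/diffP; rewrite /diff.
set P := (X in get X); have : exists df, P df; last exact: getPex.
exists lL; split => //; rewrite lim_id; last exact: norm_hausdorff.
have E : f = (fun t => f z + lL (t - z)) +o_ z (fun t : 'rV[C R]_d => t - z).
  apply/eqaddoP => e' /posC[e e0 ->].
  have [r r0 hr] := H (e / (Num.sqrt d%:R + 1)) (divr_gt0 e0 k0).
  apply/nbhs_cnormP; exists r => // w wr /=.
  have := hr _ wr; rewrite addrCA subrr addr0 => hw.
  rewrite [X in `|X|](_ : _ = f w - f z - cdot (w - z) D); last first.
    by rewrite !fctE lLE opprD addrA.
  rewrite norm_toC; apply: (@le_trans _ _
      (toC (e / (Num.sqrt d%:R + 1)) * toC (cnorm (w - z)))).
    by rewrite -toCM toC_le.
  have k1 : 0 <= toC (e / (Num.sqrt d%:R + 1)) :> C R.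
    by rewrite -[0]toC0 toC_le ltW// divr_gt0.
  apply: (le_trans (ler_wpM2l k1 (norm_row_ge _))).
  rewrite mulrA ler_wpM2r// -toCM toC_le mulrAC ler_pdivrMr//.
  by rewrite ler_wpM2l ?lerDl// ltW.
by move=> t; exact: (congr1 (@^~ t) E).
Qed.

End CDiff.

(** * Measurability on [C^d] *)

Section CvecMeasurable.
Context {R : realType}.

Lemma measurable_cont d (f : 'rV[C R]_d -> R) :
  continuous f -> measurable_fun [set: @Cvec R d] (f : @Cvec R d -> R).
Proof.
move=> cf; apply: (measurability _ (RGenOInfty.measurableE R)).
move=> _ [_ [x ->] <-]; rewrite setTI; apply: sub_sigma_algebra.
by move/continuousP: cf; apply; exact: interval_open.
Qed.

Lemma continuous_cnorm_lip d (f : 'rV[C R]_d -> R) (k : R) :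
  (forall z w, `|f z - f w| <= k * cnorm (z - w)) -> continuous f.
Proof.
move=> h z; apply/(@cvgrPdist_lt _ _ _ (nbhs z) (nbhs_filter z)) => e e0.
have k0 : 0 < `|k| + 1 by rewrite ltr_wpDl.
apply/nbhs_cnormP; exists (e / (`|k| + 1)); first by rewrite divr_gt0.
move=> w wz; apply: le_lt_trans (h z w) _.
apply: (@le_lt_trans _ _ ((`|k| + 1) * cnorm (w - z))).
  by rewrite cnormBC ler_wpM2r ?cnorm_ge0// ler_wpDr// ler_norm.
by rewrite mulrC -ltr_pdivlMr.
Qed.

Lemma continuous_cnorm d : continuous (@cnorm R d).
Proof.
apply: (@continuous_cnorm_lip _ _ 1) => z w; rewrite mul1r ler_norml ler_cnormB.
by rewrite andbT lerNl opprB cnormBC ler_cnormB.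
Qed.

Lemma continuous_coord_re d (j : 'I_d) : continuous (fun z : 'rV[C R]_d => cRe (z ord0 j)).
Proof.
apply: (@continuous_cnorm_lip _ _ 1) => z w; rewrite mul1r.
rewrite -cReN -cReD (le_trans (ler_cRe _))//.
by have := cabs_coord (z - w) j; rewrite !mxE.
Qed.

Lemma continuous_coord_im d (j : 'I_d) : continuous (fun z : 'rV[C R]_d => cIm (z ord0 j)).
Proof.
apply: (@continuous_cnorm_lip _ _ 1) => z w; rewrite mul1r.
rewrite -cImN -cImD (le_trans (ler_cIm _))//.
by have := cabs_coord (z - w) j; rewrite !mxE.
Qed.

Lemma measurable_cnorm d : measurable_fun [set: @Cvec R d] (@cnorm R d : @Cvec R d -> R).
Proof. exact: (measurable_cont (@continuous_cnorm d)). Qed.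

Definition to_reals d (z : 'rV[C R]_d) : (d + d).-tuple (measurableTypeR R) :=
  [tuple match fintype.split i with inl j => cRe (z ord0 j) | inr j => cIm (z ord0 j) end | i < d + d].

Lemma to_realsK d : cancel (@to_reals d) (@of_reals R d).
Proof.
move=> z; apply/rowP => j; rewrite mxE !tnth_mktuple.
by apply: ceqP; rewrite /= ?(unsplitK (inl j)) ?(unsplitK (inr j)).
Qed.

(** A map into [C^d] is measurable as soon as its real coordinates are: it
    factors through the tuple of those coordinates. *)
Lemma measurable_Cvec d dT (T : measurableType dT) (f : T -> @Cvec R d) :
  (forall j, measurable_fun [set: T] (fun t => cRe ((f t : 'rV[C R]_d) ord0 j))) ->
  (forall j, measurable_fun [set: T] (fun t => cIm ((f t : 'rV[C R]_d) ord0 j))) ->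
  measurable_fun [set: T] f.
Proof.
move=> mr mi.
rewrite (_ : f = @of_reals R d \o (@to_reals d \o f)); last first.
  by apply/funext => t; rewrite /= to_realsK.
apply: measurableT_comp; first exact: measurable_of_reals.
apply/measurable_fun_tnthP => i.
rewrite (_ : _ \o _ = fun t => match fintype.split i with
  inl j => cRe ((f t : 'rV[C R]_d) ord0 j) | inr j => cIm ((f t : 'rV[C R]_d) ord0 j) end).
  by case: (fintype.split i) => j; [exact: mr|exact: mi].
by apply/funext => t; rewrite /= tnth_mktuple.
Qed.

Definition cmeas dT (T : measurableType dT) (f : T -> C R) :=
  measurable_fun [set: T] (fun t => cRe (f t)) /\
  measurable_fun [set: T] (fun t => cIm (f t)).

Section cmeas.
Context {dT} {T : measurableType dT}.
Implicit Types f g : T -> C R.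

Lemma cmeas_cst (a : C R) : cmeas (fun _ : T => a).
Proof. by split; exact: measurable_cst. Qed.
Lemma cmeasD f g : cmeas f -> cmeas g -> cmeas (fun t => f t + g t).
Proof.
move=> [f1 f2] [g1 g2]; split.
  by under eq_fun do rewrite cReD; exact: measurable_funD.
by under eq_fun do rewrite cImD; exact: measurable_funD.
Qed.
Lemma cmeasM f g : cmeas f -> cmeas g -> cmeas (fun t => f t * g t).
Proof.
move=> [f1 f2] [g1 g2]; split.
  under eq_fun do rewrite cReM.
  by apply: measurable_funB; exact: measurable_funM.
under eq_fun do rewrite cImM.
by apply: measurable_funD; exact: measurable_funM.
Qed.
Lemma cmeasN f : cmeas f -> cmeas (fun t => - f t).
Proof.
move=> mf; have := cmeasM (cmeas_cst (-1)) mf.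
by under eq_fun do rewrite mulN1r.
Qed.
Lemma cmeasB f g : cmeas f -> cmeas g -> cmeas (fun t => f t - g t).
Proof. by move=> mf mg; apply: cmeasD => //; exact: cmeasN. Qed.
Lemma cmeas_toC (f : T -> R) : measurable_fun [set: T] f -> cmeas (fun t => toC (f t)).
Proof. by move=> mf; split => //; exact: measurable_cst. Qed.
Lemma cmeasJ f : cmeas f -> cmeas (fun t => (f t)^*).
Proof.
move=> [f1 f2]; split; first by under eq_fun do rewrite cReJ.
by under eq_fun do rewrite cImJ; exact: measurableT_comp.
Qed.
Lemma cmeas_sum I (r : seq I) (P : pred I) (f : I -> T -> C R) :
  (forall i, cmeas (f i)) -> cmeas (fun t => \sum_(i <- r | P i) f i t).
Proof.
move=> mf; elim: r => [|i r ih].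
  by under eq_fun do rewrite big_nil; exact: cmeas_cst.
under eq_fun do rewrite big_cons; case: (P i) => //.
exact: cmeasD.
Qed.
Lemma measurable_sqr_cabs f : cmeas f -> measurable_fun [set: T] (fun t => cabs (f t) ^+ 2).
Proof.
move=> [f1 f2]; under eq_fun do rewrite sqr_cabs.
by apply: measurable_funD; apply: measurable_funX.
Qed.
Lemma measurable_powRc (f : T -> R) p : measurable_fun [set: T] f ->
  measurable_fun [set: T] (fun t => f t `^ p).
Proof. by move=> mf; exact: (measurableT_comp (measurable_powR p) mf). Qed.
Lemma measurable_cabs f : cmeas f -> measurable_fun [set: T] (fun t => cabs (f t)).
Proof.
move=> [f1 f2]; under eq_fun do rewrite cabsE -powR12_sqrt ?addr_ge0 ?sqr_ge0//.
by apply: measurable_powRc; apply: measurable_funD; exact: measurable_funX.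
Qed.
Lemma measurable_nninv (f : T -> R) : (forall t, 0 <= f t) ->
  measurable_fun [set: T] f -> measurable_fun [set: T] (fun t => (f t)^-1).
Proof.
move=> f0 mf; under eq_fun do rewrite -powR_inv1//.
exact: measurable_powRc.
Qed.
Lemma cmeasV f : cmeas f -> cmeas (fun t => (f t)^-1).
Proof.
move=> mf; have mi : measurable_fun [set: T] (fun t => (cabs (f t) ^+ 2)^-1).
  by apply: measurable_nninv => [t|]; [rewrite sqr_ge0|exact: measurable_sqr_cabs].
case: (mf) => f1 f2; split.
  by under eq_fun do rewrite cReV; exact: measurable_funM.
under eq_fun do rewrite cImV; apply: measurable_funM => //.
exact: measurableT_comp.
Qed.
Lemma cmeas_coord d (f : T -> @Cvec R d) j : measurable_fun [set: T] f ->
  cmeas (fun t => (f t : 'rV[C R]_d) ord0 j).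
Proof.
move=> mf; split.
  exact: (measurableT_comp (measurable_cont (@continuous_coord_re d j)) mf).
exact: (measurableT_comp (measurable_cont (@continuous_coord_im d j)) mf).
Qed.
Lemma measurable_vec d (f : T -> @Cvec R d) :
  (forall j, cmeas (fun t => (f t : 'rV[C R]_d) ord0 j)) -> measurable_fun [set: T] f.
Proof. by move=> mf; apply: measurable_Cvec => j; case: (mf j). Qed.
Lemma cmeas_cdot d (f g : T -> @Cvec R d) : measurable_fun [set: T] f ->
  measurable_fun [set: T] g ->
  cmeas (fun t => cdot (f t : 'rV[C R]_d) (conjv (g t : 'rV[C R]_d))).
Proof.
move=> mf mg; apply: cmeas_sum => j; apply: cmeasM; first exact: cmeas_coord.
by under eq_fun do rewrite mxE; apply: cmeasJ; exact: cmeas_coord.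
Qed.
Lemma measurable_vecD d (f g : T -> @Cvec R d) : measurable_fun [set: T] f ->
  measurable_fun [set: T] g ->
  measurable_fun [set: T] (fun t => (f t : 'rV[C R]_d) + (g t : 'rV[C R]_d) : @Cvec R d).
Proof.
move=> mf mg; apply: measurable_vec => j; under eq_fun do rewrite mxE.
by apply: cmeasD; exact: cmeas_coord.
Qed.
Lemma measurable_vecZ d (a : T -> C R) (f : T -> @Cvec R d) : cmeas a ->
  measurable_fun [set: T] f ->
  measurable_fun [set: T] (fun t => a t *: (f t : 'rV[C R]_d) : @Cvec R d).
Proof.
move=> ma mf; apply: measurable_vec => j; under eq_fun do rewrite mxE.
by apply: cmeasM => //; exact: cmeas_coord.
Qed.
Lemma measurable_vecB d (f g : T -> @Cvec R d) : measurable_fun [set: T] f ->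
  measurable_fun [set: T] g ->
  measurable_fun [set: T] (fun t => (f t : 'rV[C R]_d) - (g t : 'rV[C R]_d) : @Cvec R d).
Proof.
move=> mf mg; apply: measurable_vec => j; under eq_fun do rewrite !mxE.
by apply: cmeasB; exact: cmeas_coord.
Qed.
Lemma measurable_mobius d (w f : T -> @Cvec R d) : measurable_fun [set: T] w ->
  measurable_fun [set: T] f ->
  measurable_fun [set: T] (fun t => mobius (w t : 'rV[C R]_d) (f t) : @Cvec R d).
Proof.
move=> mw mf.
have mobE (u v : 'rV[C R]_d) : mobius u v =
    (1 - cdot v (conjv u))^-1 *: (u - (cdot v (conjv u) / toC (cnorm u ^+ 2)) *: u
      - toC (Num.sqrt (1 - cnorm u ^+ 2)) *:
        (v - (cdot v (conjv u) / toC (cnorm u ^+ 2)) *: u)).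
  rewrite /mobius; case: ifPn => // /eqP ->.
  rewrite conjv0 cdotC cdot0l !scaler0 !subr0 cnorm0 expr0n subr0 sqrtr1 invr1.
  by rewrite toC1 !scale1r sub0r.
under eq_fun do rewrite mobE.
have mn : measurable_fun [set: T] (fun t => cnorm (w t : 'rV[C R]_d) ^+ 2).
  by apply: measurable_funX; exact: (measurableT_comp (@measurable_cnorm d) mw).
have mp : measurable_fun [set: T] (fun t =>
    (cdot (f t : 'rV[C R]_d) (conjv (w t : 'rV[C R]_d)) / toC (cnorm (w t : 'rV[C R]_d) ^+ 2)) *: (w t : 'rV[C R]_d) : @Cvec R d).
  apply: measurable_vecZ => //; apply: cmeasM; first exact: cmeas_cdot.
  by apply: cmeasV; exact: cmeas_toC.
apply: measurable_vecZ.
  by apply: cmeasV; apply: cmeasB; [exact: cmeas_cst|exact: cmeas_cdot].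
apply: measurable_vecB; first exact: measurable_vecB.
apply: measurable_vecZ; last exact: measurable_vecB.
apply: cmeas_toC.
have -> : (fun t => Num.sqrt (1 - cnorm (w t : 'rV[C R]_d) ^+ 2)) =
   (fun t => Num.max 0 (1 - cnorm (w t : 'rV[C R]_d) ^+ 2) `^ 2^-1).
  apply/funext => t; rewrite powR12_sqrt ?le_max ?lexx//.
  by case: leP => // h; rewrite sqrtr0 ler0_sqrtr// ltW.
apply: measurable_powRc; apply: measurable_maxr; first exact: measurable_cst.
by apply: measurable_funB => //; exact: measurable_cst.
Qed.

End cmeas.

Lemma measurable_uball d : measurable (uball R d : set (@Cvec R d)).
Proof.
rewrite (_ : uball R d = (@cnorm R d : @Cvec R d -> R) @^-1` `]-oo, 1[%classic).
  by rewrite -[X in measurable X]setTI; apply: measurable_cnorm.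
by apply/seteqP; split => z /=; rewrite in_itv.
Qed.

Lemma measurable_cball d (r : R) : measurable ([set z | cnorm z < r] : set (@Cvec R d)).
Proof.
rewrite (_ : [set z | _] = (@cnorm R d : @Cvec R d -> R) @^-1` `]-oo, r[%classic).
  by rewrite -[X in measurable X]setTI; apply: measurable_cnorm.
by apply/seteqP; split => z /=; rewrite in_itv.
Qed.

End CvecMeasurable.

(** * Invariance of Lebesgue measure under affine and linear maps *)

Section LebesgueAffine.
Context {R : realType}.
Local Open Scope ereal_scope.
Local Notation leb := (@lebesgue_measure R).

Lemma lebesgue_affine (r b : R) (A : set (measurableTypeR R)) : (0 < r)%R ->
  measurable A ->
  leb ((fun x => r * x + b)%R @^-1` A) = (r^-1)%:E * leb A.
Proof.
move=> r0 mA.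
have mf : measurable_fun [set: measurableTypeR R] (fun x => r * x + b : measurableTypeR R)%R.
  by apply: measurable_funD => //; apply: measurable_funM.
have r0' : (0 <= r)%R by exact: ltW.
pose mu := mscale (NngNum r0') (pushforward leb (fun x => r * x + b : measurableTypeR R)%R).
pose nu : {measure set (measurableTypeR R) -> \bar R} :=
  mscale (NngNum r0') (measure_function_pushforward__canonical__measure_function_Measure leb mf).
suff E : leb A = nu A.
  by rewrite E /nu /mscale /= muleA -EFinM mulVf ?gt_eqF// mul1e.
apply: lebesgue_measure_unique => // _ [[u v] /= uv <-].
rewrite /nu /mscale /= /pushforward.
rewrite (_ : _ @^-1` _ = `](u - b) / r, (v - b) / r]%classic)%R; last first.
  apply/seteqP; split => x /=; rewrite !in_itv /=;
    by rewrite ltr_pdivrMr// ler_pdivlMr// ltrBlDr lerBrDr (mulrC x).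
rewrite !lebesgue_measure_itv /= !lte_fin ltr_pM2r ?invr_gt0// ltrD2r.
case: ifPn => _; last by rewrite mule0.
rewrite -!EFinD -EFinM; congr EFin.
by rewrite mulrBr !(mulrC r) !divfK ?gt_eqF//; lra.
Qed.

Lemma integral_lebesgue_affine (r b : R) (f : measurableTypeR R -> \bar R) : (0 < r)%R ->
  measurable_fun [set: measurableTypeR R] f -> (forall x, 0 <= f x) ->
  \int[leb]_x f (r * x + b)%R = (r^-1)%:E * \int[leb]_x f x.
Proof.
move=> r0 mf f0.
have mg : measurable_fun [set: measurableTypeR R] (fun x => r * x + b : measurableTypeR R)%R.
  by apply: measurable_funD => //; apply: measurable_funM.
have r0' : (0 <= r^-1)%R by rewrite invr_ge0 ltW.
transitivity (\int[pushforward leb (fun x => r * x + b : measurableTypeR R)%R]_y f y).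
  by rewrite ge0_integral_pushforward.
rewrite -[(r^-1)%:E]/((NngNum r0')%:num%:E) -(ge0_integral_mscale leb measurableT _ mf)//.
apply: (@eq_measure_integral _ _ _ setT
  (mscale (NngNum r0') leb)
  (measure_function_pushforward__canonical__measure_function_Measure leb mg)).
by move=> A mA _; rewrite /= /pushforward lebesgue_affine.
Qed.

Lemma integral_leb_tuple_affine n (r : R) (b : n.-tuple R)
    (f : n.-tuple (measurableTypeR R) -> \bar R) : (0 < r)%R ->
  measurable_fun [set: n.-tuple (measurableTypeR R)] f -> (forall x, 0 <= f x) ->
  \int[leb_tuple n]_t f [tuple r * tnth t i + tnth b i | i < n]%R =
  (r^-1 ^+ n)%:E * \int[leb_tuple n]_t f t.
Proof.
move=> r0; elim: n b f => [|n ih] b f mf f0.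
  rewrite expr0 mul1e; apply: eq_integral => t _; congr f.
  by rewrite (tuple0 t) [LHS]tuple0.
pose g (p : measurableTypeR R * n.-tuple (measurableTypeR R)) := f (tcons p).
have mg : measurable_fun setT g by apply: measurableT_comp => //; exact: measurable_tcons.
pose aff (t : n.+1.-tuple (measurableTypeR R)) : n.+1.-tuple (measurableTypeR R) :=
  [tuple r * tnth t i + tnth b i | i < n.+1]%R.
have maff : measurable_fun setT aff.
  apply/measurable_fun_tnthP => i.
  rewrite (_ : _ \o _ = fun t : n.+1.-tuple (measurableTypeR R) => r * tnth t i + tnth b i)%R.
    apply: measurable_funD => //; apply: measurable_funM => //.
    exact: measurable_tnth.
  by apply/funext => t; rewrite /= tnth_mktuple.
have step (h : n.+1.-tuple (measurableTypeR R) -> \bar R) : measurable_fun setT h ->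
    (forall x, 0 <= h x) ->
  \int[leb_tuple n.+1]_t h t = \int[leb]_x \int[leb_tuple n]_t h (tcons (x, t)).
  move=> mh h0; rewrite [LHS](_ : _ = \int[pushforward (leb \x leb_tuple n) (@tcons R n)]_t h t)//.
  rewrite ge0_integral_pushforward//; last exact: measurable_tcons.
  rewrite preimage_setT fubini_tonelli1//; last by move=> x; exact: h0.
  by apply: measurableT_comp => //; exact: measurable_tcons.
rewrite (step _ (measurableT_comp mf maff) (fun x => f0 (aff x))) (step f)//.
pose b' : n.-tuple R := [tuple of behead b].
have affE x t : aff (tcons (x, t)) =
    tcons (r * x + thead b, [tuple r * tnth t i + tnth b' i | i < n])%R.
  apply: eq_from_tnth => i; rewrite tnth_mktuple.
  have [j ->|->] := unliftP ord0 i; last by rewrite !tnth0.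
  rewrite !tnthS tnth_mktuple /b' tnth_behead; congr (_ + tnth _ _)%R.
  by apply: val_inj; rewrite /= inordK // ltnS ltn_ord.
under eq_integral do under eq_integral do rewrite /= affE.
pose F x := \int[leb_tuple n]_t f (tcons (x, t)).
have mF : measurable_fun [set: measurableTypeR R] F.
  exact: (@measurable_fun_fubini_tonelli_F _ _ _ _ R (leb_tuple n) g mg (fun p => f0 (tcons p))).
transitivity (\int[leb]_x ((r^-1 ^+ n)%:E * F (r * x + thead b)%R)).
  apply: eq_integral => x _.
  apply: (ih b' (fun t => f (tcons (r * x + thead b, t)%R))) => //.
  by apply: measurableT_comp mg _; exact: pair1_measurable.
have F0 x : 0 <= F x by apply: integral_ge0.
have mFa : measurable_fun [set: measurableTypeR R] (fun x => F (r * x + thead b)%R).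
  by apply: measurableT_comp mF _; apply: measurable_funD => //; apply: measurable_funM.
have k0 : (0 <= r^-1 ^+ n)%R by rewrite exprn_ge0// invr_ge0 ltW.
rewrite (ge0_integralZl_EFin leb measurableT (fun x _ => F0 (r * x + thead b)%R) mFa k0).
by rewrite (integral_lebesgue_affine _ r0 mF)// muleA -EFinM -exprSr.
Qed.

Lemma integral_leb_C_affine d (r : R) (b : 'rV[C R]_d) (f : @Cvec R d -> \bar R) : (0 < r)%R ->
  measurable_fun [set: @Cvec R d] f -> (forall x, 0 <= f x) ->
  \int[leb_C d]_z f (toC r *: (z : 'rV[C R]_d) + b)%R =
  (r^-1 ^+ (d + d))%:E * \int[leb_C d]_z f z.
Proof.
move=> r0 mf f0.
have mg : measurable_fun [set: @Cvec R d] (fun z => toC r *: (z : 'rV[C R]_d) + b : @Cvec R d)%R.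
  apply: measurable_vecD => //.
  by apply: measurable_vecZ => //; exact: cmeas_cst.
have pf (h : @Cvec R d -> \bar R) : measurable_fun setT h -> (forall x, 0 <= h x) ->
    \int[leb_C d]_z h z = \int[leb_tuple (d + d)]_t h (of_reals t).
  move=> mh h0.
  rewrite [LHS](_ : _ = \int[pushforward (leb_tuple (d + d)) (@of_reals R d : _ -> @Cvec R d)]_t h t)//.
  by rewrite ge0_integral_pushforward// ; exact: measurable_of_reals.
rewrite (pf _ (measurableT_comp mf mg) (fun z => f0 _)) (pf f)//.
rewrite -(@integral_leb_tuple_affine (d + d) r (to_reals b : (d + d).-tuple R)
  (fun t => f (of_reals t)))//; last first.
  exact: (measurableT_comp mf (@measurable_of_reals R d)).
apply: eq_integral => t _; congr f; apply/rowP => j; rewrite !mxE !tnth_mktuple.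
by apply: ceqP; rewrite !cE ?(unsplitK (inl j)) ?(unsplitK (inr j)) /=; ring.
Qed.

End LebesgueAffine.

(** * Normalized volume as a sigma-finite translation-invariant measure *)

Section Volume.
Context {R : realType}.
Local Open Scope ereal_scope.

Definition cube n (c : R) : set (n.-tuple (measurableTypeR R)) :=
  [set t | forall i, (`|tnth t i : R| <= c)%R].

Lemma measurable_cube n c : measurable (@cube n c).
Proof.
rewrite (_ : cube c = \bigcap_(i in [set: 'I_n])
   ((fun t : n.-tuple (measurableTypeR R) => tnth t i) @^-1` `[(- c)%R, c]%classic)).
  apply: fin_bigcap_measurable => // i _.
  rewrite -[X in measurable X]setTI; apply: measurable_tnth => //.
by apply/seteqP; split => [t h i _|t h i] /=;
  [rewrite in_itv /= -ler_norml; exact: h|have := h i I; rewrite /= in_itv /= -ler_norml].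
Qed.

Lemma leb_cube n (c : R) : (0 < c)%R -> leb_tuple n (cube c) = ((c + c) ^+ n)%:E.
Proof.
move=> c0; elim: n => [|n ih].
  rewrite /= /dirac indicE mem_set//= => -[]//.
rewrite [LHS](_ : _ = (lebesgue_measure \x leb_tuple n) (@tcons R n @^-1` cube c))//.
rewrite (_ : _ @^-1` _ = `[(- c)%R, c]%classic `*` cube c); last first.
  apply/seteqP; split => [[x t] h|[x t] [/= hx ht] i].
    split; first by have := h ord0; rewrite /= tnth0 in_itv /= -ler_norml.
    by move=> i; have := h (lift ord0 i); rewrite tnthS.
  have [j ->|->] := unliftP ord0 i; first by rewrite tnthS; exact: ht.
  by rewrite tnth0; move: hx; rewrite in_itv /= -ler_norml.
rewrite product_measure1E//; last exact: measurable_cube.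
have -> : forall A, measure_function.Measure.sort (@lebesgue_measure R) A = lebesgue_measure A by [].
rewrite ih lebesgue_measure_itv /= lte_fin gtrN// -EFinD opprK -EFinM.
by rewrite exprS.
Qed.

Variable d : nat.

Lemma leb_C_ball_lty (r : R) : (0 < r)%R -> leb_C d [set z | cnorm z < r]%R < +oo.
Proof.
move=> r0; apply: (@le_lt_trans _ _ (leb_tuple (d + d) (cube r))).
  rewrite [leb_C _ _](_ : _ = leb_tuple (d + d) (@of_reals R d @^-1` [set z | cnorm z < r]%R))//.
  apply: le_measure; rewrite ?inE.
  - rewrite -[X in measurable X]setTI; apply: measurable_of_reals => //.
    exact: measurable_cball.
  - exact: measurable_cube.
  move=> t /= tr i; rewrite -(splitK i); case: (fintype.split i) => j /=.
    have /ltW := le_lt_trans (cabs_coord (of_reals t) j) tr.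
    by apply: le_trans; apply: le_trans (ler_cRe _); rewrite !mxE.
  have /ltW := le_lt_trans (cabs_coord (of_reals t) j) tr.
  by apply: le_trans; apply: le_trans (ler_cIm _); rewrite !mxE.
by rewrite leb_cube// ltry.
Qed.

Lemma leb_C_ball_gt0 : 0 < leb_C d (uball R d).
Proof.
pose c : R := ((2 * (d.+1)%:R)^-1)%R.
have c0 : (0 < c)%R by rewrite invr_gt0 mulr_gt0.
apply: (@lt_le_trans _ _ (leb_tuple (d + d) (cube c))).
  by rewrite leb_cube// lte_fin exprn_gt0// addr_gt0.
rewrite [leb_C _ _](_ : _ = leb_tuple (d + d) (@of_reals R d @^-1` (uball R d)))//.
apply: le_measure; rewrite ?inE.
- exact: measurable_cube.
- rewrite -[X in measurable X]setTI; apply: measurable_of_reals => //.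
  exact: measurable_uball.
move=> t /= tc; rewrite /uball /=.
apply: (@le_lt_trans _ _ (Num.sqrt d%:R * (c + c))%R).
  apply: cnorm_le => j; apply: le_trans (cabs_le _) _; rewrite mxE /=.
  by apply: lerD; exact: tc.
rewrite (_ : c + c = (d.+1%:R)^-1)%R; last first.
  by rewrite /c invfM -mulrDl (_ : 2^-1 + 2^-1 = 1)%R ?mul1r//; lra.
rewrite ltr_pdivrMr// mul1r -ltr_sqr ?nnegrE ?sqrtr_ge0// sqr_sqrtr//.
by rewrite -natrX ltr_nat (leq_trans (ltnSn d))// -[X in (X <= _)%N]expn1 leq_pexp2l.
Qed.

Lemma leb_C_ball_fin : leb_C d (uball R d) \is a fin_num.
Proof. by rewrite ge0_fin_numE// leb_C_ball_lty. Qed.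

(** The measure [v_] again, as a function that can carry a sigma-finite
    instance. *)
Definition vb (A : set (@Cvec R d)) : \bar R := v_ d A.

HB.instance Definition _ := Measure.copy vb (v_ d).

Definition vol_inv : R := (fine (leb_C d (uball R d)))^-1.

Lemma vol_inv_gt0 : (0 < vol_inv)%R.
Proof.
rewrite invr_gt0 fine_gt0//; apply/andP; split; first exact: leb_C_ball_gt0.
exact: leb_C_ball_lty.
Qed.

Lemma vbE A : vb A = vol_inv%:E * leb_C d A. Proof. by []. Qed.

Lemma vb_uball : vb (uball R d) = 1.
Proof.
rewrite vbE -(fineK leb_C_ball_fin) -EFinM /vol_inv mulVf//.
by rewrite -invr_eq0 gt_eqF// vol_inv_gt0.
Qed.

Lemma vb_sigma_finite : sigma_finite setT vb.
Proof.
exists (fun k => [set z | cnorm z < k.+1%:R]%R : set (@Cvec R d)).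
  apply/esym; rewrite -subTset => z _.
  exists (Num.trunc (cnorm z)) => //=.
  by have /andP[] := truncn_itv (cnorm_ge0 z).
move=> k; split; first exact: measurable_cball.
rewrite vbE lte_mul_pinfty ?lee_fin ?ltW// ?vol_inv_gt0//.
exact: leb_C_ball_lty.
Qed.

HB.instance Definition _ := Measure_isSigmaFinite.Build _ _ _ vb vb_sigma_finite.

Lemma integral_vb (D : set (@Cvec R d)) f : measurable D -> measurable_fun D f ->
  (forall z, D z -> 0 <= f z) ->
  \int[vb]_(z in D) f z = vol_inv%:E * \int[leb_C d]_(z in D) f z.
Proof.
move=> mD mf f0; have v0 : (0 <= vol_inv)%R by rewrite ltW// vol_inv_gt0.
rewrite -[vol_inv%:E]/((NngNum v0)%:num%:E) -ge0_integral_mscale//.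
Qed.

Lemma integral_vb_affine (r : R) (b : 'rV[C R]_d) (f : @Cvec R d -> \bar R) : (0 < r)%R ->
  measurable_fun [set: @Cvec R d] f -> (forall x, 0 <= f x) ->
  \int[vb]_z f (toC r *: (z : 'rV[C R]_d) + b)%R = (r^-1 ^+ (d + d))%:E * \int[vb]_z f z.
Proof.
move=> r0 mf f0.
have mg : measurable_fun [set: @Cvec R d] (fun z => toC r *: (z : 'rV[C R]_d) + b : @Cvec R d)%R.
  apply: measurable_vecD => //.
  by apply: measurable_vecZ => //; exact: cmeas_cst.
rewrite (integral_vb measurableT (measurableT_comp mf mg) (fun z _ => f0 _)).
by rewrite (integral_vb measurableT mf)// integral_leb_C_affine// muleCA.
Qed.

Lemma integral_vb_translate (b : 'rV[C R]_d) (f : @Cvec R d -> \bar R) :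
  measurable_fun [set: @Cvec R d] f -> (forall x, 0 <= f x) ->
  \int[vb]_z f (z + b)%R = \int[vb]_z f z.
Proof.
move=> mf f0; have := @integral_vb_affine 1 b f ltr01 mf f0.
rewrite invr1 expr1n mul1e => <-; apply: eq_integral => z _.
by rewrite toC1 scale1r.
Qed.

Lemma vb_ball (r : R) : (0 < r)%R -> vb [set z | cnorm z < r]%R = (r ^+ (d + d))%:E.
Proof.
move=> r0.
pose f (z : @Cvec R d) : \bar R := (\1_([set z : @Cvec R d | cnorm z < r]%R) z)%:E.
have mf : measurable_fun [set: @Cvec R d] f.
  by apply/measurable_EFinP; apply: measurable_indic; exact: measurable_cball.
have := @integral_vb_affine r 0 f r0 mf (fun z => ltac:(by rewrite lee_fin)).
rewrite [X in _ * X](_ : _ = vb [set z | cnorm z < r]%R); last first.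
  by rewrite integral_indic ?setIT//; exact: measurable_cball.
rewrite (_ : \int[vb]_z _ = 1); last first.
  rewrite -vb_uball -(setIT (uball R d)) -(integral_indic vb measurableT (@measurable_uball R d)).
  apply: eq_integral => z _; rewrite /f !indicE addr0; congr (_%:R%:E).
  congr nat_of_bool; apply/idP/idP => /set_mem h; apply/mem_set; move: h;
    by rewrite /uball /= cnormZ cabs_toC gtr0_norm// gtr_pMr.
move=> /(congr1 (fun x => (r ^+ (d + d))%:E * x)).
by rewrite mule1 muleA -EFinM exprVn mulfV ?mul1e// expf_neq0// gt_eqF.
Qed.

End Volume.
Arguments vb {R} d _.

(** * The involutive automorphisms of the ball *)

Section Mobius.
Context {R : realType} {d : nat}.
Implicit Types (w x y : 'rV[C R]_d) (t : C R).

(** Homogeneous coordinates: [mobius w] is the action on [y / t] of the linear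
    map [(t, y) |-> (mden w t y, mnum w t y)] of [C x C^d], which multiplies
    the form [|t|^2 - |y|^2] by [1 - |w|^2]. *)
Definition mden w t y : C R := t - cdot y (conjv w).
Definition mnum w t y : 'rV[C R]_d :=
  (t - cdot y (conjv w) / toC (cnorm w ^+ 2) *
      (1 - toC (Num.sqrt (1 - cnorm w ^+ 2)))) *: w
  - toC (Num.sqrt (1 - cnorm w ^+ 2)) *: y.

Lemma mobiusE w x : mobius w x = (mden w 1 x)^-1 *: mnum w 1 x.
Proof.
rewrite /mobius /mnum /mden; case: ifPn => [/eqP ->|_]; last first.
  congr (_ *: _); rewrite scalerBl scale1r mulrBr mulr1 scalerBl scalerBr scalerA.
  by rewrite [X in X *: w]mulrC; apply/rowP => j; rewrite !mxE; ring.
rewrite conjv0 cdotC cdot0l scaler0 subr0 cnorm0 expr0n subr0 sqrtr1 invr1.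
by rewrite toC1 !scale1r sub0r.
Qed.

Lemma mdenZ w (a : C R) t y : mden w (a * t) (a *: y) = a * mden w t y.
Proof. by rewrite /mden cdotZl mulrBr. Qed.

Lemma mnumZ w (a : C R) t y : mnum w (a * t) (a *: y) = a *: mnum w t y.
Proof.
rewrite /mnum cdotZl; apply/rowP => j; rewrite !mxE; ring.
Qed.

Lemma mobius_homog w t y : t != 0 ->
  mobius w (t^-1 *: y) = (mden w t y)^-1 *: mnum w t y.
Proof.
move=> t0; rewrite mobiusE -{1 2}(mulVf t0) mdenZ mnumZ scalerA.
by rewrite invfM invrK mulrAC divff ?mul1r// .
Qed.

Lemma sqr_sqrt_ball w : cnorm w < 1 ->
  toC (Num.sqrt (1 - cnorm w ^+ 2)) * toC (Num.sqrt (1 - cnorm w ^+ 2))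
  = 1 - toC (cnorm w ^+ 2) :> C R.
Proof.
move=> w1; rewrite -toCM -expr2 sqr_sqrtr ?toCB ?toC1// subr_ge0.
by rewrite exprn_ile1 ?cnorm_ge0// ltW.
Qed.

Lemma mform w t y : cnorm w < 1 ->
  cabs (mden w t y) ^+ 2 - cnorm (mnum w t y) ^+ 2 =
  (1 - cnorm w ^+ 2) * (cabs t ^+ 2 - cnorm y ^+ 2).
Proof.
move=> w1; have [w0|w0] := eqVneq w 0.
  rewrite /mden /mnum w0 conjv0 cdotC cdot0l subr0 scaler0 sub0r cnormN cnorm0.
  by rewrite expr0n subr0 sqrtr1 toC1 scale1r mul1r.
have W0 : toC (cnorm w ^+ 2) != 0 :> C R by rewrite toC_eq0 expf_eq0 cnorm_eq0.
have s2 := sqr_sqrt_ball w1.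
suff : toC (cabs (mden w t y) ^+ 2 - cnorm (mnum w t y) ^+ 2) =
  toC ((1 - cnorm w ^+ 2) * (cabs t ^+ 2 - cnorm y ^+ 2)) by case.
rewrite toCB (toCM (1 - _)) !toCB toC1 -!mul_conj -(cdot_conj (mnum _ _ _)) -(cdot_conj y).
rewrite /mden /mnum conjvB !conjvZ !conjB !conjM conjB conj1 !toC_conj conjV toC_conj.
rewrite !(cdotBl, cdotBr, cdotZl, cdotZr) !cdot_conj.
rewrite -(conj_cdot y w).
set s := toC (Num.sqrt _) in s2 *; set W := toC (cnorm w ^+ 2) in W0 s2 *.
set a := cdot y _; set Y := toC (cnorm y ^+ 2).
move: s2; rewrite -expr2 => s2.
have EW : W = 1 - s ^+ 2 by rewrite s2; ring.
rewrite EW in W0 *; field.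
exact: W0.
Qed.

Lemma mden_invol w t y : cnorm w < 1 ->
  mden w (mden w t y) (mnum w t y) = toC (1 - cnorm w ^+ 2) * t.
Proof.
move=> w1; have [w0|w0] := eqVneq w 0.
  by rewrite /mden /mnum w0 conjv0 !(cdotC _ 0) !cdot0l !subr0 cnorm0 expr0n subr0 toC1 mul1r.
have W0 : toC (cnorm w ^+ 2) != 0 :> C R by rewrite toC_eq0 expf_eq0 cnorm_eq0.
rewrite /mden /mnum cdotBl !cdotZl cdot_conj toCB toC1.
set s := toC (Num.sqrt _); set W := toC (cnorm w ^+ 2) in W0 *.
by set a := cdot y _; field.
Qed.

Lemma mnum_invol w t y : cnorm w < 1 ->
  mnum w (mden w t y) (mnum w t y) = toC (1 - cnorm w ^+ 2) *: y.
Proof.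
move=> w1; have [w0|w0] := eqVneq w 0.
  rewrite /mnum w0 !scaler0 !sub0r cnorm0 expr0n subr0 sqrtr1 toC1 !scale1r.
  by rewrite opprK.
have W0 : toC (cnorm w ^+ 2) != 0 :> C R by rewrite toC_eq0 expf_eq0 cnorm_eq0.
have s2 := sqr_sqrt_ball w1.
rewrite /mden /mnum cdotBl !cdotZl cdot_conj toCB toC1.
set s := toC (Num.sqrt _) in s2 *; set W := toC (cnorm w ^+ 2) in W0 s2 *.
set a := cdot y _; apply/rowP => j; rewrite !mxE.
have EW : W = 1 - s ^+ 2 by rewrite expr2 s2; ring.
rewrite EW in W0 *; field.
exact: W0.
Qed.

Lemma den_neq0 w x : cnorm w < 1 -> cnorm x < 1 -> mden w 1 x != 0.
Proof.
move=> w1 x1; rewrite /mden subr_eq0; apply/eqP => e.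
have := cauchy_schwarz x w; rewrite -e cabs1.
move=> h; have := le_lt_trans h (ltr_pM (cnorm_ge0 _) (cnorm_ge0 _) x1 w1).
by rewrite mulr1 ltxx.
Qed.

Lemma mobius_ball w x : cnorm w < 1 -> cnorm x < 1 ->
  1 - cnorm (mobius w x) ^+ 2 =
  (1 - cnorm w ^+ 2) * (1 - cnorm x ^+ 2) / cabs (1 - cdot x (conjv w)) ^+ 2.
Proof.
move=> w1 x1; have u0 := den_neq0 w1 x1.
have := mform 1 x w1; rewrite cabs1 expr1n => <-.
rewrite mobiusE cnormZ cabsV -/(mden w 1 x) exprMn exprVn mulrBl divff; last first.
  by rewrite expf_neq0// cabs_eq0.
by rewrite [X in 1 - X]mulrC.
Qed.

(* keeps unification from unfolding the quotient when it compares norms *)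
Local Opaque mobius.

Lemma lt1_sqr (a : R) : 0 <= a -> (0 < 1 - a ^+ 2) = (a < 1).
Proof. by move=> a0; rewrite subr_gt0 expr_lt1. Qed.

Lemma mobius_lt1 w x : cnorm w < 1 -> cnorm x < 1 -> cnorm (mobius w x) < 1.
Proof.
move=> w1 x1; rewrite -lt1_sqr ?cnorm_ge0// mobius_ball//.
have := den_neq0 w1 x1; rewrite -cabs_gt0 /mden => u0.
by rewrite divr_gt0 ?exprn_gt0// mulr_gt0// lt1_sqr ?cnorm_ge0.
Qed.

Lemma mobiusK w x : cnorm w < 1 -> cnorm x < 1 -> mobius w (mobius w x) = x.
Proof.
move=> w1 x1; have u0 := den_neq0 w1 x1.
rewrite [X in mobius w X]mobiusE mobius_homog// mden_invol// mnum_invol// mulr1.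
rewrite scalerA mulVf ?scale1r// toC_eq0 gt_eqF// lt1_sqr ?cnorm_ge0//.
Qed.

Lemma mobius0 w : mobius w 0 = w.
Proof.
rewrite mobiusE /mden /mnum cdot0l subr0 mul0r mul0r subr0 scaler0 subr0.
by rewrite invr1 !scale1r.
Qed.

Lemma cnorm_mobiusC w x : cnorm w < 1 -> cnorm x < 1 ->
  cnorm (mobius w x) = cnorm (mobius x w).
Proof.
move=> w1 x1.
have : 1 - cnorm (mobius w x) ^+ 2 = 1 - cnorm (mobius x w) ^+ 2.
  apply: etrans (mobius_ball w1 x1) _; apply: etrans _ (esym (mobius_ball x1 w1)).
  rewrite [(1 - cnorm x ^+ 2) * _]mulrC -(cabsJ (1 - cdot w _)) conjB conj1.
  by rewrite conj_cdot.
move=> /addrI/oppr_inj/eqP e; apply/eqP; move: e.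
by rewrite eqrXn2// cnorm_ge0.
Qed.

End Mobius.

(** * Linear maps scale a translation-invariant measure by a constant *)

Section HaarLinear.
Context {R : realType} {disp} {T : measurableType disp}.
Variables (m : {sigma_finite_measure set T -> \bar R}).
Variables (add sub : T -> T -> T) (A : T -> T) (o : T).
Local Open Scope ereal_scope.

Hypothesis madd : measurable_fun [set: T * T] (fun p => add p.1 p.2).
Hypothesis msub : measurable_fun [set: T * T] (fun p => sub p.1 p.2).
Hypothesis mA : measurable_fun [set: T] A.
Hypothesis addK : forall x y, sub (add y x) x = y.
Hypothesis subC : forall x y, sub y (add y x) = sub o x.
Hypothesis A_add : forall y, exists y', forall x, add y (A x) = A (add x y').
Hypothesis minv : forall f b, measurable_fun [set: T] f -> (forall x, 0 <= f x) ->
  \int[m]_x f (add x b) = \int[m]_x f x.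

(** Both orders of integration of [g(y) f(y + A x)]: translating the inner
    variable gives [(int f o A) (int g)] one way and [(int f) (int g o -A)] the
    other. *)
Lemma haar_linear (B : set T) : measurable B -> 0 < m B -> m B < +oo ->
  exists2 c : \bar R, 0 <= c & forall f, measurable_fun [set: T] f ->
    (forall x, 0 <= f x) -> \int[m]_x f (A x) = c * \int[m]_x f x.
Proof.
move=> mB B0 Boo.
pose g (x : T) : \bar R := (\1_B x)%:E.
have mg : measurable_fun [set: T] g.
  by apply/measurable_EFinP; exact: measurable_indic.
have g0 x : 0 <= g x by rewrite lee_fin.
have intg : \int[m]_x g x = m B by rewrite integral_indic// setIT.
pose k := \int[m]_x g (sub o (A x)).
have k0 : 0 <= k by apply: integral_ge0.
pose Bi : R := ((fine (m B))^-1)%R.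
have BE : m B = (fine (m B))%:E by rewrite fineK// ge0_fin_numE// ltW.
have B1 : (0 < fine (m B))%R by rewrite -lte_fin -BE.
have BB : Bi%:E * m B = 1 by rewrite BE -EFinM mulVf// gt_eqF.
exists (Bi%:E * k); first by rewrite mule_ge0// lee_fin invr_ge0 ltW.
move=> f mf f0.
have mfst := @measurable_fst _ _ T T; have msnd := @measurable_snd _ _ T T.
have mpA : measurable_fun [set: T * T] (fun p : T * T => (p.1, A p.2)).
  by apply/measurable_fun_pairP; split => //; exact: measurableT_comp mA msnd.
have mf2 : measurable_fun [set: T * T] (fun p : T * T => f (add p.1 (A p.2))).
  exact: (measurableT_comp mf (measurableT_comp madd mpA)).
have mg2 : measurable_fun [set: T * T] (fun p : T * T => g (sub p.1 (A p.2))).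
  exact: (measurableT_comp mg (measurableT_comp msub mpA)).
have mF : measurable_fun [set: T * T] (fun p : T * T => g p.1 * f (add p.1 (A p.2))).
  apply: emeasurable_funM => //; exact: measurableT_comp mg mfst.
have mG : measurable_fun [set: T * T] (fun p : T * T => f p.1 * g (sub p.1 (A p.2))).
  apply: emeasurable_funM => //; exact: measurableT_comp mf mfst.
have mfA : measurable_fun [set: T] (f \o A) by exact: measurableT_comp.
have E1 : \int[m]_y \int[m]_x (g y * f (add y (A x))) = m B * \int[m]_x f (A x).
  transitivity (\int[m]_y (g y * \int[m]_x f (A x))).
    apply: eq_integral => y _.
    have mfy : measurable_fun [set: T] (fun x => f (add y (A x))).
      exact: measurableT_comp mf2 (@pair1_measurable _ _ T T y).
    rewrite (ge0_integralZl m measurableT mfy (fun x _ => f0 _) (g0 y)).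
    congr (_ * _); have [y' yE] := A_add y.
    under eq_integral do rewrite yE.
    exact: (minv y' mfA (fun x => f0 _)).
  have If0 : 0 <= \int[m]_x f (A x) by apply: integral_ge0.
  by rewrite (ge0_integralZr m measurableT mg (fun x _ => g0 x) If0) intg.
have E2 : \int[m]_x \int[m]_y (g y * f (add y (A x))) =
    \int[m]_x \int[m]_y (f y * g (sub y (A x))).
  apply: eq_integral => x _.
  have mh : measurable_fun [set: T] (fun y => f y * g (sub y (A x))).
    exact: measurableT_comp mG (pair2_measurable x).
  rewrite -(minv (A x) mh (fun y => mule_ge0 (f0 y) (g0 _))).
  by apply: eq_integral => y _; rewrite addK muleC.
have E3 : \int[m]_y \int[m]_x (f y * g (sub y (A x))) = k * \int[m]_x f x.
  transitivity (\int[m]_y (f y * k)).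
    apply: eq_integral => y _.
    have mgy : measurable_fun [set: T] (fun x => g (sub y (A x))).
      exact: measurableT_comp mg2 (@pair1_measurable _ _ T T y).
    rewrite (ge0_integralZl m measurableT mgy (fun x _ => g0 _) (f0 y)).
    congr (_ * _); have [y' yE] := A_add y.
    rewrite -(minv y' mgy (fun x => g0 _)).
    by apply: eq_integral => x _; rewrite -yE subC.
  by rewrite (ge0_integralZr m measurableT mf (fun x _ => f0 x) k0) muleC.
have := E1; rewrite (@fubini_tonelli _ _ _ _ _ m m _ mF (fun p => mule_ge0 (g0 _) (f0 _))).
rewrite E2 -(@fubini_tonelli _ _ _ _ _ m m _ mG (fun p => mule_ge0 (f0 _) (g0 _))).
rewrite E3 -muleA => ->.
by rewrite muleA BB mul1e.
Qed.

End HaarLinear.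

Section ComplexScaling.
Context {R : realType} {d : nat}.
Local Open Scope ereal_scope.
Local Notation V := (@Cvec R d).

Lemma integral_vb_indic (A : set V) : measurable A ->
  \int[vb d]_z (\1_A z)%:E = vb d A.
Proof. by move=> mA; rewrite (integral_indic (vb d) measurableT mA) setIT. Qed.

Lemma integral_vb_scale (a : C R) (f : V -> \bar R) : a != 0%R ->
  measurable_fun [set: V] f -> (forall x, 0 <= f x) ->
  \int[vb d]_z f (a *: (z : 'rV[C R]_d))%R = ((cabs a)^-1 ^+ (d + d))%:E * \int[vb d]_z f z.
Proof.
move=> a0 mf f0.
have ca0 : (0 < cabs a)%R by rewrite cabs_gt0.
have mfst := @measurable_fst _ _ V V; have msnd := @measurable_snd _ _ V V.
have mZ (b : C R) : measurable_fun [set: V] (fun z => b *: (z : 'rV[C R]_d) : V)%R.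
  by apply: measurable_vecZ => //; exact: cmeas_cst.
have [c c0 cE] : exists2 c : \bar R, 0 <= c & forall f : V -> \bar R,
    measurable_fun [set: V] f -> (forall x, 0 <= f x) ->
    \int[vb d]_x f (a *: (x : 'rV[C R]_d))%R = c * \int[vb d]_x f x.
  apply: (@haar_linear R _ V (vb d) (fun x y : 'rV[C R]_d => x + y)%R
    (fun x y : 'rV[C R]_d => x - y)%R (fun x : 'rV[C R]_d => a *: x)%R (0 : 'rV[C R]_d)%R
    (measurable_vecD mfst msnd) (measurable_vecB mfst msnd) (mZ a) _ _ _ _ (uball R d)).
  - by move=> x y; rewrite addrK.
  - by move=> x y; rewrite opprD addNKr sub0r.
  - move=> y; exists (a^-1 *: y)%R => x.
    by rewrite scalerDr scalerA divff// scale1r addrC.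
  - by move=> h b mh h0; exact: integral_vb_translate.
  - exact: measurable_uball.
  - by rewrite -[X in _ < X]/(vb d (uball R d)) vb_uball lte_fin.
  - by rewrite -[X in X < _]/(vb d (uball R d)) vb_uball ltry.
rewrite (cE f mf f0); congr (_ * _).
have mi r : measurable_fun [set: V] (fun z : V => (\1_([set z : V | cnorm z < r]%R) z)%:E : \bar R).
  by apply/measurable_EFinP; apply: measurable_indic; exact: measurable_cball.
have := cE _ (mi 1%R) (fun z => ltac:(by rewrite lee_fin)).
rewrite (integral_vb_indic (@measurable_cball R d 1%R)).
rewrite [X in _ = c * X](_ : _ = 1); last exact: vb_uball.
rewrite mule1 => <-; rewrite -(@vb_ball R d (cabs a)^-1%R) ?invr_gt0//.
rewrite -(integral_vb_indic (@measurable_cball R d _)).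
apply: eq_integral => z _; rewrite !indicE; congr (_%:R%:E).
congr nat_of_bool; apply/idP/idP => /set_mem h; apply/mem_set; move: h;
    by rewrite /= cnormZ -ltr_pdivlMl// mulr1.
Qed.

End ComplexScaling.

(** * The invariant measure of the ball *)

Section MobiusInvariance.
Context {R : realType} {d : nat}.
Local Open Scope ereal_scope.
Local Notation V1 := (@Cvec R 1).
Local Notation V := (@Cvec R d).
Local Notation m := (vb 1 \x vb d).
Local Opaque mobius.

Definition jac (x : 'rV[C R]_d) : R :=
  if (cnorm x < 1)%R then ((1 - cnorm x ^+ 2)^-1 ^+ d.+1)%R else 0%R.

Lemma jac_ge0 x : (0 <= jac x)%R.
Proof.
rewrite /jac; case: ifPn => // x1.
by rewrite exprn_ge0// invr_ge0 ltW// lt1_sqr ?cnorm_ge0.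
Qed.

Lemma measurable_lt_fun dT (T : measurableType dT) (f g : T -> R) :
  measurable_fun [set: T] f -> measurable_fun [set: T] g ->
  measurable_fun [set: T] (fun t => f t < g t)%R.
Proof. by move=> mf mg; exact: measurable_fun_ltr. Qed.

Lemma measurable_jac : measurable_fun [set: V] (jac : V -> R).
Proof.
apply: measurable_fun_ifT.
- by apply: measurable_lt_fun; [exact: measurable_cnorm|exact: measurable_cst].
- apply: measurable_funX.
  rewrite (_ : (fun _ => _) = fun x : V => (1 - cnorm (x : 'rV[C R]_d) ^+ 2) / (1 - cnorm (x : 'rV[C R]_d) ^+ 2) ^+ 2)%R.
    apply: measurable_funM.
      by apply: measurable_funB => //; apply: measurable_funX; exact: measurable_cnorm.
    apply: measurable_nninv => [x|]; first exact: sqr_ge0.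
    apply: measurable_funX; apply: measurable_funB => //.
    by apply: measurable_funX; exact: measurable_cnorm.
  apply/funext => x.
  have [->|h] := eqVneq (1 - cnorm (x : 'rV[C R]_d) ^+ 2)%R 0%R.
    by rewrite invr0 mul0r.
  by rewrite expr2 invfM mulrA divff// mul1r.
- exact: measurable_cst.
Qed.

Let tt (p : V1 * V) : C R := (p.1 : 'rV[C R]_1) ord0 ord0.
Let qf (p : V1 * V) : R := (cabs (tt p) ^+ 2 - cnorm (p.2 : 'rV[C R]_d) ^+ 2)%R.
Let F (g : V -> \bar R) (b : R) (p : V1 * V) : \bar R :=
  if (0 < qf p < b)%R then g ((tt p)^-1 *: (p.2 : 'rV[C R]_d))%R else 0.
Let G (g : V -> \bar R) (b : R) (p : V1 * V) : \bar R :=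
  ((cabs (tt p) ^+ (d + d))%R)%:E *
  (if (0 < cabs (tt p) ^+ 2 * (1 - cnorm (p.2 : 'rV[C R]_d) ^+ 2) < b)%R then g p.2 else 0).

Let mtt : cmeas tt.
Proof. exact: (cmeas_coord ord0 (@measurable_fst _ _ V1 V)). Qed.
Let mn2 : measurable_fun [set: V1 * V] (fun p => cnorm (p.2 : 'rV[C R]_d)).
Proof. exact: (measurableT_comp (@measurable_cnorm R d) (@measurable_snd _ _ V1 V)). Qed.
Let mqf : measurable_fun [set: V1 * V] qf.
Proof.
by apply: measurable_funB; [exact: measurable_sqr_cabs|exact: measurable_funX].
Qed.

Let mband (f : V1 * V -> R) b : measurable_fun [set: V1 * V] f ->
  measurable_fun [set: V1 * V] (fun p => 0 < f p < b)%R.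
Proof.
move=> mf; apply: measurable_and; apply: measurable_lt_fun => //; exact: measurable_cst.
Qed.

Let mF g b : measurable_fun [set: V] g -> measurable_fun [set: V1 * V] (F g b).
Proof.
move=> mg; apply: measurable_fun_ifT.
- exact: mband.
- have mdiv : measurable_fun [set: V1 * V] (fun p => (tt p)^-1 *: (p.2 : 'rV[C R]_d) : V)%R.
    by apply: measurable_vecZ; [exact: cmeasV|exact: measurable_snd].
  exact: measurableT_comp mg mdiv.
- exact: measurable_cst.
Qed.

Let mG g b : measurable_fun [set: V] g -> measurable_fun [set: V1 * V] (G g b).
Proof.
move=> mg; apply: emeasurable_funM.
  by apply/measurable_EFinP; apply: measurable_funX; exact: measurable_cabs.
apply: measurable_fun_ifT.
- apply: mband; apply: measurable_funM; first exact: measurable_sqr_cabs.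
  by apply: measurable_funB; [exact: measurable_cst|exact: measurable_funX].
- exact: measurableT_comp mg (@measurable_snd _ _ V1 V).
- exact: measurable_cst.
Qed.

Let kappa : \bar R := \int[vb 1]_t ((cabs ((t : 'rV[C R]_1) ord0 ord0) ^+ (d + d))%:E *
   (if (0 < cabs ((t : 'rV[C R]_1) ord0 ord0) ^+ 2 < 1)%R then 1 else 0)).

Let cnorm1 (t : 'rV[C R]_1) : cnorm t = cabs (t ord0 ord0).
Proof. by rewrite /cnorm big_ord1 sqrtr_sqr ger0_norm// cabs_ge0. Qed.

Let mc1 : measurable_fun [set: V1] (fun t : V1 => cabs ((t : 'rV[C R]_1) ord0 ord0)).
Proof. by apply: measurable_cabs; apply: cmeas_coord. Qed.

Let mkap b (r : R) : measurable_fun [set: V1] (fun t : V1 =>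
   (cabs ((t : 'rV[C R]_1) ord0 ord0) ^+ (d + d))%:E *
   (if (0 < cabs ((t : 'rV[C R]_1) ord0 ord0) ^+ 2 * r < b)%R then 1 else 0) : \bar R).
Proof.
apply: emeasurable_funM; first by apply/measurable_EFinP; exact: measurable_funX.
apply: measurable_fun_ifT; try exact: measurable_cst.
apply: measurable_and; apply: measurable_lt_fun; try exact: measurable_cst.
  by apply: measurable_funM; [exact: measurable_funX|exact: measurable_cst].
by apply: measurable_funM; [exact: measurable_funX|exact: measurable_cst].
Qed.

Let kappa_scale b (r : R) : (0 < b)%R -> (0 < r)%R ->
  \int[vb 1]_t ((cabs ((t : 'rV[C R]_1) ord0 ord0) ^+ (d + d))%:E *
   (if (0 < cabs ((t : 'rV[C R]_1) ord0 ord0) ^+ 2 * r < b)%R then 1 else 0)) =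
  ((b * r^-1) ^+ d.+1)%:E * kappa.
Proof.
move=> b0 r0; pose a := Num.sqrt (b / r).
have br0 : (0 < b / r)%R by rewrite divr_gt0.
have a0 : (0 < a)%R by rewrite sqrtr_gt0.
have a2 : (a ^+ 2 = b / r)%R by rewrite sqr_sqrtr// ltW.
have k0 (t : V1) : 0 <= ((cabs ((t : 'rV[C R]_1) ord0 ord0) ^+ (d + d))%:E *
   (if (0 < cabs ((t : 'rV[C R]_1) ord0 ord0) ^+ 2 * r < b)%R then 1 else 0) : \bar R).
  by rewrite mule_ge0 ?lee_fin ?exprn_ge0 ?cabs_ge0//; case: ifP.
have := @integral_vb_scale R 1 (toC a) _ _ (mkap b r) k0.
rewrite toC_eq0 gt_eqF// => /(_ isT); rewrite cabs_toC gtr0_norm//.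
set L := (X in X = _ -> _); set J := (X in _ = _ * X -> _) => E.
have EL : L = (a ^+ (d + d))%:E * kappa.
  rewrite /L /kappa -ge0_integralZl_EFin//.
  - apply: eq_integral => t _; rewrite mxE cabsM cabs_toC gtr0_norm// exprMn.
    rewrite EFinM -muleA exprMn a2 mulrAC divfK ?gt_eqF//.
    rewrite pmulr_rgt0// gtr_pMr//.
  - by move=> t _; rewrite mule_ge0 ?lee_fin ?exprn_ge0 ?cabs_ge0//; case: ifP.
  - by have := mkap 1%R 1%R; under eq_fun do rewrite mulr1.
  - by rewrite exprn_ge0// ltW.
have a20 : (a ^+ 2 != 0)%R by rewrite expf_neq0// gt_eqF.
have : (a ^+ 2)%:E * L = J.
  by rewrite E muleA -EFinM exprVn mulfV// mul1e.
move=> E2; apply: etrans (esym E2) _.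
rewrite EL muleA -EFinM -exprD -a2 -exprM; congr ((a ^+ _)%:E * _).
by rewrite mulnS mulnC muln2 addnn.
Qed.

Let kappa_gt0 : 0 < kappa.
Proof.
pose B r : set V1 := [set z | cnorm z < r]%R.
have mB r : measurable (B r) by exact: measurable_cball.
pose e : R := ((2^-1) ^+ (d + d))%R.
have e0 : (0 < e)%R by rewrite exprn_gt0.
apply: (@lt_le_trans _ _ (\int[vb 1]_t (e%:E * (\1_(B 1%R `\` B (2^-1)%R) t)%:E))).
  have mD : measurable (B 1%R `\` B (2^-1)%R) by exact: measurableD.
  rewrite ge0_integralZl_EFin//; last 2 first.
  - by apply/measurable_EFinP; exact: measurable_indic.
  - exact: ltW.
  rewrite integral_vb_indic// mule_gt0 ?lte_fin//.
  have B1 : vb 1 (B 1%R) < +oo by rewrite (vb_ball 1 ltr01) ltry.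
  rewrite (@measureD _ _ _ (vb 1) _ _ (mB 1%R) (mB (2^-1)%R) B1).
  rewrite setIidr; last by move=> t /= h; apply: lt_trans h _; rewrite invf_lt1// ltr1n.
  have h0 : (0 < 2^-1 :> R)%R by [].
  rewrite [X in X - _](vb_ball 1 ltr01) [X in _ - X](vb_ball 1 h0) -EFinD lte_fin.
  by rewrite expr1n subr_gt0 expr_lt1// invf_lt1// ltr1n.
apply: ge0_le_integral => //.
- by move=> t _; rewrite mule_ge0// lee_fin// ltW.
- apply: measurable_funeM; apply/measurable_EFinP; apply: measurable_indic.
  exact: measurableD.
- by have := mkap 1%R 1%R; under eq_fun do rewrite mulr1.
move=> t _; rewrite indicE; case: ifPn => /=; last first.
  move=> h; rewrite mule0; case: (boolP (_ \in _)) => [/set_mem[]|]; last by rewrite mule0.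
  rewrite /B /= !cnorm1 => h1 /negP; rewrite -leNgt => h2.
  move: h; rewrite expr_lt1 ?cabs_ge0// h1 andbT exprn_gt0//.
  exact: lt_le_trans h2.
rewrite mule1 => _; case: (boolP (_ \in _)) => [/set_mem[]|_]; last first.
  by rewrite mule0 lee_fin exprn_ge0// cabs_ge0.
rewrite /B /= !cnorm1 => h1 /negP; rewrite -leNgt => h2.
by rewrite mule1 lee_fin lerXn2r ?nnegrE ?cabs_ge0.
Qed.

Let kappa_lty : kappa < +oo.
Proof.
pose B : set V1 := [set z | cnorm z < 1]%R.
have mB : measurable B by exact: measurable_cball.
apply: (@le_lt_trans _ _ (\int[vb 1]_t (\1_B t)%:E)); last first.
  by rewrite integral_vb_indic// (vb_ball 1 ltr01) ltry.
apply: ge0_le_integral => //.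
- by move=> t _; rewrite mule_ge0 ?lee_fin ?exprn_ge0 ?cabs_ge0//; case: ifP.
- by have := mkap 1%R 1%R; under eq_fun do rewrite mulr1.
- by apply/measurable_EFinP; exact: measurable_indic.
move=> t _; case: ifPn => [/andP[_]|_]; last by rewrite mule0 lee_fin.
rewrite expr_lt1 ?cabs_ge0// => h; rewrite mule1 indicE mem_set /B /= ?cnorm1//.
by rewrite lee_fin exprn_ile1 ?cabs_ge0// ltW.
Qed.

Let Iv (g : V -> \bar R) := \int[vb d]_x (g x * (jac x)%:E).

Let F0 g b p : (forall x, 0 <= g x) -> 0 <= F g b p.
Proof. by move=> g0; rewrite /F; case: ifP. Qed.
Let G0 g b p : (forall x, 0 <= g x) -> 0 <= G g b p.
Proof.
move=> g0; rewrite /G mule_ge0 ?lee_fin ?exprn_ge0 ?cabs_ge0//.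
by case: ifP.
Qed.

(** Fubini in polar-like coordinates [y = t x] on the cone [|y| < |t|]. *)
Let cone_integral g b : measurable_fun [set: V] g -> (forall x, 0 <= g x) -> (0 < b)%R ->
  \int[m]_p F g b p = (b ^+ d.+1)%:E * kappa * Iv g.
Proof.
move=> mg g0 b0.
have mFg := mF b mg; have mGg := mG b mg.
rewrite (@fubini_tonelli1 _ _ _ _ _ (vb 1) (vb d) _ mFg (fun p => F0 b p g0)).
transitivity (\int[vb 1]_t \int[vb d]_x G g b (t, x)).
  apply: eq_integral => t _; rewrite /fubini_F.
  have [t0|t0] := eqVneq ((t : 'rV[C R]_1) ord0 ord0) 0%R.
    transitivity (\int[vb d]_x (cst 0 x : \bar R)).
      apply: eq_integral => x _; rewrite /F /qf /tt /= t0 cabs0 expr0n sub0r.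
      by rewrite oppr_gt0 ltNge sqr_ge0.
    apply: eq_integral => x _; rewrite /G /tt /= t0 cabs0 [(0 ^+ 2)%R]expr0n /=.
    by rewrite mul0r ltxx mule0.
  have mFt : measurable_fun [set: V] (fun x => F g b (t, x)).
    exact: (measurableT_comp mFg (@pair1_measurable _ _ V1 V t)).
  have ct0 : (0 < cabs ((t : 'rV[C R]_1) ord0 ord0))%R by rewrite cabs_gt0.
  have E := integral_vb_scale t0 mFt (fun x => F0 b (t, x) g0).
  have : (cabs ((t : 'rV[C R]_1) ord0 ord0) ^+ (d + d))%:E * (\int[vb d]_z F g b (t, ((t : 'rV[C R]_1) ord0 ord0 *: (z : 'rV[C R]_d))%R))
     = \int[vb d]_x F g b (t, x).
    rewrite E muleA -EFinM exprVn mulfV ?mul1e// expf_neq0// gt_eqF//.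
  move=> <-; rewrite -ge0_integralZl_EFin//.
  - apply: eq_integral => x _; rewrite /F /G /qf /tt /= cnormZ exprMn.
    have -> (u v : R) : (u - u * v = u * (1 - v))%R by ring.
    by rewrite scalerA mulVf// scale1r.
  - by move=> x _; exact: F0.
  - have mtx : measurable_fun [set: V] (fun x : V => ((t : 'rV[C R]_1) ord0 ord0 *: (x : 'rV[C R]_d))%R : V).
      by apply: measurable_vecZ => //; exact: cmeas_cst.
    exact: (measurableT_comp mFt mtx).
  - by rewrite exprn_ge0// cabs_ge0.
rewrite (@fubini_tonelli _ _ _ _ _ (vb 1) (vb d) _ mGg (fun p => G0 b p g0)).
rewrite /Iv -ge0_integralZl//; last 3 first.
- apply: emeasurable_funM => //; apply/measurable_EFinP; exact: measurable_jac.
- by move=> x _; rewrite mule_ge0// lee_fin jac_ge0.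
- by rewrite mule_ge0 ?lee_fin ?exprn_ge0 ?ltW.
apply: eq_integral => x _; rewrite /jac; case: ifPn => x1; last first.
  rewrite !mule0; transitivity (\int[vb 1]_t (cst 0 t : \bar R)); last exact: integral0.
  apply: eq_integral => t _; rewrite /G /tt /= ifF ?mule0//.
  apply/negbTE/negP => /andP[]; rewrite ltNge => /negP h _; apply: h.
  rewrite mulr_ge0_le0 ?sqr_ge0// subr_le0 expr_ge1 ?cnorm_ge0// leNgt//.
have r0 : (0 < 1 - cnorm (x : 'rV[C R]_d) ^+ 2)%R by rewrite lt1_sqr ?cnorm_ge0.
transitivity (g x * (((b * (1 - cnorm (x : 'rV[C R]_d) ^+ 2)^-1) ^+ d.+1)%:E * kappa)).
  rewrite -(kappa_scale b0 r0) -ge0_integralZl//; last first.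
    by move=> t _; rewrite mule_ge0 ?lee_fin ?exprn_ge0 ?cabs_ge0//; case: ifP.
  apply: eq_integral => t _; rewrite /G /tt /= muleCA; congr (_ * _).
  by case: ifP; rewrite ?mule1 ?mule0.
by rewrite [RHS]muleCA exprMn EFinM muleAC.
Qed.

Let ball_bounds r : (0 < r < 1)%R ->
  0 < Iv (fun x => (\1_([set z : V | cnorm z < r]%R) x)%:E) < +oo.
Proof.
move=> /andP[r0 r1]; set g := fun x : V => (\1_([set z : V | cnorm z < r]%R) x)%:E : \bar R.
have mB : measurable ([set z | (cnorm z < r)%R] : set V).
  exact: measurable_cball.
have r2 : (0 < 1 - r ^+ 2)%R by rewrite lt1_sqr// ltW.
have mg : measurable_fun [set: V] g by apply/measurable_EFinP; exact: measurable_indic.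
have mgj : measurable_fun [set: V] (fun x => g x * (jac x)%:E).
  by apply: emeasurable_funM => //; apply/measurable_EFinP; exact: measurable_jac.
have j1 x : (cnorm x < r)%R -> (1 <= jac x <= ((1 - r ^+ 2)^-1) ^+ d.+1)%R.
  move=> xr; have x1 := lt_trans xr r1; rewrite /jac x1.
  have s0 : (0 < 1 - cnorm x ^+ 2)%R by rewrite lt1_sqr ?cnorm_ge0.
  apply/andP; split.
    by rewrite exprn_ege1// invf_ge1// gerBl sqr_ge0.
  rewrite lerXn2r ?nnegrE ?invr_ge0 ?(ltW s0) ?(ltW r2)//.
  rewrite lef_pV2 ?posrE// lerD2l lerN2.
  by rewrite lerXn2r ?nnegrE ?cnorm_ge0// ltW.
apply/andP; split.
  apply: (@lt_le_trans _ _ (\int[vb d]_x g x)).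
    by rewrite integral_vb_indic// vb_ball// lte_fin exprn_gt0.
  apply: ge0_le_integral => //; first by move=> x _; rewrite lee_fin.
  move=> x _; rewrite /g indicE; case: (boolP (_ \in _)) => [/set_mem /= xr|_]; last by rewrite mul0e.
  by rewrite mul1e lee_fin; have /andP[] := j1 _ xr.
apply: (@le_lt_trans _ _ (\int[vb d]_x ((((1 - r ^+ 2)^-1) ^+ d.+1)%:E * g x))).
  apply: ge0_le_integral => //.
  - by move=> x _; rewrite mule_ge0// lee_fin ?jac_ge0.
  - exact: measurable_funeM.
  move=> x _; rewrite /g indicE; case: (boolP (_ \in _)) => [/set_mem /= xr|_]; last by rewrite mul0e mule0.
  by rewrite mul1e mule1 lee_fin; have /andP[] := j1 _ xr.
rewrite ge0_integralZl_EFin//; last 2 first.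
- by move=> x _; rewrite lee_fin.
- by rewrite exprn_ge0// invr_ge0 ltW.
by rewrite integral_vb_indic// vb_ball// -EFinM ltry.
Qed.

Let prod_sigma_finite : sigma_finite [set: V1 * V] m.
Proof.
have /sigma_finiteP[A [TA ndA Aoo]] := sigma_finiteT (vb (R := R) 1).
have /sigma_finiteP[B [TB ndB Boo]] := sigma_finiteT (vb (R := R) d).
exists (fun k => A k `*` B k).
  apply/esym; rewrite -subTset => -[t x] _.
  have : (\bigcup_k A k) t by rewrite -TA.
  have : (\bigcup_k B k) x by rewrite -TB.
  move=> [k _ Bk] [l _ Al]; exists (maxn l k) => //; split => /=.
    by move: Al; exact/subsetPset/ndA/leq_maxl.
  by move: Bk; exact/subsetPset/ndB/leq_maxr.
move=> k; have [mA Ak] := Aoo k; have [mB Bk] := Boo k; split.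
  exact: measurableX.
by rewrite product_measure1E// lte_mul_pinfty// ge0_fin_numE.
Qed.

Let mprod (A : set (V1 * V)) : \bar R := m A.
HB.instance Definition _ := Measure.copy mprod m.
HB.instance Definition _ :=
  Measure_isSigmaFinite.Build _ _ _ mprod prod_sigma_finite.

Let addp (p p' : V1 * V) : V1 * V :=
  ((p.1 : 'rV[C R]_1) + (p'.1 : 'rV[C R]_1), (p.2 : 'rV[C R]_d) + (p'.2 : 'rV[C R]_d))%R.
Let subp (p p' : V1 * V) : V1 * V :=
  ((p.1 : 'rV[C R]_1) - (p'.1 : 'rV[C R]_1), (p.2 : 'rV[C R]_d) - (p'.2 : 'rV[C R]_d))%R.

Let mprod_translate (f : V1 * V -> \bar R) q : measurable_fun [set: V1 * V] f ->
  (forall p, 0 <= f p) -> \int[mprod]_p f (addp p q) = \int[mprod]_p f p.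
Proof.
move=> mf f0.
have madd : measurable_fun [set: V1 * V] (fun p => addp p q).
  apply/measurable_fun_pairP; split.
    exact: (measurable_vecD (@measurable_fst _ _ V1 V) (measurable_cst (q.1 : V1))).
  exact: (measurable_vecD (@measurable_snd _ _ V1 V) (measurable_cst (q.2 : V))).
have mfa := measurableT_comp mf madd.
rewrite [LHS](@fubini_tonelli1 _ _ _ _ _ (vb 1) (vb d) _ mfa (fun p => f0 _)).
rewrite [RHS](@fubini_tonelli1 _ _ _ _ _ (vb 1) (vb d) _ mf f0).
have mg := @measurable_fun_fubini_tonelli_F _ _ _ _ _ (vb d) _ mf f0.
rewrite -(integral_vb_translate q.1 mg); last by move=> t; apply: integral_ge0.
apply: eq_integral => t _; rewrite /fubini_F /=.
have mft : measurable_fun [set: V] (fun x => f ((t : 'rV[C R]_1) + (q.1 : 'rV[C R]_1), x)%R).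
  exact: (measurableT_comp mf (@pair1_measurable _ _ V1 V _)).
by rewrite -(integral_vb_translate q.2 mft).
Qed.

Section invariance.
Variable w : 'rV[C R]_d.
Hypothesis w1 : (cnorm w < 1)%R.

Let Aw (p : V1 * V) : V1 * V :=
  ((const_mx (mden w (tt p) p.2) : 'rV[C R]_1), mnum w (tt p) p.2).

Let mAw : measurable_fun [set: V1 * V] Aw.
Proof.
have msnd := @measurable_snd _ _ V1 V.
have mc : cmeas (fun p : V1 * V => cdot (p.2 : 'rV[C R]_d) (conjv w)).
  by apply: (cmeas_cdot msnd); exact: measurable_cst.
apply/measurable_fun_pairP; split.
  apply: measurable_vec => j; rewrite /Aw /=; under eq_fun do rewrite mxE.
  exact: cmeasB.
rewrite /Aw /= /mnum; apply: measurable_vecB; last first.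
  by apply: measurable_vecZ => //; exact: cmeas_cst.
apply: measurable_vecZ; last exact: measurable_cst.
apply: cmeasB => //; apply: cmeasM; last exact: cmeas_cst.
by apply: cmeasM => //; exact: cmeas_cst.
Qed.

Let Aw_add p q : Aw (addp p q) = addp (Aw p) (Aw q).
Proof.
rewrite /Aw /addp /tt /=; congr pair; apply/rowP => j; rewrite !mxE.
  by rewrite /mden cdotDl; ring.
by rewrite cdotDl; ring.
Qed.

Let Aw_surj q : exists q', Aw q' = q.
Proof.
have c0 : toC (1 - cnorm w ^+ 2) != 0%R :> C R.
  by rewrite toC_eq0 gt_eqF// lt1_sqr ?cnorm_ge0.
pose k : C R := ((toC (1 - cnorm w ^+ 2))^-1)%R.
exists ((const_mx (k * mden w (tt q) q.2) : 'rV[C R]_1)%R, k *: mnum w (tt q) q.2)%R.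
rewrite /Aw /tt /= mxE mdenZ mnumZ mden_invol// mnum_invol//.
rewrite /k scalerA mulrA mulVf// mul1r scale1r.
by case: q => q1 q2; congr pair; apply/rowP => j; rewrite mxE !ord1.
Qed.

Let F_mobius g p : F (fun x => g (mobius w x)) 1 p = F g (1 - cnorm w ^+ 2) (Aw p).
Proof.
have c0 : (0 < 1 - cnorm w ^+ 2)%R by rewrite lt1_sqr ?cnorm_ge0.
rewrite /F; have -> : (qf (Aw p) = (1 - cnorm w ^+ 2) * qf p)%R.
  by rewrite /qf /Aw /tt /= mxE mform.
rewrite pmulr_rgt0// gtr_pMr//; case: ifPn => // /andP[q0 _].
have t0 : tt p != 0%R.
  rewrite -cabs_eq0; apply/eqP => e; move: q0; rewrite /qf e expr0n sub0r.
  by rewrite oppr_gt0 ltNge sqr_ge0.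
by rewrite mobius_homog// /Aw /tt /= mxE.
Qed.

Let mob_meas g : measurable_fun [set: V] g -> measurable_fun [set: V] (fun x : V => g (mobius w x : V) : \bar R).
Proof.
move=> mg.
have mm := measurable_mobius (measurable_cst (w : V) : measurable_fun [set: V] _) (@measurable_id _ V setT).
exact: measurableT_comp mg mm.
Qed.

(** The constant by which [mobius w] scales the invariant integral squares to
    one, as [mobius w] is an involution. *)
Lemma integral_mobius (g : V -> \bar R) : measurable_fun [set: V] g -> (forall x, 0 <= g x) ->
  \int[vb d]_x (g (mobius w x) * (jac x)%:E) = \int[vb d]_x (g x * (jac x)%:E).
Proof.
have [c c0 cE] : exists2 c : \bar R, 0 <= c & forall f, measurable_fun [set: V1 * V] f ->
    (forall x, 0 <= f x) -> \int[mprod]_x f (Aw x) = c * \int[mprod]_x f x.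
  pose B : set (V1 * V) := (uball R 1 : set V1) `*` (uball R d : set V).
  have mB : measurable B by apply: measurableX; exact: measurable_uball.
  have B1 : mprod B = 1.
    rewrite [LHS](product_measure1E (vb 1) (vb d)); try exact: measurable_uball.
    by rewrite [X in X * _](vb_uball 1) [X in _ * X](vb_uball d) mule1.
  have mfst := @measurable_fst _ _ (V1 * V)%type (V1 * V)%type.
  have msnd := @measurable_snd _ _ (V1 * V)%type (V1 * V)%type.
  have mf1 := @measurable_fst _ _ V1 V; have ms1 := @measurable_snd _ _ V1 V.
  apply: (@haar_linear R _ _ mprod addp subp Aw (const_mx 0, const_mx 0)%R _ _ mAw _ _ _ _ B mB).
  - apply/measurable_fun_pairP; split.
      exact: (measurable_vecD (measurableT_comp mf1 mfst) (measurableT_comp mf1 msnd)).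
    exact: (measurable_vecD (measurableT_comp ms1 mfst) (measurableT_comp ms1 msnd)).
  - apply/measurable_fun_pairP; split.
      exact: (measurable_vecB (measurableT_comp mf1 mfst) (measurableT_comp mf1 msnd)).
    exact: (measurable_vecB (measurableT_comp ms1 mfst) (measurableT_comp ms1 msnd)).
  - by move=> [x1 x2] [y1 y2]; rewrite /subp /addp /= !addrK.
  - by move=> [x1 x2] [y1 y2]; rewrite /subp /addp /= !opprD !addNKr !sub0r.
  - move=> y; have [y' <-] := Aw_surj y; exists y' => x; rewrite Aw_add.
    by rewrite /addp; congr pair; rewrite addrC.
  - by move=> f b mf f0; exact: mprod_translate.
  - by rewrite -[X in _ < X]/(mprod B) B1 lte_fin.
  - by rewrite -[X in X < _]/(mprod B) B1 ltry.
have b0 : (0 < 1 - cnorm w ^+ 2)%R by rewrite lt1_sqr ?cnorm_ge0.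
have kfin : kappa \is a fin_num by rewrite ge0_fin_numE// ltW.
pose c' := c * ((1 - cnorm w ^+ 2) ^+ d.+1)%:E.
have E g' : measurable_fun [set: V] g' -> (forall x, 0 <= g' x) ->
    Iv (fun x => g' (mobius w x)) = c' * Iv g'.
  move=> mg' g0'.
  have H1 := cone_integral (mob_meas mg') (fun x => g0' (mobius w x)) ltr01.
  have H2 := cone_integral mg' g0' b0.
  have H3 := cE _ (mF (1 - cnorm w ^+ 2) mg') (fun p => F0 _ p g0').
  have : kappa * Iv (fun x => g' (mobius w x)) = kappa * (c' * Iv g').
    rewrite expr1n mul1e in H1; rewrite -H1.
    transitivity (\int[mprod]_x F g' (1 - cnorm w ^+ 2) (Aw x)).
      by apply: eq_integral => p _; rewrite F_mobius.
    rewrite H3 [X in c * X]H2 /c' -!muleA [RHS]muleCA.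
    by congr (c * _); rewrite muleCA.
  have kk : (fine kappa)^-1%:E * kappa = 1.
    rewrite -[X in _ * X]fineK// -EFinM mulVf// gt_eqF// fine_gt0//.
    by apply/andP; split.
  move=> /(congr1 (fun x => (fine kappa)^-1%:E * x)).
  by rewrite !muleA kk !mul1e.
have c'1 : c' = 1.
  pose h (x : V) := (\1_([set z : V | cnorm z < 2^-1]%R) x)%:E : \bar R.
  have mh : measurable_fun [set: V] h.
    by apply/measurable_EFinP; apply: measurable_indic; exact: measurable_cball.
  have h0 x : 0 <= h x by rewrite lee_fin.
  have /andP[I0 Ioo] : 0 < Iv h < +oo.
    by apply: ball_bounds; rewrite invr_gt0 ltr0n invf_lt1// ltr1n.
  have Ifin : Iv h \is a fin_num by rewrite ge0_fin_numE// ltW.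
  have : Iv h = c' * (c' * Iv h).
    rewrite -E// -(E _ (mob_meas mh))//.
    apply: eq_integral => x _; rewrite /jac; case: ifPn => x1; last by rewrite !mule0.
    by rewrite mobiusK.
  have c'0 : 0 <= c' by rewrite mule_ge0// lee_fin exprn_ge0// ltW.
  rewrite -(fineK Ifin); have i0 : (0 < fine (Iv h))%R by rewrite fine_gt0// I0.
  move: c'0; case: c' {E} => [r| |] //=; rewrite ?lee_fin.
    move=> r0; rewrite -!EFinM => -[] /(congr1 (fun x => x / fine (Iv h)))%R.
    rewrite mulrA divff ?gt_eqF// mulfK ?gt_eqF// -expr2 => /esym/eqP.
    by rewrite sqrp_eq1// => /eqP ->.
  by rewrite !gt0_mulye ?lte_fin// => _ [].
by move=> mg g0; rewrite -[LHS]/(Iv (fun x => g (mobius w x))) E// c'1 mul1e.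
Qed.

End invariance.

End MobiusInvariance.

(** * Goursat's theorem and the mean value over circles *)

Section Goursat.
Context {R : realType}.
Implicit Types (a b c d : R) (F : R -> R).

Definition rint F a b : R := \int[lebesgue_measure]_(x in `[a, b]) F x.

Lemma rint_integrable F a b : continuous F ->
  (@lebesgue_measure R).-integrable `[a, b] (EFin \o F).
Proof.
move=> cF; apply: continuous_compact_integrable; first exact: segment_compact.
exact: continuous_subspaceT.
Qed.

Lemma rint_cat F a b c : continuous F -> a <= b -> b <= c ->
  rint F a c = rint F a b + rint F b c.
Proof.
move=> cF ab bc; rewrite /rint.
have := @Rintegral_itvB _ F (BLeft a) (BRight c) b (rint_integrable a c cF).
rewrite !bnd_simp => /(_ ab bc) => E.
have -> : \int[lebesgue_measure]_(x in `[b, c]) F x = \int[lebesgue_measure]_(x in `]b, c]) F x.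
  rewrite -[LHS]Rintegral_itv_obnd_cbnd//.
  apply: integrableS (rint_integrable b c cF) => //.
  by move=> x /=; rewrite !in_itv /= => /andP[/ltW -> ->].
by rewrite -E; ring.
Qed.

Lemma rintD F G a b : continuous F -> continuous G ->
  rint (fun x => F x + G x) a b = rint F a b + rint G a b.
Proof. by move=> cF cG; rewrite /rint RintegralD//; exact: rint_integrable. Qed.

Lemma rint_bound F a b (k e : R) : a <= b -> continuous F ->
  (forall x, a <= x <= b -> `|F x - k| <= e) ->
  `|rint F a b - k * (b - a)| <= e * (b - a).
Proof.
move=> ab cF h.
have mab : lebesgue_measure `[a, b]%classic = (b - a)%:E :> \bar R.
  rewrite lebesgue_measure_itv /= lte_fin; case: ltP => // ba.
  by rewrite (@le_anti _ _ a b) ?subrr// ab.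
have cstE r : rint (cst r) a b = r * (b - a).
  by rewrite /rint Rintegral_cst// [X in fine X](_ : _ = (b - a)%:E).
have ccst r : continuous (cst r : R -> R) by move=> x; exact: cst_continuous.
have H1 : rint (cst (k - e)) a b <= rint F a b.
  by apply: le_Rintegral => //; try exact: rint_integrable;
    move=> x /=; rewrite in_itv /= => /h; rewrite ler_norml /cst; lra.
have H2 : rint F a b <= rint (cst (k + e)) a b.
  by apply: le_Rintegral => //; try exact: rint_integrable;
    move=> x /=; rewrite in_itv /= => /h; rewrite ler_norml /cst; lra.
move: H1 H2; rewrite !cstE mulrBl mulrDl ler_norml => H1 H2.
by apply/andP; split; lra.
Qed.

(** [Q dy + P dx] around a rectangle; [dP/dy = dQ/dx] at each point. *)
Section rectangle.
Variables (P Q : R -> R -> R) (a0 b0 c0 d0 : R).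
Hypothesis contP : forall y, continuous (P ^~ y).
Hypothesis contQ : forall x, continuous (Q x).

Definition bdry a b c d :=
  rint (fun x => P x c - P x d) a b + rint (fun y => Q b y - Q a y) c d.

Definition closed_at x0 y0 := exists al be ga : R, forall e, 0 < e ->
  exists2 r : R, 0 < r & forall x y, a0 <= x <= b0 -> c0 <= y <= d0 ->
    `|x - x0| < r -> `|y - y0| < r ->
    `|Q x y - Q x0 y0 - (al * (x - x0) + be * (y - y0))| <= e * (`|x - x0| + `|y - y0|) /\
    `|P x y - P x0 y0 - (ga * (x - x0) + al * (y - y0))| <= e * (`|x - x0| + `|y - y0|).

Hypothesis closedPQ : forall x y, a0 <= x <= b0 -> c0 <= y <= d0 -> closed_at x y.

Let cP y y' : continuous (fun x => P x y - P x y').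
Proof. by move=> x; apply: continuousB; exact: contP. Qed.
Let cQ x x' : continuous (fun y => Q x y - Q x' y).
Proof. by move=> y; apply: continuousB; exact: contQ. Qed.

Lemma bdry_splitx a m b c d : a <= m -> m <= b ->
  bdry a b c d = bdry a m c d + bdry m b c d.
Proof.
move=> am mb; rewrite /bdry (rint_cat (@cP c d) am mb).
have -> : (fun y => Q b y - Q a y) = (fun y => (Q m y - Q a y) + (Q b y - Q m y)).
  by apply/funext => y; ring.
by rewrite rintD//; ring.
Qed.

Lemma bdry_splity a b c m d : c <= m -> m <= d ->
  bdry a b c d = bdry a b c m + bdry a b m d.
Proof.
move=> cm md; rewrite /bdry (rint_cat (@cQ b a) cm md).
have -> : (fun x => P x c - P x d) = (fun x => (P x c - P x m) + (P x m - P x d)).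
  by apply/funext => y; ring.
by rewrite rintD//; ring.
Qed.

Lemma bdry_local x0 y0 e : a0 <= x0 <= b0 -> c0 <= y0 <= d0 -> 0 < e ->
  exists2 r : R, 0 < r & forall a b c d, a0 <= a -> b <= b0 -> c0 <= c -> d <= d0 ->
    a <= x0 <= b -> c <= y0 <= d -> b - a < r -> d - c < r ->
    `|bdry a b c d| <= e * ((b - a) + (d - c)) ^+ 2.
Proof.
move=> x00 y00 e0; have [al [be [ga H]]] := closedPQ x00 y00.
have [r r0 Hr] := H (e / 2) ltac:(lra).
exists r => // a b c d aa bb cc dd /andP[ax xb] /andP[cy yd] br dr.
have ab : a <= b by exact: le_trans ax xb.
have cd : c <= d by exact: le_trans cy yd.
have HH x y : a <= x <= b -> c <= y <= d ->
    `|Q x y - Q x0 y0 - (al * (x - x0) + be * (y - y0))| <= e / 2 * ((b - a) + (d - c)) /\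
    `|P x y - P x0 y0 - (ga * (x - x0) + al * (y - y0))| <= e / 2 * ((b - a) + (d - c)).
  move=> /andP[ax' xb'] /andP[cy' yd'].
  have i1 : a0 <= x <= b0 by apply/andP; split; lra.
  have i2 : c0 <= y <= d0 by apply/andP; split; lra.
  have i3 : `|x - x0| <= b - a by rewrite ler_norml; apply/andP; split; lra.
  have i4 : `|y - y0| <= d - c by rewrite ler_norml; apply/andP; split; lra.
  have [q1 q2] := Hr x y i1 i2 (le_lt_trans i3 br) (le_lt_trans i4 dr).
  have i5 : e / 2 * (`|x - x0| + `|y - y0|) <= e / 2 * ((b - a) + (d - c)).
    by rewrite ler_pM2l ?divr_gt0// lerD.
  by split; [exact: le_trans q1 i5|exact: le_trans q2 i5].
have aab : a <= a <= b by rewrite lexx.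
have abb : a <= b <= b by rewrite lexx andbT.
have ccd : c <= c <= d by rewrite lexx.
have cdd : c <= d <= d by rewrite lexx andbT.
have P1 x : a <= x <= b -> `|P x c - P x d - al * (c - d)| <= e * ((b - a) + (d - c)).
  move=> xab; have [_ h1] := HH x c xab ccd; have [_ h2] := HH x d xab cdd.
  have -> : P x c - P x d - al * (c - d) =
    (P x c - P x0 y0 - (ga * (x - x0) + al * (c - y0))) -
    (P x d - P x0 y0 - (ga * (x - x0) + al * (d - y0))) by ring.
  by apply: le_trans (ler_normB _ _) _; apply: le_trans (lerD h1 h2) _; lra.
have Q1 y : c <= y <= d -> `|Q b y - Q a y - al * (b - a)| <= e * ((b - a) + (d - c)).
  move=> ycd; have [h1 _] := HH b y abb ycd; have [h2 _] := HH a y aab ycd.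
  have -> : Q b y - Q a y - al * (b - a) =
    (Q b y - Q x0 y0 - (al * (b - x0) + be * (y - y0))) -
    (Q a y - Q x0 y0 - (al * (a - x0) + be * (y - y0))) by ring.
  by apply: le_trans (ler_normB _ _) _; apply: le_trans (lerD h1 h2) _; lra.
have IP := rint_bound ab (@cP c d) P1.
have IQ := rint_bound cd (@cQ b a) Q1.
rewrite /bdry; set A := rint _ _ _ in IP *; set B := rint _ _ _ in IQ *.
have -> : A + B = (A - al * (c - d) * (b - a)) + (B - al * (b - a) * (d - c)) by ring.
apply: le_trans (ler_normD _ _) _; apply: le_trans (lerD IP IQ) _.
by rewrite -mulrDr -mulrA -expr2.
Qed.

Hypothesis ab0 : a0 <= b0.
Hypothesis cd0 : c0 <= d0.

Let w n := (b0 - a0) / 2 ^+ n.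
Let h n := (d0 - c0) / 2 ^+ n.
Let sq n (p : R * R) := bdry p.1 (p.1 + w n) p.2 (p.2 + h n).

Let wS n : w n = w n.+1 + w n.+1.
Proof.
have t0 : (2 ^+ n : R) != 0 by rewrite expf_neq0.
by rewrite /w exprS; field.
Qed.
Let hS n : h n = h n.+1 + h n.+1.
Proof.
have t0 : (2 ^+ n : R) != 0 by rewrite expf_neq0.
by rewrite /h exprS; field.
Qed.
Let w0 n : 0 <= w n.
Proof. by rewrite divr_ge0 ?subr_ge0// exprn_ge0. Qed.
Let h0 n : 0 <= h n.
Proof. by rewrite divr_ge0 ?subr_ge0// exprn_ge0. Qed.

Let quarter n p : exists q : R * R, [/\ p.1 <= q.1, q.1 + w n.+1 <= p.1 + w n,
  p.2 <= q.2, q.2 + h n.+1 <= p.2 + h n & `|sq n p| <= 4 * `|sq n.+1 q|].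
Proof.
have := w0 n.+1; have := h0 n.+1; move=> hh ww.
pose q1 : R * R := p; pose q2 := (p.1 + w n.+1, p.2).
pose q3 := (p.1, p.2 + h n.+1); pose q4 := (p.1 + w n.+1, p.2 + h n.+1).
have E : sq n p = sq n.+1 q1 + sq n.+1 q3 + (sq n.+1 q2 + sq n.+1 q4).
  rewrite /sq /= (@bdry_splitx p.1 (p.1 + w n.+1)); [|by lra|by rewrite (wS n); lra].
  rewrite (wS n) (hS n) (addrA p.1) (addrA p.2).
  have i1 : p.2 <= p.2 + h n.+1 by rewrite lerDl.
  have i2 : p.2 + h n.+1 <= p.2 + h n.+1 + h n.+1 by rewrite lerDl.
  by rewrite (bdry_splity p.1 (p.1 + w n.+1) i1 i2)
    (bdry_splity (p.1 + w n.+1) (p.1 + w n.+1 + w n.+1) i1 i2).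
have [H|H1] := leP `|sq n p| (4 * `|sq n.+1 q1|).
  by exists q1; rewrite /q1 (wS n) (hS n); split => //; lra.
have [H|H2] := leP `|sq n p| (4 * `|sq n.+1 q2|).
  by exists q2; rewrite /q2 /= (wS n) (hS n); split => //; lra.
have [H|H3] := leP `|sq n p| (4 * `|sq n.+1 q3|).
  by exists q3; rewrite /q3 /= (wS n) (hS n); split => //; lra.
have [H|H4] := leP `|sq n p| (4 * `|sq n.+1 q4|).
  by exists q4; rewrite /q4 /= (wS n) (hS n); split => //; lra.
exfalso; have := ler_normD (sq n.+1 q1 + sq n.+1 q3) (sq n.+1 q2 + sq n.+1 q4).
have := ler_normD (sq n.+1 q1) (sq n.+1 q3); have := ler_normD (sq n.+1 q2) (sq n.+1 q4).
rewrite -E; lra.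
Qed.

Let next n p := projT1 (cid (quarter n p)).
Let pt := fix pt n : R * R := if n is k.+1 then next k (pt k) else (a0, c0).

Let ptP n : [/\ (pt n).1 <= (pt n.+1).1, (pt n.+1).1 + w n.+1 <= (pt n).1 + w n,
  (pt n).2 <= (pt n.+1).2, (pt n.+1).2 + h n.+1 <= (pt n).2 + h n
  & `|sq n (pt n)| <= 4 * `|sq n.+1 (pt n.+1)|].
Proof. by rewrite /= /next; case: cid. Qed.

Let nested (u l : nat -> R) : (forall n, u n <= u n.+1) ->
  (forall n, u n.+1 + l n.+1 <= u n + l n) -> (forall n, 0 <= l n) ->
  exists x, forall n, u n <= x <= u n + l n.
Proof.
move=> ui li l0.
have um n k : u n <= u (n + k)%N.
  by elim: k => [|k ih]; rewrite ?addn0// addnS (le_trans ih).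
have lm n k : u (n + k)%N + l (n + k)%N <= u n + l n.
  by elim: k => [|k ih]; rewrite ?addn0// addnS (le_trans (li _)).
have ub n k : u k <= u n + l n.
  apply: le_trans (lm n k); apply: le_trans (um k n) _.
  by rewrite addnC lerDl.
exists (sup (range u)) => n; apply/andP; split.
  apply: ub_le_sup; last by exists n.
  by exists (u 0%N + l 0%N) => _ [k _ <-].
apply: ge_sup; first by exists (u 0%N), 0%N.
by move=> _ [k _ <-].
Qed.

(** Bisection keeps a quarter of the defect while the local estimate makes it
    smaller than any multiple of the area. *)
Lemma goursat : bdry a0 b0 c0 d0 = 0.
Proof.
have [x0 xP] : exists x, forall n, (pt n).1 <= x <= (pt n).1 + w n.
  by apply: nested => // n; have [] := ptP n.
have [y0 yP] : exists x, forall n, (pt n).2 <= x <= (pt n).2 + h n.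
  by apply: nested => // n; have [] := ptP n.
have E0 : a0 + w 0 = b0 by rewrite /w expr0 divr1; ring.
have F0 : c0 + h 0 = d0 by rewrite /h expr0 divr1; ring.
have bnd n : a0 <= (pt n).1 /\ (pt n).1 + w n <= b0 /\ c0 <= (pt n).2 /\ (pt n).2 + h n <= d0.
  elim: n => [|n [i1 [i2 [i3 i4]]]]; first by rewrite /= E0 F0.
  by have [j1 j2 j3 j4 _] := ptP n; do !split;
    [exact: le_trans j1|exact: le_trans i2|exact: le_trans j3|exact: le_trans i4].
have growth n : `|bdry a0 b0 c0 d0| <= 4 ^+ n * `|sq n (pt n)|.
  elim: n => [|n ih]; first by rewrite expr0 mul1r /sq /= E0 F0.
  apply: le_trans ih _; rewrite exprSr -mulrA ler_pM2l ?exprn_gt0//.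
  by have [] := ptP n.
have x00 : a0 <= x0 <= b0 by have := xP 0%N; rewrite /= E0.
have y00 : c0 <= y0 <= d0 by have := yP 0%N; rewrite /= F0.
apply/eqP; rewrite -normr_eq0 eq_le normr_ge0 andbT.
apply/ler_addgt0Pl => e e0; rewrite addr0.
pose S := ((b0 - a0) + (d0 - c0)) ^+ 2 + 1.
have S0 : 0 < S by rewrite ltr_wpDl// sqr_ge0.
have [r r0 Hr] := bdry_local x00 y00 (divr_gt0 e0 S0).
have [n nr] : exists n, w n < r /\ h n < r.
  have [n Hn] : exists n : nat, ((b0 - a0) + (d0 - c0)) / r < n%:R.
    have A0 : 0 <= ((b0 - a0) + (d0 - c0)) / r.
      by rewrite divr_ge0 ?(ltW r0)// addr_ge0 ?subr_ge0.
    by exists (Num.trunc (((b0 - a0) + (d0 - c0)) / r)).+1;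
      have /andP[] := truncn_itv A0.
  exists n; have n2 : n%:R <= 2 ^+ n :> R.
    by rewrite -natrX ler_nat ltnW// ltn_expl.
  move: Hn; rewrite ltr_pdivrMr// => Hn.
  have Hn' : b0 - a0 + (d0 - c0) < r * 2 ^+ n.
    by apply: lt_le_trans Hn _; rewrite mulrC ler_pM2l.
  rewrite /w /h; rewrite !ltr_pdivrMr ?exprn_gt0//.
  by split; apply: le_lt_trans Hn'; rewrite ?lerDl ?lerDr subr_ge0.
have [b1 [b2 [b3 b4]]] := bnd n.
have := Hr _ _ _ _ b1 b2 b3 b4 (xP n) (yP n).
rewrite !(addrC (pt n).1) !(addrC (pt n).2) !addrK; case: nr => nr1 nr2 => /(_ nr1 nr2) B.
apply: le_trans (growth n) _; rewrite /sq !(addrC (pt n).1) !(addrC (pt n).2).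
apply: le_trans (ler_wpM2l _ B) _; first by rewrite exprn_ge0.
rewrite -{1}[4%R](_ : 2 ^+ 2 = 4); last by rewrite -natrX.
have two0 : 2 ^+ n != 0 :> R by rewrite expf_neq0.
rewrite -exprM mulnC exprM /w /h -mulrDl.
have -> : (2 ^+ n) ^+ 2 * (e / S * ((b0 - a0 + (d0 - c0)) / 2 ^+ n) ^+ 2) =
  e * ((b0 - a0 + (d0 - c0)) ^+ 2 / S) by field; rewrite two0 gt_eqF.
by rewrite ger_pMr// ler_pdivrMr// mul1r lerDl.
Qed.

End rectangle.
End Goursat.

(** * Principal powers on the right half-plane *)

Section Powers.
Context {R : realType}.
Implicit Types (z w : C R) (a : R).

Definition cis (t : R) : C R := Complex (cos t) (sin t).

Lemma cisD (s t : R) : cis (s + t) = cis s * cis t.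
Proof. by apply: ceqP; rewrite !cE ?cosD ?sinD; ring. Qed.
Lemma cabs_cis (t : R) : cabs (cis t) = 1.
Proof. by rewrite cabsE !cE cos2Dsin2 sqrtr1. Qed.
Lemma conj_cis (t : R) : (cis t)^* = cis (- t).
Proof. by apply: ceqP; rewrite !cE ?cosN ?sinN. Qed.
Lemma cis0 : cis 0 = 1.
Proof. by apply: ceqP; rewrite !cE ?cos0 ?sin0. Qed.

Lemma polar_pos z : 0 < cRe z ->
  z = toC (cabs z) * cis (atan (cIm z / cRe z)).
Proof.
move=> z0; set t := cIm z / cRe z.
have s0 : 0 < 1 + t ^+ 2 by rewrite ltr_pwDl// sqr_ge0.
have E : cabs z = cRe z * Num.sqrt (1 + t ^+ 2).
  rewrite cabsE -{2}(ger0_norm (ltW z0)) -sqrtr_sqr -sqrtrM ?sqr_ge0//.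
  by congr Num.sqrt; rewrite /t; field; rewrite gt_eqF.
have r0 : Num.sqrt (1 + t ^+ 2) != 0 by rewrite gt_eqF// sqrtr_gt0.
have ct : cos (atan t) = (Num.sqrt (1 + t ^+ 2))^-1 by rewrite cos_atan.
have st : sin (atan t) = t * (Num.sqrt (1 + t ^+ 2))^-1.
  have e := atanK t; rewrite /tan ct invrK in e.
  by rewrite -[X in X * _]e mulfK.
apply: ceqP; rewrite !cE mul0r ?subr0 ?addr0 E; first by rewrite ct mulfK.
by rewrite st mulrACA divff// mulr1 /t mulrC divfK// gt_eqF.
Qed.

Lemma carg_pos z : 0 < cRe z -> carg z = atan (cIm z / cRe z).
Proof.
move=> z0; have zn0 : z != 0 by apply/eqP => e; move: z0; rewrite e ltxx.
have a0 : 0 < cabs z by rewrite cabs_gt0.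
rewrite /carg (negbTE zn0).
have -> : cRe z / cabs z = cos (atan (cIm z / cRe z)).
  have := congr1 cRe (polar_pos z0); rewrite !cE mul0r subr0 => {1}->.
  by rewrite mulrAC divff ?mul1r// gt_eqF.
have := atan_ltpi2 (cIm z / cRe z); have := atan_gtNpi2 (cIm z / cRe z).
have p0 := pi_gt0 R; move=> h1 h2.
case: ifPn => [i0|]; last rewrite -ltNge => i0.
  have t0 : 0 <= atan (cIm z / cRe z).
    by rewrite -atan0; apply: le_atan; rewrite divr_ge0// ltW.
  by rewrite cosK// in_itv /=; apply/andP; split => //; lra.
have t0 : atan (cIm z / cRe z) <= 0.
  rewrite -atan0; apply: le_atan.
  by rewrite -oppr_ge0 -mulNr divr_ge0 ?oppr_ge0 ?(ltW i0)// ltW.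
by rewrite cosKN ?opprK//; apply/andP; split => //; lra.
Qed.

Lemma cpow_pos z a : 0 < cRe z ->
  cpow z a = toC (cabs z `^ a) * cis (a * atan (cIm z / cRe z)).
Proof. by move=> z0; rewrite /cpow carg_pos. Qed.

Lemma cabs_cpow z a : cabs (cpow z a) = cabs z `^ a.
Proof. by rewrite /cpow cabsM cabs_toC (cabs_cis _) mulr1 ger0_norm// powR_ge0. Qed.

Lemma cRe_gt0_neq0 z : 0 < cRe z -> z != 0.
Proof. by move=> z0; apply/eqP => e; move: z0; rewrite e ltxx. Qed.

Lemma cpow_neq0 z a : 0 < cRe z -> cpow z a != 0.
Proof. by move=> z0; rewrite -cabs_gt0 cabs_cpow powR_gt0// cabs_gt0 cRe_gt0_neq0. Qed.

Lemma cpow_conj z a : 0 < cRe z -> cpow (z^*) a = (cpow z a)^*.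
Proof.
move=> z0; rewrite !cpow_pos ?cReJ// cabsJ conjM toC_conj conj_cis cImJ.
by rewrite mulNr atanN mulrN.
Qed.

Lemma cpowN z a : 0 < cRe z -> cpow z (- a) = (cpow z a)^-1.
Proof.
move=> z0; rewrite !cpow_pos// invfM powRN toCV; congr (_ * _).
rewrite mulNr; apply: (@mulfI _ (cis (a * atan (cIm z / cRe z)))).
  by rewrite -cabs_eq0 cabs_cis oner_eq0.
by rewrite -cisD subrr cis0 mulfV// -cabs_eq0 cabs_cis oner_eq0.
Qed.

Lemma cpowB1 z a : 0 < cRe z -> cpow z (a - 1) = cpow z a / z.
Proof.
move=> z0; have c0 : 0 < cabs z by rewrite cabs_gt0 cRe_gt0_neq0.
apply: (canRL (mulfK (cRe_gt0_neq0 z0))).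
rewrite [X in _ * X = _](polar_pos z0) !cpow_pos// mulrACA -toCM -cisD.
have -> : cabs z `^ (a - 1) * cabs z = cabs z `^ a.
  rewrite -[X in _ * X](powRr1 (ltW c0)) -powRD ?subrK//.
  by rewrite (gt_eqF c0) implybT.
by congr (_ * cis _); ring.
Qed.

Lemma inv_cpow_conj z a : 0 < cRe z ->
  (cpow (z^*) a)^-1 = cpow z a / toC (cabs z `^ a ^+ 2).
Proof.
move=> z0; rewrite cpow_conj//; have n0 := cpow_neq0 a z0.
have j0 : (cpow z a)^* != 0 by rewrite -cabs_eq0 cabsJ cabs_eq0.
by rewrite -cabs_cpow -mul_conj invfM mulrA mulfV// mul1r.
Qed.

(** ** Second-order Taylor estimate *)

Lemma is_derive_cpow_line z w a (t : R) : 0 < cRe (z + toC t * w) ->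
  is_derive t 1 (fun s => cRe (cpow (z + toC s * w) a))
    (a * cRe (w * cpow (z + toC t * w) (a - 1))) /\
  is_derive t 1 (fun s => cIm (cpow (z + toC s * w) a))
    (a * cIm (w * cpow (z + toC t * w) (a - 1))).
Proof.
move=> p0.
pose p : R -> R := cst (cRe z) + id * cst (cRe w).
pose q : R -> R := cst (cIm z) + id * cst (cIm w).
have pE s : cRe (z + toC s * w) = p s by rewrite !cE mul0r subr0.
have qE s : cIm (z + toC s * w) = q s by rewrite !cE mul0r addr0.
have pt0 : 0 < p t by rewrite -pE.
have dp : is_derive t 1 p (cRe w).
  apply: is_derive_eq (is_deriveD (is_derive_cst (cRe z) t 1)
    (is_deriveM (is_derive_id t 1) (is_derive_cst (cRe w) t 1))) _.
  by rewrite scaler0 add0r add0r /cst [_ *: _]mulr1.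
have dq : is_derive t 1 q (cIm w).
  apply: is_derive_eq (is_deriveD (is_derive_cst (cIm z) t 1)
    (is_deriveM (is_derive_id t 1) (is_derive_cst (cIm w) t 1))) _.
  by rewrite scaler0 add0r add0r /cst [_ *: _]mulr1.
pose n : R -> R := p * p + q * q.
have nt0 : 0 < n t.
  by rewrite /n /= ltr_pwDl// ?mulr_gt0// -expr2 sqr_ge0.
have dn := is_deriveD (is_deriveM dp dp) (is_deriveM dq dq).
have dL := is_derive1_comp (is_derive1_ln nt0) dn.
have dr := is_deriveM dq (is_deriveV (lt0r_neq0 pt0) dp).
set rr := (q * _)%R in dr.
have dT := is_derive1_comp (is_derive1_atan (rr t)) dr.
have dE := is_derive1_comp (is_derive_expR _) (is_deriveM (is_derive_cst (a / 2) t 1) dL).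
have dC := is_derive1_comp (is_derive_cos _) (is_deriveM (is_derive_cst a t 1) dT).
have dS := is_derive1_comp (is_derive_sin _) (is_deriveM (is_derive_cst a t 1) dT).
have near_pos : \forall s \near t, 0 < p s.
  have cp : {for t, continuous p}.
    by apply/differentiable_continuous/derivable1_diffP; exact: ex_derive.
  by have := @cvgr_gt _ _ (nbhs t) _ p (p t) cp 0 pt0; exact.
have cpE s : 0 < p s -> cpow (z + toC s * w) a =
    toC (expR (a / 2 * ln (n s))) * cis (a * atan (rr s)).
  move=> ps0; have ps0' : 0 < cRe (z + toC s * w) by rewrite pE.
  rewrite cpow_pos// pE qE; congr (toC _ * cis (a * atan _)).
  have c0 : 0 < cabs (z + toC s * w) by rewrite cabs_gt0 cRe_gt0_neq0.
  rewrite /powR gt_eqF//; congr expR.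
  have -> : n s = cabs (z + toC s * w) ^+ 2 by rewrite sqr_cabs pE qE !expr2.
  by rewrite lnXn// mulr2n; field.
have c0 := cRe_gt0_neq0 p0.
have nE : cabs (z + toC t * w) ^+ 2 = n t by rewrite sqr_cabs pE qE !expr2.
have fE : w * cpow (z + toC t * w) (a - 1) =
   (w * (z + toC t * w)^-1) * (toC (expR (a / 2 * ln (n t))) * cis (a * atan (rr t))).
  by rewrite cpowB1// cpE//; ring.
have rt : 1 + rr t ^+ 2 = n t / p t ^+ 2.
  have -> : rr t = q t * (p t)^-1 by [].
  have -> : n t = p t * p t + q t * q t by [].
  by field; rewrite gt_eqF.
have pn0 : p t != 0 by rewrite gt_eqF.
have nn0 : p t * p t + q t * q t != 0 by rewrite gt_eqF.
rewrite fE; split.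
  apply: (near_eq_is_derive (f := (expR \o (cst (a / 2) * (ln (R:=R) \o n))) * (cos \o (cst a * (atan \o rr))))) => //.
    by apply: filterS near_pos => s ps; rewrite cpE// !cE mul0r subr0.
  apply: is_derive_eq (is_deriveM dE dC) _.
  rewrite rt !cE !cReV !cImV nE pE qE !mul0r !subr0 !addr0.
  rewrite -[(expR \o _) t]/(expR (a / 2 * ln (n t))) -[(cos \o _) t]/(cos (a * atan (rr t))).
  rewrite -[(cst (a / 2) * _) t]/(a / 2 * ln (n t)) -[(cst a * _) t]/(a * atan (rr t)).
  rewrite /cst -!/(_ * _); set e := expR _; set co := cos _; set si := sin _.
  rewrite -[n t]/(p t * p t + q t * q t).
  have smE (u v : R) : u *: v = u * v by [].
  rewrite !smE; field; by rewrite ?pn0 ?nn0.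
apply: (near_eq_is_derive (f := (expR \o (cst (a / 2) * (ln (R:=R) \o n))) * (sin \o (cst a * (atan \o rr))))) => //.
  by apply: filterS near_pos => s ps; rewrite cpE// !cE mul0r addr0.
apply: is_derive_eq (is_deriveM dE dS) _.
rewrite rt !cE !cReV !cImV nE pE qE !mul0r !subr0 !addr0.
rewrite -[(expR \o _) t]/(expR (a / 2 * ln (n t))) -[(sin \o _) t]/(sin (a * atan (rr t))).
rewrite -[(cst (a / 2) * _) t]/(a / 2 * ln (n t)) -[(cst a * _) t]/(a * atan (rr t)).
rewrite /cst; set e := expR _; set co := cos _; set si := sin _.
rewrite -[n t]/(p t * p t + q t * q t).
have smE (u v : R) : u *: v = u * v by [].
rewrite !smE; field; by rewrite ?pn0 ?nn0.
Qed.

(** The mean value theorem twice on a segment. *)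
Lemma taylor_unit (f f1 f2 : R -> R) (M : R) :
  (forall t : R, 0 <= t <= 1 -> is_derive t 1 f (f1 t)) ->
  (forall t : R, 0 <= t <= 1 -> is_derive t 1 f1 (f2 t)) ->
  (forall t : R, 0 <= t <= 1 -> `|f2 t| <= M) ->
  `|f 1 - f 0 - f1 0| <= M.
Proof.
move=> d1 d2 b2.
have itvP (c t : R) : 0 <= c <= 1 -> t \in `]0, c[ -> 0 <= t <= 1.
  by move=> /andP[c0 c1]; rewrite in_itv /= => /andP[/ltW -> /ltW tc]; exact: le_trans tc c1.
have cont (g g1 : R -> R) c : 0 <= c <= 1 ->
    (forall t : R, 0 <= t <= 1 -> is_derive t 1 g (g1 t)) -> {within `[0, c], continuous g}.
  move=> /andP[c0 c1] dg; apply: derivable_within_continuous => t.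
  rewrite in_itv /= => /andP[t0 tc].
  by have := dg t; rewrite t0 (le_trans tc c1) => /(_ isT) [].
have i1 : 0 <= (1 : R) <= 1 by rewrite ler01 lexx.
have [c cI E1] := MVT_segment ler01 (fun t tI => d1 t (itvP _ _ i1 tI)) (cont _ _ _ i1 d1).
have c01 : 0 <= c <= 1 by move: cI; rewrite in_itv.
have [c0 _] := andP c01.
have [c' cI' E2] := MVT_segment c0 (fun t tI => d2 t (itvP _ _ c01 tI)) (cont _ _ _ c01 d2).
have c'01 : 0 <= c' <= 1.
  move: cI'; rewrite in_itv /= => /andP[-> h]; apply: le_trans h _.
  by have [] := andP c01.
rewrite E1 subr0 mulr1 E2 subr0 normrM.
apply: le_trans (_ : M * 1 <= _); last by rewrite mulr1.
apply: ler_pM => //; first exact: b2.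
by rewrite ger0_norm//; have [] := andP c01.
Qed.

Lemma powR_le_sum (x dl p : R) : 0 < dl -> dl <= x -> x <= 2 ->
  x `^ p <= dl `^ p + 2 `^ p.
Proof.
move=> dl0 dx x2; have x0 := lt_le_trans dl0 dx.
have [p0|p0] := leP 0 p.
  apply: le_trans (_ : 2 `^ p <= _); last by rewrite lerDr powR_ge0.
  by apply: ge0_ler_powR => //; rewrite nnegrE// ltW.
apply: le_trans (_ : dl `^ p <= _); last by rewrite lerDl powR_ge0.
rewrite -(opprK p) !(powRN _ (- p)) lef_pV2 ?posrE ?powR_gt0//.
by apply: ge0_ler_powR => //; rewrite ?nnegrE ?oppr_ge0// ltW.
Qed.

Lemma cpow_taylor a (dl : R) : 0 < dl -> exists2 M : R, 0 <= M & forall z w,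
  dl <= cRe z -> dl <= cRe (z + w) -> cabs z <= 2 -> cabs (z + w) <= 2 ->
  cabs (cpow (z + w) a - cpow z a - toC a * (w * cpow z (a - 1))) <= M * cabs w ^+ 2.
Proof.
move=> dl0.
pose K := `|a * (a - 1)| * (dl `^ (a - 1 - 1) + 2 `^ (a - 1 - 1)).
have K0 : 0 <= K by rewrite mulr_ge0// addr_ge0// powR_ge0.
exists (K + K); first by rewrite addr_ge0.
move=> z w zl zwl z2 zw2.
have reE t : cRe (z + toC t * w) = (1 - t) * cRe z + t * cRe (z + w) by rewrite !cE; ring.
have seg t : 0 <= t <= 1 -> dl <= cRe (z + toC t * w).
  by move=> /andP[t0 t1]; rewrite reE; nra.
have seg2 t : 0 <= t <= 1 -> cabs (z + toC t * w) <= 2.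
  move=> /andP[t0 t1].
  have -> : z + toC t * w = toC (1 - t) * z + toC t * (z + w) by rewrite toCB toC1; ring.
  apply: le_trans (cabsD _ _) _; rewrite !cabsM !cabs_toC (ger0_norm t0) ger0_norm ?subr_ge0//.
  by nra.
have seg0 t : 0 <= t <= 1 -> 0 < cRe (z + toC t * w) by move=> /seg; exact: lt_le_trans.
have d1 t (h : 0 <= t <= 1) := is_derive_cpow_line a (seg0 t h).
have d2 t (h : 0 <= t <= 1) := is_derive_cpow_line (a - 1) (seg0 t h).
set k := w * _.
have bd t : 0 <= t <= 1 -> cabs (toC (a * (a - 1)) * (w * (w * cpow (z + toC t * w) (a - 1 - 1))))
    <= K * cabs w ^+ 2.
  (* a power is itself a product, which the rewriting of moduli must not see *)
  move=> t01; have := cabs_cpow (z + toC t * w) (a - 1 - 1).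
  move: (cpow _ _) => Y YE; rewrite !cabsM cabs_toC YE.
  have := powR_le_sum (a - 1 - 1) dl0 (le_trans (seg _ t01) (le_trans (ler_norm _) (ler_cRe _))) (seg2 _ t01).
  set X := _ `^ _ => h; rewrite /K expr2.
  rewrite [X in X <= _](_ : _ = `|a * (a - 1)| * X * (cabs w * cabs w)); last by ring.
  by rewrite ler_wpM2r ?mulr_ge0 ?cabs_ge0// ler_wpM2l.
have H f1 f2 (f : R -> R) := @taylor_unit f f1 f2 (K * cabs w ^+ 2).
have Z0 : z + toC 0 * w = z by rewrite toC0 mul0r addr0.
have Z1 : z + toC 1 * w = z + w by rewrite toC1 mul1r.
have lin (c : R) (u : C R) (g h : R -> C R) (t : R) :
    is_derive t (1 : R) (fun s : R => cRe (g s)) (cRe (h t)) ->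
    is_derive t (1 : R) (fun s : R => cIm (g s)) (cIm (h t)) ->
    is_derive t (1 : R) (fun s : R => c * cRe (u * g s)) (c * cRe (u * h t)) /\
    is_derive t (1 : R) (fun s : R => c * cIm (u * g s)) (c * cIm (u * h t)).
  move=> dr di; split.
    rewrite (_ : (fun s => _) = (cst (c * cRe u) * (fun s => cRe (g s)) - cst (c * cIm u) * (fun s => cIm (g s)))); last first.
      by apply/funext => s; rewrite !fctE !cE; ring.
    apply: is_derive_eq (is_deriveB (is_deriveM (is_derive_cst _ t 1) dr) (is_deriveM (is_derive_cst _ t 1) di)) _.
    by rewrite !scaler0 !addr0 /cst !cE /GRing.scale /=; ring.
  rewrite (_ : (fun s => _) = (cst (c * cRe u) * (fun s => cIm (g s)) + cst (c * cIm u) * (fun s => cRe (g s)))); last first.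
    by apply/funext => s; rewrite !fctE !cE; ring.
  apply: is_derive_eq (is_deriveD (is_deriveM (is_derive_cst _ t 1) di) (is_deriveM (is_derive_cst _ t 1) dr)) _.
  by rewrite !scaler0 !addr0 /cst !cE /GRing.scale /=; ring.
apply: le_trans (cabs_le _) _; rewrite mulrDl; apply: lerD.
  have := H (fun t => a * cRe (w * cpow (z + toC t * w) (a - 1)))
    (fun t => a * cRe (w * (toC (a - 1) * (w * cpow (z + toC t * w) (a - 1 - 1)))))
    (fun t => cRe (cpow (z + toC t * w) a)).
  rewrite Z0 Z1 => HR.
  have -> : cRe (cpow (z + w) a - cpow z a - toC a * k) =
      cRe (cpow (z + w) a) - cRe (cpow z a) - a * cRe k.
    by rewrite cReD cReN cReD cReN (cReM (toC a)) cRe_toC cIm_toC mul0r subr0.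
  apply: HR.
  - by move=> t /d1[].
  - move=> t h; have [d3 d4] := d2 t h.
    have [] := lin a w (fun s => cpow (z + toC s * w) (a - 1))
      (fun s => toC (a - 1) * (w * cpow (z + toC s * w) (a - 1 - 1))) t.
    + by apply: is_derive_eq d3 _; rewrite (cReM (toC _)) cRe_toC cIm_toC mul0r subr0.
    + by apply: is_derive_eq d4 _; rewrite (cImM (toC _)) cRe_toC cIm_toC mul0r addr0.
    by [].
  - move=> t h; apply: le_trans (bd t h).
    have <- : toC a * (w * (toC (a - 1) * (w * cpow (z + toC t * w) (a - 1 - 1)))) =
      toC (a * (a - 1)) * (w * (w * cpow (z + toC t * w) (a - 1 - 1))) by rewrite toCM; ring.
    by apply: le_trans (ler_cRe _); rewrite (cReM (toC a)) cRe_toC cIm_toC mul0r subr0.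
have := H (fun t => a * cIm (w * cpow (z + toC t * w) (a - 1)))
    (fun t => a * cIm (w * (toC (a - 1) * (w * cpow (z + toC t * w) (a - 1 - 1)))))
    (fun t => cIm (cpow (z + toC t * w) a)).
rewrite Z0 Z1 => HR.
have -> : cIm (cpow (z + w) a - cpow z a - toC a * k) =
    cIm (cpow (z + w) a) - cIm (cpow z a) - a * cIm k.
  by rewrite cImD cImN cImD cImN (cImM (toC a)) cRe_toC cIm_toC mul0r addr0.
apply: HR.
- by move=> t /d1[].
- move=> t h; have [d3 d4] := d2 t h.
  have [] := lin a w (fun s => cpow (z + toC s * w) (a - 1))
      (fun s => toC (a - 1) * (w * cpow (z + toC s * w) (a - 1 - 1))) t.
  + by apply: is_derive_eq d3 _; rewrite (cReM (toC _)) cRe_toC cIm_toC mul0r subr0.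
  + by apply: is_derive_eq d4 _; rewrite (cImM (toC _)) cRe_toC cIm_toC mul0r addr0.
  by [].
- move=> t h; apply: le_trans (bd t h).
  have <- : toC a * (w * (toC (a - 1) * (w * cpow (z + toC t * w) (a - 1 - 1)))) =
      toC (a * (a - 1)) * (w * (w * cpow (z + toC t * w) (a - 1 - 1))) by rewrite toCM; ring.
  by apply: le_trans (ler_cIm _); rewrite (cImM (toC a)) cRe_toC cIm_toC mul0r addr0.
Qed.

End Powers.

(** * The mean value property on the ball *)

Section CircleMean.
Context {R : realType}.

Lemma derive_small (f : R -> R) (x f' : R) : is_derive x (1 : R) f f' ->
  forall e : R, 0 < e -> exists2 r : R, 0 < r & forall h, `|h| < r ->
    `|f (x + h) - f x - f' * h| <= e * `|h|.
Proof.
move=> [df dE] e e0.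
have := derivable_nbhs df; rewrite dE => /eqaddoP /(_ e e0) /nbhs_ballP[r /= r0 H].
exists r => // h hr; have := H h; rewrite /ball /= sub0r normrN => /(_ hr).
rewrite !fctE /= [h *: f']mulrC [h *: 1]mulr1 (addrC h x).
by rewrite opprD addrA.
Qed.

Lemma cexp_small (e : R) : 0 < e -> exists2 r : R, 0 < r & forall x y, `|x| < r -> `|y| < r ->
  cabs (toC (expR x) * cis y - 1 - (Complex x y : C R)) <= e * (`|x| + `|y|).
Proof.
move=> e0; pose e1 := Num.min 1 (e / 8).
have e10 : 0 < e1 by rewrite lt_min ltr01 divr_gt0.
have e11 : e1 <= 1 by rewrite ge_min lexx.
have e18 : e1 <= e / 8 by rewrite ge_min lexx orbT.
clearbody e1.
have [r1 r10 H1] := derive_small (is_derive_expR 0) e10.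
have [r2 r20 H2] := derive_small (is_derive_cos 0) e10.
have [r3 r30 H3] := derive_small (is_derive_sin 0) e10.
exists (Num.min (Num.min r1 r2) (Num.min r3 e1)).
  by rewrite !lt_min r10 r20 r30 e10.
move=> x y; rewrite !lt_min => /andP[/andP[x1 x2] /andP[x3 x4]].
move=> /andP[/andP[y1 y2] /andP[y3 y4]].
have := H1 _ x1; have := H2 _ y2; have := H3 _ y3.
rewrite !add0r expR0 cos0 sin0 oppr0 mul0r !mul1r !subr0 addr0 => s3 s2 s1.
have ax := normr_ge0 x; have ay := normr_ge0 y.
have ex : `|expR x - 1| <= 2 * `|x|.
  have -> : expR x - 1 = (expR x - 1 - x) + x by ring.
  by apply: le_trans (ler_normD _ _) _; apply: le_trans (lerD s1 (lexx _)) _; nra.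
have E3 : `|expR x| <= 3.
  have -> : expR x = (expR x - 1) + 1 by ring.
  by apply: le_trans (ler_normD _ _) _; rewrite normr1; lra.
apply: le_trans (cabs_le _) _; rewrite !cE !mul0r subr0 addr0 subr0.
have -> : expR x * cos y - 1 - x = (expR x - 1 - x) + expR x * (cos y - 1) by ring.
have -> : expR x * sin y - y = expR x * (sin y - y) + (expR x - 1) * y by ring.
have t1 : `|expR x * (cos y - 1)| <= 3 * (e1 * `|y|) by rewrite normrM ler_pM.
have t2 : `|expR x * (sin y - y)| <= 3 * (e1 * `|y|) by rewrite normrM ler_pM.
have t3 : `|(expR x - 1) * y| <= (2 * e1) * `|y|.
  by rewrite normrM ler_pM//; apply: le_trans ex _; rewrite ler_pM2l// ltW.
apply: le_trans (lerD (ler_normD _ _) (ler_normD _ _)) _.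
nra.
Qed.

Context {d : nat}.
Variable h : 'rV[C R]_d -> C R.
Hypothesis holo : forall z, cnorm z < 1 -> exists D, cdiff h z D.
Variable u : 'rV[C R]_d.
Hypothesis u1 : cnorm u < 1.

Let lam (x y : R) : C R := toC (expR x) * cis y.

Let lam_ball x y : x <= 0 -> cnorm (lam x y *: u) < 1.
Proof.
move=> x0; rewrite cnormZ cabsM cabs_cis mulr1 cabs_toC ger0_norm ?expR_ge0//.
apply: le_lt_trans u1; rewrite -[leRHS]mul1r ler_wpM2r ?cnorm_ge0//.
by rewrite -expR0 ler_expR.
Qed.

Let polar_diff x0 y0 : x0 <= 0 -> exists A : C R, forall e : R, 0 < e ->
  exists2 r : R, 0 < r & forall x y, `|x - x0| < r -> `|y - y0| < r ->
  cabs (h (lam x y *: u) - h (lam x0 y0 *: u) - A * (Complex (x - x0) (y - y0) : C R))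
    <= e * (`|x - x0| + `|y - y0|).
Proof.
move=> x00; have [D HD] := holo (lam_ball y0 x00).
pose l0 := lam x0 y0; pose A := l0 * cdot u D; exists A => e e0.
pose m := cabs l0 * cnorm u; have m0 : 0 <= m by rewrite mulr_ge0 ?cabs_ge0 ?cnorm_ge0.
have A0 := cabs_ge0 A.
pose eta := e / (4 * (m + 1)); have eta0 : 0 < eta by rewrite divr_gt0 ?mulr_gt0 ?ltr_wpDl.
pose e' := Num.min 1 (e / (2 * (cabs A + 1))).
have e'0 : 0 < e' by rewrite lt_min ltr01 divr_gt0 ?mulr_gt0 ?ltr_wpDl.
have e'1 : e' <= 1 by rewrite ge_min lexx.
have e'A : e' <= e / (2 * (cabs A + 1)) by rewrite ge_min lexx orbT.
clearbody e'.
have [rh rh0 Hh] := HD _ eta0.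
have [rc rc0 Hc] := cexp_small e'0.
have k0 : 0 < rh / (4 * (m + 1)) by rewrite divr_gt0 ?mulr_gt0 ?ltr_wpDl.
exists (Num.min rc (rh / (4 * (m + 1)))); first by rewrite lt_min rc0.
move=> x y; rewrite !lt_min => /andP[xc xh] /andP[yc yh].
pose dx := x - x0; pose dy := y - y0; pose s := `|dx| + `|dy|.
have s0 : 0 <= s by rewrite addr_ge0.
pose E := toC (expR dx) * cis dy : C R.
have lE : lam x y = l0 * E.
  rewrite /lam /l0 /lam /E mulrACA -toCM -expRD -cisD /dx /dy.
  by congr (toC (expR _) * cis _); ring.
have HE := Hc _ _ xc yc; rewrite -/E -/dx -/dy -/s in HE.
have E1 : cabs (E - 1) <= 2 * s.
  have -> : E - 1 = (E - 1 - (Complex dx dy : C R)) + (Complex dx dy : C R) by ring.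
  apply: le_trans (cabsD _ _) _.
  have : cabs (Complex dx dy : C R) <= s by exact: cabs_le.
  by move: HE; nra.
pose v := (l0 * (E - 1)) *: u.
have vE : lam x y *: u = l0 *: u + v by rewrite lE /v -scalerDl; congr (_ *: u); ring.
have vn : cnorm v <= m * (2 * s).
  rewrite /v cnormZ cabsM mulrAC -/m ler_wpM2l//.
have vr : cnorm v < rh.
  apply: le_lt_trans vn _.
  have : s < 2 * (rh / (4 * (m + 1))) by rewrite /s; lra.
  move: k0; set k := rh / _ => k0 sk.
  have -> : rh = k * (4 * (m + 1)) by rewrite /k; field; rewrite gt_eqF// ltr_wpDl.
  by nra.
have := Hh _ vr; rewrite -vE => Hv.
have -> : h (lam x y *: u) - h (lam x0 y0 *: u) - A * (Complex dx dy : C R) =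
  (h (lam x y *: u) - h (lam x0 y0 *: u) - cdot v D) + A * (E - 1 - (Complex dx dy : C R)).
  by rewrite /v cdotZl /A; ring.
apply: le_trans (cabsD _ _) _; rewrite cabsM -/s.
have T1 : eta * cnorm v <= e / 2 * s.
  apply: le_trans (ler_wpM2l (ltW eta0) vn) _.
  rewrite (_ : eta * (m * (2 * s)) = e / 2 * (m / (m + 1)) * s).
    rewrite ler_wpM2r// ger_pMr ?divr_gt0// ler_pdivrMr ?ltr_wpDl// mul1r.
    by rewrite lerDl.
  by rewrite /eta; field; rewrite gt_eqF// ltr_wpDl.
have T2 : cabs A * cabs (E - 1 - (Complex dx dy : C R)) <= e / 2 * s.
  apply: le_trans (ler_wpM2l A0 HE) _; rewrite mulrA ler_wpM2r//.
  apply: le_trans (ler_wpM2l A0 e'A) _.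
  rewrite (_ : cabs A * _ = e / 2 * (cabs A / (cabs A + 1))).
    by rewrite ger_pMr ?divr_gt0// ler_pdivrMr ?ltr_wpDl// mul1r lerDl.
  by field; rewrite gt_eqF// ltr_wpDl.
apply: le_trans (lerD Hv T2) _; apply: le_trans (lerD T1 (lexx _)) _.
by lra.
Qed.

Let polar_cont x0 y0 (e : R) : x0 <= 0 -> 0 < e -> exists2 r : R, 0 < r & forall x y,
  `|x - x0| < r -> `|y - y0| < r -> cabs (h (lam x y *: u) - h (lam x0 y0 *: u)) < e.
Proof.
move=> x00 e0; have [A HA] := polar_diff y0 x00; have [r r0 Hr] := HA 1 ltr01.
have A0 := cabs_ge0 A.
have k0 : 0 < e / (2 * (cabs A + 1)) by rewrite divr_gt0 ?mulr_gt0 ?ltr_wpDl.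
exists (Num.min r (e / (2 * (cabs A + 1)))); first by rewrite lt_min r0.
move=> x y; rewrite !lt_min => /andP[xr xk] /andP[yr yk].
have := Hr _ _ xr yr; set c : C R := Complex _ _ => H.
rewrite -[X in cabs X](subrK (A * c)); apply: le_lt_trans (cabsD _ _) _.
apply: le_lt_trans (lerD H (lexx _)) _; rewrite cabsM mul1r.
have : cabs c <= `|x - x0| + `|y - y0| by exact: cabs_le.
set s := `|x - x0| + `|y - y0| => cs.
have : s < 2 * (e / (2 * (cabs A + 1))) by rewrite /s; lra.
move: k0; set k := e / _ => k0 sk.
have -> : e = k * (2 * (cabs A + 1)) by rewrite /k; field; rewrite gt_eqF// ltr_wpDl.
by nra.
Qed.

Let cm x : R := Num.min x 0.
Let cm_le x : cm x <= 0. Proof. by rewrite ge_min lexx orbT. Qed.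
Let cm_lip x x' : `|cm x - cm x'| <= `|x - x'|.
Proof.
rewrite /cm; case: (leP x 0) => hx; case: (leP x' 0) => hx' //.
- by rewrite subr0 ler0_norm//; have := ler_norm (x' - x); rewrite distrC; lra.
- by rewrite sub0r normrN ler0_norm//; have := ler_norm (x - x'); lra.
- by rewrite subrr normr0.
Qed.
Let cm_id x : x <= 0 -> cm x = x. Proof. by rewrite /cm => h0; rewrite min_l. Qed.

Let hU x y := h (lam (cm x) y *: u).

Let cont1 (g : C R -> R) y : (forall a b, `|g a - g b| <= cabs (a - b)) ->
  continuous (fun x : R => g (hU x y)).
Proof.
move=> gl x0; apply/cvgrPdist_lt => e e0.
have [r r0 H] := polar_cont y (cm_le x0) e0.
apply/nbhs_ballP; exists r => // x; rewrite /ball /= distrC => xr.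
rewrite distrC; apply: le_lt_trans (gl _ _) _; apply: H; last by rewrite subrr normr0.
exact: le_lt_trans (cm_lip _ _) xr.
Qed.

Let cont2 (g : C R -> R) x : (forall a b, `|g a - g b| <= cabs (a - b)) ->
  continuous (fun y : R => g (hU x y)).
Proof.
move=> gl y0; apply/cvgrPdist_lt => e e0.
have [r r0 H] := polar_cont y0 (cm_le x) e0.
apply/nbhs_ballP; exists r => // y; rewrite /ball /= distrC => yr.
rewrite distrC; apply: le_lt_trans (gl _ _) _; apply: H => //; by rewrite subrr normr0.
Qed.

Let glre (a b : C R) : `|cRe a - cRe b| <= cabs (a - b).
Proof. by rewrite -cReN -cReD ler_cRe. Qed.
Let glim (a b : C R) : `|cIm a - cIm b| <= cabs (a - b).
Proof. by rewrite -cImN -cImD ler_cIm. Qed.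

Let cis2pi : cis (pi * 2) = 1 :> C R.
Proof. by apply: ceqP; rewrite !cE mulr_natr ?cos2pi ?sin2pi. Qed.

Let twopi0 : 0 <= pi * 2 :> R.
Proof. by rewrite mulr_ge0// ltW// pi_gt0. Qed.

Let rect (a : R) : a <= 0 ->
  rint (fun y => cRe (hU 0 y) - cRe (hU a y)) 0 (pi * 2) = 0.
Proof.
move=> a0.
have : bdry (fun x y => cIm (hU x y)) (fun x y => cRe (hU x y)) a 0 0 (pi * 2) = 0.
  apply: (@goursat R _ _ a 0 0 (pi * 2)
    (fun y => @cont1 cIm y glim) (fun x => @cont2 cRe x glre) _ a0 twopi0).
  move=> x0 y0 /andP[_ x00] _; have [A HA] := polar_diff y0 x00.
  exists (cRe A), (- cIm A), (cIm A) => e e0; have [r r0 Hr] := HA e e0.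
  exists r => // x y /andP[_ x0'] _ xr yr; have := Hr _ _ xr yr.
  rewrite /hU !cm_id//; set X := h _ - h _ - _ => H; split; apply: le_trans H.
    by apply: le_trans (ler_cRe X); rewrite /X !cE mulNr.
  apply: le_trans (ler_cIm X).
  by rewrite /X cImD cImN (cImM A) cImD cImN cReE cImE (addrC (cRe A * _)) lexx.
rewrite /bdry [X in X + _ = _](_ : _ = 0) ?add0r//.
rewrite /rint [LHS](_ : _ = \int[lebesgue_measure]_(x in `[a, 0]) 0); last first.
  by apply: eq_Rintegral => x _; rewrite /hU /lam cis0 cis2pi subrr.
by rewrite /Rintegral integral0.
Qed.

Let UE t : cRe (h (cis t *: u)) = cRe (hU 0 t).
Proof. by rewrite /hU /lam (cm_id (lexx 0)) expR0 toC1 mul1r. Qed.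

Lemma continuous_circle_re : continuous (fun t : R => cRe (h (cis t *: u))).
Proof. by under [X in continuous X]eq_fun do rewrite UE; exact: (@cont2 cRe). Qed.

Lemma circle_mean_re : rint (fun t => cRe (h (cis t *: u))) 0 (pi * 2) = pi * 2 * cRe (h 0).
Proof.
have c01 : cnorm (0 : 'rV[C R]_d) < 1 by rewrite cnorm0.
have [D HD] := holo c01; have [r r0 Hr] := HD 1 ltr01.
under [in LHS]eq_fun do rewrite UE.
apply/eqP; rewrite -subr_eq0 -normr_eq0 eq_le normr_ge0 andbT.
apply/ler_addgt0Pl => e e0; rewrite addr0.
have p0 : 0 < pi * 2 :> R by rewrite mulr_gt0// pi_gt0.
pose k := cnorm (conjv D) + 1; have k0 : 0 < k by rewrite ltr_wpDl ?cnorm_ge0.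
pose dl := Num.min (r / 2) (Num.min 1 (e / (pi * 2 * k))).
have q0 : 0 < e / (pi * 2 * k) by rewrite divr_gt0// mulr_gt0.
have dl0 : 0 < dl by rewrite !lt_min ltr01 q0 divr_gt0.
have [dr [d1 de]] : dl <= r / 2 /\ dl <= 1 /\ dl <= e / (pi * 2 * k).
  by rewrite /dl !ge_min !lexx ?orbT.
clearbody dl.
pose a := ln dl; have a0 : a <= 0 by rewrite /a ln_le0.
have U0 y : `|cRe (hU a y) - cRe (h 0)| <= e / (pi * 2).
  rewrite -cReN -cReD; apply: le_trans (ler_cRe _) _.
  rewrite /hU cm_id// /lam /a lnK ?posrE//.
  pose v := (toC dl * cis y) *: u.
  have vn : cnorm v <= dl.
    rewrite /v cnormZ cabsM cabs_cis mulr1 cabs_toC gtr0_norm// ger_pMr//.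
    exact: ltW.
  have := Hr v; rewrite add0r => /(_ (le_lt_trans vn _)) H.
  have {}H := H ltac:(lra).
  rewrite -[X in cabs X](subrK (cdot v D)); apply: le_trans (cabsD _ _) _.
  apply: le_trans (lerD H (lexx _)) _.
  have DD : D = conjv (conjv D) by apply/rowP => j; rewrite !mxE conjCK.
  rewrite {1}DD; apply: le_trans (lerD (lexx _) (cauchy_schwarz _ _)) _.
  rewrite mul1r -[X in X + _]mulr1 -mulrDr (addrC 1) -/k.
  apply: le_trans (ler_wpM2r (ltW k0) (le_trans vn de)) _.
  by rewrite invfM mulrA divfK ?lexx// gt_eqF.
have cb := rint_bound twopi0 (@cont2 cRe a glre) (fun y _ => U0 y).
rewrite (_ : rint _ _ _ = rint (fun y => cRe (hU a y)) 0 (pi * 2)); last first.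
  transitivity (rint (fun y => (cRe (hU 0 y) - cRe (hU a y)) + cRe (hU a y)) 0 (pi * 2)).
    by congr (rint _ _ _); apply/funext => y; rewrite subrK.
  rewrite rintD ?rect ?add0r//.
  - by move=> y; apply: cvgB; exact: (@cont2 cRe _ glre).
  - exact: (@cont2 cRe _ glre).
rewrite subr0 divfK ?gt_eqF// in cb.
by rewrite (mulrC (pi * 2)).
Qed.

End CircleMean.

Section BallMean.
Context {R : realType} {d : nat}.
Local Notation V := (@Cvec R d).
Local Notation leb := (@lebesgue_measure R).

(** Extension by zero turns continuity on the ball into global measurability. *)
Definition on_ball (h : 'rV[C R]_d -> C R) (x : 'rV[C R]_d) : C R :=
  if cnorm x < 1 then h x else 0.

Lemma on_ball_cmeas (h : 'rV[C R]_d -> C R) :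
  (forall z, cnorm z < 1 -> exists D, cdiff h z D) -> cmeas (on_ball h : V -> C R).
Proof.
move=> hh.
have key (g : C R -> R) : (forall a b, `|g a - g b| <= cabs (a - b)) -> g 0 = 0 ->
    measurable_fun [set: V] (fun x : V => g (on_ball h x)).
  move=> gl g0.
  have -> : (fun x : V => g (on_ball h x)) =
      (fun x : V => if cnorm (x : 'rV[C R]_d) < 1 then g (h x) else 0).
    by apply/funext => x; rewrite /on_ball; case: ifP.
  apply: measurable_fun_if => //.
  - by apply: measurable_lt_fun; [exact: measurable_cnorm|exact: measurable_cst].
  - rewrite setTI; apply: (measurability _ (RGenOInfty.measurableE R)).
    move=> _ [_ [c ->] <-]; apply: sub_sigma_algebra.
    rewrite openE => z [/= z1]; rewrite in_itv /= andbT => cz.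
    have [D HD] := hh _ z1; have [r r0 Hr] := HD 1 ltr01.
    pose k := cnorm (conjv D) + 1; have k0 : 0 < k by rewrite ltr_wpDl ?cnorm_ge0.
    have e0 : 0 < (g (h z) - c) / k by rewrite divr_gt0// subr_gt0.
    apply/nbhs_cnormP; exists (Num.min r (Num.min (1 - cnorm z) ((g (h z) - c) / k))).
      by rewrite !lt_min r0 e0 subr_gt0 z1.
    move=> w; rewrite !lt_min => /andP[wr /andP[w1 wk]]; split => /=.
      have := cnormD (w - z) z; rewrite subrK; lra.
    rewrite in_itv /= andbT.
    have := Hr _ wr; rewrite addrCA subrr addr0 => H.
    have : cabs (h w - h z) < g (h z) - c.
      rewrite -[X in cabs X](subrK (cdot (w - z) D)); apply: le_lt_trans (cabsD _ _) _.
      apply: le_lt_trans (lerD H (lexx _)) _.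
      have DD : D = conjv (conjv D) by apply/rowP => j; rewrite !mxE conjCK.
      rewrite {1}DD; apply: le_lt_trans (lerD (lexx _) (cauchy_schwarz _ _)) _.
      by rewrite mul1r -[X in X + _]mulr1 -mulrDr (addrC 1) -/k -ltr_pdivlMr.
    have := gl (h w) (h z) => g1 g2.
    by have := le_lt_trans (le_trans (ler_norm _) (le_trans (_ : _ <= `|g (h w) - g (h z)|) g1)) g2;
      move=> /(_ (- (g (h w) - g (h z)))); rewrite normrN lexx => /(_ isT); lra.
split; apply: key => // a b.
  by rewrite -cReN -cReD ler_cRe.
by rewrite -cImN -cImD ler_cIm.
Qed.

Lemma integral_rotate (a : C R) (f : V -> R) : cabs a = 1 -> measurable_fun [set: V] f ->
  (\int[vb d]_x (f (a *: (x : 'rV[C R]_d)))%:E = \int[vb d]_x (f x)%:E)%E.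
Proof.
move=> a1 mf; have a0 : a != 0 by rewrite -cabs_eq0 a1 oner_eq0.
rewrite [LHS]integralE [RHS]integralE; congr (_ - _)%E.
- have mp : measurable_fun [set: V] (fun x => ((EFin \o f)^\+ x)%E).
    by apply: measurable_funepos; apply/measurable_EFinP.
  transitivity (\int[vb d]_x ((EFin \o f)^\+ (a *: (x : 'rV[C R]_d))))%E.
    by apply: eq_integral => x _; rewrite !funeposE.
  have := integral_vb_scale a0 mp (fun x => funepos_ge0 _ x).
  by rewrite a1 invr1 expr1n mul1e.
- have mp : measurable_fun [set: V] (fun x => ((EFin \o f)^\- x)%E).
    by apply: measurable_funeneg; apply/measurable_EFinP.
  transitivity (\int[vb d]_x ((EFin \o f)^\- (a *: (x : 'rV[C R]_d))))%E.
    by apply: eq_integral => x _; rewrite !funenegE.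
  have := integral_vb_scale a0 mp (fun x => funeneg_ge0 _ x).
  by rewrite a1 invr1 expr1n mul1e.
Qed.

Variables (h : 'rV[C R]_d -> C R) (G : V -> R).
Hypothesis holo : forall z, cnorm z < 1 -> exists D, cdiff h z D.
Hypothesis mG : measurable_fun [set: V] G.
Hypothesis Gball : forall x, ~~ (cnorm (x : 'rV[C R]_d) < 1) -> G x = 0.
Hypothesis Grot : forall a (x : V), cabs a = 1 -> G (a *: (x : 'rV[C R]_d)) = G x.

Let f (x : V) : R := cRe (on_ball h x) * G x.
Hypothesis intf : (vb d).-integrable [set: V] (EFin \o f).
Hypothesis intG : (vb d).-integrable [set: V] (EFin \o G).

Let mf : measurable_fun [set: V] f.
Proof. by apply: measurable_funM => //; have [] := on_ball_cmeas holo. Qed.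

Let I : set (measurableTypeR R) := `[0, pi * 2]%classic.
Let F (p : measurableTypeR R * V) : \bar R :=
  (\1_I p.1 * f (cis p.1 *: (p.2 : 'rV[C R]_d)))%:E.

Let lebI : leb I = (pi * 2)%:E.
Proof.
rewrite /I lebesgue_measure_itv /= lte_fin mulr_gt0 ?pi_gt0//.
by rewrite -EFinD subr0.
Qed.

Let mF : measurable_fun [set: measurableTypeR R * V] F.
Proof.
have mI : measurable I by exact: measurable_itv.
apply/measurable_EFinP; apply: measurable_funM.
  exact: (measurableT_comp (measurable_indic mI) (@measurable_fst _ _ (measurableTypeR R) V)).
have mc : cmeas (fun p : measurableTypeR R * V => cis p.1).
  have fs := @measurable_fst _ _ (measurableTypeR R) V.
  split; rewrite /cis /=.
    exact: (measurableT_comp (continuous_measurable_fun (@continuous_cos R)) fs).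
  exact: (measurableT_comp (continuous_measurable_fun (@continuous_sin R)) fs).
exact: (measurableT_comp mf (measurable_vecZ mc (@measurable_snd _ _ (measurableTypeR R) V))).
Qed.

Let mI : measurable I. Proof. exact: measurable_itv. Qed.

Let intF : (leb \x vb d)%E.-integrable [set: measurableTypeR R * V] F.
Proof.
apply/(integrable12ltyP _ _ mF).
apply: (@le_lt_trans _ _ (\int[leb]_t ((\1_I t)%:E * \int[vb d]_x `|(f x)%:E|))%E).
  apply: ge0_le_integral => //.
  - by move=> t _; apply: integral_ge0.
  - exact: (@measurable_fun_fubini_tonelli_F _ _ _ _ R (vb d) _ (measurableT_comp (@abse_measurable R setT) mF) (fun p => abse_ge0 _)).
  - apply: emeasurable_funM; last exact: measurable_cst.
    by apply/measurable_EFinP; exact: measurable_indic.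
  move=> t _; rewrite /F /=.
  under eq_integral do rewrite normrM EFinM (ger0_norm (_ : 0 <= \1_I t))//.
  have mft : measurable_fun [set: V] (fun x : V => `|f (cis t *: (x : 'rV[C R]_d))|%:E).
    apply/measurable_EFinP; apply: measurableT_comp => //.
    exact: (measurableT_comp mf (measurable_vecZ (cmeas_cst (cis t)) (@measurable_id _ V setT))).
  rewrite ge0_integralZl_EFin//.
  have mnf : measurable_fun [set: V] (fun x => `|f x|) by exact: measurableT_comp.
  by rewrite (integral_rotate (cabs_cis t) mnf).
have If : (\int[vb d]_x `|(f x)%:E| < +oo)%E by have /integrableP[] := intf.
have mi : measurable_fun [set: measurableTypeR R] (fun t => (\1_I t)%:E : \bar R).
  by apply/measurable_EFinP; exact: measurable_indic.
rewrite (ge0_integralZr leb measurableT mi)//; last by apply: integral_ge0.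
rewrite integral_indic// setIT [X in (X * _)%E]lebI.
by rewrite lte_mul_pinfty ?lee_fin ?mulr_ge0// ltW// pi_gt0.
Qed.

(** Rotating by every angle, then averaging over the angle first. *)
Lemma ball_mean_re : (\int[vb d]_x (f x)%:E = (cRe (h 0))%:E * \int[vb d]_x (G x)%:E)%E.
Proof.
have p0 : 0 < pi * 2 :> R by rewrite mulr_gt0// pi_gt0.
have intfin : (\int[vb d]_x (f x)%:E)%E \is a fin_num by exact: integrable_fin_num.
have := Fubini intF.
have -> : (\int[leb]_t \int[vb d]_x F (t, x) = (pi * 2)%:E * \int[vb d]_x (f x)%:E)%E.
  transitivity (\int[leb]_t ((fine (\int[vb d]_x (f x)%:E))%:E * (\1_I t)%:E))%E.
    apply: eq_integral => t _; rewrite /F /=.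
    transitivity (\int[vb d]_x ((\1_I t) * f (cis t *: (x : 'rV[C R]_d)))%:E)%E.
      by [].
    have mft : measurable_fun [set: V] (fun x : V => \1_I t * f x).
      by apply: measurable_funM.
    rewrite (integral_rotate (f := fun x : V => \1_I t * f x) (cabs_cis t) mft).
    under eq_integral do rewrite EFinM.
    by rewrite integralZl// muleC fineK.
  rewrite integralZl//; last first.
    apply/integrableP; split.
      by apply/measurable_EFinP; exact: measurable_indic.
    under eq_integral do rewrite /= ger0_norm//.
    by rewrite integral_indic// setIT [X in (X < _)%E]lebI ltry.
  by rewrite integral_indic// setIT [X in (_ * X)%E]lebI fineK// muleC.
have inner x : (\int[leb]_t F (t, x) = (pi * 2 * cRe (h 0))%:E * (G x)%:E)%E.
  have [x1|x1] := boolP (cnorm (x : 'rV[C R]_d) < 1); last first.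
    rewrite (Gball x1) mule0; apply: integral0_eq => t _.
    by rewrite /F /f Grot ?cabs_cis//= Gball// !mulr0.
  have cg := continuous_circle_re holo x1.
  have /integrableP[mg ig] := rint_integrable 0 (pi * 2) cg.
  transitivity (\int[leb]_(t in I) ((cRe (h (cis t *: (x : 'rV[C R]_d))))%:E * (G x)%:E))%E.
    rewrite [RHS]integral_mkcond; apply: eq_integral => t _; rewrite /F /= patchE indicE.
    case: ifP => _ /=; last by rewrite mul0r.
    by rewrite mul1r /f Grot ?cabs_cis// EFinM /on_ball cnormZ cabs_cis mul1r x1.
  rewrite integralZr//; last exact: rint_integrable.
  rewrite -[X in (X * _)%E]fineK; last by apply: integrable_fin_num => //; exact: rint_integrable.
  by have := circle_mean_re holo x1; rewrite /rint /Rintegral => <-.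
have -> : (\int[vb d]_x \int[leb]_t F (t, x) = (pi * 2)%:E * ((cRe (h 0))%:E * \int[vb d]_x (G x)%:E))%E.
  under eq_integral do rewrite inner.
  by rewrite integralZl// muleA.
move=> /(congr1 (fun x => ((pi * 2)^-1)%:E * x))%E.
by rewrite !muleA -!EFinM mulVf ?gt_eqF// mul1r mul1e.
Qed.

End BallMean.

(** * Complex-valued integrals and the weighted square norm *)

Section ComplexIntegral.
Context {R : realType} dT (T : measurableType dT) (mu : {measure set T -> \bar R}).
Implicit Types g : T -> C R.

Definition cint g : C R := Complex (\int[mu]_x cRe (g x)) (\int[mu]_x cIm (g x)).

Definition cintegrable g := cmeas g /\ (\int[mu]_x (cabs (g x))%:E < +oo)%E.

Lemma cintegrable_cabs g : cintegrable g -> mu.-integrable setT (fun x => (cabs (g x))%:E).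
Proof.
move=> [mg ig]; apply/integrableP; split; first by apply/measurable_EFinP; exact: measurable_cabs.
by under eq_integral do rewrite abse_EFin (ger0_norm (cabs_ge0 _)).
Qed.

Lemma cintegrable_re g : cintegrable g -> mu.-integrable setT (fun x => (cRe (g x))%:E).
Proof.
move=> ig; apply: le_integrable (cintegrable_cabs ig) => //.
  by apply/measurable_EFinP; case: ig => [[]].
by move=> x _; rewrite lee_fin (ger0_norm (cabs_ge0 _)) ler_cRe.
Qed.

Lemma cintegrable_im g : cintegrable g -> mu.-integrable setT (fun x => (cIm (g x))%:E).
Proof.
move=> ig; apply: le_integrable (cintegrable_cabs ig) => //.
  by apply/measurable_EFinP; case: ig => [[]].
by move=> x _; rewrite lee_fin (ger0_norm (cabs_ge0 _)) ler_cIm.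
Qed.

Lemma cintegrable_le g (k : T -> R) : cmeas g -> (forall x, cabs (g x) <= k x) ->
  measurable_fun setT k -> (\int[mu]_x (k x)%:E < +oo)%E -> cintegrable g.
Proof.
move=> mg gk mk ik; split => //; apply: le_lt_trans ik; apply: ge0_le_integral => //.
- by move=> x _; rewrite lee_fin cabs_ge0.
- by apply/measurable_EFinP; exact: measurable_cabs.
- exact/measurable_EFinP.
- by move=> x _; rewrite lee_fin.
Qed.

Lemma cintegrableD g1 g2 : cintegrable g1 -> cintegrable g2 ->
  cintegrable (fun x => g1 x + g2 x).
Proof.
move=> i1 i2; have [m1 j1] := i1; have [m2 j2] := i2.
apply: (@cintegrable_le _ (fun x => cabs (g1 x) + cabs (g2 x))) => //.
- exact: cmeasD.
- by move=> x; exact: cabsD.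
- by apply: measurable_funD; exact: measurable_cabs.
- under eq_integral do rewrite EFinD.
  rewrite ge0_integralD//; first exact: lte_add_pinfty.
  + by move=> x _; rewrite lee_fin cabs_ge0.
  + by apply/measurable_EFinP; exact: measurable_cabs.
  + by move=> x _; rewrite lee_fin cabs_ge0.
  + by apply/measurable_EFinP; exact: measurable_cabs.
Qed.

Lemma cintegrableZ c g : cintegrable g -> cintegrable (fun x => c * g x).
Proof.
move=> [mg ig]; split; first by apply: cmeasM => //; exact: cmeas_cst.
under eq_integral do rewrite cabsM EFinM.
rewrite ge0_integralZl_EFin ?cabs_ge0//.
- by rewrite lte_mul_pinfty ?lee_fin ?cabs_ge0.
- by move=> x _; rewrite lee_fin cabs_ge0.
- by apply/measurable_EFinP; exact: measurable_cabs.
Qed.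

Lemma cintD g1 g2 : cintegrable g1 -> cintegrable g2 ->
  cint (fun x => g1 x + g2 x) = cint g1 + cint g2.
Proof.
move=> i1 i2; apply: ceqP; rewrite cE [LHS]/=.
  under [in LHS]eq_Rintegral do rewrite cReD.
  by rewrite RintegralD//; exact: cintegrable_re.
under [in LHS]eq_Rintegral do rewrite cImD.
by rewrite RintegralD//; exact: cintegrable_im.
Qed.

Lemma cintZ c g : cintegrable g -> cint (fun x => c * g x) = c * cint g.
Proof.
move=> ig; have ir := cintegrable_re ig; have ii := cintegrable_im ig.
have sr r : mu.-integrable setT (EFin \o (fun x => r * cRe (g x))).
  by under [X in _.-integrable _ X]eq_fun do rewrite /= EFinM; exact: integrableZl.
have si r : mu.-integrable setT (EFin \o (fun x => r * cIm (g x))).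
  by under [X in _.-integrable _ X]eq_fun do rewrite /= EFinM; exact: integrableZl.
apply: ceqP; rewrite cE [LHS]/=.
  under [in LHS]eq_Rintegral do rewrite cReM -mulNr.
  by rewrite RintegralD// !RintegralZl// mulNr.
under [in LHS]eq_Rintegral do rewrite cImM.
by rewrite RintegralD// !RintegralZl.
Qed.

Lemma cintB g1 g2 : cintegrable g1 -> cintegrable g2 ->
  cint (fun x => g1 x - g2 x) = cint g1 - cint g2.
Proof.
move=> i1 i2; have i2' := cintegrableZ (-1) i2.
rewrite -[- cint g2]mulN1r -cintZ// -cintD//.
by congr cint; apply/funext => x; rewrite mulN1r.
Qed.

Lemma cabs_cint g : cintegrable g -> ((cabs (cint g))%:E <= \int[mu]_x (cabs (g x))%:E)%E.
Proof.
move=> ig; have [c0|c0] := eqVneq (cint g) 0.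
  by rewrite c0 cabs0; apply: integral_ge0 => x _; rewrite lee_fin cabs_ge0.
have c1 : 0 < cabs (cint g) by rewrite cabs_gt0.
set c := (cint g)^*; have ic := cintegrableZ c ig.
have H : \int[mu]_x cRe (c * g x) = cabs (cint g) ^+ 2.
  by rewrite -[LHS]/(cRe (cint _)) cintZ// /c mulrC mul_conj.
have L : \int[mu]_x cRe (c * g x) <= cabs (cint g) * \int[mu]_x cabs (g x).
  have ia := cintegrable_cabs ig.
  rewrite -RintegralZl//; apply: le_Rintegral => //; first exact: cintegrable_re.
    by under [X in _.-integrable _ X]eq_fun do rewrite /= EFinM; exact: integrableZl.
  by move=> x _; apply: le_trans (ler_norm _) _; rewrite -(cabsJ (cint g)) -cabsM ler_cRe.
move: L; rewrite H expr2 ler_pM2l// => L.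
rewrite -[leRHS]fineK; first by rewrite lee_fin.
by apply: integrable_fin_num => //; exact: cintegrable_cabs.
Qed.

Lemma cint_sum I (r : seq I) (k : I -> C R) (F : I -> T -> C R) :
  (forall i, cintegrable (F i)) ->
  cintegrable (fun x => \sum_(i <- r) k i * F i x) /\
  cint (fun x => \sum_(i <- r) k i * F i x) = \sum_(i <- r) k i * cint (F i).
Proof.
move=> iF; elim: r => [|i r [IH1 IH2]].
  have -> : (fun x => \sum_(i <- [::]) k i * F i x) = (fun=> 0) by apply/funext => x; rewrite big_nil.
  rewrite big_nil; split; last by apply: ceqP; rewrite /cint /= /Rintegral integral0.
  split; first exact: cmeas_cst.
  by under eq_integral do rewrite cabs0; rewrite integral0.
have -> : (fun x => \sum_(j <- i :: r) k j * F j x) =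
    (fun x => k i * F i x + \sum_(j <- r) k j * F j x) by apply/funext => x; rewrite big_cons.
have iZ := cintegrableZ (k i) (iF i).
by split; [exact: cintegrableD|rewrite cintD// IH2 cintZ// big_cons].
Qed.

End ComplexIntegral.

Section SquareNorm.
Context {R : realType} {d : nat} (alpha : R).
Local Notation V := (@Cvec R d).
Implicit Types f g : 'rV[C R]_d -> C R.

Definition wt (y : 'rV[C R]_d) : R :=
  if cnorm y < 1 then (1 - cnorm y ^+ 2) `^ alpha else 0.

Lemma wt_ge0 y : 0 <= wt y. Proof. by rewrite /wt; case: ifP => // _; exact: powR_ge0. Qed.

Lemma wt_out y : ~~ (cnorm y < 1) -> wt y = 0.
Proof. by rewrite /wt => /negbTE ->. Qed.

Lemma measurable_wt : measurable_fun [set: V] (wt : V -> R).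
Proof.
apply: measurable_fun_ifT.
- by apply: measurable_lt_fun; [exact: measurable_cnorm|exact: measurable_cst].
- apply: measurable_powRc; apply: measurable_funB; first exact: measurable_cst.
  by apply: measurable_funX; exact: measurable_cnorm.
- exact: measurable_cst.
Qed.

Definition sqnorm f : \bar R := (\int[vb d]_(y in [set: V]) (cabs (f y) ^+ 2 * wt y)%:E)%E.

Lemma sqnorm_ge0 f : (0 <= sqnorm f)%E.
Proof. by apply: integral_ge0 => y _; rewrite lee_fin mulr_ge0 ?sqr_ge0 ?wt_ge0. Qed.

Lemma integral_ball_wt f :
  (\int[v_ d]_(z in uball R d) (cabs (f z) ^+ 2 * (1 - cnorm z ^+ 2) `^ alpha)%:E)%E = sqnorm f.
Proof.
rewrite /sqnorm integral_mkcond; apply: eq_integral => y _; rewrite patchE /wt.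
case: ifPn => y1; first by move: y1; rewrite inE /uball /= => ->.
by rewrite ifN ?mulr0//; move: y1; apply: contra => y1; rewrite inE.
Qed.

Lemma A2normE f : A2norm alpha f = sqrte (sqnorm f).
Proof. by rewrite /A2norm integral_ball_wt. Qed.

Lemma sqnorm_on_ball f : sqnorm (on_ball f) = sqnorm f.
Proof.
apply: eq_integral => y _; rewrite /on_ball; case: ifPn => // y1.
by rewrite wt_out// !mulr0.
Qed.

(** Values outside the ball enter no integral, and holomorphy says nothing about them. *)
Definition bmeas f := cmeas (on_ball f : V -> C R).

Lemma on_ballD f g : on_ball (fun y => f y + g y) = (fun y => on_ball f y + on_ball g y).
Proof. by apply/funext => y; rewrite /on_ball; case: ifP => //; rewrite addr0. Qed.
Lemma on_ballZ c f : on_ball (fun y => c * f y) = (fun y => c * on_ball f y).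
Proof. by apply/funext => y; rewrite /on_ball; case: ifP => //; rewrite mulr0. Qed.
Lemma bmeasD f g : bmeas f -> bmeas g -> bmeas (fun y => f y + g y).
Proof. by move=> mf mg; rewrite /bmeas on_ballD; exact: cmeasD. Qed.
Lemma bmeasZ c f : bmeas f -> bmeas (fun y => c * f y).
Proof. by move=> mf; rewrite /bmeas on_ballZ; apply: cmeasM => //; exact: cmeas_cst. Qed.
Lemma bmeasB f g : bmeas f -> bmeas g -> bmeas (fun y => f y - g y).
Proof.
move=> mf mg; have := bmeasD mf (bmeasZ (-1) mg).
by congr bmeas; apply/funext => y; rewrite mulN1r.
Qed.
Lemma bmeas_sum I (r : seq I) (F : I -> 'rV[C R]_d -> C R) : (forall i, bmeas (F i)) ->
  bmeas (fun y => \sum_(i <- r) F i y).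
Proof.
move=> mF; elim: r => [|i r IH].
  rewrite /bmeas (_ : on_ball _ = (fun=> 0)); first exact: cmeas_cst.
  by apply/funext => y; rewrite /on_ball big_nil; case: ifP.
have := bmeasD (mF i) IH; congr bmeas; by apply/funext => y; rewrite big_cons.
Qed.

Lemma measurable_sqwt f : bmeas f ->
  measurable_fun [set: V] (fun y : V => (cabs (f y) ^+ 2 * wt y)%:E).
Proof.
move=> mf.
rewrite (_ : (fun y : V => _) = (fun y : V => (cabs (on_ball f y) ^+ 2 * wt y)%:E)).
  apply/measurable_EFinP; apply: measurable_funM; last exact: measurable_wt.
  exact: measurable_sqr_cabs.
apply/funext => y; rewrite /on_ball; case: ifPn => // y1.
by rewrite wt_out// !mulr0.
Qed.

Lemma sqnormZ c f : bmeas f -> sqnorm (fun y => c * f y) = ((cabs c ^+ 2)%:E * sqnorm f)%E.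
Proof.
move=> mf; rewrite /sqnorm -ge0_integralZl_EFin ?sqr_ge0//.
- by apply: eq_integral => y _; rewrite cabsM exprMn -mulrA EFinM.
- by move=> y _; rewrite lee_fin mulr_ge0 ?sqr_ge0 ?wt_ge0.
- exact: measurable_sqwt.
Qed.

(** Weighted form of the triangle inequality; optimizing over [t] gives the usual one. *)
Lemma sqnormD_le f g (t : R) : bmeas f -> bmeas g -> 0 < t ->
  (sqnorm (fun y => (f y + g y)%R) <= (1 + t)%:E * sqnorm f + (1 + t^-1)%:E * sqnorm g)%E.
Proof.
move=> mf mg t0.
have p1 : 0 <= 1 + t by rewrite addr_ge0// ltW.
have p2 : 0 <= 1 + t^-1 by rewrite addr_ge0// invr_ge0 ltW.
have w0 h y : (0 <= (cabs (h y) ^+ 2 * wt y)%:E)%E.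
  by rewrite lee_fin mulr_ge0 ?sqr_ge0 ?wt_ge0.
rewrite /sqnorm -!ge0_integralZl_EFin//; try by exact: measurable_sqwt.
rewrite -ge0_integralD//.
- apply: ge0_le_integral => //.
  + by move=> y _; exact: (w0 (fun y => f y + g y)).
  + by apply: measurable_sqwt; exact: bmeasD.
  + by apply: emeasurable_funD; apply: emeasurable_funM => //; exact: measurable_sqwt.
  + move=> y _; rewrite -!EFinM -EFinD lee_fin !mulrA -mulrDl ler_wpM2r ?wt_ge0//.
    apply: (@le_trans _ _ ((cabs (f y) + cabs (g y)) ^+ 2)).
      by rewrite lerXn2r ?nnegrE ?addr_ge0 ?cabs_ge0// cabsD.
    set a := cabs (f y); set b := cabs (g y); rewrite -subr_ge0.
    have -> : (1 + t) * a * a + (1 + t^-1) * b * b - (a + b) ^+ 2 = t^-1 * (t * a - b) ^+ 2.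
      by field; rewrite gt_eqF.
    by rewrite mulr_ge0 ?sqr_ge0// invr_ge0 ltW.
- by move=> y _; rewrite mule_ge0.
- by apply: emeasurable_funM => //; exact: measurable_sqwt.
- by move=> y _; rewrite mule_ge0.
- by apply: emeasurable_funM => //; exact: measurable_sqwt.
Qed.

(** The norm as a real number, to be used for functions of finite norm. *)
Definition nrm f : R := Num.sqrt (fine (sqnorm f)).

Lemma nrm_ge0 f : 0 <= nrm f. Proof. exact: sqrtr_ge0. Qed.

Lemma sqnormE f : (sqnorm f < +oo)%E -> sqnorm f = (nrm f ^+ 2)%:E.
Proof.
move=> ff; rewrite /nrm sqr_sqrtr ?fine_ge0 ?sqnorm_ge0// fineK//.
by rewrite ge0_fin_numE ?sqnorm_ge0.
Qed.

Lemma A2norm_nrm f : (sqnorm f < +oo)%E -> A2norm alpha f = (nrm f)%:E.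
Proof.
by move=> ff; rewrite A2normE (sqnormE ff) EFin_expe sqrte_sqr gee0_abs// lee_fin nrm_ge0.
Qed.

Lemma A2norm_lty f : (A2norm alpha f < +oo)%E = (sqnorm f < +oo)%E.
Proof.
rewrite A2normE -ge0_fin_numE ?sqrte_ge0// sqrte_fin_num ?sqnorm_ge0//.
by rewrite ge0_fin_numE// sqnorm_ge0.
Qed.

Lemma le_nrm f (x : R) : 0 <= x -> (sqnorm f <= (x ^+ 2)%:E)%E -> nrm f <= x.
Proof.
move=> x0 fx; have ff : (sqnorm f < +oo)%E by apply: le_lt_trans fx _; exact: ltry.
by move: fx; rewrite sqnormE// lee_fin ler_sqr ?nnegrE ?nrm_ge0.
Qed.

Lemma sqnormD_lty f g : bmeas f -> bmeas g -> (sqnorm f < +oo)%E -> (sqnorm g < +oo)%E ->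
  (sqnorm (fun y => f y + g y)%R < +oo)%E.
Proof.
move=> mf mg ff fg; apply: le_lt_trans (sqnormD_le mf mg ltr01) _.
by rewrite (sqnormE ff) (sqnormE fg) -!EFinM -EFinD ltry.
Qed.

Lemma nrmD f g : bmeas f -> bmeas g -> (sqnorm f < +oo)%E -> (sqnorm g < +oo)%E ->
  nrm (fun y => f y + g y) <= nrm f + nrm g.
Proof.
move=> mf mg ff fg; apply/ler_addgt0Pl => e e0.
have f0 := nrm_ge0 f; have g0 := nrm_ge0 g.
apply: le_nrm; first by lra.
pose a := nrm f + e / 2; pose b := nrm g + e / 2.
have a0 : 0 < a by rewrite /a; lra.
have b0 : 0 < b by rewrite /b; lra.
apply: le_trans (sqnormD_le mf mg (divr_gt0 b0 a0)) _.
rewrite (sqnormE ff) (sqnormE fg) -!EFinM -EFinD lee_fin.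
have -> : (e + (nrm f + nrm g)) ^+ 2 = (1 + b / a) * a ^+ 2 + (1 + (b / a)^-1) * b ^+ 2.
  have -> : e + (nrm f + nrm g) = a + b by rewrite /a /b; field.
  by field; rewrite !gt_eqF.
have ba : 0 <= b / a by rewrite divr_ge0// ltW.
have ab : 0 <= (b / a)^-1 by rewrite invr_ge0.
apply: lerD; rewrite ler_wpM2l ?addr_ge0// ler_sqr ?nnegrE//.
- by rewrite /a; lra.
- exact: ltW.
- by rewrite /b; lra.
- exact: ltW.
Qed.

Definition ip f g : C R := cint (vb d) (fun y : V => on_ball f y * (on_ball g y)^* * toC (wt y)).

Lemma ip_integrable f g : bmeas f -> bmeas g -> (sqnorm f < +oo)%E -> (sqnorm g < +oo)%E ->
  cintegrable (vb d) (fun y : V => on_ball f y * (on_ball g y)^* * toC (wt y)).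
Proof.
move=> mf mg ff fg.
apply: (@cintegrable_le _ _ _ _ _ (fun y : V => cabs (on_ball f y) ^+ 2 * wt y + cabs (on_ball g y) ^+ 2 * wt y)).
- apply: cmeasM; first by apply: cmeasM => //; exact: cmeasJ.
  by apply: cmeas_toC; exact: measurable_wt.
- move=> y; rewrite !cabsM cabsJ cabs_toC ger0_norm ?wt_ge0// -mulrDl ler_wpM2r ?wt_ge0//.
  by have := cabs_ge0 (on_ball f y); have := cabs_ge0 (on_ball g y); nra.
- apply: measurable_funD; apply: measurable_funM; try exact: measurable_wt.
    exact: measurable_sqr_cabs.
  exact: measurable_sqr_cabs.
- under eq_integral do rewrite EFinD.
  have w0 h y : (0 <= (cabs (h y) ^+ 2 * wt y)%:E)%E.
    by rewrite lee_fin mulr_ge0 ?sqr_ge0 ?wt_ge0.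
  rewrite ge0_integralD//.
  + have := sqnorm_on_ball f; have := sqnorm_on_ball g; rewrite /sqnorm => -> ->.
    by rewrite lte_add_pinfty.
  + by apply/measurable_EFinP; apply: measurable_funM; [exact: measurable_sqr_cabs|exact: measurable_wt].
  + by apply/measurable_EFinP; apply: measurable_funM; [exact: measurable_sqr_cabs|exact: measurable_wt].
Qed.

Lemma cauchy_schwarz_ip f g : bmeas f -> bmeas g -> (sqnorm f < +oo)%E -> (sqnorm g < +oo)%E ->
  cabs (ip f g) <= nrm f * nrm g.
Proof.
move=> mf mg ff fg.
have f0 := nrm_ge0 f; have g0 := nrm_ge0 g.
have key (t : R) : 0 < t -> 2 * cabs (ip f g) <= t * nrm f ^+ 2 + t^-1 * nrm g ^+ 2.
  move=> t0; rewrite -lee_fin EFinM.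
  have w0 h y : (0 <= (cabs (h y) ^+ 2 * wt y)%:E)%E.
    by rewrite lee_fin mulr_ge0 ?sqr_ge0 ?wt_ge0.
  apply: le_trans (lee_wpmul2l _ (cabs_cint (ip_integrable mf mg ff fg))) _ => //.
  have -> : ((t * nrm f ^+ 2 + t^-1 * nrm g ^+ 2)%:E = t%:E * sqnorm f + t^-1%:E * sqnorm g)%E.
    by rewrite (sqnormE ff) (sqnormE fg).
  rewrite -(sqnorm_on_ball f) -(sqnorm_on_ball g) /sqnorm.
  have mz h : bmeas h -> measurable_fun [set: V] (fun y : V => (cabs (on_ball h y) ^+ 2 * wt y)%:E).
    move=> mh; apply/measurable_EFinP; apply: measurable_funM; last exact: measurable_wt.
    exact: measurable_sqr_cabs.
  rewrite -!ge0_integralZl_EFin ?invr_ge0 ?(ltW t0)//; try by exact: mz.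
  - rewrite -ge0_integralD//.
    + apply: ge0_le_integral => //.
      * by move=> y _; rewrite -EFinM lee_fin mulr_ge0 ?cabs_ge0.
      * apply: emeasurable_funM => //; apply/measurable_EFinP.
        by apply: measurable_cabs; have [] := ip_integrable mf mg ff fg.
      * by apply: emeasurable_funD; apply: emeasurable_funM => //; exact: mz.
      * move=> y _; rewrite -!EFinM -EFinD lee_fin cabsM cabsM cabsJ cabs_toC.
        rewrite ger0_norm ?wt_ge0// !mulrA -mulrDl ler_wpM2r ?wt_ge0//.
        set a := cabs _; set b := cabs _; rewrite -subr_ge0.
        have -> : t * a * a + t^-1 * b * b - 2 * a * b = t^-1 * (t * a - b) ^+ 2.
          by field; rewrite gt_eqF.
        by rewrite mulr_ge0 ?sqr_ge0// invr_ge0 ltW.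
    + by move=> y _; rewrite mule_ge0// lee_fin ltW.
    + by apply: emeasurable_funM => //; exact: mz.
    + by move=> y _; rewrite mule_ge0// lee_fin invr_ge0 ltW.
    + by apply: emeasurable_funM => //; exact: mz.
  - by move=> y _; rewrite lee_fin cabs_ge0.
  - by apply/measurable_EFinP; apply: measurable_cabs; have [] := ip_integrable mf mg ff fg.
apply/ler_addgt0Pl => e e0.
have lim (u v : R) : 0 < u -> 0 < v -> nrm f <= u -> nrm g <= v -> cabs (ip f g) <= u * v.
  move=> u0 v0 fu gv; have := key _ (divr_gt0 v0 u0).
  have f2 : nrm f ^+ 2 <= u ^+ 2 by rewrite ler_sqr ?nnegrE// ltW.
  have g2 : nrm g ^+ 2 <= v ^+ 2 by rewrite ler_sqr ?nnegrE// ltW.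
  have k1 : 0 <= v / u by rewrite divr_ge0// ltW.
  have k2 : 0 <= (v / u)^-1 by rewrite invr_ge0.
  move=> H; have {H} := le_trans H (lerD (ler_wpM2l k1 f2) (ler_wpM2l k2 g2)).
  have -> : v / u * u ^+ 2 + (v / u)^-1 * v ^+ 2 = 2 * (u * v) by field; rewrite !gt_eqF.
  by rewrite ler_pM2l.
pose k := nrm f + nrm g + 1; have k0 : 0 < k by rewrite /k; lra.
pose eta := Num.min 1 (e / (2 * k)).
have [e1 [e2 e3]] : 0 < eta /\ eta <= 1 /\ eta <= e / (2 * k).
  by rewrite /eta lt_min !ge_min !lexx ltr01 orbT divr_gt0// mulr_gt0.
clearbody eta; apply: (le_trans (lim (nrm f + eta) (nrm g + eta) _ _ _ _)); try lra.
have : eta * k <= e / 2.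
  by move: e3; rewrite ler_pdivlMr ?mulr_gt0// => h; lra.
by rewrite /k; nra.
Qed.

End SquareNorm.

(** * Mean values of holomorphic functions over Bergman balls *)

Section Holomorphic.
Context {R : realType} {d : nat}.
Implicit Types f g : 'rV[C R]_d -> C R.

Definition holo f := forall z, cnorm z < 1 -> exists D, cdiff f z D.

Lemma holoP f : (forall z, uball R d z -> differentiable f z) <-> holo f.
Proof.
split=> hf z z1; first by apply: differentiable_cdiff; exact: hf.
by have [D HD] := hf z z1; exact: cdiff_differentiable HD.
Qed.

Lemma holoM f g : holo f -> holo g -> holo (fun z => f z * g z).
Proof.
move=> /holoP hf /holoP hg; apply/holoP => z z1.
by apply: differentiableM; [exact: hf|exact: hg].
Qed.

Lemma holoD f g : holo f -> holo g -> holo (fun z => f z + g z).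
Proof.
move=> /holoP hf /holoP hg; apply/holoP => z z1.
by apply: differentiableD; [exact: hf|exact: hg].
Qed.

Lemma holo_cst c : holo (fun=> c).
Proof. by apply/holoP => z _; exact: differentiable_cst. Qed.

Lemma holo_sum I (r : seq I) (F : I -> 'rV[C R]_d -> C R) : (forall i, holo (F i)) ->
  holo (fun z => \sum_(i <- r) F i z).
Proof.
move=> hF; elim: r => [|i r IH].
  by under eq_fun do rewrite big_nil; exact: holo_cst.
by under eq_fun do rewrite big_cons; exact: holoD.
Qed.

Lemma bmeas_holo f : holo f -> bmeas f.
Proof. exact: on_ball_cmeas. Qed.

Lemma differentiable_cdot (c z : 'rV[C R]_d) : differentiable (fun x => cdot x c) z.
Proof.
apply: (@cdiff_differentiable _ _ _ _ c) => e e0; exists 1 => // h _.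
rewrite cdotDl [X in cabs X](_ : _ = 0); last by ring.
by rewrite cabs0 mulr_ge0 ?cnorm_ge0// ltW.
Qed.

Lemma differentiable_row (F : 'rV[C R]_d -> 'rV[C R]_d) z :
  (forall j, differentiable (fun x => F x ord0 j : C R) z) -> differentiable F z.
Proof.
move=> dF.
rewrite (_ : F = \sum_(j < d) (fun x => (F x ord0 j : C R) *: delta_mx 0 j : 'rV[C R]_d)).
  by apply: differentiable_sum => j; exact: differentiableZl.
by apply/funext => x; rewrite fct_sumE {1}(row_sum_delta (F x)).
Qed.

Lemma differentiable_mobius (w z : 'rV[C R]_d) : cnorm w < 1 -> cnorm z < 1 ->
  differentiable (mobius w) z.
Proof.
move=> w1 z1; apply: differentiable_row => j.
pose k := (toC (cnorm w ^+ 2))^-1 * (1 - toC (Num.sqrt (1 - cnorm w ^+ 2))).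
rewrite (_ : (fun x => _) = (fun x => (mden w 1 x)^-1) *
   ((cst 1 - (fun x => cdot x (conjv w)) * cst k) * cst (w ord0 j)
     - cst (toC (Num.sqrt (1 - cnorm w ^+ 2))) * (fun x : 'rV[C R]_d => x ord0 j))); last first.
  by apply/funext => x; rewrite mobiusE /mnum !mxE /= !fctE /k !mulrA.
have dc := differentiable_cdot (conjv w) z.
apply: differentiableM.
  apply: differentiableV; last exact: den_neq0.
  exact: (differentiableB (differentiable_cst _ _) dc).
apply: differentiableB.
  exact: (differentiableM (differentiableB (differentiable_cst _ _)
    (differentiableM dc (differentiable_cst _ _))) (differentiable_cst _ _)).
exact: (differentiableM (differentiable_cst _ _) (differentiable_coord _ _ _)).
Qed.

Lemma holo_mobius f w : cnorm w < 1 -> holo f -> holo (fun z => f (mobius w z)).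
Proof.
move=> w1 /holoP hf; apply/holoP => z z1.
apply: (differentiable_comp (differentiable_mobius w1 z1)); apply: hf.
exact: mobius_lt1.
Qed.

Lemma cRe_1B_ge (y c : 'rV[C R]_d) : 1 - cnorm y * cnorm c <= cRe (1 - cdot y (conjv c)).
Proof.
rewrite !cE lerD2l lerN2; apply: le_trans (ler_norm _) _.
by apply: le_trans (ler_cRe _) _; exact: cauchy_schwarz.
Qed.

Lemma cabs_1B_le (y c : 'rV[C R]_d) : cnorm y <= 1 -> cnorm c <= 1 ->
  cabs (1 - cdot y (conjv c)) <= 2.
Proof.
move=> y1 c1; apply: le_trans (cabsB _ _) _; rewrite cabs1.
have := cauchy_schwarz y c; have := cnorm_ge0 y; have := cnorm_ge0 c; nra.
Qed.

(** First-order expansion in [y] of [(1 - y . conj c)^b], with a remainder that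
    is uniform in the parameter [c]. *)
Lemma cpow_cdot_taylor (b dl : R) : 0 < dl -> exists2 M : R, 0 <= M & forall y h c : 'rV[C R]_d,
  cnorm c <= 1 -> cnorm y <= 1 -> cnorm (y + h) <= 1 ->
  cnorm y * cnorm c <= 1 - dl -> cnorm (y + h) * cnorm c <= 1 - dl ->
  cabs (cpow (1 - cdot (y + h) (conjv c)) b - cpow (1 - cdot y (conjv c)) b
    - cdot h ((- toC b * cpow (1 - cdot y (conjv c)) (b - 1)) *: conjv c)) <= M * cnorm h ^+ 2.
Proof.
move=> dl0; have [M M0 HM] := cpow_taylor b dl0; exists M => // y h c c1 y1 yh1 yc yhc.
have E : 1 - cdot (y + h) (conjv c) = (1 - cdot y (conjv c)) + - cdot h (conjv c).
  by rewrite cdotDl; ring.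
rewrite E; apply: le_trans (_ : M * cabs (- cdot h (conjv c)) ^+ 2 <= _); last first.
  rewrite ler_wpM2l// lerXn2r ?nnegrE ?cabs_ge0 ?cnorm_ge0// cabsN.
  apply: le_trans (cauchy_schwarz _ _) _.
  by rewrite ler_piMr ?cnorm_ge0.
have := HM (1 - cdot y (conjv c)) (- cdot h (conjv c)).
rewrite -E => /(_ _ _ _ _); move/(_ _ _ _ _) => H.
rewrite cdotZr (_ : - toC b * _ * _ = toC b * (- cdot h (conjv c) * cpow (1 - cdot y (conjv c)) (b - 1)));
  last by ring.
apply: H.
- by apply: le_trans (cRe_1B_ge _ _); lra.
- by apply: le_trans (cRe_1B_ge _ _); lra.
- exact: cabs_1B_le.
- exact: cabs_1B_le.
Qed.

Lemma holo_cpow (b : R) (c : 'rV[C R]_d) : cnorm c < 1 ->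
  holo (fun y => cpow (1 - cdot y (conjv c)) b).
Proof.
move=> c1 z z1; have dl0 : 0 < 1 - cnorm c by rewrite subr_gt0.
have [M M0 HM] := cpow_cdot_taylor b dl0.
exists ((- toC b * cpow (1 - cdot z (conjv c)) (b - 1)) *: conjv c) => e e0.
exists (Num.min (1 - cnorm z) (e / (M + 1))).
  by rewrite lt_min subr_gt0 z1 divr_gt0// ltr_wpDl.
move=> h; rewrite lt_min => /andP[h1 h2].
have zh : cnorm (z + h) <= 1 by have := cnormD z h; lra.
apply: le_trans (HM z h c (ltW c1) (ltW z1) zh _ _) _.
- by have := cnorm_ge0 z; have := cnorm_ge0 c; nra.
- by have := cnorm_ge0 (z + h); have := cnorm_ge0 c; nra.
rewrite expr2 mulrA ler_wpM2r ?cnorm_ge0//.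
move: h2; rewrite ltr_pdivlMr ?ltr_wpDl//.
by have := cnorm_ge0 h; lra.
Qed.

End Holomorphic.

Section MobiusMean.
Context {R : realType} {d : nat} (w : 'rV[C R]_d) (w1 : cnorm w < 1).
Local Notation V := (@Cvec R d).
Variables (G : V -> R).
Hypothesis G0 : forall x, 0 <= G x.
Hypothesis mG : measurable_fun [set: V] G.
Hypothesis Grot : forall a (x : V), cabs a = 1 -> G (a *: (x : 'rV[C R]_d)) = G x.

Lemma measurable_mobius_l : measurable_fun [set: V] (mobius w : V -> V).
Proof. by apply: measurable_mobius; [exact: measurable_cst|exact: measurable_id]. Qed.

Hypothesis intG : (\int[vb d]_u (G u * jac u)%:E < +oo)%E.

Let mGm : measurable_fun [set: V] (fun x : V => G (mobius w x) * jac x).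
Proof.
by apply: measurable_funM (measurableT_comp mG measurable_mobius_l) measurable_jac.
Qed.

Lemma integral_mobius_G :
  (\int[vb d]_x (G (mobius w x) * jac x)%:E = \int[vb d]_u (G u * jac u)%:E)%E.
Proof.
under eq_integral do rewrite EFinM.
under [RHS]eq_integral do rewrite EFinM.
apply: (integral_mobius w1 (g := fun x => (G x)%:E)) => //.
exact/measurable_EFinP.
Qed.

Let mean_re (H : 'rV[C R]_d -> C R) : holo H ->
  (\int[vb d]_x (cabs (on_ball H x) * (G (mobius w x) * jac x))%:E < +oo)%E ->
  (\int[vb d]_x (cRe (on_ball H x) * (G (mobius w x) * jac x))%:E =
   (cRe (H w))%:E * \int[vb d]_u (G u * jac u)%:E)%E.
Proof.
move=> hH iH; pose h u := H (mobius w u).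
have hh : holo h := holo_mobius w1 hH.
have [mr _] := on_ball_cmeas hh; have mc := measurable_cabs (on_ball_cmeas hh).
have oE (x : V) : jac x != 0 -> on_ball h (mobius w x) = on_ball H x.
  rewrite /jac /on_ball; case: ifPn => [x1 _|]; last by rewrite eqxx.
  by rewrite mobius_lt1// /h mobiusK.
pose k (u : V) := cRe (on_ball h u) * G u.
have mk : measurable_fun [set: V] k by exact: measurable_funM.
have kE x : cRe (on_ball H x) * (G (mobius w x) * jac x) = k (mobius w x) * jac x.
  by have [->|j0] := eqVneq (jac x) 0; rewrite ?mulr0// /k oE// mulrA.
have kjE (u : V) : cRe (on_ball h u) * (G u * jac u) = k u * jac u by rewrite mulrA.
have jG0 (x : V) : ~~ (cnorm (x : 'rV[C R]_d) < 1) -> G x * jac x = 0.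
  by rewrite /jac => /negbTE ->; rewrite mulr0.
have jGr a (x : V) : cabs a = 1 -> G (a *: (x : 'rV[C R]_d)) * jac (a *: (x : 'rV[C R]_d)) = G x * jac x.
  by move=> a1; rewrite Grot// /jac cnormZ a1 mul1r.
have mjG : measurable_fun [set: V] (fun x : V => G x * jac x) := measurable_funM mG measurable_jac.
have iG : (vb d).-integrable [set: V] (EFin \o (fun x => G x * jac x)).
  apply/integrableP; split; first exact/measurable_EFinP.
  by under eq_integral do rewrite /= ger0_norm ?mulr_ge0 ?jac_ge0//.
have iF : (vb d).-integrable [set: V] (EFin \o (fun x => cRe (on_ball h x) * (G x * jac x))).
  apply/integrableP; split; first by apply/measurable_EFinP; exact: measurable_funM.
  apply: le_lt_trans iH.
  have mp : measurable_fun [set: V] (fun u : V => (cabs (on_ball h u) * G u)%:E).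
    by apply/measurable_EFinP; exact: measurable_funM.
  have := integral_mobius w1 mp (fun u => ltac:(by rewrite lee_fin mulr_ge0 ?cabs_ge0)).
  move=> E; rewrite [leRHS](_ : _ = (\int[vb d]_x ((cabs (on_ball h (mobius w x)) * G (mobius w x))%:E * (jac x)%:E))%E); last first.
    apply: eq_integral => x _; rewrite -EFinM; congr EFin.
    by have [->|j0] := eqVneq (jac x) 0; rewrite ?mulr0// oE// mulrA.
  rewrite E; apply: ge0_le_integral => //.
  - by apply/measurable_EFinP; apply: measurableT_comp => //; exact: measurable_funM.
  - by apply: emeasurable_funM => //; apply/measurable_EFinP; exact: measurable_jac.
  - move=> x _; rewrite -EFinM lee_fin normrM (ger0_norm (mulr_ge0 (G0 x) (jac_ge0 _))).
    by rewrite -mulrA ler_wpM2r ?mulr_ge0 ?jac_ge0 ?ler_cRe.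
have := ball_mean_re hh mjG jG0 jGr iF iG; rewrite /h mobius0 -/h => <-.
under eq_integral do rewrite kE.
under [RHS]eq_integral do rewrite kjE.
have sgn (f1 f2 : R) : 0 <= f2 -> Num.max (f1 * f2) 0 = Num.max f1 0 * f2.
  by move=> f20; rewrite maxr_pMl// mul0r.
have mpos : measurable_fun [set: V] (fun u : V => (Num.max (k u) 0)%:E).
  by apply/measurable_EFinP; exact: measurable_maxr.
have mneg : measurable_fun [set: V] (fun u : V => (Num.max (- k u) 0)%:E).
  by apply/measurable_EFinP; apply: measurable_maxr => //; exact: measurableT_comp.
rewrite [LHS]integralE [RHS]integralE; congr (_ - _)%E.
- have Ip := integral_mobius w1 mpos (fun u => ltac:(by rewrite lee_fin le_max lexx orbT)).
  transitivity (\int[vb d]_x ((Num.max (k (mobius w x)) 0)%:E * (jac x)%:E))%E.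
    by apply: eq_integral => x _; rewrite funeposE -EFin_max sgn ?jac_ge0.
  rewrite Ip; apply: eq_integral => x _; by rewrite funeposE -EFin_max (sgn (k x)) ?jac_ge0.
- have Ip := integral_mobius w1 mneg (fun u => ltac:(by rewrite lee_fin le_max lexx orbT)).
  transitivity (\int[vb d]_x ((Num.max (- k (mobius w x)) 0)%:E * (jac x)%:E))%E.
    by apply: eq_integral => x _; rewrite funenegE -EFinN -EFin_max -mulNr sgn ?jac_ge0.
  rewrite Ip; apply: eq_integral => x _; by rewrite funenegE -EFinN -EFin_max -(mulNr (k x)) (sgn (- k x)) ?jac_ge0.
Qed.

(** The measure with density [jac] is Moebius invariant, so a mean over a
    Bergman ball centred at [w] reduces to a mean over a ball centred at [0]. *)
Lemma mobius_mean (H : 'rV[C R]_d -> C R) : holo H ->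
  (\int[vb d]_x (cabs (on_ball H x) * (G (mobius w x) * jac x))%:E < +oo)%E ->
  cint (vb d) (fun x : V => on_ball H x * toC (G (mobius w x) * jac x)) =
  H w * toC (\int[vb d]_u (G u * jac u)).
Proof.
move=> hH iH.
have IG : (\int[vb d]_u (G u * jac u)%:E = (\int[vb d]_u (G u * jac u))%:E)%E.
  rewrite /Rintegral fineK// ge0_fin_numE//; apply: integral_ge0 => u _.
  by rewrite lee_fin mulr_ge0 ?jac_ge0.
pose j : C R := Complex 0 (-1).
have jE z : cRe (j * z) = cIm z by rewrite !cE mul0r mulN1r opprK add0r.
have j1 : cabs j = 1 by rewrite cabsE /= expr0n add0r sqrrN expr1n sqrtr1.
have hi : holo (fun z => j * H z) by exact: holoM (holo_cst _) hH.
have ii : (\int[vb d]_x (cabs (on_ball (fun z => j * H z)%R x) * (G (mobius w x) * jac x))%:E < +oo)%E.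
  by under eq_integral do rewrite on_ballZ cabsM j1 mul1r.
have := mean_re hi ii; have := mean_re hH iH.
rewrite IG -!EFinM => E1 E2.
apply: ceqP; rewrite !cE mulr0 ?subr0 ?addr0 ?add0r.
  rewrite -[LHS]/(\int[vb d]_x _) /Rintegral.
  by under eq_integral do rewrite !cE mulr0 subr0; rewrite E1.
rewrite -[LHS]/(\int[vb d]_x _) /Rintegral -jE.
rewrite -[RHS]/(fine (_ * _)%:E) -E2; congr fine; apply: eq_integral => x _.
by rewrite on_ballZ jE !cE mulr0 add0r.
Qed.

End MobiusMean.

(** * Concentric hyperbolic shells *)

Section Series.
Context {R : realType}.

Lemma nneseries_le_bound (u : nat -> \bar R) (c : \bar R) : (forall k, (0 <= u k)%E) ->
  (forall n, (\sum_(0 <= k < n) u k <= c)%E) -> (\sum_(0 <= k <oo) u k <= c)%E.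
Proof.
move=> u0 uc; apply: lime_le; first by apply: is_cvg_nneseries => n _ _; exact: u0.
by apply: nearW => n; exact: uc.
Qed.

Lemma geometric_le (q : R) n : 0 <= q -> q < 1 -> \sum_(0 <= k < n) q ^+ k <= (1 - q)^-1.
Proof.
move=> q0 q1; have q1' : 0 < 1 - q by rewrite subr_gt0.
rewrite -[leRHS]mul1r ler_pdivlMr// big_mkord mulrC.
have -> : (1 - q) * \sum_(i < n) q ^+ i = 1 - q ^+ n.
  elim: n => [|n IH]; first by rewrite big_ord0 mulr0 expr0 subrr.
  by rewrite big_ord_recr /= mulrDr IH exprS; ring.
by rewrite gerBl exprn_ge0.
Qed.

Lemma nneseries_geometric (q c : R) : 0 <= c -> 0 <= q -> q < 1 ->
  (\sum_(0 <= k <oo) (c * q ^+ k)%:E <= (c / (1 - q))%:E)%E.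
Proof.
move=> c0 q0 q1; apply: nneseries_le_bound => [k|n]; first by rewrite lee_fin mulr_ge0 ?exprn_ge0.
by rewrite sumEFin lee_fin -mulr_sumr ler_wpM2l// geometric_le.
Qed.

End Series.

Section Shells.
Context {R : realType} {d : nat}.
Local Notation V := (@Cvec R d).

Definition rho (t : R) : R := (expR t - 1) / (expR t + 1).

(** Bergman distance to the origin. *)
Definition bd (u : 'rV[C R]_d) : R := ln ((1 + cnorm u) / (1 - cnorm u)).

Let p1 (t : R) : 0 < expR t + 1. Proof. by rewrite addr_gt0// expR_gt0. Qed.

Lemma bd_lt u (t : R) : cnorm u < 1 -> (bd u < t) = (cnorm u < rho t).
Proof.
move=> u1; have u0 := cnorm_ge0 u.
have q0 : 0 < 1 - cnorm u by rewrite subr_gt0.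
have q1 : 0 < 1 + cnorm u by lra.
rewrite -ltr_expR lnK ?posrE ?divr_gt0//.
rewrite ltr_pdivrMr// /rho ltr_pdivlMr//.
by apply/idP/idP; nra.
Qed.

Definition sh (k : nat) : set V :=
  [set u | cnorm (u : 'rV[C R]_d) < 1 /\ k%:R <= bd u < k.+1%:R].

Lemma rho_lt1 t : rho t < 1.
Proof. by rewrite ltr_pdivrMr// mul1r; lra. Qed.

Lemma rho_ge0 t : 0 <= t -> 0 <= rho t.
Proof. by move=> t0; rewrite divr_ge0 ?(ltW (p1 t))// subr_ge0 -expR0 ler_expR. Qed.

Lemma rho_gt0 t : 0 < t -> 0 < rho t.
Proof. by move=> t0; rewrite divr_gt0// subr_gt0 -expR0 ltr_expR. Qed.

Lemma rho_le s t : s <= t -> rho s <= rho t.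
Proof.
rewrite -ler_expR => st; rewrite ler_pdivrMr// mulrAC ler_pdivlMr//.
nra.
Qed.

Lemma shE k : sh k = [set u : V | cnorm (u : 'rV[C R]_d) < rho k.+1%:R] `\`
                     [set u : V | cnorm (u : 'rV[C R]_d) < rho k%:R].
Proof.
apply/seteqP; split => u /=.
  by move=> [u1 /andP[k1 k2]]; rewrite -!bd_lt//; split => //; apply/negP; rewrite -leNgt.
move=> [k2 /negP k1]; have u1 := lt_trans k2 (rho_lt1 _).
by split => //; move: k1 k2; rewrite -!bd_lt// -leNgt => -> ->.
Qed.

Lemma measurable_sh k : measurable (sh k).
Proof. by rewrite shE; apply: measurableD; exact: measurable_cball. Qed.

Lemma sh_cover : \bigcup_k sh k = uball R d.
Proof.
apply/seteqP; split => [u [k _ []]//|u u1].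
have u0 := cnorm_ge0 u; rewrite /uball /= in u1.
have b0 : 0 <= bd u.
  by rewrite ln_ge0// ler_pdivlMr ?subr_gt0// mul1r; lra.
by exists (Num.truncn (bd u)) => //; split => //; exact: truncn_itv.
Qed.

Lemma sh_triv : trivIset [set: nat] sh.
Proof.
move=> i j _ _ [u [[_ /andP[i1 i2]] [_ /andP[j1 j2]]]].
have := le_lt_trans i1 j2; have := le_lt_trans j1 i2.
by rewrite !ltr_nat !ltnS => ji ij; apply/eqP; rewrite eqn_leq ij.
Qed.

Lemma vb_ball0 (r : R) : 0 <= r -> (0 < d)%N ->
  vb d [set z : V | cnorm (z : 'rV[C R]_d) < r] = (r ^+ (d + d))%:E.
Proof.
rewrite le_eqVlt => /predU1P[<-|r0] d0; last exact: vb_ball.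
rewrite expr0n addn_eq0 (gtn_eqF d0) [X in vb d X](_ : _ = set0) ?measure0//.
by apply/seteqP; split => // z /=; rewrite ltNge cnorm_ge0.
Qed.

Lemma vb_sh k : (0 < d)%N ->
  vb d (sh k) = (rho k.+1%:R ^+ (d + d) - rho k%:R ^+ (d + d))%:E.
Proof.
move=> d0; rewrite shE measureD; try exact: measurable_cball; last first.
  by rewrite -[X in (X < _)%E]/(vb d _) vb_ball0 ?rho_ge0// ltry.
rewrite setIidr; first by rewrite -[X in (X - _)%E]/(vb d _) -[X in (_ - X)%E]/(vb d _) !vb_ball0 ?rho_ge0.
by move=> u /= h; apply: lt_le_trans h _; apply: rho_le; rewrite ler_nat.
Qed.

Lemma vb_sh_le k : (0 < d)%N -> (vb d (sh k) <= ((d + d)%:R * 2 * expR (- k%:R))%:E)%E.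
Proof.
move=> d0; rewrite vb_sh// lee_fin.
have r0 : 0 <= rho k%:R by exact: rho_ge0.
have B (x : R) n : 0 <= x -> x <= 1 -> 1 - x ^+ n <= n%:R * (1 - x).
  move=> x0 x1; elim: n => [|n IH]; first by rewrite expr0 subrr mul0r.
  have := exprn_ile1 n x0 x1; have := exprn_ge0 n x0.
  by rewrite exprS -(natr1 n); nra.
have E1 : rho k.+1%:R ^+ (d + d) <= 1.
  by apply: exprn_ile1; [exact: rho_ge0|exact/ltW/rho_lt1].
apply: (@le_trans _ _ (1 - rho k%:R ^+ (d + d))); first by rewrite lerD2r.
apply: le_trans (B _ _ r0 (ltW (rho_lt1 _))) _; rewrite -mulrA ler_wpM2l//.
have E0 : 0 < expR k%:R + 1 :> R by exact: p1.
have -> : 1 - rho k%:R = 2 * (expR k%:R + 1)^-1 by rewrite /rho; field; rewrite gt_eqF.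
by rewrite expRN ler_pM2l// lef_pV2 ?posrE ?expR_gt0// lerDl.
Qed.

Lemma vb_sh_ge k : (0 < d)%N ->
  ((rho 1 ^+ (d + d) / 4 * expR (- k%:R))%:E <= vb d (sh k))%E.
Proof.
move=> d0; rewrite vb_sh// lee_fin.
set x := rho k.+1%:R; set y := rho k%:R; set r := rho 1.
have r0 : 0 < r by exact: rho_gt0.
have rx : r <= x by apply: rho_le; rewrite ler1n.
have y0 : 0 <= y by exact: rho_ge0.
have yx : y <= x by apply: rho_le; rewrite ler_nat.
have [m mE] : exists m, (d + d)%N = m.+1 by exists (d + d).-1; rewrite prednK// addn_gt0 d0.
rewrite mE.
have H1 : x ^+ m * (x - y) <= x ^+ m.+1 - y ^+ m.+1.
  rewrite mulrBr -exprSr lerD2l lerN2 exprSr ler_wpM2r// lerXn2r// nnegrE.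
  exact: le_trans y0 yx.
apply: le_trans _ H1.
have H2 : expR (- k%:R) / 4 <= x - y.
  rewrite /x /y /rho -[k.+1%:R]natr1 expRD.
  set E := expR k%:R; set e := expR 1.
  have E1 : 1 <= E by rewrite /E -expR0 ler_expR.
  have e2 : 2 <= e by have := expR_ge1Dx (1 : R); rewrite /e; lra.
  rewrite expRN -/E.
  have -> : (E * e - 1) / (E * e + 1) - (E - 1) / (E + 1) =
      2 * E * (e - 1) / ((E * e + 1) * (E + 1)).
    by field; apply/andP; split; rewrite gt_eqF//; nra.
  rewrite ler_pdivlMr; last by nra.
  rewrite mulrAC ler_pdivrMr// ler_pdivrMl; last by lra.
  have h1 : (E * e + 1) * (E + 1) <= (2 * (E * e)) * (2 * E) by apply: ler_pM; nra.
  apply: le_trans h1 _.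
  have : 0 <= E * E * (e - 2) by rewrite mulr_ge0 ?mulr_ge0//; lra.
  by nra.
apply: (@le_trans _ _ (r ^+ m.+1 * (x - y))).
  by rewrite -mulrA ler_wpM2l ?exprn_ge0 ?(ltW r0)// mulrC.
rewrite ler_wpM2r ?subr_ge0//.
apply: (@le_trans _ _ (r ^+ m)); last by rewrite lerXn2r ?nnegrE ?(ltW r0)// (le_trans (ltW r0)).
by rewrite exprSr ler_piMr ?exprn_ge0 ?(ltW r0)// ltW// rho_lt1.
Qed.

(** On the [k]-th shell, [1 - |u|^2] is comparable to [exp (- k)]. *)
Lemma sh_pow k (u : V) (g : R) : sh k u ->
  expR (- g * k%:R - 2 * `|g|) <= (1 - cnorm (u : 'rV[C R]_d) ^+ 2) `^ g <= expR (- g * k%:R + 2 * `|g|).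
Proof.
move=> [u1 /andP[k1 k2]]; have u0 := cnorm_ge0 (u : 'rV[C R]_d).
set r := cnorm _ in u0 u1.
have q0 : 0 < 1 - r by rewrite subr_gt0.
have q1 : 0 < 1 + r by lra.
pose t := ln (1 - r ^+ 2) + k%:R.
have E : bd u = 2 * ln (1 + r) - ln (1 - r ^+ 2).
  rewrite /bd -/r ln_div ?posrE//.
  by rewrite (_ : 1 - r ^+ 2 = (1 - r) * (1 + r)) ?lnM ?posrE//; ring.
have l0 : 0 <= ln (1 + r) by rewrite ln_ge0// lerDl.
have l1 : ln (1 + r) <= 1.
  rewrite -[leRHS](expRK 1) ler_ln ?posrE ?expR_gt0//.
  by have := expR_ge1Dx (1 : R); lra.
have t2 : `|t| <= 2.
  rewrite ler_norml /t; move: k1 k2; rewrite E -natr1 => k1 k2; lra.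
have P : 0 < 1 - r ^+ 2 by rewrite (_ : _ - _ = (1 - r) * (1 + r)) ?mulr_gt0//; ring.
rewrite (_ : (1 - r ^+ 2) `^ g = expR (- g * k%:R + g * t)); last first.
  rewrite -[X in X `^ _](lnK P) -expRM /t; congr expR; ring.
rewrite !ler_expR !lerD2l -ler_norml normrM mulrC ler_wpM2r//.
Qed.

End Shells.

Section BergmanVolume.
Context {R : realType} {d : nat} (d0 : (0 < d)%N).
Local Notation V := (@Cvec R d).

Lemma integral_sh_le (f : V -> R) k (c : R) : 0 <= c -> measurable_fun [set: V] f ->
  (forall u, 0 <= f u) -> (forall u, sh k u -> f u <= c) ->
  (\int[vb d]_(u in sh k) (f u)%:E <= (c * ((d + d)%:R * 2 * expR (- k%:R)))%:E)%E.
Proof.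
move=> c0 mf f0 fc; have ms := @measurable_sh R d k.
apply: (@le_trans _ _ (\int[vb d]_(u in sh k) (cst c%:E u))%E).
  apply: ge0_le_integral => //.
  - by move=> u _; rewrite lee_fin.
  - by apply/measurable_EFinP; exact: measurable_funTS.
rewrite integral_cst// EFinM; apply: lee_wpmul2l; first by rewrite lee_fin.
exact: vb_sh_le.
Qed.

Lemma integral_sh_ge (f : V -> R) k (c : R) : 0 <= c -> measurable_fun [set: V] f ->
  (forall u, sh k u -> c <= f u) ->
  ((c * (rho 1 ^+ (d + d) / 4 * expR (- k%:R)))%:E <= \int[vb d]_(u in sh k) (f u)%:E)%E.
Proof.
move=> c0 mf fc; have ms := @measurable_sh R d k.
apply: (@le_trans _ _ (\int[vb d]_(u in sh k) (cst c%:E u))%E).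
  rewrite integral_cst// EFinM; apply: lee_wpmul2l; first by rewrite lee_fin.
  exact: vb_sh_ge.
apply: ge0_le_integral => //.
by apply/measurable_EFinP; exact: measurable_funTS.
Qed.

Variable (alpha : R) (alpha1 : -1 < alpha).

Lemma integral_wt_lty : (\int[vb d]_(y in [set: V]) (wt alpha y)%:E < +oo)%E.
Proof.
have mw := @measurable_wt R d alpha.
have -> : (\int[vb d]_(y in [set: V]) (wt alpha y)%:E =
    \int[vb d]_(y in \bigcup_k sh k) (wt alpha y)%:E)%E.
  rewrite [RHS]integral_mkcond; apply: eq_integral => y _; rewrite patchE sh_cover.
  case: ifPn => // /negP yb; rewrite wt_out//; apply/negP => y1; apply: yb.
  by rewrite inE.
rewrite ge0_integral_bigcup.
- pose q := expR (- (1 + alpha)).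
  have q1 : q < 1 by rewrite /q expR_lt1 oppr_lt0 -ltrBlDl sub0r.
  pose c := expR (2 * `|alpha|) * ((d + d)%:R * 2).
  apply: (@le_lt_trans _ _ (\sum_(0 <= k <oo) (c * q ^+ k)%:E)%E); last first.
    apply: le_lt_trans (nneseries_geometric _ (expR_ge0 _) q1) (ltry _).
    by rewrite mulr_ge0 ?expR_ge0// mulr_ge0.
  apply: lee_nneseries => [k _ _|k _].
    by apply: integral_ge0 => y _; rewrite lee_fin wt_ge0.
  have sc (u : V) : sh k u -> wt alpha u <= expR (- alpha * k%:R + 2 * `|alpha|).
    by move=> su; rewrite /wt (proj1 su); have /andP[] := sh_pow alpha su.
  apply: le_trans (integral_sh_le (expR_ge0 _) mw (@wt_ge0 _ _ alpha) sc) _.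
  rewrite lee_fin /c /q -expRM_natr expRD le_eqVlt; apply/orP; left; apply/eqP.
  rewrite (_ : - (1 + alpha) * k%:R = - alpha * k%:R + - k%:R); last by ring.
  by rewrite expRD; ring.
- exact: measurable_sh.
- by apply/measurable_EFinP; apply: measurable_funTS.
- by move=> y _; rewrite lee_fin wt_ge0.
- exact: sh_triv.
Qed.

Lemma integral_wt_gt0 : (0 < \int[vb d]_(y in [set: V]) (wt alpha y)%:E)%E.
Proof.
have mw := @measurable_wt R d alpha.
have sc (u : V) : sh 0 u -> expR (- alpha * 0%:R - 2 * `|alpha|) <= wt alpha u.
  by move=> su; rewrite /wt (proj1 su); have /andP[] := sh_pow alpha su.
apply: lt_le_trans (le_trans (integral_sh_ge (expR_ge0 _) mw sc) _).
  by rewrite lte_fin !mulr_gt0 ?expR_gt0 ?invr_gt0// exprn_gt0// rho_gt0.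
apply: ge0_subset_integral => //; first exact: measurable_sh.
  exact/measurable_EFinP.
by move=> y _; rewrite lee_fin wt_ge0.
Qed.

End BergmanVolume.

(** * The Bergman kernel: reproducing property and completeness *)

Section Kernel.
Context {R : realType} {d : nat} (d0 : (0 < d)%N) (alpha : R) (alpha1 : -1 < alpha).
Local Notation V := (@Cvec R d).
Local Notation a := (d%:R + 1 + alpha).
Local Notation K := (bergman_kernel alpha).
Implicit Types f g : 'rV[C R]_d -> C R.

Let W : R := \int[vb d]_y wt alpha y.
Local Notation bc := (@bergman_const R d alpha).

Let W_E : (\int[vb d]_(y in [set: V]) (wt alpha y)%:E = W%:E)%E.
Proof.
rewrite /W /Rintegral fineK// ge0_fin_numE ?integral_wt_lty//.
by apply: integral_ge0 => y _; rewrite lee_fin wt_ge0.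
Qed.

Let W0 : 0 < W.
Proof. by rewrite -lte_fin -W_E; exact: integral_wt_gt0. Qed.

Lemma bergman_constE : bc = W^-1.
Proof.
rewrite /bergman_const /W /Rintegral; congr (fine _)^-1.
rewrite -[LHS]/(\int[vb d]_(z in (uball R d : set V)) ((1 - cnorm (z : 'rV[C R]_d) ^+ 2) `^ alpha)%:E)%E.
rewrite [LHS]integral_mkcond; apply: eq_integral => y _; rewrite patchE /wt.
case: ifPn => y1; first by move: y1; rewrite inE /uball /= => ->.
by rewrite ifN //; move: y1; apply: contra => y1; rewrite inE.
Qed.

Lemma bergman_const_gt0 : 0 < bc. Proof. by rewrite bergman_constE invr_gt0. Qed.

Lemma kexp_gt0 : 0 < a.
Proof.
have a1 : 0 < 1 + alpha by rewrite -ltrBlDl sub0r.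
by rewrite -addrA ltr_wpDl.
Qed.

Lemma cRe_1B_gt0 (y x : 'rV[C R]_d) : cnorm y < 1 -> cnorm x < 1 ->
  0 < cRe (1 - cdot y (conjv x)).
Proof.
move=> y1 x1; apply: lt_le_trans (cRe_1B_ge _ _); rewrite subr_gt0.
by apply: mulr_ilt1; rewrite ?cnorm_ge0.
Qed.

Lemma kernel_conj (x y : 'rV[C R]_d) : cnorm x < 1 -> cnorm y < 1 -> K x y = (K y x)^*.
Proof.
move=> x1 y1; rewrite /bergman_kernel.
have -> : 1 - cdot x (conjv y) = (1 - cdot y (conjv x))^*.
  by rewrite conjB conjC1 conj_cdot.
by rewrite cpow_conj ?cRe_1B_gt0// conjM conjV toC_conj.
Qed.

Lemma kernel_cpow (x y : 'rV[C R]_d) : cnorm x < 1 -> cnorm y < 1 ->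
  K y x = toC bc * cpow (1 - cdot y (conjv x)) (- a).
Proof. by move=> x1 y1; rewrite /bergman_kernel cpowN// cRe_1B_gt0. Qed.

Lemma eq_holo f g : (forall z, cnorm z < 1 -> f z = g z) -> holo f -> holo g.
Proof.
move=> fg hf z z1; have [D HD] := hf z z1; exists D => e e0.
have [r r0 Hr] := HD e e0; exists (Num.min r (1 - cnorm z)).
  by rewrite lt_min r0 subr_gt0.
move=> h; rewrite lt_min => /andP[h1 h2]; rewrite -!fg//; first exact: Hr.
by have := cnormD z h; lra.
Qed.

Lemma holo_kernel (x : 'rV[C R]_d) : cnorm x < 1 -> holo (K ^~ x).
Proof.
move=> x1; apply: eq_holo (holoM (holo_cst (toC bc)) (holo_cpow (- a) x1)) => z z1.
by rewrite kernel_cpow.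
Qed.

Lemma kernel_bound (x y : 'rV[C R]_d) : cnorm x < 1 -> cnorm y < 1 ->
  cabs (K y x) <= bc / (1 - cnorm x) `^ a.
Proof.
move=> x1 y1; rewrite /bergman_kernel cabs_div cabs_toC gtr0_norm ?bergman_const_gt0//.
have q0 : 0 < 1 - cnorm x by rewrite subr_gt0.
rewrite ler_pM2l ?bergman_const_gt0// cabs_cpow.
have H : 1 - cnorm x <= cabs (1 - cdot y (conjv x)).
  apply: le_trans (le_trans (ler_norm _) (ler_cRe _)).
  by apply: le_trans (cRe_1B_ge _ _); have := cnorm_ge0 x; nra.
rewrite lef_pV2 ?posrE ?powR_gt0//; last exact: lt_le_trans H.
by rewrite ge0_ler_powR ?nnegrE ?cabs_ge0 ?(ltW kexp_gt0)// ltW.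
Qed.

Lemma sqnorm_bound f (M : R) : bmeas f -> (forall y, cnorm y < 1 -> cabs (f y) <= M) ->
  (sqnorm alpha f < +oo)%E.
Proof.
move=> mf fM; have mw := @measurable_wt R d alpha.
apply: (@le_lt_trans _ _ (\int[vb d]_y ((M ^+ 2)%:E * (wt alpha y)%:E))%E).
  apply: ge0_le_integral => //.
  - by move=> y _; rewrite lee_fin mulr_ge0 ?sqr_ge0 ?wt_ge0.
  - exact: measurable_sqwt.
  - by apply: emeasurable_funM => //; exact/measurable_EFinP.
  move=> y _; rewrite -EFinM lee_fin.
  have [y1|y1] := boolP (cnorm (y : 'rV[C R]_d) < 1); last by rewrite wt_out// !mulr0.
  rewrite ler_wpM2r ?wt_ge0// lerXn2r ?nnegrE ?cabs_ge0 ?fM//.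
  exact: le_trans (cabs_ge0 _) (fM _ y1).
rewrite ge0_integralZl_EFin ?sqr_ge0//; last exact/measurable_EFinP.
- by rewrite [X in (_ * X)%E]W_E ltry.
- by move=> y _; rewrite lee_fin wt_ge0.
Qed.

Lemma bmeas_kernel (x : 'rV[C R]_d) : cnorm x < 1 -> bmeas (K ^~ x).
Proof. by move=> x1; exact/bmeas_holo/holo_kernel. Qed.

Lemma sqnorm_kernel_lty (x : 'rV[C R]_d) : cnorm x < 1 -> (sqnorm alpha (K ^~ x) < +oo)%E.
Proof.
move=> x1; apply: sqnorm_bound (bmeas_kernel x1) _ => y y1.
exact: kernel_bound.
Qed.

Lemma cpow_toC (r b : R) : 0 < r -> cpow (toC r) b = toC (r `^ b).
Proof.
by move=> r0; rewrite cpow_pos// /cIm /= mul0r atan0 mulr0 cis0 mulr1 cabs_toC gtr0_norm.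
Qed.

(** After the change of variables by [mobius z], the integrand is a radial
    weight times a holomorphic function. *)
Theorem reproducing f (z : 'rV[C R]_d) : holo f -> (sqnorm alpha f < +oo)%E -> cnorm z < 1 ->
  ip alpha f (K ^~ z) = f z.
Proof.
move=> hf ff z1; have z2 : 0 < 1 - cnorm z ^+ 2 by rewrite lt1_sqr ?cnorm_ge0.
pose c : R := bc / (1 - cnorm z ^+ 2) `^ a.
pose H y := toC c * (f y * cpow (1 - cdot y (conjv z)) a).
have hH : holo H by apply: holoM (holo_cst _) _; apply: holoM hf (holo_cpow a z1).
pose G (u : V) : R := if cnorm (u : 'rV[C R]_d) < 1 then (1 - cnorm (u : 'rV[C R]_d) ^+ 2) `^ a else 0.
have G0 x : 0 <= G x by rewrite /G; case: ifP => // _; exact: powR_ge0.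
have mG : measurable_fun [set: V] G.
  apply: measurable_fun_ifT.
  - by apply: measurable_lt_fun; [exact: measurable_cnorm|exact: measurable_cst].
  - apply: measurable_powRc; apply: measurable_funB; first exact: measurable_cst.
    by apply: measurable_funX; exact: measurable_cnorm.
  - exact: measurable_cst.
have Grot b (x : V) : cabs b = 1 -> G (b *: (x : 'rV[C R]_d)) = G x.
  by move=> b1; rewrite /G cnormZ b1 mul1r.
have GJ (u : V) : cnorm (u : 'rV[C R]_d) < 1 -> G u * jac u = wt alpha u.
  move=> u1; rewrite /G /jac /wt u1.
  have u2 : 0 < 1 - cnorm (u : 'rV[C R]_d) ^+ 2 by rewrite lt1_sqr ?cnorm_ge0.
  rewrite (_ : a = alpha + d.+1%:R); last by rewrite -natr1; ring.
  rewrite powRD; last by apply/implyP => _; rewrite gt_eqF.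
  by rewrite powR_mulrn ?(ltW u2)// exprVn mulfK// expf_neq0// gt_eqF.
have GJ' u : G u * jac u = wt alpha u.
  have [|u1] := boolP (cnorm (u : 'rV[C R]_d) < 1); first exact: GJ.
  by rewrite wt_out// /jac (negbTE u1) mulr0.
have intG : (\int[vb d]_u (G u * jac u)%:E < +oo)%E.
  by under eq_integral do rewrite GJ'; exact: integral_wt_lty.
have E y : on_ball f y * (on_ball (K ^~ z) y)^* * toC (wt alpha y) =
    on_ball H y * toC (G (mobius z y) * jac y).
  rewrite /on_ball; case: ifPn => y1; last by rewrite !mul0r.
  have m1 := mobius_lt1 z1 y1; have y2 : 0 < 1 - cnorm y ^+ 2 by rewrite lt1_sqr ?cnorm_ge0.
  set q := 1 - cdot y (conjv z).
  have q0 : 0 < cRe q by exact: cRe_1B_gt0.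
  have qa : 0 < cabs q by rewrite cabs_gt0 cRe_gt0_neq0.
  have gE : G (mobius z y) = (1 - cnorm z ^+ 2) `^ a * G y / cabs q `^ a ^+ 2.
    rewrite /G m1 y1 mobius_ball// powRM ?mulr_ge0 ?(ltW z2) ?(ltW y2) ?invr_ge0 ?sqr_ge0//.
    rewrite powRM ?(ltW z2) ?(ltW y2)//; congr (_ * _).
    rewrite -powR_inv1 ?sqr_ge0// -powRrM mulrC powRrM powR_inv1 ?powR_ge0//; congr _^-1.
    by rewrite -powR_mulrn ?cabs_ge0// -powRrM mulrC powRrM powR_mulrn ?powR_ge0.
  rewrite -(GJ _ y1) gE /H -/q /bergman_kernel -/q conjM conjV toC_conj -cpow_conj//.
  rewrite inv_cpow_conj// /c.
  have : toC ((1 - cnorm z ^+ 2) `^ a) != 0 by rewrite toC_eq0 gt_eqF// powR_gt0.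
  have : toC (cabs q `^ a ^+ 2) != 0 by rewrite toC_eq0 gt_eqF// exprn_gt0// powR_gt0.
  move: (cpow q a) (cabs q `^ a ^+ 2) ((1 - cnorm z ^+ 2) `^ a) bc (jac y) (G y) (f y).
  by move=> X Q P b J g fy n1 n2; rewrite !toCM !toCV; field; apply/andP.
have iH : (\int[vb d]_x (cabs (on_ball H x) * (G (mobius z x) * jac x))%:E < +oo)%E.
  have [_ ] := ip_integrable (bmeas_holo hf) (bmeas_kernel z1) ff (sqnorm_kernel_lty z1).
  congr (_ < _)%E; apply: eq_integral => x _; rewrite E cabsM cabs_toC ger0_norm//.
  by rewrite mulr_ge0 ?jac_ge0.
have := mobius_mean z1 G0 mG Grot intG hH iH.
rewrite /ip => M; transitivity (H z * toC (\int[vb d]_u (G u * jac u))).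
  by rewrite -M; congr cint; apply/funext => y; exact: E.
under eq_Rintegral do rewrite GJ'.
rewrite -/W /H /c cdot_conj -toC1 -toCB cpow_toC// bergman_constE.
have : toC ((1 - cnorm z ^+ 2) `^ a) != 0 by rewrite toC_eq0 gt_eqF// powR_gt0.
have : toC W != 0 by rewrite toC_eq0 gt_eqF.
move: (f z) W ((1 - cnorm z ^+ 2) `^ a) => fz W1 P n1 n2.
by rewrite !toCM !toCV; field; apply/andP.
Qed.

Lemma ip_self f : bmeas f -> (sqnorm alpha f < +oo)%E -> sqnorm alpha f = (cRe (ip alpha f f))%:E.
Proof.
move=> mf ff; rewrite /ip /cint [cRe _]/= /Rintegral.
have -> : (\int[vb d]_y (cRe (on_ball f y * (on_ball f y)^* * toC (wt alpha y)))%:E = sqnorm alpha f)%E.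
  rewrite -sqnorm_on_ball; apply: eq_integral => y _.
  by rewrite mul_conj -toCM.
by rewrite fineK// ge0_fin_numE ?sqnorm_ge0.
Qed.

Lemma sqnorm_kernel (x : 'rV[C R]_d) : cnorm x < 1 ->
  sqnorm alpha (K ^~ x) = (bc / (1 - cnorm x ^+ 2) `^ a)%:E.
Proof.
move=> x1; have kf := sqnorm_kernel_lty x1.
rewrite ip_self//; last exact: bmeas_kernel.
rewrite reproducing//; last exact: holo_kernel.
rewrite /bergman_kernel cdot_conj -toC1 -toCB cpow_toC ?lt1_sqr ?cnorm_ge0//.
by rewrite -toCV -toCM.
Qed.

Lemma ipBl f g h : bmeas f -> bmeas g -> bmeas h -> (sqnorm alpha f < +oo)%E ->
  (sqnorm alpha g < +oo)%E -> (sqnorm alpha h < +oo)%E ->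
  ip alpha (fun y => f y - g y) h = ip alpha f h - ip alpha g h.
Proof.
move=> mf mg mh ff fg fh; rewrite /ip -cintB; [|exact: ip_integrable..].
congr cint; apply/funext => y; rewrite /on_ball; case: ifP => _; last by ring.
by ring.
Qed.

Lemma eval_bound f (y : 'rV[C R]_d) : holo f -> (sqnorm alpha f < +oo)%E -> cnorm y < 1 ->
  cabs (f y) <= nrm alpha f * nrm alpha (K ^~ y).
Proof.
move=> hf ff y1; rewrite -{1}(reproducing hf ff y1).
by apply: cauchy_schwarz_ip => //; [exact: bmeas_holo|exact: bmeas_kernel|exact: sqnorm_kernel_lty].
Qed.

(** Differentiation under the integral sign. *)
Lemma holo_of_reproducing f : bmeas f -> (sqnorm alpha f < +oo)%E ->
  (forall y, cnorm y < 1 -> f y = ip alpha f (K ^~ y)) -> holo f.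
Proof.
move=> mf ff rf y y1.
have one1 : bmeas (fun _ : 'rV[C R]_d => 1 : C R) by exact/bmeas_holo/holo_cst.
have one2 : (sqnorm alpha (fun _ : 'rV[C R]_d => 1%R : C R) < +oo)%E.
  by apply: (@sqnorm_bound _ 1) => // z _; rewrite cabs1.
pose F (u : V) : C R := on_ball f u * toC (bc * wt alpha u).
have iF : cintegrable (vb d) F.
  have := cintegrableZ (toC bc) (ip_integrable mf one1 ff one2).
  congr cintegrable; apply/funext => u; rewrite /F /on_ball.
  by case: ifP => _; rewrite ?mul0r ?mulr0// conjC1 mulr1 toCM; ring.
have fE z : cnorm z < 1 -> f z = cint (vb d) (fun u : V => F u * cpow (1 - cdot z (conjv u)) (- a)).
  move=> z1; rewrite rf//; congr cint; apply/funext => u; rewrite /F /on_ball.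
  case: ifPn => u1; last by rewrite !mul0r.
  by rewrite -kernel_conj// kernel_cpow// toCM; ring.
have iFz z : cnorm z < 1 -> cintegrable (vb d) (fun u : V => F u * cpow (1 - cdot z (conjv u)) (- a)).
  move=> z1; have := ip_integrable mf (bmeas_kernel z1) ff (sqnorm_kernel_lty z1).
  congr cintegrable; apply/funext => u; rewrite /F /on_ball.
  case: ifPn => u1; last by rewrite !mul0r.
  by rewrite -kernel_conj// kernel_cpow// toCM; ring.
pose c (u : V) : C R := - toC (- a) * cpow (1 - cdot y (conjv u)) (- a - 1).
pose dl := (1 - cnorm y) / 2; have dl0 : 0 < dl by rewrite divr_gt0// subr_gt0.
have [M M0 HM] := @cpow_cdot_taylor R d (- a) dl dl0.
have cF : cmeas F by case: iF.
pose B := `|a| / (1 - cnorm y) `^ (a + 1).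
have cE (u : V) : cnorm (u : 'rV[C R]_d) < 1 ->
    c u = toC a * (cpow (1 - cdot (u : 'rV[C R]_d) (conjv y)) (- a - 1))^*.
  move=> u1; rewrite -cpow_conj ?cRe_1B_gt0// conjB conjC1 conj_cdot.
  by rewrite /c toCN opprK.
have cB (u : V) : cnorm (u : 'rV[C R]_d) < 1 -> cabs (c u) <= B.
  move=> u1; rewrite cE// cabsM cabsJ cabs_toC ler_wpM2l// cabs_cpow.
  have q0 : 0 < 1 - cnorm y by rewrite subr_gt0.
  have H : 1 - cnorm y <= cabs (1 - cdot (u : 'rV[C R]_d) (conjv y)).
    apply: le_trans (le_trans (ler_norm _) (ler_cRe _)).
    by apply: le_trans (cRe_1B_ge _ _); have := cnorm_ge0 y; nra.
  rewrite -opprD powRN lef_pV2 ?posrE ?powR_gt0//; last exact: lt_le_trans H.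
  have a1 : 0 <= a + 1 by rewrite addr_ge0// ltW// kexp_gt0.
  by rewrite ge0_ler_powR ?nnegrE ?cabs_ge0// ltW.
pose Fj j (u : V) : C R := F u * (c u * conjv (u : 'rV[C R]_d) ord0 j).
have iFj j : cintegrable (vb d) (Fj j).
  have mF : cmeas (fun u : V => F u * (on_ball (fun u => toC a *
      (cpow (1 - cdot u (conjv y)) (- a - 1))^* ) u * (conjv (u : 'rV[C R]_d) ord0 j))).
    apply: cmeasM => //; apply: cmeasM.
      rewrite on_ballZ; apply: cmeasM; first exact: cmeas_cst.
      rewrite (_ : on_ball _ = fun u => (on_ball (fun u => cpow (1 - cdot u (conjv y)) (- a - 1)) u)^*).
        exact/cmeasJ/on_ball_cmeas/holo_cpow.
      by apply/funext => u; rewrite /on_ball; case: ifP => // _; rewrite conjC0.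
    under eq_fun do rewrite mxE; apply: cmeasJ.
    exact: (cmeas_coord j (@measurable_id _ V setT)).
  apply: (@cintegrable_le _ _ _ _ _ (fun u => B * cabs (F u))).
  - move: mF; congr cmeas; apply/funext => u; rewrite /Fj /on_ball.
    case: ifPn => u1; first by rewrite cE.
    by rewrite /F /on_ball (negbTE u1) !mul0r.
  - move=> u; have [u1|u1] := boolP (cnorm (u : 'rV[C R]_d) < 1); last first.
      by rewrite /Fj /F /on_ball (negbTE u1) !mul0r cabs0 mulr0.
    rewrite /Fj cabsM mulrC ler_wpM2r ?cabs_ge0// cabsM -[leRHS]mulr1.
    apply: ler_pM; rewrite ?cabs_ge0 ?cB// mxE cabsJ.
    by apply: le_trans (cabs_coord _ _) _; exact: ltW.
  - by apply: measurable_funM; [exact: measurable_cst|exact: measurable_cabs].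
  - under eq_integral do rewrite EFinM.
    have B0 : 0 <= B by rewrite divr_ge0 ?powR_ge0.
    rewrite ge0_integralZl_EFin//.
    + by rewrite lte_mul_pinfty ?lee_fin//; case: iF.
    + by move=> u _; rewrite lee_fin cabs_ge0.
    + by apply/measurable_EFinP; exact: measurable_cabs.
exists (\row_j cint (vb d) (Fj j)) => e e0.
pose I := fine (\int[vb d]_u (cabs (F u))%:E).
have IE : (\int[vb d]_u (cabs (F u))%:E = I%:E)%E.
  rewrite /I fineK// ge0_fin_numE; first by case: iF.
  by apply: integral_ge0 => u _; rewrite lee_fin cabs_ge0.
have I0 : 0 <= I by rewrite -lee_fin -IE; apply: integral_ge0 => u _; rewrite lee_fin cabs_ge0.
exists (Num.min dl (e / (M * I + 1))).
  by rewrite lt_min dl0 divr_gt0// ltr_wpDl// mulr_ge0.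
move=> h; rewrite lt_min => /andP[h1 h2].
have yh1 : cnorm (y + h) < 1 - dl.
  apply: le_lt_trans (cnormD _ _) _; move: h1; rewrite /dl; lra.
have yh2 : cnorm (y + h) < 1 by lra.
have yl : cnorm y <= 1 - dl by rewrite /dl; lra.
have [iS SE] := cint_sum (index_enum 'I_d) (fun j => h ord0 j) iFj.
have dE : cdot h (\row_j cint (vb d) (Fj j)) = cint (vb d) (fun u => \sum_j h ord0 j * Fj j u).
  by rewrite SE /cdot; apply: eq_bigr => j _; rewrite mxE.
rewrite (fE _ yh2) (fE _ y1) dE -cintB; [|exact: iFz..].
have iB := cintegrableD (iFz _ yh2) (cintegrableZ (-1) (iFz _ y1)).
have iB' : cintegrable (vb d) (fun u : V => F u * cpow (1 - cdot (y + h) (conjv u)) (- a)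
    - F u * cpow (1 - cdot y (conjv u)) (- a)).
  by move: iB; congr cintegrable; apply/funext => u; rewrite mulN1r.
rewrite -cintB// -lee_fin.
have iD := cintegrableD iB' (cintegrableZ (-1) iS).
have iD' : cintegrable (vb d) (fun u : V => F u * cpow (1 - cdot (y + h) (conjv u)) (- a)
    - F u * cpow (1 - cdot y (conjv u)) (- a) - \sum_j h ord0 j * Fj j u).
  by move: iD; congr cintegrable; apply/funext => u; rewrite mulN1r.
apply: le_trans (cabs_cint iD') _.
apply: (@le_trans _ _ (\int[vb d]_u ((M * cnorm h ^+ 2)%:E * (cabs (F u))%:E))%E).
  apply: ge0_le_integral => //.
  - by move=> u _; rewrite lee_fin cabs_ge0.
  - by apply/measurable_EFinP; apply: measurable_cabs; case: iD'.
  - by apply: emeasurable_funM => //; apply/measurable_EFinP; exact: measurable_cabs.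
  move=> u _; rewrite -EFinM lee_fin.
  have [u1|u1] := boolP (cnorm (u : 'rV[C R]_d) < 1); last first.
    have F0 : F u = 0 by rewrite /F /on_ball (negbTE u1) mul0r.
    rewrite F0 !mul0r subrr sub0r cabsN cabs0 mulr0 big1 ?cabs0// => j _.
    by rewrite /Fj F0 mul0r mulr0.
  have -> : F u * cpow (1 - cdot (y + h) (conjv u)) (- a) - F u * cpow (1 - cdot y (conjv u)) (- a)
      - \sum_j h ord0 j * Fj j u = F u * (cpow (1 - cdot (y + h) (conjv u)) (- a)
      - cpow (1 - cdot y (conjv u)) (- a) - cdot h (c u *: conjv u)).
    rewrite !mulrBr /cdot mulr_sumr; congr (_ - _); apply: eq_bigr => j _.
    by rewrite /Fj !mxE mulrCA.
  rewrite cabsM mulrC ler_wpM2r ?cabs_ge0//.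
  have cu := ltW u1; have u0 := cnorm_ge0 (u : 'rV[C R]_d).
  apply: HM => //; [exact: ltW|exact: ltW| |].
    by have := cnorm_ge0 y; nra.
  by have := cnorm_ge0 (y + h); nra.
rewrite ge0_integralZl_EFin ?(mulr_ge0 M0 (sqr_ge0 _))//; last 2 first.
- by move=> u _; rewrite lee_fin cabs_ge0.
- by apply/measurable_EFinP; exact: measurable_cabs.
rewrite [X in (_ * X)%E]IE -EFinM lee_fin.
move: h2; rewrite ltr_pdivlMr ?ltr_wpDl ?mulr_ge0// => h2.
rewrite expr2 mulrA mulrAC ler_wpM2r ?cnorm_ge0//.
by have := cnorm_ge0 h; lra.
Qed.

End Kernel.

Section Completeness.
Context {R : realType}.

Lemma limn_einf_le (u : nat -> \bar R) (c : \bar R) : (forall n, (u n <= c)%E) ->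
  (limn_einf u <= c)%E.
Proof.
move=> uc; rewrite limn_einf_lim; apply: lime_le; first exact: is_cvg_einfs.
apply: nearW => n; apply: le_trans (uc n).
by apply: ereal_inf_lbound; exists n => //=.
Qed.

Lemma nneseries_term_lty (u : nat -> \bar R) : (forall k, (0 <= u k)%E) ->
  (\sum_(0 <= k <oo) u k < +oo)%E -> forall n, (u n < +oo)%E.
Proof.
move=> u0 us n; apply: le_lt_trans us.
apply: le_trans (nneseries_lim_ge n.+1 (fun k _ _ => u0 k)).
rewrite big_nat_recr//= leeDr//; apply: sume_ge0 => k _; exact: u0.
Qed.

Lemma cseries_cvg (u : nat -> C R) : (\sum_(0 <= k <oo) (cabs (u k))%:E < +oo)%E ->
  exists l : C R, (fun N : nat => \sum_(k < N) u k) @ \oo --> l.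
Proof.
move=> us.
have key (g : C R -> R) : (forall z, `|g z| <= cabs z) -> cvgn (series (g \o u)).
  move=> gz; apply: normed_cvg; apply: nnseries_is_cvg => [k|]; first by rewrite normr_ge0.
  apply: le_lt_trans us; apply: lee_nneseries => [k _ _|k _].
    by rewrite lee_fin normr_ge0.
  by rewrite lee_fin gz.
have /cvg_ex[a /cvgrPdist_lt Ha] := key cRe (@ler_cRe R).
have /cvg_ex[b /cvgrPdist_lt Hb] := key cIm (@ler_cIm R).
exists (Complex a b); apply/cvg_cabsP => e e0.
have e2 : 0 < e / 2 by rewrite divr_gt0.
near=> N.
have h1 : `|a - series (cRe \o u) N| < e / 2 by near: N; exact: Ha.
have h2 : `|b - series (cIm \o u) N| < e / 2 by near: N; exact: Hb.
apply: le_lt_trans (cabs_le _) _; rewrite cReD cReN cImD cImN cRe_sum cIm_sum.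
rewrite distrC [X in _ + X]distrC.
move: h1 h2; rewrite /series /= !big_mkord; rewrite /cRe /cIm /=; lra.
Unshelve. all: by end_near.
Qed.

Context {d : nat}.
Local Notation V := (@Cvec R d).
Variable alpha : R.
Local Notation sqn := (sqnorm alpha).
Local Notation nr := (nrm alpha).
Implicit Types f g : 'rV[C R]_d -> C R.

Lemma bmeas_lim (F : nat -> 'rV[C R]_d -> C R) f : (forall n, bmeas (F n)) ->
  (forall y, cnorm y < 1 -> F ^~ y @ \oo --> f y) -> bmeas f.
Proof.
move=> mF cF.
have key (g : C R -> R) : (forall a b, `|g a - g b| <= cabs (a - b)) ->
    forall y, (fun n => g (on_ball (F n) y)) @ \oo --> g (on_ball f y).
  move=> gl y; rewrite /on_ball; case: ifPn => y1; last exact: cvg_cst.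
  apply/cvgrPdist_lt => e e0; have /cvg_cabsP /(_ e e0) := cF y y1.
  by apply: filterS => n h; rewrite distrC; apply: le_lt_trans (gl _ _) h.
split.
  apply: (@measurable_fun_cvg _ V R setT (fun n (y : V) => cRe (on_ball (F n) y)) (fun y : V => cRe (on_ball f y))).
    by move=> n; case: (mF n).
  by move=> y _; apply: key => a b; rewrite -cReN -cReD ler_cRe.
apply: (@measurable_fun_cvg _ V R setT (fun n (y : V) => cIm (on_ball (F n) y)) (fun y : V => cIm (on_ball f y))).
  by move=> n; case: (mF n).
by move=> y _; apply: key => a b; rewrite -cImN -cImD ler_cIm.
Qed.

Lemma sqnorm_fatou (F : nat -> 'rV[C R]_d -> C R) f : (forall n, bmeas (F n)) ->
  (forall y, cnorm y < 1 -> F ^~ y @ \oo --> f y) ->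
  (sqn f <= limn_einf (fun n => sqn (F n)))%E.
Proof.
move=> mF cF; rewrite /sqnorm.
have lim y : (fun n => (cabs (F n y) ^+ 2 * wt alpha y)%:E) @ \oo -->
    (cabs (f y) ^+ 2 * wt alpha y)%:E.
  have [y1|y1] := boolP (cnorm y < 1); last first.
    rewrite (_ : (fun n => _) = cst (cabs (f y) ^+ 2 * wt alpha y)%:E); first exact: cvg_cst.
    by apply/funext => n; rewrite wt_out// !mulr0.
  apply: cvg_EFin; first by apply: nearW.
  apply: cvgM; last exact: cvg_cst.
  have c1 : (fun n => cabs (F n y)) @ \oo --> cabs (f y).
    apply/cvgrPdist_lt => e e0; have /cvg_cabsP /(_ e e0) := cF y y1.
    apply: filterS => n h; apply: le_lt_trans h; rewrite ler_norml.
    have := ler_cabsB (f y) (F n y); rewrite cabsBC => h1.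
    by have := ler_cabsB (F n y) (f y); lra.
  rewrite (_ : (fun n => _) = (fun n => cabs (F n y) * cabs (F n y))); last first.
    by apply/funext => n; rewrite expr2.
  by rewrite expr2; exact: cvgM.
rewrite (_ : (\int[vb d]_y _ = \int[vb d]_y
    limn_einf (fun n => (cabs (F n y) ^+ 2 * wt alpha y)%:E))%E); last first.
  apply: eq_integral => y _; have cy := lim y.
  by rewrite is_cvg_limn_einfE ?(cvg_lim _ cy)//; exact: cvgP cy.
apply: fatou => // [n|n y _]; first exact: measurable_sqwt.
by rewrite lee_fin mulr_ge0 ?sqr_ge0 ?wt_ge0.
Qed.

Lemma nrm_sum I (r : seq I) (F : I -> 'rV[C R]_d -> C R) : (forall i, bmeas (F i)) ->
  (forall i, sqn (F i) < +oo)%E ->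
  (sqn (fun y => (\sum_(i <- r) F i y)%R) < +oo)%E /\
  nr (fun y => \sum_(i <- r) F i y) <= \sum_(i <- r) nr (F i).
Proof.
move=> mF fF; elim: r => [|i r [IH1 IH2]].
  have z : sqn (fun y => (\sum_(i <- [::]) F i y)%R) = 0%E.
    by apply: integral0_eq => y _; rewrite big_nil cabs0 expr0n mul0r.
  by rewrite big_nil z; split; [exact: ltry|rewrite /nrm z sqrtr0].
have -> : (fun y => \sum_(j <- i :: r) F j y) = (fun y => F i y + \sum_(j <- r) F j y).
  by apply/funext => y; rewrite big_cons.
have ms := bmeas_sum r mF.
split; first exact: sqnormD_lty.
by rewrite big_cons; apply: le_trans (nrmD _ _ _ _) _ => //; rewrite lerD2l.
Qed.

Hypotheses (d0 : (0 < d)%N) (alpha1 : -1 < alpha).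

(** An absolutely convergent series converges, because the point evaluations are
    bounded; the limit is holomorphic since it inherits the reproducing formula. *)
Theorem A2_complete (u : nat -> 'rV[C R]_d -> C R) : (forall k, holo (u k)) ->
  (\sum_(0 <= k <oo) A2norm alpha (u k) < +oo)%E -> exists S, A2_series alpha u S.
Proof.
move=> hu us.
have mu k : bmeas (u k) by exact: bmeas_holo.
have fu k : (sqn (u k) < +oo)%E.
  by rewrite -A2norm_lty; apply: nneseries_term_lty us k => n; exact: sqrte_ge0.
have {}us : (\sum_(0 <= k <oo) (nr (u k))%:E < +oo)%E.
  by move: us; congr (_ < _)%E; apply: eq_eseriesr => k _; rewrite A2norm_nrm.
have n0 k : (0 <= (nr (u k))%:E)%E by rewrite lee_fin nrm_ge0.
have pw y : cnorm y < 1 -> exists l : C R, (fun N : nat => \sum_(k < N) u k y) @ \oo --> l.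
  move=> y1; apply: (cseries_cvg (u := fun k => u k y)).
  pose B := nr ((bergman_kernel alpha) ^~ y).
  apply: (@le_lt_trans _ _ (\sum_(0 <= k <oo) (B%:E * (nr (u k))%:E))%E).
    apply: lee_nneseries => k _; first by rewrite lee_fin cabs_ge0.
    by rewrite -EFinM lee_fin mulrC; exact: eval_bound.
  by rewrite nneseriesZl// lte_mul_pinfty// lee_fin nrm_ge0.
pose S y := if pselect (cnorm y < 1) is left y1 then projT1 (cid (pw y y1)) else 0.
have SE y : cnorm y < 1 -> (fun N : nat => \sum_(k < N) u k y) @ \oo --> S y.
  by rewrite /S => y1; case: pselect => // y1'; case: (cid _).
pose T N y := \sum_(k < N) u k y.
have mT N : bmeas (T N) by exact: bmeas_sum.
have fT N : (sqn (T N) < +oo)%E by have [] := nrm_sum (index_enum 'I_N) (fun i => mu i) (fun i => fu i).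
have mS : bmeas S := bmeas_lim mT SE.
pose tl N := fine (\sum_(N <= k <oo) (nr (u k))%:E)%E.
have tlE N : (\sum_(N <= k <oo) (nr (u k))%:E = (tl N)%:E)%E.
  rewrite /tl fineK// ge0_fin_numE; last by apply: nneseries_ge0.
  apply: le_lt_trans us; rewrite [leRHS](nneseries_split 0 N)// leeDr//.
  by apply: sume_ge0.
have tl0 N : 0 <= tl N by rewrite -lee_fin -tlE; apply: nneseries_ge0.
have tlc : tl @ \oo --> 0.
  have := nneseries_tail_cvg us (fun k _ => n0 k).
  by rewrite (_ : (fun N : nat => _) = EFin \o tl); [move=> /fine_cvgP[]|apply/funext => N; exact: tlE].
have bnd N : (sqn (fun y => (T N y - S y)%R) <= (tl N ^+ 2)%:E)%E.
  pose F M y := \sum_(N <= k < N + M) (- 1) * u k y.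
  have mz k : bmeas (fun y => (- 1) * u k y) by exact: bmeasZ.
  have fz k : (sqn (fun y => (- 1 * u k y)%R) < +oo)%E.
    by rewrite sqnormZ// cabsN cabs1 expr1n mul1e.
  have mF M : bmeas (F M) by exact: bmeas_sum.
  have cF y : cnorm y < 1 -> F ^~ y @ \oo --> T N y - S y.
    move=> y1; have FE M : F M y = T N y - T (N + M)%N y.
      rewrite /F /T -mulr_sumr mulN1r -!(big_mkord xpredT (fun k => u k y)).
      by rewrite [in X in _ = _ - X](@big_cat_nat _ _ _ N)//= ?leq_addr//; ring.
    apply/cvg_cabsP => e e0; have /cvg_cabsP /(_ e e0) [M0 _ HM] := SE y y1.
    exists M0 => // M /= hM; rewrite FE (_ : _ - _ = - (T (N + M)%N y - S y)); last by ring.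
    by rewrite cabsN; apply: HM; rewrite /= (leq_trans hM)// leq_addl.
  apply: le_trans (sqnorm_fatou mF cF) _; apply: limn_einf_le => M.
  have [f1 f2] := nrm_sum (index_iota N (N + M)) mz fz.
  rewrite /F (sqnormE f1) lee_fin ler_sqr ?nnegrE ?nrm_ge0//.
  apply: le_trans f2 _; rewrite -lee_fin -tlE -sumEFin.
  apply: le_trans (nneseries_lim_ge (N + M) (fun k _ _ => n0 k)).
  rewrite le_eqVlt; apply/orP; left; apply/eqP; apply: eq_bigr => k _.
  by rewrite /nrm sqnormZ// cabsN cabs1 expr1n mul1e.
have bnd' N : (sqn (fun y => (T N y - S y)%R) < +oo)%E.
  by apply: le_lt_trans (bnd N) (ltry _).
have fS : (sqn S < +oo)%E.
  have := sqnormD_lty (mT 0%N) (bmeasZ (-1) (bmeasB (mT 0%N) mS)) (fT 0%N).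
  rewrite sqnormZ ?cabsN ?cabs1 ?expr1n ?mul1e; last exact: bmeasB.
  move=> /(_ (bnd' 0%N)); congr (sqnorm _ _ < _)%E; apply/funext => y; ring.
have hT N : holo (T N) by exact: holo_sum.
have rS y : cnorm y < 1 -> S y = ip alpha S ((bergman_kernel alpha) ^~ y).
  move=> y1; have mK := bmeas_kernel alpha y1; have fK := sqnorm_kernel_lty d0 alpha1 y1.
  pose B := nr ((bergman_kernel alpha) ^~ y).
  have H N : cabs (T N y - ip alpha S ((bergman_kernel alpha) ^~ y)) <= tl N * B.
    rewrite -{1}(reproducing d0 alpha1 (hT N) (fT N) y1) -ipBl//.
    apply: le_trans (cauchy_schwarz_ip _ _ _ _) _ => //; first exact: bmeasB.
    by rewrite ler_wpM2r ?nrm_ge0//; exact: le_nrm.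
  have : T ^~ y @ \oo --> ip alpha S ((bergman_kernel alpha) ^~ y).
    apply/cvg_cabs; apply: (@squeeze_cvgr _ _ _ _ (cst 0) (fun N => tl N * B)).
    - by apply: nearW => N; rewrite cabs_ge0 H.
    - exact: cvg_cst.
    - by rewrite -(mul0r B); apply: cvgM => //; exact: cvg_cst.
  by move/(cvg_unique _ (SE y y1)); apply.
have hS : holo S := holo_of_reproducing d0 alpha1 mS fS rS.
exists S; split; first by split; [exact/holoP|rewrite A2norm_lty].
have -> : (fun N : nat => A2norm alpha (fun y => \sum_(k < N) u k y - S y)) =
    (fun N => (nr (fun y => T N y - S y))%:E).
  by apply/funext => N; exact: A2norm_nrm (bnd' N).
apply: cvg_EFin; first by apply: nearW.
apply: (@squeeze_cvgr _ _ _ _ (cst 0) tl) => //; last exact: cvg_cst.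
by apply: nearW => N /=; rewrite nrm_ge0 le_nrm.
Qed.

End Completeness.

(** * Weights of the hyperbolic shells *)

Section RadialIntegrals.
Context {R : realType} {d : nat} (d0 : (0 < d)%N).
Local Notation V := (@Cvec R d).

Definition rsh (i j : nat) : set V :=
  [set u | cnorm (u : 'rV[C R]_d) < 1 /\ i%:R <= bd u < j%:R].

Lemma rshS i j : (i <= j)%N -> rsh i j.+1 = rsh i j `|` sh j.
Proof.
move=> ij; apply/seteqP; split => u /=.
  move=> [u1 /andP[b1 b2]]; case: (ltP (bd u) j%:R) => h; [left|right]; split => //.
    by rewrite b1.
  by rewrite h.
move=> [[u1 /andP[b1 b2]]|[u1 /andP[b1 b2]]]; split => //.
  by rewrite b1 (lt_le_trans b2)// ler_nat.
by rewrite b2 andbT; apply: le_trans b1; rewrite ler_nat.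
Qed.

Lemma rsh_id i : rsh i i = set0.
Proof.
by apply/seteqP; split => // u [_ /andP[a b]]; have := le_lt_trans a b; rewrite ltxx.
Qed.

Lemma measurable_rsh i j : (i <= j)%N -> measurable (rsh i j).
Proof.
move=> /subnKC <-; elim: (j - i)%N => [|n IH]; first by rewrite addn0 rsh_id.
by rewrite addnS rshS ?leq_addr//; apply: measurableU => //; exact: measurable_sh.
Qed.

Lemma measurable_bd : measurable_fun [set: V] (bd : V -> R).
Proof.
apply: measurableT_comp; first exact: measurable_ln.
pose f (u : V) := Num.max (1 - cnorm (u : 'rV[C R]_d)) 0.
rewrite /bd; apply: measurable_funM.
  by apply: measurable_funD; [exact: measurable_cst|exact: measurable_cnorm].
have := cmeasV (cmeas_toC (measurable_funB (measurable_cst (1 : R)) (@measurable_cnorm R d))).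
by move=> [+ _]; congr measurable_fun; apply/funext => u; rewrite -toCV.
Qed.

Lemma integral_rsh_sum (f : V -> R) i j : (i <= j)%N -> measurable_fun [set: V] f ->
  (forall u, 0 <= f u) ->
  (\int[vb d]_(u in rsh i j) (f u)%:E = \sum_(i <= k < j) \int[vb d]_(u in sh k) (f u)%:E)%E.
Proof.
move=> /subnKC <- mf f0; elim: (j - i)%N => [|n IH].
  by rewrite addn0 rsh_id integral_set0 big_geq.
rewrite addnS rshS ?leq_addr// ge0_integral_setU//.
- by rewrite IH big_nat_recr ?leq_addr.
- by apply: measurable_rsh; rewrite leq_addr.
- exact: measurable_sh.
- by apply/measurable_EFinP; exact: measurable_funTS.
- by move=> u _; rewrite lee_fin.
- apply/disj_setPS => u [[_ /andP[_ a]] [_ /andP[b _]]].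
  by have := lt_le_trans a b; rewrite ltxx.
Qed.

Definition radw (s g : R) (u : 'rV[C R]_d) : R := expR (- s * bd u) * (1 - cnorm u ^+ 2) `^ g.

Lemma radw_ge0 s g u : 0 <= radw s g u.
Proof. by rewrite mulr_ge0 ?expR_ge0 ?powR_ge0. Qed.

Lemma measurable_radw s g : measurable_fun [set: V] (radw s g : V -> R).
Proof.
apply: measurable_funM.
  apply: measurableT_comp; first exact: measurable_expR.
  by apply: measurable_funM; [exact: measurable_cst|exact: measurable_bd].
apply: measurable_powRc; apply: measurable_funB; first exact: measurable_cst.
by apply: measurable_funX; exact: measurable_cnorm.
Qed.

Definition radC (g : R) : R := expR (2 * `|g|) * ((d + d)%:R * 2).
Definition radc (g : R) : R := expR (- (2 * `|g|)) * (rho 1 ^+ (d + d) / 4).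

Lemma radC_ge0 g : 0 <= radC g. Proof. by rewrite mulr_ge0 ?expR_ge0// mulr_ge0. Qed.
Lemma radc_gt0 g : 0 < radc g.
Proof. by rewrite mulr_gt0 ?expR_gt0// divr_gt0// exprn_gt0// rho_gt0. Qed.

Lemma integral_radw_le (s g : R) k : 0 <= s ->
  (\int[vb d]_(u in sh k) (radw s g u)%:E <= (radC g * expR (- (s + g + 1)) ^+ k)%:E)%E.
Proof.
move=> s0; pose c := expR (- s * k%:R) * expR (- g * k%:R + 2 * `|g|).
have H (u : V) : sh k u -> radw s g u <= c.
  move=> su; have [_ /andP[b1 _]] := su; apply: ler_pM; rewrite ?expR_ge0 ?powR_ge0//.
    by rewrite ler_expR !mulNr lerN2 ler_wpM2l.
  by have /andP[] := sh_pow g su.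
have c0 : 0 <= c by rewrite mulr_ge0 ?expR_ge0.
apply: le_trans (integral_sh_le d0 c0 (measurable_radw s g) (radw_ge0 s g) H) _.
rewrite lee_fin le_eqVlt; apply/orP; left; apply/eqP.
rewrite /c /radC -expRM_natr.
rewrite (_ : - (s + g + 1) * k%:R = - s * k%:R + - g * k%:R + - k%:R); last by ring.
by rewrite !expRD; ring.
Qed.

Lemma integral_radw_ge (s g : R) k : 0 <= s ->
  ((radc g * expR (- s) * expR (- (s + g + 1)) ^+ k)%:E <= \int[vb d]_(u in sh k) (radw s g u)%:E)%E.
Proof.
move=> s0; pose c := expR (- s * k.+1%:R) * expR (- g * k%:R - 2 * `|g|).
have H (u : V) : sh k u -> c <= radw s g u.
  move=> su; have [_ /andP[_ b1]] := su; apply: ler_pM; rewrite ?expR_ge0//.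
    by rewrite ler_expR !mulNr lerN2 ler_wpM2l// ltW.
  by have /andP[] := sh_pow g su.
have c0 : 0 <= c by rewrite mulr_ge0 ?expR_ge0.
apply: le_trans (integral_sh_ge d0 c0 (measurable_radw s g) H).
rewrite lee_fin le_eqVlt; apply/orP; left; apply/eqP.
rewrite /c /radc -expRM_natr -(natr1 k).
rewrite (_ : - (s + g + 1) * k%:R = - s * k%:R + - g * k%:R + - k%:R); last by ring.
rewrite (_ : - s * (k%:R + 1) = - s * k%:R - s); last by ring.
by rewrite !expRD; ring.
Qed.

End RadialIntegrals.

Section Weights.
Context {R : realType} {d : nat} (d0 : (0 < d)%N) (alpha beta lambda : R).
Hypotheses (alpha1 : -1 < alpha) (abeta : alpha + d%:R + 1 <= beta) (lambda0 : 0 < lambda).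
Local Notation V := (@Cvec R d).
Local Notation a := (d%:R + 1 + alpha).
Local Notation K := (bergman_kernel alpha).
Local Notation bc := (@bergman_const R d alpha).
Variable (z : 'rV[C R]_d).
Hypothesis z1 : cnorm z < 1.

Local Opaque mobius.

Definition reg (i j : nat) : set V :=
  [set x | cnorm (x : 'rV[C R]_d) < 1 /\ i%:R <= dB z (x : 'rV[C R]_d) < j%:R].

Lemma dBE (x : 'rV[C R]_d) : cnorm x < 1 -> dB z x = bd (mobius z x).
Proof. by move=> x1; exact: (congr1 (fun r => ln ((1 + r) / (1 - r))) (cnorm_mobiusC x1 z1)). Qed.

Lemma regE i j (x : V) : reg i j x <-> cnorm (x : 'rV[C R]_d) < 1 /\ rsh i j (mobius z x).
Proof.
split=> [[x1 h]|[x1 [_ h]]]; last by split; [exact: x1|rewrite (dBE x1); exact: h].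
split; [exact: x1|split; first exact: mobius_lt1 z1 x1].
by rewrite -(dBE x1); exact: h.
Qed.

Lemma measurable_reg i j : (i <= j)%N -> measurable (reg i j).
Proof.
move=> ij; rewrite (_ : reg i j = uball R d `&` (mobius z @^-1` rsh i j : set V)).
  apply: measurableI; first exact: measurable_uball.
  by rewrite -[X in measurable X]setTI; apply: (measurable_mobius_l z) => //; exact: measurable_rsh.
by apply/seteqP; split => x /= /regE.
Qed.

Definition dens (x : 'rV[C R]_d) : R := lambda / (1 - cnorm x ^+ 2) `^ (beta + 1).

Lemma dens_ge0 x : 0 <= dens x.
Proof. by rewrite divr_ge0 ?powR_ge0// ltW. Qed.

Lemma measurable_dens : measurable_fun [set: V] (dens : V -> R).
Proof.
apply: measurable_funM; first exact: measurable_cst.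
apply: measurable_nninv; first by move=> x; exact: powR_ge0.
apply: measurable_powRc; apply: measurable_funB; first exact: measurable_cst.
by apply: measurable_funX; exact: measurable_cnorm.
Qed.

Let z2 : 0 < 1 - cnorm z ^+ 2. Proof. by rewrite lt1_sqr ?cnorm_ge0. Qed.

Lemma indic_reg i j (x : V) : cnorm (x : 'rV[C R]_d) < 1 ->
  \1_(reg i j) x = \1_(rsh i j) (mobius z x : V) :> R.
Proof.
move=> x1; have E : (x \in reg i j) = ((mobius z x : V) \in rsh i j).
  apply/idP/idP => /set_mem h; apply/mem_set; last by apply/regE.
  by case: (iffLR (regE i j x) h).
by rewrite (indicE R (reg i j) x) (indicE R (rsh i j) (mobius z x : V)) E.
Qed.

(** The weight is chosen so that, against the intensity, it becomes radial after
    recentring at [z]. *)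
Lemma weight_dens s i j (x : V) :
  \1_(reg i j) x * (weight beta s z x * dens x) =
  lambda * (\1_(rsh i j) (mobius z x : V) * radw s (d%:R - beta) (mobius z x) * jac x).
Proof.
have [x1|x1] := boolP (cnorm (x : 'rV[C R]_d) < 1); last first.
  rewrite /jac (negbTE x1) !mulr0 indicE memNset ?mul0r// => /regE[].
  by rewrite (negbTE x1).
rewrite indic_reg// /weight /radw dBE// mobius_ball// /dens /jac x1.
set e := expR _; set I := \1_(_) _; set q := cabs _ ^+ 2.
have q0 : 0 < q by rewrite exprn_gt0// cabs_gt0; exact: den_neq0.
have x2 : 0 < 1 - cnorm (x : 'rV[C R]_d) ^+ 2 by rewrite lt1_sqr ?cnorm_ge0.
set P := 1 - cnorm z ^+ 2; set Q := 1 - cnorm x ^+ 2.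
have -> : (P * Q / q) `^ (d%:R - beta) = (q / P) `^ (beta - d%:R) * Q `^ (d%:R - beta).
  rewrite (_ : P * Q / q = (q / P)^-1 * Q); last by rewrite invf_div; ring.
  have qP : 0 <= q / P := divr_ge0 (ltW q0) (ltW z2).
  have iqP : 0 <= (q / P)^-1 by rewrite invr_ge0.
  rewrite (powRM _ iqP (ltW x2)); congr (_ * _).
  by rewrite -(powR_inv1 qP) -powRrM mulN1r opprB.
have -> : Q `^ (beta + 1) = Q ^+ d.+1 / Q `^ (d%:R - beta).
  rewrite (_ : beta + 1 = d.+1%:R - (d%:R - beta)); last by rewrite -natr1; ring.
  rewrite powRB; last by apply/implyP => _; rewrite gt_eqF.
  by rewrite powR_mulrn ?(ltW x2).
rewrite exprVn; have : Q ^+ d.+1 != 0 by rewrite expf_neq0// gt_eqF.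
have : Q `^ (d%:R - beta) != 0 by rewrite gt_eqF// powR_gt0.
move: (Q ^+ d.+1) (Q `^ (d%:R - beta)) ((q / P) `^ _) => A B D n1 n2.
by field; apply/andP.
Qed.

Lemma measurable_dB : measurable_fun [set: V] (fun x : V => dB z x).
Proof.
have mm : measurable_fun [set: V] (fun x : V => cnorm (mobius x z)).
  exact: (measurableT_comp (@measurable_cnorm R d)
    (measurable_mobius (@measurable_id _ V setT) (measurable_cst (z : V)))).
rewrite /dB; apply: measurableT_comp; first exact: measurable_ln.
apply: measurable_funM; first by apply: measurable_funD => //; exact: measurable_cst.
have := cmeasV (cmeas_toC (measurable_funB (measurable_cst (1 : R)) mm)).
by move=> [+ _]; congr measurable_fun; apply/funext => u; rewrite -toCV.
Qed.

Lemma measurable_weight s : measurable_fun [set: V] (fun x : V => weight beta s z x).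
Proof.
rewrite /weight; apply: measurable_funM.
  apply: measurableT_comp; first exact: measurable_expR.
  by apply: measurable_funM; [exact: measurable_cst|exact: measurable_dB].
apply: measurable_powRc; apply: measurable_funM; last exact: measurable_cst.
apply: measurable_sqr_cabs; apply: cmeasB; first exact: cmeas_cst.
exact: (cmeas_cdot (@measurable_id _ V setT) (measurable_cst (z : V))).
Qed.

Definition cw s i j : R :=
  lambda * \int[vb d]_u (\1_(rsh i j) u * radw s (d%:R - beta) u * jac u).

Lemma radw_jac (s g : R) (u : V) : cnorm (u : 'rV[C R]_d) < 1 ->
  radw s g u * jac u = radw s (g - d.+1%:R) u.
Proof.
move=> u1; rewrite /radw /jac u1 -mulrA; congr (_ * _).
have u2 : 0 < 1 - cnorm (u : 'rV[C R]_d) ^+ 2 by rewrite lt1_sqr ?cnorm_ge0.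
rewrite [RHS]powRB; last by apply/implyP => _; rewrite gt_eqF.
by rewrite powR_mulrn ?(ltW u2)// exprVn.
Qed.

Lemma integral_radw_jac (s g : R) i j : (i <= j)%N ->
  (\int[vb d]_u (\1_(rsh i j) u * radw s g u * jac u)%:E =
   \sum_(i <= k < j) \int[vb d]_(u in sh k) (radw s (g - d.+1%:R) u)%:E)%E.
Proof.
move=> ij; rewrite -integral_rsh_sum//; [|exact: measurable_radw|exact: radw_ge0].
rewrite [RHS]integral_mkcond; apply: eq_integral => u _; rewrite patchE indicE.
case: ifPn => [ur|_]; last by rewrite !mul0r.
by rewrite mul1r radw_jac//; have [] := set_mem ur.
Qed.

Lemma integral_cw s i j : (i <= j)%N ->
  (\int[vb d]_u (\1_(rsh i j) u * radw s (d%:R - beta) u * jac u)%:E =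
   \sum_(i <= k < j) \int[vb d]_(u in sh k) (radw s (- (beta + 1)) u)%:E)%E.
Proof.
move=> ij; rewrite integral_radw_jac// (_ : d%:R - beta - _ = - (beta + 1))//.
by rewrite -natr1; ring.
Qed.

Lemma integral_cw_lty s i j : 0 <= s -> (i <= j)%N ->
  (\int[vb d]_u (\1_(rsh i j) u * radw s (d%:R - beta) u * jac u)%:E < +oo)%E.
Proof.
move=> s0 ij; rewrite integral_cw//.
apply: le_lt_trans (ltry (\sum_(i <= k < j) (radC (d:=d) (- (beta + 1)) * expR (- (s + - (beta + 1) + 1)) ^+ k))).
rewrite -sumEFin; apply: lee_sum => k _; exact: integral_radw_le.
Qed.

Lemma cwE s i j : 0 <= s -> (i <= j)%N ->
  ((cw s i j)%:E = \sum_(i <= k < j) (cw s k k.+1)%:E)%E.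
Proof.
move=> s0 ij.
have E i' j' : (i' <= j')%N -> ((cw s i' j')%:E = lambda%:E *
    \sum_(i' <= k < j') \int[vb d]_(u in sh k) (radw s (- (beta + 1)) u)%:E)%E.
  move=> ij'; rewrite /cw EFinM /Rintegral fineK -?integral_cw//.
  rewrite ge0_fin_numE ?integral_cw_lty//; apply: integral_ge0 => u _.
  by rewrite lee_fin mulr_ge0 ?jac_ge0// mulr_ge0 ?radw_ge0.
rewrite E// ge0_sume_distrr; last first.
  by move=> k _; apply: integral_ge0 => u _; rewrite lee_fin radw_ge0.
by apply: eq_bigr => k _; rewrite E// big_nat1.
Qed.

Lemma cw_le s k : 0 <= s ->
  cw s k k.+1 <= lambda * radC (d:=d) (- (beta + 1)) * expR (- (s - beta)) ^+ k.
Proof.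
move=> s0; have le := @integral_radw_le R d d0 s (- (beta + 1)) k s0.
rewrite -mulrA /cw ler_pM2l// -lee_fin /Rintegral fineK; last first.
  rewrite ge0_fin_numE ?integral_cw_lty//; apply: integral_ge0 => u _.
  by rewrite lee_fin mulr_ge0 ?jac_ge0// mulr_ge0 ?radw_ge0.
rewrite integral_cw// big_nat1; apply: le_trans le _.
by rewrite (_ : s + - (beta + 1) + 1 = s - beta)//; ring.
Qed.

Lemma cw_ge s k : 0 <= s ->
  lambda * (radc (d:=d) (- (beta + 1)) * expR (- s)) * expR (- (s - beta)) ^+ k <= cw s k k.+1.
Proof.
move=> s0; have le := @integral_radw_ge R d d0 s (- (beta + 1)) k s0.
rewrite -mulrA /cw ler_pM2l// -lee_fin /Rintegral fineK; last first.
  rewrite ge0_fin_numE ?integral_cw_lty//; apply: integral_ge0 => u _.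
  by rewrite lee_fin mulr_ge0 ?jac_ge0// mulr_ge0 ?radw_ge0.
rewrite integral_cw// big_nat1; apply: le_trans le.
by rewrite (_ : s + - (beta + 1) + 1 = s - beta)//; ring.
Qed.

Lemma weight_ge0 s (x : 'rV[C R]_d) : 0 <= weight beta s z x.
Proof. by rewrite mulr_ge0 ?expR_ge0 ?powR_ge0. Qed.

Lemma region_mean s i j (H : 'rV[C R]_d -> C R) (M : R) : 0 <= s -> (i <= j)%N -> holo H ->
  (forall x, cnorm x < 1 -> cabs (H x) <= M) ->
  cint (vb d) (fun x : V => on_ball H x * toC (\1_(reg i j) x * (weight beta s z x * dens x))) =
  H z * toC (cw s i j).
Proof.
move=> s0 ij hH HM.
pose G (u : V) := \1_(rsh i j) u * radw s (d%:R - beta) u.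
have G0 u : 0 <= G u by rewrite mulr_ge0 ?radw_ge0.
have mG : measurable_fun [set: V] G.
  by apply: measurable_funM; [apply: measurable_indic; exact: measurable_rsh ij|exact: measurable_radw].
have Grot b (x : V) : cabs b = 1 -> G (b *: (x : 'rV[C R]_d)) = G x.
  move=> b1; have nb : cnorm (b *: (x : 'rV[C R]_d)) = cnorm (x : 'rV[C R]_d) by rewrite cnormZ b1 mul1r.
  rewrite /G /radw /bd nb; congr (_ * _); rewrite !indicE; congr (_%:R); congr nat_of_bool.
  by apply/idP/idP => /set_mem => h; apply/mem_set; move: h; rewrite /rsh /= /bd nb.
have iG := integral_cw_lty s0 ij.
have cH (x : 'rV[C R]_d) : cabs (on_ball H x) <= `|M|.
  by rewrite /on_ball; case: ifPn => [x1|_]; [exact: le_trans (HM _ x1) (ler_norm _)|rewrite cabs0].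
have iH : (\int[vb d]_x (cabs (on_ball H x) * (G (mobius z x) * jac x))%:E < +oo)%E.
  apply: (@le_lt_trans _ _ (\int[vb d]_x (`|M|%:E * (G (mobius z x) * jac x)%:E))%E).
    have mGm : measurable_fun [set: V] (fun x : V => G (mobius z x) * jac x).
      by apply: measurable_funM (measurableT_comp mG (measurable_mobius_l z)) (@measurable_jac R d).
    apply: ge0_le_integral => //.
    - by move=> x _; rewrite lee_fin mulr_ge0 ?cabs_ge0// mulr_ge0 ?jac_ge0.
    - apply/measurable_EFinP; apply: measurable_funM => //.
      by apply: measurable_cabs; exact: on_ball_cmeas.
    - by apply: emeasurable_funM => //; exact/measurable_EFinP.
    move=> x _; rewrite -EFinM lee_fin; apply: ler_wpM2r (cH x).
    exact: mulr_ge0 (G0 _) (jac_ge0 _).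
  rewrite ge0_integralZl_EFin//.
  - by rewrite integral_mobius_G// lte_mul_pinfty.
  - by move=> x _; rewrite lee_fin mulr_ge0 ?jac_ge0.
  - apply/measurable_EFinP.
    by apply: measurable_funM (measurableT_comp mG (measurable_mobius_l z)) (@measurable_jac R d).
have E := mobius_mean z1 G0 mG Grot iG hH iH.
have ig : cintegrable (vb d) (fun x : V => on_ball H x * toC (G (mobius z x) * jac x)).
  split; last first.
    move: iH; congr (_ < _)%E; apply: eq_integral => x _; rewrite cabsM cabs_toC ger0_norm//.
    by rewrite mulr_ge0 ?jac_ge0.
  apply: cmeasM; first exact: on_ball_cmeas.
  apply: cmeas_toC.
  by apply: measurable_funM (measurableT_comp mG (measurable_mobius_l z)) (@measurable_jac R d).
rewrite /cw toCM mulrCA -E -cintZ//; congr cint; apply/funext => x.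
by rewrite weight_dens toCM mulrCA.
Qed.

Definition regV : R := lambda * bc * (((4 / (1 - cnorm z ^+ 2)) `^ (beta - d%:R)) ^+ 2
  * (4 / (1 - cnorm z ^+ 2)) `^ (a + beta - d%:R)) * radC (d:=d) (- (a + beta + 1)).

Lemma regV_ge0 : 0 <= regV.
Proof.
rewrite /regV !mulr_ge0 ?radC_ge0 ?powR_ge0// ltW//; exact: bergman_const_gt0.
Qed.

Lemma regV_le s i j : beta < s -> (i <= j)%N ->
  (\int[vb d]_x (\1_(reg i j) x * (weight beta s z x ^+ 2 * (bc / (1 - cnorm (x : 'rV[C R]_d) ^+ 2) `^ a) * dens x))%:E
   <= \sum_(i <= k < j) (regV * (expR (- (s - beta)) ^+ 2) ^+ k)%:E)%E.
Proof.
move=> bs ij.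
have bd0 : 0 <= beta - d%:R by have := alpha1; have := abeta; rewrite -subr_gt0 opprK; lra.
have a0 : 0 <= a by exact/ltW/kexp_gt0.
have b0 : 0 <= beta by apply: le_trans bd0 _; rewrite gerBl.
have s0 : 0 <= 2 * s by lra.
set k4 := 4 / (1 - cnorm z ^+ 2).
have k40 : 0 < k4 by rewrite divr_gt0.
pose c : R := lambda * bc * ((k4 `^ (beta - d%:R)) ^+ 2 * k4 `^ (a + beta - d%:R)).
have bc0 := @bergman_const_gt0 R d d0 alpha alpha1.
have c0 : 0 <= c by rewrite /c !mulr_ge0 ?powR_ge0// ltW.
pose g := - (a + beta - d%:R).
pose G (u : V) := \1_(rsh i j) u * radw (2 * s) g u.
have G0 u : 0 <= G u by rewrite mulr_ge0 ?radw_ge0.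
have mG : measurable_fun [set: V] G.
  by apply: measurable_funM; [apply: measurable_indic; exact: measurable_rsh ij|exact: measurable_radw].
have mGm : measurable_fun [set: V] (fun x : V => G (mobius z x) * jac x).
  by apply: measurable_funM (measurableT_comp mG (measurable_mobius_l z)) (@measurable_jac R d).
have base (x : V) : cnorm (x : 'rV[C R]_d) < 1 ->
    weight beta s z x ^+ 2 * (bc / (1 - cnorm (x : 'rV[C R]_d) ^+ 2) `^ a) * dens x <=
    c * (radw (2 * s) g (mobius z x) * jac x).
  move=> x1; rewrite /weight /radw (dBE x1) /dens /jac x1.
  have x2 : 0 < 1 - cnorm (x : 'rV[C R]_d) ^+ 2 by rewrite lt1_sqr ?cnorm_ge0.
  have U0 : 0 < 1 - cnorm (mobius z x) ^+ 2 by rewrite lt1_sqr ?cnorm_ge0// mobius_lt1.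
  have UE := mobius_ball z1 x1.
  have q4 : cabs (1 - cdot x (conjv z)) ^+ 2 <= 4.
    rewrite (_ : 4 = 2 ^+ 2); last by ring.
    by rewrite lerXn2r ?nnegrE ?cabs_ge0// cabs_1B_le// ltW.
  have n0 := cnorm_ge0 z.
  have qP : (1 - cnorm z ^+ 2) ^+ 2 <= 4 * cabs (1 - cdot x (conjv z)) ^+ 2.
    have h : 1 - cnorm z <= cabs (1 - cdot x (conjv z)).
      apply: le_trans (le_trans (ler_norm _) (ler_cRe _)).
      by apply: le_trans (cRe_1B_ge _ _); nra.
    rewrite (_ : 4 * _ = (2 * cabs (1 - cdot x (conjv z))) ^+ 2); last by ring.
    rewrite lerXn2r ?nnegrE ?mulr_ge0 ?cabs_ge0 ?(ltW z2)//; nra.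
  have q0 : 0 < cabs (1 - cdot x (conjv z)) ^+ 2.
    by rewrite exprn_gt0// cabs_gt0; exact: den_neq0.
  move: x2 U0 UE q4 qP q0; move: (cabs _ ^+ 2) (1 - cnorm (mobius z x) ^+ 2) => q U.
  move: (1 - cnorm x ^+ 2) (bd (mobius z x)) => Q D x2 U0 UE q4 qP q0.
  have UQ : Q^-1 <= k4 / U.
    rewrite UE /k4; move: z2 qP; move: (1 - cnorm z ^+ 2) => P P0 qP.
    rewrite (_ : 4 / P / (P * Q / q) = (4 * q / P ^+ 2) * Q^-1); last by field; rewrite !gt_eqF.
    rewrite ler_peMl ?invr_ge0 ?(ltW x2)//.
    by rewrite ler_pdivlMr ?exprn_gt0// mul1r.
  have p0 : 0 <= a + beta - d%:R by lra.
  have e1 : (q / (1 - cnorm z ^+ 2)) `^ (beta - d%:R) <= k4 `^ (beta - d%:R).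
    rewrite ge0_ler_powR ?nnegrE ?divr_ge0 ?(ltW q0) ?(ltW z2)//.
    by rewrite ler_wpM2r// invr_ge0 ltW.
  have i0 : 0 <= Q^-1 by rewrite invr_ge0 ltW.
  have u0 : 0 <= U^-1 by rewrite invr_ge0 ltW.
  have e2 : Q^-1 `^ (a + beta - d%:R) <= k4 `^ (a + beta - d%:R) * U `^ g.
    rewrite (_ : U `^ g = U^-1 `^ (a + beta - d%:R)); last first.
      by rewrite -(powR_inv1 (ltW U0)) -powRrM mulN1r.
    rewrite -powRM ?(ltW k40)// ge0_ler_powR ?nnegrE//.
    by rewrite mulr_ge0// ltW.
  have E : (bc / Q `^ a) * (lambda / Q `^ (beta + 1)) =
      lambda * bc * (Q^-1 `^ (a + beta - d%:R) * Q^-1 ^+ d.+1).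
    have iv b : Q^-1 `^ b = (Q `^ b)^-1.
      by rewrite -(powR_inv1 (ltW x2)) -powRrM mulN1r powRN.
    have pD b b' : Q `^ b * Q `^ b' = Q `^ (b + b').
      by rewrite powRD//; apply/implyP => _; rewrite gt_eqF.
    rewrite exprVn -(powR_mulrn d.+1 (ltW x2)) iv -[X in _ = _ * X]invfM pD.
    rewrite (_ : a + beta - d%:R + d.+1%:R = a + (beta + 1)); last by rewrite -natr1; ring.
    rewrite -(pD a (beta + 1)) invfM.
    by move: (Q `^ a)^-1 (Q `^ (beta + 1))^-1 bc => A B C0; ring.
  rewrite -mulrA E exprMn (_ : expR (- s * D) ^+ 2 = expR (- (2 * s) * D)); last first.
    by rewrite -expRM_natr; congr expR; ring.
  move: (expR _) (expR_ge0 (- (2 * s) * D)) => e e0.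
  rewrite /c (_ : _ * (e * U `^ g * _) = e * (k4 `^ (beta - d%:R)) ^+ 2 * (lambda * bc *
    ((k4 `^ (a + beta - d%:R) * U `^ g) * Q^-1 ^+ d.+1))); last by ring.
  apply: ler_pM.
  - by rewrite mulr_ge0 ?sqr_ge0.
  - rewrite !mulr_ge0 ?powR_ge0 ?exprn_ge0// ltW//.
  - by rewrite ler_wpM2l// lerXn2r ?nnegrE ?powR_ge0.
  - rewrite ler_wpM2l ?mulr_ge0 ?(ltW lambda0) ?(ltW bc0)//.
    by rewrite ler_wpM2r ?exprn_ge0.
have key (x : V) : \1_(reg i j) x * (weight beta s z x ^+ 2 * (bc / (1 - cnorm (x : 'rV[C R]_d) ^+ 2) `^ a) * dens x)
    <= c * (G (mobius z x) * jac x).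
  have [x1|x1] := boolP (cnorm (x : 'rV[C R]_d) < 1); last first.
    rewrite (indicE R (reg i j) x) memNset ?mul0r; last by move=> /regE[]; rewrite (negbTE x1).
    exact: mulr_ge0 c0 (mulr_ge0 (G0 _) (jac_ge0 _)).
  rewrite indic_reg// /G -[X in c * X]mulrA (mulrCA c).
  by apply: ler_wpM2l; [|exact: base].
have mL : measurable_fun [set: V] (fun x : V => \1_(reg i j) x *
    (weight beta s z x ^+ 2 * (bc / (1 - cnorm (x : 'rV[C R]_d) ^+ 2) `^ a) * dens x)).
  apply: measurable_funM; first by apply: measurable_indic; exact: measurable_reg ij.
  apply: measurable_funM; last exact: measurable_dens.
  apply: measurable_funM; first by apply: measurable_funX; exact: measurable_weight.
  apply: measurable_funM; first exact: measurable_cst.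
  apply: measurable_nninv; first by move=> x; exact: powR_ge0.
  apply: measurable_powRc; apply: measurable_funB; first exact: measurable_cst.
  by apply: measurable_funX; exact: measurable_cnorm.
apply: (@le_trans _ _ (\int[vb d]_x (c%:E * (G (mobius z x) * jac x)%:E))%E).
  apply: ge0_le_integral => //.
  - move=> x _; rewrite lee_fin mulr_ge0// mulr_ge0 ?dens_ge0// mulr_ge0 ?sqr_ge0//.
    by rewrite divr_ge0 ?powR_ge0// ltW.
  - exact/measurable_EFinP.
  - by apply: emeasurable_funM => //; exact/measurable_EFinP.
  - by move=> x _; rewrite -EFinM lee_fin key.
rewrite ge0_integralZl_EFin//; last 2 first.
- by move=> x _; rewrite lee_fin; exact: mulr_ge0 (G0 _) (jac_ge0 _).
- exact/measurable_EFinP.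
rewrite integral_mobius_G// /G integral_radw_jac// ge0_sume_distrr; last first.
  by move=> k _; apply: integral_ge0 => u _; rewrite lee_fin radw_ge0.
apply: lee_sum => k _.
rewrite (_ : g - d.+1%:R = - (a + beta + 1)); last by rewrite /g -natr1; ring.
have le := @integral_radw_le R d d0 (2 * s) (- (a + beta + 1)) k s0.
apply: le_trans (lee_wpmul2l _ le) _; first by rewrite lee_fin.
rewrite -EFinM lee_fin /regV -/k4 -/c mulrA ler_wpM2l ?(mulr_ge0 c0 (radC_ge0 _))//.
by rewrite lerXn2r ?nnegrE ?sqr_ge0 ?expR_ge0// -expRM_natr ler_expR; have := abeta; lra.
Qed.

End Weights.

(** * Sums over a configuration in a region away from the boundary *)

Section BallTopology.
Context {R : realType} {d : nat}.
Local Notation V := (@Cvec R d).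
Local Notation E := (uball R d).

Lemma compact_cnorm (r : R) : compact [set z : 'rV[C R]_d | cnorm z <= r].
Proof.
pose f (p : R * R) : C R := Complex p.1 p.2.
have cf : continuous f.
  move=> p; apply/(@cvg_cabsP _ _ (nbhs p) (nbhs_filter p)) => e e0.
  have e2 : 0 < e / 2 by rewrite divr_gt0.
  apply/nbhs_ballP; exists (e / 2) => //= q [/= q1 q2].
  apply: le_lt_trans (cabs_le _) _; rewrite cReD cReN cImD cImN /=.
  by rewrite distrC [X in _ + X]distrC [ltRHS]splitr; exact: ltrD.
have cA : compact (f @` (`[- r, r] `*` `[- r, r])).
  apply: continuous_compact; first exact: continuous_subspaceT.
  by apply: compact_setX; exact: segment_compact.
apply: (subclosed_compact _ (rV_compact (fun=> cA))).
  rewrite (_ : [set z | _] = @cnorm R d @^-1` [set x | x <= r]) //.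
  apply: closed_comp; last exact: closed_le.
  by move=> z _; exact: continuous_cnorm.
move=> z /= zr i; exists (cRe (z ord0 i), cIm (z ord0 i)); last by case: (z ord0 i).
have h := le_trans (cabs_coord z i) zr.
split; rewrite /= in_itv /= -ler_norml; apply: le_trans h; first exact: ler_cRe.
exact: ler_cIm.
Qed.

Lemma nbhs_val (x : E) (B : set E) : nbhs x B ->
  exists2 U : set 'rV[C R]_d, nbhs (\val x) U & forall y : E, U (\val y) -> B y.
Proof.
rewrite nbhsE; case=> O [oO Ox] OB; case: oO => U oU OE; exists U; last first.
  by move=> y Uy; apply: OB; rewrite -OE.
rewrite -OE in Ox.
exact: open_nbhs_nbhs.
Qed.

Lemma precompact_ball (r : R) (B : set E) : r < 1 -> (forall x, B x -> cnorm (\val x) <= r) ->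
  precompact B.
Proof.
move=> r1 Br; exists [set x : E | cnorm (\val x) <= r]; first by move=> x; exact: Br.
split.
  move=> F FF FK.
  have GK : (\val @ F) [set z : 'rV[C R]_d | cnorm z <= r] by [].
  have [p [pr pc]] := compact_cnorm (fmap_proper_filter _ FF) GK.
  have p1 : p \in uball R d by rewrite inE; exact: le_lt_trans pr r1.
  exists (SigSub p1); split => // A B' FA /nbhs_val[U Up UB].
  have FvA : F ((\val : E -> 'rV[C R]_d) @^-1` [set \val x | x in A]).
    by apply: filterS FA => x Ax; exists x.
  have [_ [[x Ax <-] Ux]] := pc _ _ FvA Up; exists x; split => //; exact: UB.
apply: (@closed_comp _ _ (\val : E -> 'rV[C R]_d) [set z | cnorm z <= r]).
  by move=> x _; exact: initial_continuous.
rewrite (_ : [set z | _] = @cnorm R d @^-1` [set x | x <= r]) //.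
apply: closed_comp; last exact: closed_le.
by move=> z _; exact: continuous_cnorm.
Qed.

Lemma borel_val (A : set V) : measurable A -> borel ((\val : E -> V) @^-1` A).
Proof.
move=> mA; pose S : set (set V) := [set A | borel ((\val : E -> V) @^-1` A)].
have : <<s @open 'rV[C R]_d >> `<=` S.
  apply: smallest_sub; last first.
    move=> U oU; apply: sub_gen_smallest.
    exact: (open_comp (fun x _ => @initial_continuous _ _ (\val : E -> 'rV[C R]_d) x) oU).
  have [b0 bC bU] : sigma_algebra [set: E] (@borel E) by exact: smallest_sigma_algebra.
  split; first by rewrite /S /= preimage_set0.
    by move=> B SB; exact: bC SB.
  by move=> F SF; rewrite /S /= preimage_bigcup; exact: bU.
by apply; exact: mA.
Qed.

End BallTopology.

Section FiniteSums.
Context {R : realType} {d : nat}.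
Local Notation V := (@Cvec R d).
Local Notation E := (uball R d).
Variable A : set V.
Local Notation B := ((\val : E -> V) @^-1` A : set E).
Hypothesis preB : precompact B.
Hypothesis mA : measurable A.
Implicit Types X : conf E.

(** Local finiteness turns sums over the region into sums over a list. *)
Definition pts X : seq E := finmap.enum_fset (fset_set (B `&` [set x | X x != 0%N])).

Let finB X : finite_set (B `&` [set x | X x != 0%N]).
Proof. exact: mult_locally_finite. Qed.

Lemma mem_pts X x : x \in pts X -> A (\val x).
Proof. by move=> h; have := in_fset_set (finB X) x; rewrite h => /esym/set_mem[]. Qed.

Lemma fsum_pts (T : Type) (idx : T) (op : Monoid.com_law idx) X (g : E -> T) :
  (forall x, X x = 0%N -> g x = idx) ->
  \big[op/idx]_(x \in B) g x = \big[op/idx]_(x <- pts X) g x.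
Proof.
move=> g0; rewrite -(fsbig_finite _ _ (finB X)); apply/esym/fsbig_widen; first by move=> x [].
move=> x [Bx /= nx]; apply: g0; apply/eqP; apply: contra_notT nx => x0.
by split.
Qed.

Definition csum X (g : V -> R) : R := \sum_(x <- pts X) (X x)%:R * g (\val x).

Let ball0_subproof : (0 : 'rV[C R]_d) \in uball R d.
Proof. by rewrite inE /uball /= cnorm0. Qed.

Definition ball0 : E := SigSub ball0_subproof.

Definition kap X : {measure set V -> \bar R} :=
  msum (fun i => mscale (NngNum (ler0n R (X (nth ball0 (pts X) i))))
    (\d_(\val (nth ball0 (pts X) i) : V))) (size (pts X)).

Lemma kapE X (g : V -> R) : measurable_fun [set: V] g -> (forall x, 0 <= g x) ->
  (\int[kap X]_x (g x)%:E)%E = (csum X g)%:E.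
Proof.
move=> mg g0; have mg' : measurable_fun [set: V] (fun x => (g x)%:E) by exact/measurable_EFinP.
have g0' (x : V) : [set: V] x -> (0 <= (g x)%:E)%E by rewrite lee_fin.
rewrite /kap ge0_integral_measure_sum//.
have -> : csum X g = \sum_(i < size (pts X)) (X (nth ball0 (pts X) i))%:R * g (\val (nth ball0 (pts X) i)).
  by rewrite /csum; etransitivity; [exact: (big_nth ball0)|rewrite big_mkord].
rewrite -sumEFin.
apply: eq_bigr => i _.
apply: etrans (ge0_integral_mscale _ measurableT _ mg' g0') _; rewrite /= EFinM; congr (_ * _)%E.
have := @integral_dirac _ V (sval (nth ball0 (pts X) i) : V) R setT measurableT _ mg'.
by rewrite diracT mul1e.
Qed.

Lemma kap_count X U : measurable U ->
  kap X U = (\sum_(x \in ((\val : E -> V) @^-1` (A `&` U))) X x)%N%:R%:E.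
Proof.
move=> mU; rewrite preimage_setI fsbig_mkcondr (@fsum_pts nat 0%N _ X); last by move=> x ->; case: ifP.
rewrite /kap /msum natr_sum.
rewrite [in RHS](_ : \sum_(x <- pts X) _ = \sum_(i < size (pts X)) ((if nth ball0 (pts X) i \in
    (\val : E -> V) @^-1` U then X (nth ball0 (pts X) i) else 0%N)%:R : R)); last first.
  by etransitivity; [exact: (big_nth ball0)|rewrite big_mkord].
rewrite -sumEFin; apply: eq_bigr => i _.
rewrite -[LHS]/((X (nth ball0 (pts X) i))%:R%:E * dirac (\val (nth ball0 (pts X) i) : V) U)%E diracE.
case: (boolP (nth ball0 (pts X) i \in (\val : E -> V) @^-1` U)) => h.
  by rewrite (_ : (_ \in U) = true) ?mule1//; apply/mem_set; exact: (set_mem h).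
rewrite (_ : (_ \in U) = false) ?mule0//.
by apply/negbTE; apply: contra h => h; apply/mem_set; exact: (set_mem h).
Qed.

Lemma measurable_count (U : set V) : measurable U -> U `<=` A ->
  measurable_fun [set: Conf E] (fun X : Conf E =>
    ((\sum_(x \in ((\val : E -> V) @^-1` U)) (X : conf E) x)%N%:R%:E : \bar R)).
Proof.
move=> mU UA.
have pU : precompact ((\val : E -> V) @^-1` U).
  by have [K HK cK] := preB; exists K => // x Ux; apply: HK; exact: UA.
pose N (X : Conf E) := (\sum_(x \in ((\val : E -> V) @^-1` U)) (X : conf E) x)%N.
have mN n : measurable [set X | N X = n].
  apply: sub_gen_smallest; exists ((\val : E -> V) @^-1` U), n; split => //.
  exact: borel_val.
move=> _ Y mY; rewrite setTI.
rewrite (_ : _ @^-1` Y = \bigcup_n (if `[< Y n%:R%:E >] then [set X | N X = n] else set0)).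
  apply: bigcupT_measurable => n.
  by case: ifP => _; [exact: mN|exact: measurable0].
apply/seteqP; split => [X /= YX|X [n _]].
  by exists (N X) => //; case: ifPn => // /asboolPn; apply.
by case: ifPn => // /asboolP Yn /= NX; rewrite -/(N X) NX.
Qed.

Lemma measurable_kap U : measurable U ->
  measurable_fun [set: Conf E] (fun X : Conf E => kap X U).
Proof.
move=> mU; under eq_fun do rewrite (kap_count _ mU).
by apply: measurable_count => //; exact: measurableI.
Qed.

End FiniteSums.

(** * First and second moments of sums over the process *)

Section JointMeasurability.
Context {R : realType} {d : nat}.
Local Notation V := (@Cvec R d).
Local Notation E := (uball R d).
Local Notation Om := (Conf E).
Variable A : set V.
Hypothesis preB : precompact ((\val : E -> V) @^-1` A : set E).
Hypothesis mA : measurable A.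
Variable n : nat.

Let P := (Om * V)%type.

(** The truncation makes the kernel uniformly bounded. *)
Definition tkap (p : P) : {measure set V -> \bar R} :=
  if (kap A (p.1 : conf E) setT <= n%:R%:E)%E then kap A (p.1 : conf E)
  else [the {measure set V -> \bar R} of mzero].

Let measurable_tkap (U : set V) : measurable U -> measurable_fun [set: P] (tkap ^~ U).
Proof.
move=> mU; have f1 := @measurable_fst _ _ Om V.
rewrite (_ : (fun p => tkap p U) = (fun p => if (kap A (p.1 : conf E) setT <= n%:R%:E)%E
  then kap A (p.1 : conf E) U else 0%E)); last first.
  by apply/funext => p; rewrite /tkap; case: ifP.
apply: measurable_fun_ifT => //.
- apply: measurable_fun_lee; last exact: measurable_cst.
  exact: (measurableT_comp (measurable_kap preB mA measurableT) f1).
- exact: (measurableT_comp (measurable_kap preB mA mU) f1).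
Qed.

HB.instance Definition _ := isKernel.Build _ _ P V R tkap measurable_tkap.

Let tkap_uub : measure_fam_uub tkap.
Proof.
exists n.+1%:R => p; rewrite /tkap; case: ifPn => h; last by rewrite /= /mzero lte_fin ltr0n.
by apply: le_lt_trans h _; rewrite lte_fin ltr_nat.
Qed.

HB.instance Definition _ := Kernel_isFinite.Build _ _ P V R tkap tkap_uub.

Lemma measurable_tkap_integral (g : P * V -> \bar R) : (forall q, 0 <= g q)%E ->
  measurable_fun [set: P * V] g ->
  measurable_fun [set: P] (fun p => \int[tkap p]_x g (p, x))%E.
Proof. by move=> g0 mg; exact: measurable_fun_integral_finite_kernel. Qed.

End JointMeasurability.

Section Moments.
Import HBNNSimple.
Context {R : realType} {d : nat} (beta lambda : R) (lambda0 : 0 < lambda).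
Local Notation V := (@Cvec R d).
Local Notation E := (uball R d).
Local Notation Om := (Conf E).
Variable Pi : probability Om R.
Local Notation dens := (dens beta lambda).
Hypothesis intensity : forall B : set E, borel B -> first_intensity Pi B =
  (\int[v_ d]_(z in [set \val x | x in B]) (lambda / (1 - cnorm z ^+ 2) `^ (beta + 1))%:E)%E.

Variable A : set V.
Hypothesis mA : measurable A.
Variable (r : R) (r1 : r < 1).
Hypothesis Ar : forall x : V, A x -> cnorm (x : 'rV[C R]_d) <= r.

Let preB : precompact ((\val : E -> V) @^-1` A : set E).
Proof. by apply: (precompact_ball r1) => x; exact: Ar. Qed.

Let AE (U : set V) : [set \val x | x in (\val : E -> V) @^-1` (A `&` U)] = A `&` U.
Proof.
apply/seteqP; split => [_ [x xA <-]//|x [Ax Ux]].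
have x1 : (x : 'rV[C R]_d) \in uball R d by rewrite inE; exact: le_lt_trans (Ar Ax) r1.
by exists (SigSub x1).
Qed.

Local Notation cs X g := (csum A (X : conf E) g).

Lemma csumD (X : Om) (f g : V -> R) : cs X (fun x => f x + g x) = cs X f + cs X g.
Proof. by rewrite /csum -big_split/=; apply: eq_bigr => x _; rewrite mulrDr. Qed.
Lemma csumZ (X : Om) k (g : V -> R) : cs X (fun x => k * g x) = k * cs X g.
Proof. by rewrite /csum mulr_sumr; apply: eq_bigr => x _; rewrite mulrCA. Qed.
Lemma csum_ge0 (X : Om) (g : V -> R) : (forall x, 0 <= g x) -> 0 <= cs X g.
Proof. by move=> g0; apply: sumr_ge0 => x _; rewrite mulr_ge0. Qed.

Lemma eq_csum (X : Om) (f g : V -> R) : (forall x, A x -> f x = g x) -> cs X f = cs X g.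
Proof.
move=> fg; rewrite /csum !big_seq; apply: eq_bigr => x xp; congr (_ * _); apply: fg.
exact: (mem_pts preB xp).
Qed.

Lemma measurable_csum_nn (g : V -> V -> R) :
  (forall x y, 0 <= g x y) -> measurable_fun [set: V * V] (fun p => g p.1 p.2) ->
  measurable_fun [set: Om * V] (fun p : Om * V => cs p.1 (fun x => g x p.2)).
Proof.
move=> g0 mg; apply/measurable_EFinP.
pose G (q : (Om * V) * V) : \bar R := (g q.2 q.1.2)%:E.
have mG : measurable_fun [set: (Om * V) * V] G.
  apply/measurable_EFinP.
  apply: (measurableT_comp (f := fun p : V * V => g p.1 p.2) mg
    (g := fun q : (Om * V) * V => (q.2, q.1.2))).
  apply/measurable_fun_pairP; split; first exact: measurable_snd.
  exact: (measurableT_comp (@measurable_snd _ _ Om V) (@measurable_fst _ _ (Om * V)%type V)).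
apply: (@emeasurable_fun_cvg _ _ _ _ (fun n p => \int[tkap A n p]_x G (p, x))%E).
  by move=> n; apply: measurable_tkap_integral => // q; rewrite lee_fin.
move=> [X y] _ /=.
have kf : (kap A (X : conf E) setT = (\sum_(x \in ((\val : E -> V) @^-1` (A `&` setT))) (X : conf E) x)%N%:R%:E)%E.
  exact: kap_count.
set N := (\sum_(x \in _) _)%N in kf.
apply: cvg_near_cst; exists N => // n /= Nn.
rewrite /tkap /= kf lee_fin ler_nat Nn kapE//.
exact: (measurableT_comp mg (measurable_fun_pair (@measurable_id _ V setT) (measurable_cst y))).
Qed.

Lemma measurable_csum2 (g : V -> V -> R) : measurable_fun [set: V * V] (fun p => g p.1 p.2) ->
  measurable_fun [set: Om * V] (fun p : Om * V => cs p.1 (fun x => g x p.2)).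
Proof.
move=> mg.
rewrite (_ : (fun p : Om * V => _) = (fun p : Om * V => cs p.1 (fun x => Num.max (g x p.2) 0) +
    (- 1) * cs p.1 (fun x => Num.max (- g x p.2) 0))); last first.
  apply/funext => p; rewrite -csumZ -csumD; apply: eq_csum => x _.
  by rewrite mulN1r; case: (leP (g x p.2) 0) => h; case: (leP (- g x p.2) 0) => h'; lra.
apply: measurable_funD; last apply: measurable_funM.
- apply: (measurable_csum_nn (g := fun x y => Num.max (g x y) 0)).
    by move=> x y; rewrite le_max lexx orbT.
  exact: measurable_maxr.
- exact: measurable_cst.
- apply: (measurable_csum_nn (g := fun x y => Num.max (- g x y) 0)).
    by move=> x y; rewrite le_max lexx orbT.
  by apply: measurable_maxr => //; exact: measurableT_comp.
Qed.

Lemma measurable_csum (g : V -> R) : measurable_fun [set: V] g ->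
  measurable_fun [set: Om] (fun X : Om => cs X g).
Proof.
move=> mg.
have h : measurable_fun [set: V * V] (fun p : V * V => g p.1).
  exact: (measurableT_comp mg (@measurable_fst _ _ V V)).
exact: (measurableT_comp (measurable_csum2 (g := fun x _ => g x) h)
  (measurable_fun_pair (@measurable_id _ Om setT) (measurable_cst (0 : V)))).
Qed.

Lemma esum_pts (X : conf E) (g : E -> R) : (forall x, 0 <= g x) ->
  (forall x, ~ A (\val x) -> g x = 0) -> (forall x, X x = 0%N -> g x = 0) ->
  (\esum_(x in [set: E]) (g x)%:E = (\sum_(x <- pts A X) g x)%:E)%E.
Proof.
move=> g0 gA gX.
have finB : finite_set ((\val : E -> V) @^-1` A `&` [set x : E | X x != 0%N]).
  exact: mult_locally_finite.
transitivity (\esum_(x in (\val : E -> V) @^-1` A `&` [set x : E | X x != 0%N]) (g x)%:E)%E.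
  rewrite [RHS]esum_mkcond; apply: eq_esum => x _; case: ifPn => // /negP xF.
  suff -> : g x = 0 by [].
  have [Ax|nA] := pselect (A (\val x)); last exact: gA.
  apply: gX; apply/eqP; apply: contra_notT xF => X0; apply/mem_set; split => //.
rewrite esum_fset//; last by move=> x _; rewrite lee_fin.
by rewrite fsbig_finite// sumEFin.
Qed.

Lemma num_points_kap (U : set V) X : measurable U ->
  num_points ((\val : E -> V) @^-1` (A `&` U)) X = kap A (X : conf E) U.
Proof.
move=> mU; rewrite /num_points esum_mkcond.
rewrite (kap_count preB X mU).
transitivity (\esum_(x in [set: E]) ((if x \in (\val : E -> V) @^-1` (A `&` U) then (X x)%:R else 0) : R)%:E)%E.
  by apply: eq_esum => x _; case: ifP.
rewrite (esum_pts (X := X)).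
- congr EFin; rewrite preimage_setI fsbig_mkcondr (@fsum_pts R d A preB nat 0%N _ X); last first.
    by move=> x ->; case: ifP.
  rewrite natr_sum !big_seq; apply: eq_bigr => x xp; have Ax := mem_pts preB xp.
  rewrite in_setI (_ : (x \in \val @^-1` A) = true) ?andTb; last exact/mem_set.
  by case: ifP.
- by move=> x; case: ifP.
- move=> x nA; rewrite ifF//; apply/negbTE/negP => /set_mem[]//.
- by move=> x ->; case: ifP.
Qed.

Lemma campbell_kap (f : V -> \bar R) : measurable_fun [set: V] f -> (forall x, (0 <= f x)%E) ->
  (\int[Pi]_X \int[kap A (X : conf E)]_x f x = \int[vb d]_(x in A) (f x * (dens x)%:E))%E.
Proof.
move=> mf f0.
have md : measurable_fun [set: V] (fun x : V => (dens x)%:E).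
  by apply/measurable_EFinP; exact: measurable_dens.
have d0 x : (0 <= (dens x)%:E)%E by rewrite lee_fin dens_ge0.
have mk (h : V -> \bar R) : measurable_fun [set: V] h -> (forall x, (0 <= h x)%E) ->
    measurable_fun [set: Om] (fun X : Om => \int[kap A (X : conf E)]_x h x)%E.
  move=> mh h0; apply: measurable_fun_integral_kernel => // U mU.
  exact: measurable_kap.
have ind (U : set V) : measurable U -> (\int[Pi]_X \int[kap A (X : conf E)]_x (\1_U x)%:E =
    \int[vb d]_(x in A) ((\1_U x)%:E * (dens x)%:E))%E.
  move=> mU.
  under eq_integral do rewrite integral_indic// setIT -num_points_kap//.
  have := intensity (borel_val (measurableI _ _ mA mU)); rewrite /first_intensity AE => ->.
  rewrite -[LHS]/(\int[vb d]_(z in A `&` U) (dens z)%:E)%E.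
  rewrite integral_mkcondr; apply: eq_integral => x _; rewrite patchE indicE.
  by case: ifP => _; rewrite ?mul1e ?mul0e.
pose f_ n := nnsfun_approx measurableT mf n.
have mf_ n : measurable_fun [set: V] (fun x => (f_ n x)%:E) by exact/measurable_EFinP.
have f_0 n x : (0 <= (f_ n x)%:E)%E by rewrite lee_fin.
have simple n : (\int[Pi]_X \int[kap A (X : conf E)]_x (f_ n x)%:E =
    \int[vb d]_(x in A) ((f_ n x)%:E * (dens x)%:E))%E.
  move: (f_ n) => h; set rg := finmap.enum_fset (fset_set (range h)).
  have rg0 y : y \in rg -> Num.max y 0 = y.
    rewrite in_fset_set// => /set_mem[t _ <-].
    by rewrite max_l.
  have hE x : (h x)%:E = (\sum_(y <- rg) ((Num.max y 0)%:E * (\1_(h @^-1` [set y]) x)%:E))%E.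
    rewrite [in LHS](fimfunE h) fsbig_finite// -sumEFin !big_seq.
    by apply: eq_bigr => y yr; rewrite rg0.
  have mi y : measurable (h @^-1` [set y]) by exact: measurable_sfunP.
  have mhi y : measurable_fun [set: V] (fun x => (\1_(h @^-1` [set y]) x)%:E : \bar R).
    by apply/measurable_EFinP; exact: measurable_indic.
  have c0 (y : R) : 0 <= Num.max y 0 by rewrite le_max lexx orbT.
  have c0e (y : R) : (0 <= (Num.max y 0)%:E)%E by rewrite lee_fin.
  have i0 y x : (0 <= (\1_(h @^-1` [set y]) x)%:E :> \bar R)%E by rewrite lee_fin.
  have L X : (\int[kap A (X : conf E)]_x (h x)%:E = \sum_(y <- rg) ((Num.max y 0)%:E *
      \int[kap A (X : conf E)]_x (\1_(h @^-1` [set y]) x)%:E))%E.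
    under eq_integral do rewrite hE.
    rewrite ge0_integral_sum//.
    - by apply: eq_bigr => y _; rewrite ge0_integralZl_EFin.
    - by move=> y; apply: emeasurable_funM.
    - by move=> y x _; exact: mule_ge0 (c0e y) (i0 y x).
  under eq_integral do rewrite L.
  rewrite ge0_integral_sum//; last 2 first.
  - by move=> y; apply: emeasurable_funM => //; exact: mk.
  - by move=> y X _; apply: mule_ge0 (c0e y) _; apply: integral_ge0 => x _; exact: i0.
  transitivity (\int[vb d]_(x in A) \sum_(y <- rg) ((Num.max y 0)%:E * ((\1_(h @^-1` [set y]) x)%:E * (dens x)%:E)))%E; last first.
    apply: eq_integral => x _; rewrite hE ge0_sume_distrl; last by move=> y _; exact: mule_ge0 (c0e y) (i0 y x).
    by apply: eq_bigr => y _; rewrite muleA.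
  rewrite ge0_integral_sum//; last 2 first.
  - move=> y; apply: measurable_funTS; apply: emeasurable_funM => //.
    by apply: emeasurable_funM.
  - by move=> y x _; apply: mule_ge0 => //; apply: mule_ge0 => //; exact: d0.
  apply: eq_bigr => y _; rewrite ge0_integralZl_EFin//; last 2 first.
  - by move=> X _; apply: integral_ge0 => x _; exact: i0.
  - by apply: mk => // x; exact: i0.
  rewrite ind// -ge0_integralZl_EFin//.
  - by move=> x _; apply: mule_ge0 => //; exact: d0.
  - by apply: measurable_funTS; exact: emeasurable_funM.
have lim x : limn (fun n => (f_ n x)%:E) = f x.
  by apply: cvg_lim => //; exact: cvg_nnsfun_approx.
have nd x : {homo (fun n => (f_ n x)%:E) : n m / (n <= m)%N >-> (n <= m)%E}.
  by move=> n m nm; rewrite lee_fin; exact/lefP/nd_nnsfun_approx.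
transitivity (\int[Pi]_X limn (fun n => \int[kap A (X : conf E)]_x (f_ n x)%:E))%E.
  apply: eq_integral => X _; rewrite -monotone_convergence//.
  by apply: eq_integral => x _; rewrite lim.
rewrite monotone_convergence//.
- transitivity (limn (fun n => \int[vb d]_(x in A) ((f_ n x)%:E * (dens x)%:E))%E).
    by congr (limn _); apply/funext => n; exact: simple.
  rewrite -monotone_convergence//.
  + apply: eq_integral => x _; apply: cvg_lim => //.
    by apply: cvgeZr => //; exact: cvg_nnsfun_approx.
  + by move=> n; apply: measurable_funTS; apply: emeasurable_funM.
  + by move=> n x _; apply: mule_ge0 => //; exact: d0.
  + by move=> x _ n m nm; apply: lee_wpmul2r => //; exact: nd.
- by move=> n; exact: mk.
- by move=> n X _; apply: integral_ge0.
- move=> X _ n m nm; apply: ge0_le_integral => // x _; exact: nd.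
Qed.

Lemma campbell (g : V -> R) : measurable_fun [set: V] g -> (forall x, 0 <= g x) ->
  (\int[Pi]_X (cs X g)%:E = \int[vb d]_(x in A) (g x * dens x)%:E)%E.
Proof.
move=> mg g0; rewrite -(campbell_kap (f := fun x => (g x)%:E)).
- by apply: eq_integral => X _; rewrite kapE.
- exact/measurable_EFinP.
- by move=> x; rewrite lee_fin.
Qed.

Hypothesis dA : (\int[vb d]_(x in A) (dens x)%:E < +oo)%E.

Let fin_dens (g : V -> R) (M : R) : measurable_fun [set: V] g -> (forall x, 0 <= g x) ->
  (forall x, A x -> g x <= M) -> (\int[vb d]_(x in A) (g x * dens x)%:E < +oo)%E.
Proof.
move=> mg g0 gM; have md := measurable_dens (d:=d) beta lambda.
apply: (@le_lt_trans _ _ (\int[vb d]_(x in A) (`|M|%:E * (dens x)%:E))%E).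
  apply: ge0_le_integral => //.
  - by move=> x _; rewrite lee_fin mulr_ge0 ?dens_ge0.
  - by apply/measurable_EFinP; apply: measurable_funTS; apply: measurable_funM.
  - by apply: emeasurable_funM => //; apply/measurable_EFinP; exact: measurable_funTS.
  move=> x Ax; rewrite -EFinM lee_fin ler_wpM2r ?dens_ge0//.
  exact: le_trans (gM _ Ax) (ler_norm _).
rewrite ge0_integralZl_EFin//.
- by rewrite lte_mul_pinfty.
- by move=> x _; rewrite lee_fin dens_ge0.
- by apply/measurable_EFinP; exact: measurable_funTS.
Qed.

Variables (g : V -> R) (M : R).
Hypotheses (mg : measurable_fun [set: V] g) (gM : forall x, A x -> `|g x| <= M).

Let gp x := Num.max (g x) 0.
Let gn x := Num.max (- g x) 0.
Let gpn x : g x = gp x - gn x.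
Proof. by rewrite /gp /gn; case: (leP (g x) 0) => h; case: (leP (- g x) 0) => h'; lra. Qed.
Let gp0 x : 0 <= gp x. Proof. by rewrite le_max lexx orbT. Qed.
Let gn0 x : 0 <= gn x. Proof. by rewrite le_max lexx orbT. Qed.
Let mgp : measurable_fun [set: V] gp. Proof. exact: measurable_maxr. Qed.
Let mgn : measurable_fun [set: V] gn.
Proof. by apply: measurable_maxr => //; exact: measurableT_comp. Qed.
Let gpM x : A x -> gp x <= M.
Proof.
move=> /gM h; rewrite ge_max (le_trans (ler_norm _) h) (le_trans _ h)//.
Qed.
Let gnM x : A x -> gn x <= M.
Proof.
move=> /gM h; rewrite ge_max (le_trans _ h)/=; last by rewrite -normrN ler_norm.
by rewrite (le_trans _ h).
Qed.

Lemma csum_mean : \int[Pi]_X (cs X g) = \int[vb d]_(x in A) (g x * dens x).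
Proof.
have md := measurable_dens (d:=d) beta lambda.
have iOm (k : V -> R) : measurable_fun [set: V] k -> (forall x, 0 <= k x) ->
    (forall x, A x -> k x <= M) -> Pi.-integrable setT (EFin \o (fun X : Om => cs X k)).
  move=> mk k0 kM; apply/integrableP; split.
    by apply/measurable_EFinP; exact: measurable_csum.
  under eq_integral do rewrite /= ger0_norm ?csum_ge0//.
  by rewrite campbell//; exact: fin_dens kM.
have iV (k : V -> R) : measurable_fun [set: V] k -> (forall x, 0 <= k x) ->
    (forall x, A x -> k x <= M) -> (vb d).-integrable A (EFin \o (fun x => k x * dens x)).
  move=> mk k0 kM; apply/integrableP; split.
    by apply/measurable_EFinP; apply: measurable_funTS; exact: measurable_funM.
  have kd x : 0 <= k x * dens x by rewrite mulr_ge0 ?dens_ge0.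
  under eq_integral do rewrite abse_EFin (ger0_norm (kd _)).
  exact: fin_dens kM.
transitivity (\int[Pi]_X (cs X gp - cs X gn)).
  apply: eq_Rintegral => X _; rewrite -mulN1r -csumZ -csumD; apply: eq_csum => x _.
  by rewrite mulN1r -gpn.
rewrite RintegralB//; [|exact: iOm..].
transitivity (\int[vb d]_(x in A) (gp x * dens x - gn x * dens x)).
  rewrite RintegralB//; [|exact: iV..].
  by rewrite /Rintegral !campbell.
by apply: eq_Rintegral => x _; rewrite -mulrBl -gpn.
Qed.

Variable c : R.
Hypothesis varPi : forall f : E -> C R,
  (forall U : set (C R), open U -> borel (f @^-1` U)) ->
  (\int[Pi]_X sum_nneg X (fun x => (cabs (f x) + cabs (f x) ^+ 2)%R) < +oo)%E ->
  (variance_C Pi (sum_complex ^~ f) <=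
   c%:E * \int[Pi]_X sum_nneg X (fun x => (cabs (f x) ^+ 2)%R))%E.

Let f (x : E) : C R := toC (\1_A (\val x : V) * g (\val x)).

Let sum_nneg_f (k : R -> R) (X : conf E) : k 0 = 0 -> (forall t, 0 <= k t) ->
  (sum_nneg X (fun x => k (\1_A (\val x : V) * g (\val x))%R) = (csum A X (fun x => k (g x)))%:E)%E.
Proof.
move=> k0 kp; rewrite /sum_nneg.
rewrite (esum_pts (X := X) (g := fun x => (X x)%:R * k (\1_A (\val x : V) * g (\val x)))).
- congr EFin; rewrite /csum !big_seq; apply: eq_bigr => x xp; congr (_ * k _).
  by rewrite indicE mem_set ?mul1r//; exact: mem_pts xp.
- by move=> x; rewrite mulr_ge0.
- by move=> x nA; rewrite indicE memNset// mul0r k0 mulr0.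
- by move=> x ->; rewrite mul0r.
Qed.

Lemma csum_variance :
  (\int[Pi]_X ((cs X g - \int[vb d]_(x in A) (g x * dens x)) ^+ 2)%:E <=
   c%:E * \int[vb d]_(x in A) (g x ^+ 2 * dens x)%:E)%E.
Proof.
have SX (X : conf E) : sum_complex X f = toC (csum A X g).
  apply: ceqP.
    rewrite -[LHS]/(Defs.sum_real X (fun x => \1_A (\val x : V) * g (\val x))) /Defs.sum_real.
    have m0 (t : R) : 0 <= Num.max t 0 by rewrite le_max lexx orbT.
    have k0 : Num.max (0 : R) 0 = 0 by rewrite maxxx.
    have k1 : Num.max (- 0 : R) 0 = 0 by rewrite oppr0 maxxx.
    rewrite (sum_nneg_f (k := fun t => Num.max t 0) X k0 m0).
    rewrite (sum_nneg_f (k := fun t => Num.max (- t) 0) X k1 (fun t => m0 (- t))).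
    rewrite /= -mulN1r -(csumZ X) -(csumD X); apply: (eq_csum X) => x _.
    by rewrite mulN1r -gpn.
  rewrite -[LHS]/(Defs.sum_real X (fun x => 0)) /Defs.sum_real oppr0; exact: subrr.
have VE : variance_C Pi (sum_complex ^~ f) =
    (\int[Pi]_X ((cs X g - \int[vb d]_(x in A) (g x * dens x)) ^+ 2)%:E)%E.
  have EE : expectation_C Pi (sum_complex ^~ f) = toC (\int[vb d]_(x in A) (g x * dens x)).
    apply: ceqP; rewrite /expectation_C /=.
      by rewrite -csum_mean; apply: eq_Rintegral => X _; exact: (congr1 (@cRe R) (SX X)).
    rewrite [LHS](_ : _ = \int[Pi]_X 0); last by apply: eq_Rintegral => X _; exact: (congr1 (@cIm R) (SX X)).
    by rewrite /Rintegral integral0.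
  apply: eq_integral => X _; rewrite EE SX -toCB cabs_toC; congr EFin.
  by rewrite real_normK// num_real.
have cf x : cabs (f x) = `|\1_A (\val x : V) * g (\val x)| by rewrite /f cabs_toC.
have n2 : (\int[Pi]_X sum_nneg X (fun x => (cabs (f x) ^+ 2)%R) =
    \int[vb d]_(x in A) (g x ^+ 2 * dens x)%:E)%E.
  rewrite -(campbell (g := fun x => g x ^+ 2)); last 2 first.
  - exact: measurable_funX.
  - by move=> x; exact: sqr_ge0.
  apply: eq_integral => X _; rewrite -(sum_nneg_f (k := fun t => t ^+ 2)) ?expr0n//; last first.
    by move=> t; exact: sqr_ge0.
  by congr sum_nneg; apply/funext => x; rewrite cf real_normK// num_real.
rewrite -VE -n2; apply: varPi.
- move=> U oU.
  have mh : measurable_fun [set: V] (fun x : V => \1_A x * g x : R).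
    by apply: measurable_funM => //; exact: measurable_indic.
  have oT : open [set t : R | U (toC t)].
    apply: (open_comp (f := fun t : R => toC t)) oU => t _.
    apply/(@cvg_cabsP _ _ (nbhs t) (nbhs_filter t)) => e e0.
    apply/nbhs_ballP; exists e => // t' /=; rewrite /ball /= => h.
    by rewrite -toCB cabs_toC distrC.
  have := mh measurableT _ (open_measurable oT); rewrite setTI => /borel_val.
  by congr borel; apply/seteqP; split.
- have -> : (\int[Pi]_X sum_nneg X (fun x => (cabs (f x) + cabs (f x) ^+ 2)%R) =
      \int[vb d]_(x in A) ((`|g x| + g x ^+ 2) * dens x)%:E)%E.
    rewrite -(campbell (g := fun x => `|g x| + g x ^+ 2)); last 2 first.
    + by apply: measurable_funD; [exact: measurableT_comp|exact: measurable_funX].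
    + by move=> x; rewrite addr_ge0 ?sqr_ge0.
    apply: eq_integral => X _; rewrite -(sum_nneg_f (k := fun t => `|t| + t ^+ 2)); last 2 first.
    + by rewrite normr0 expr0n addr0.
    + by move=> t; rewrite addr_ge0 ?sqr_ge0.
    by congr sum_nneg; apply/funext => x; rewrite cf real_normK// num_real.
  apply: (fin_dens (M := M + M ^+ 2)).
  + by apply: measurable_funD; [exact: measurableT_comp|exact: measurable_funX].
  + by move=> x; rewrite addr_ge0 ?sqr_ge0.
  + move=> x /gM h; apply: lerD => //.
    by rewrite -[leLHS]real_normK ?num_real// lerXn2r ?nnegrE// (le_trans _ h).
Qed.

End Moments.

(** * Mean square deviation of the weighted kernel sums *)

Section Regions.
Context {R : realType} {d : nat} (d0 : (0 < d)%N) (alpha beta lambda : R).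
Hypotheses (alpha1 : -1 < alpha) (abeta : alpha + d%:R + 1 <= beta) (lambda0 : 0 < lambda).
Local Notation V := (@Cvec R d).
Local Notation E := (uball R d).
Local Notation Om := (Conf E).
Local Notation K := (bergman_kernel alpha).
Local Notation a := (d%:R + 1 + alpha).
Local Notation bc := (@bergman_const R d alpha).
Local Notation dens := (dens beta lambda).
Variable (z : 'rV[C R]_d).
Hypothesis z1 : cnorm z < 1.
Local Notation w s := (weight beta s z).
Local Notation reg := (reg z).

Let bd0 : 0 <= beta - d%:R.
Proof.
have a1 : 0 < 1 + alpha by rewrite -ltrBlDl sub0r.
by have := abeta; lra.
Qed.

Lemma beta_ge0 : 0 <= beta.
Proof. by apply: le_trans bd0 _; rewrite gerBl. Qed.

Let z2 : 0 < 1 - cnorm z ^+ 2. Proof. by rewrite lt1_sqr ?cnorm_ge0. Qed.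

Definition regr j : R := Num.sqrt (1 - (1 - cnorm z ^+ 2) * (1 - rho j%:R ^+ 2) / 4).

Let regd (j : nat) : 0 < (1 - cnorm z ^+ 2) * (1 - rho j%:R ^+ 2) / 4.
Proof. by rewrite divr_gt0// mulr_gt0// lt1_sqr ?rho_lt1 ?rho_ge0. Qed.

Lemma regr_lt1 j : regr j < 1.
Proof. by rewrite -[ltRHS]sqrtr1 ltr_sqrt// gtrBl. Qed.

Lemma reg_regr i j (x : V) : reg i j x -> cnorm (x : 'rV[C R]_d) <= regr j.
Proof.
move=> rx; have [x1 ux] := iffLR (regE z1 i j x) rx; have [u1 /andP[_ bu]] := ux.
have x0 := cnorm_ge0 (x : 'rV[C R]_d).
rewrite -[leLHS]ger0_norm// -sqrtr_sqr /regr ler_wsqrtr//.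
have ur := bu; rewrite bd_lt// in ur.
have UE := mobius_ball z1 x1.
have q0 : 0 < cabs (1 - cdot (x : 'rV[C R]_d) (conjv z)) ^+ 2.
  by rewrite exprn_gt0// cabs_gt0; exact: den_neq0.
have n0 := cnorm_ge0 z.
have q4 : (1 - cnorm z ^+ 2) ^+ 2 <= 4 * cabs (1 - cdot (x : 'rV[C R]_d) (conjv z)) ^+ 2.
  have h : 1 - cnorm z <= cabs (1 - cdot (x : 'rV[C R]_d) (conjv z)).
    apply: le_trans (le_trans (ler_norm _) (ler_cRe _)).
    by apply: le_trans (cRe_1B_ge _ _); nra.
  rewrite (_ : 4 * _ = (2 * cabs (1 - cdot (x : 'rV[C R]_d) (conjv z))) ^+ 2); last by ring.
  rewrite lerXn2r ?nnegrE ?mulr_ge0 ?cabs_ge0 ?(ltW z2)//; nra.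
have U1 : 1 - rho j%:R ^+ 2 <= 1 - cnorm (mobius z x) ^+ 2.
  by rewrite lerD2l lerN2 lerXn2r ?nnegrE ?cnorm_ge0 ?rho_ge0// ltW.
move: U1 UE q0 q4 z2; have x2 : 0 <= 1 - cnorm (x : 'rV[C R]_d) ^+ 2.
  by rewrite ltW// lt1_sqr.
have -> : cnorm (x : 'rV[C R]_d) ^+ 2 = 1 - (1 - cnorm (x : 'rV[C R]_d) ^+ 2) by ring.
move: x2; move: (1 - cnorm x ^+ 2) (cabs _ ^+ 2) (1 - cnorm (mobius z x) ^+ 2) (1 - cnorm z ^+ 2) (1 - rho j%:R ^+ 2).
move=> Q q U P r Q0 rU UE q0 q4 P0; rewrite lerD2l lerN2 ler_pdivrMr//.
apply: le_trans (ler_wpM2l (ltW P0) rU) _; rewrite UE.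
rewrite (_ : P * (P * _ / q) = P ^+ 2 / q * Q); last by ring.
by rewrite mulrC ler_wpM2l// ler_pdivrMr.
Qed.

Let preR i j : precompact ((\val : E -> V) @^-1` reg i j : set E).
Proof. by apply: (precompact_ball (regr_lt1 j)) => x; exact: reg_regr. Qed.

Lemma dens_reg_lty i j : (i <= j)%N -> (\int[vb d]_(x in reg i j) (dens x)%:E < +oo)%E.
Proof.
move=> ij; have mA := measurable_reg z1 ij.
set k := (1 - cnorm z ^+ 2) * (1 - rho j%:R ^+ 2) / 4; have k0 : 0 < k := regd j.
pose M := lambda / k `^ (beta + 1).
have b1 : 0 <= beta + 1 by rewrite addr_ge0// beta_ge0.
apply: (@le_lt_trans _ _ (\int[vb d]_(x in reg i j) (cst M%:E x))%E).
  apply: ge0_le_integral => //.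
  - by move=> x _; rewrite lee_fin dens_ge0.
  - by apply/measurable_EFinP; apply: measurable_funTS; exact: measurable_dens.
  move=> x rx; rewrite lee_fin /Defs.weight.
  have x1 := reg_regr rx.
  have kx : k <= 1 - cnorm (x : 'rV[C R]_d) ^+ 2.
    have k1 : 0 <= 1 - k.
      rewrite subr_ge0 /k ler_pdivrMr// mul1r.
      have := sqr_ge0 (cnorm z); have := sqr_ge0 (rho j%:R : R).
      have : rho j%:R ^+ 2 <= 1 :> R by rewrite expr_le1 ?rho_ge0// ltW ?rho_lt1.
      by have := z2; nra.
    have : cnorm (x : 'rV[C R]_d) ^+ 2 <= regr j ^+ 2 by rewrite lerXn2r ?nnegrE ?cnorm_ge0 ?sqrtr_ge0.
    have aux (u v : R) : v <= 1 - u -> u <= 1 - v by lra.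
    have E2 : regr j ^+ 2 = 1 - k by rewrite /regr sqr_sqrtr.
    by rewrite E2; exact: aux.
  rewrite ler_pM2l// lef_pV2 ?posrE ?powR_gt0//; last exact: lt_le_trans kx.
  by rewrite ge0_ler_powR ?nnegrE ?(ltW k0)// (le_trans _ kx)// ltW.
rewrite integral_cst//.
have M0 : 0 <= M by rewrite divr_ge0 ?powR_ge0// ltW.
rewrite lte_mul_pinfty// (@le_lt_trans _ _ (vb d (uball R d)))//; last by rewrite vb_uball ltry.
by apply: le_measure; rewrite ?inE//; [exact: measurable_uball|move=> x []].
Qed.

Lemma weight_le s (x : 'rV[C R]_d) : 0 <= s -> cnorm x < 1 ->
  w s x <= (4 / (1 - cnorm z ^+ 2)) `^ (beta - d%:R).
Proof.
move=> s0 x1; have mx := mobius_lt1 z1 x1.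
have m0 := cnorm_ge0 (mobius z x).
have D0 : 0 <= dB z x.
  by rewrite (dBE z1 x1) ln_ge0// ler_pdivlMr ?subr_gt0// mul1r; lra.
rewrite /weight -[leRHS]mul1r; apply: ler_pM; rewrite ?expR_ge0 ?powR_ge0//.
  by rewrite expR_le1 mulNr oppr_le0 mulr_ge0.
rewrite ge0_ler_powR ?nnegrE ?divr_ge0 ?sqr_ge0 ?(ltW z2)//.
rewrite ler_wpM2r ?invr_ge0 ?(ltW z2)//.
rewrite (_ : 4 = 2 ^+ 2); last by ring.
by rewrite lerXn2r ?nnegrE ?cabs_ge0// cabs_1B_le// ltW.
Qed.

(** The kernel cut off outside the ball, in a form that is jointly measurable. *)
Definition kb (y x : 'rV[C R]_d) : C R :=
  if cnorm y < 1 then (if cnorm x < 1 then K y x else 0) else 0.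

Lemma cmeas_kb : cmeas (fun p : V * V => kb p.1 p.2).
Proof.
have f1 := @measurable_fst _ _ V V; have f2 := @measurable_snd _ _ V V.
pose q (p : V * V) : C R := 1 - cdot (p.1 : 'rV[C R]_d) (conjv (p.2 : 'rV[C R]_d)).
have mq : cmeas q by apply: cmeasB; [exact: cmeas_cst|exact: cmeas_cdot].
have [mq1 mq2] := mq.
have mt : measurable_fun [set: V * V] (fun p => a * atan (cIm (q p) / cRe (q p))).
  apply: measurable_funM; first exact: measurable_cst.
  apply: (measurableT_comp (continuous_measurable_fun (@continuous_atan R))).
  apply: measurable_funM => //.
  by have [+ _] := cmeasV (cmeas_toC mq1); congr measurable_fun; apply/funext => u; rewrite -toCV.
pose k (p : V * V) : C R := toC bc / (toC (cabs (q p) `^ a) * cis (a * atan (cIm (q p) / cRe (q p)))).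
have mk : cmeas k.
  apply: cmeasM; first exact: cmeas_cst.
  apply: cmeasV; apply: cmeasM.
    by apply: cmeas_toC; apply: measurable_powRc; exact: measurable_cabs.
  split; rewrite /cis /=.
    exact: (measurableT_comp (continuous_measurable_fun (@continuous_cos R)) mt).
  exact: (measurableT_comp (continuous_measurable_fun (@continuous_sin R)) mt).
rewrite (_ : (fun p : V * V => _) = (fun p : V * V => if cnorm (p.1 : 'rV[C R]_d) < 1 then
    (if cnorm (p.2 : 'rV[C R]_d) < 1 then k p else 0) else 0)); last first.
  apply/funext => p; rewrite /kb; case: ifPn => // p1; case: ifPn => // p2.
  by rewrite /k /bergman_kernel cpow_pos ?cRe_1B_gt0.
have l1 : measurable_fun [set: V * V] (fun p : V * V => cnorm (p.1 : 'rV[C R]_d) < 1).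
  apply: measurable_lt_fun; last exact: measurable_cst.
  exact: (measurableT_comp (@measurable_cnorm R d) f1).
have l2 : measurable_fun [set: V * V] (fun p : V * V => cnorm (p.2 : 'rV[C R]_d) < 1).
  apply: measurable_lt_fun; last exact: measurable_cst.
  exact: (measurableT_comp (@measurable_cnorm R d) f2).
have [mk1 mk2] := mk; have m0 := measurable_cst (0 : R).
split.
  rewrite (_ : (fun p : V * V => _) = (fun p : V * V => if cnorm (p.1 : 'rV[C R]_d) < 1 then
    (if cnorm (p.2 : 'rV[C R]_d) < 1 then cRe (k p) else 0) else 0)).
    by apply: measurable_fun_ifT => //; apply: measurable_fun_ifT.
  by apply/funext => p; do 2 case: ifP => // _.
rewrite (_ : (fun p : V * V => _) = (fun p : V * V => if cnorm (p.1 : 'rV[C R]_d) < 1 then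
    (if cnorm (p.2 : 'rV[C R]_d) < 1 then cIm (k p) else 0) else 0)).
  by apply: measurable_fun_ifT => //; apply: measurable_fun_ifT.
by apply/funext => p; do 2 case: ifP => // _.
Qed.

Definition Lr s i j (X : conf E) (y : 'rV[C R]_d) : C R :=
  \sum_(x <- pts (reg i j) X) (X x)%:R * (toC (w s (\val x)) * K y (\val x)).

Let rem s y (x : V) : R := w s x * cRe (kb y x).
Let imm s y (x : V) : R := w s x * cIm (kb y x).

Lemma LrE s i j X y : cnorm y < 1 ->
  Lr s i j X y = Complex (csum (reg i j) X (rem s y)) (csum (reg i j) X (imm s y)).
Proof.
move=> y1; have natC (n : nat) : (n%:R : C R) = toC n%:R.
  by elim: n => [|n IH]//; rewrite -!natr1 IH toCD toC1.
have kE (x : E) : kb y (\val x) = K y (\val x).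
  by have := valP x; rewrite inE /uball /= => x1; rewrite /kb y1 x1.
apply: ceqP; rewrite ?cRe_sum ?cIm_sum /=; apply: eq_bigr => x _.
  by rewrite /rem kE natC !cE !mul0r ?mulr0 !subr0.
by rewrite /imm kE natC !cE !mul0r ?mulr0 ?subr0 !addr0.
Qed.

Variable s : R.
Hypothesis bs : beta < s.
Let s0 : 0 <= s. Proof. exact: le_trans beta_ge0 (ltW bs). Qed.
Variables i j : nat.
Hypothesis ij : (i <= j)%N.
Local Notation A := (reg i j).
Let mA : measurable A := measurable_reg z1 ij.

Let k4 : R := (4 / (1 - cnorm z ^+ 2)) `^ (beta - d%:R).
Local Notation cc := (cw (d:=d) beta lambda s i j).

Lemma region_mean_re (H : 'rV[C R]_d -> C R) (M : R) : holo H ->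
  (forall x, cnorm x < 1 -> cabs (H x) <= M) ->
  \int[vb d]_(x in A) (w s x * cRe (H x) * dens x) = cRe (H z) * cc.
Proof.
move=> hH HM; have := congr1 (@cRe R) (region_mean d0 beta lambda z1 s0 ij hH HM).
rewrite [in RHS]cReM [X in _ - _ * X]/= mulr0 subr0 => <-.
rewrite /cint /= /Rintegral; congr fine; rewrite integral_mkcond.
apply: eq_integral => x _; rewrite patchE indicE /on_ball.
case: ifPn => xA; last by rewrite mul0r cReM /= !mulr0 subr0.
by rewrite (proj1 (set_mem xA)) mul1r cReM /= mulr0 subr0; congr EFin; ring.
Qed.

Lemma region_mean_im (H : 'rV[C R]_d -> C R) (M : R) : holo H ->
  (forall x, cnorm x < 1 -> cabs (H x) <= M) ->
  \int[vb d]_(x in A) (w s x * cIm (H x) * dens x) = cIm (H z) * cc.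
Proof.
move=> hH HM; have := congr1 (@cIm R) (region_mean d0 beta lambda z1 s0 ij hH HM).
rewrite [in RHS]cImM [X in _ * X + _]/= mulr0 add0r => <-.
rewrite /cint /= /Rintegral; congr fine; rewrite integral_mkcond.
apply: eq_integral => x _; rewrite patchE indicE /on_ball.
case: ifPn => xA; last by rewrite mul0r cImM /= !mulr0 add0r.
by rewrite (proj1 (set_mem xA)) mul1r cImM /= mulr0 add0r; congr EFin; ring.
Qed.

Let mw : measurable_fun [set: V] (fun x : V => w s x) := measurable_weight beta z s.
Let md : measurable_fun [set: V] (fun x : V => dens x) := measurable_dens beta lambda.

Let mkb1 (y : V) : cmeas (fun x : V => kb y x).
Proof.
have mp := measurable_fun_pair (measurable_cst y) (@measurable_id _ V setT).
have [m1 m2] := cmeas_kb.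
by split; [exact: (measurableT_comp m1 mp)|exact: (measurableT_comp m2 mp)].
Qed.

Let mkb2 (x : V) : cmeas (fun y : V => kb y x).
Proof.
have mp := measurable_fun_pair (@measurable_id _ V setT) (measurable_cst x).
have [m1 m2] := cmeas_kb.
by split; [exact: (measurableT_comp m1 mp)|exact: (measurableT_comp m2 mp)].
Qed.

Let mkbs : cmeas (fun p : V * V => kb p.2 p.1).
Proof.
have mp := measurable_fun_pair (@measurable_snd _ _ V V) (@measurable_fst _ _ V V).
have [m1 m2] := cmeas_kb.
by split; [exact: (measurableT_comp m1 mp)|exact: (measurableT_comp m2 mp)].
Qed.

Let mrem : measurable_fun [set: V * V] (fun p : V * V => rem s p.2 p.1).
Proof.
apply: measurable_funM; last by have [] := mkbs.
exact: (measurableT_comp mw (@measurable_fst _ _ V V)).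
Qed.

Let mimm : measurable_fun [set: V * V] (fun p : V * V => imm s p.2 p.1).
Proof.
apply: measurable_funM; last by have [] := mkbs.
exact: (measurableT_comp mw (@measurable_fst _ _ V V)).
Qed.

Let kbE y x : cnorm y < 1 -> cnorm x < 1 -> kb y x = (K x y)^*.
Proof. by move=> y1 x1; rewrite /kb y1 x1; exact: kernel_conj. Qed.

Let Mb (y : 'rV[C R]_d) := bc / (1 - cnorm y) `^ a.

Let kb_le y x : cnorm y < 1 -> cnorm x < 1 -> cabs (kb y x) <= Mb y.
Proof. by move=> y1 x1; rewrite kbE// cabsJ; exact: kernel_bound. Qed.

Variable Pi : probability Om R.
Hypothesis intensity : forall B : set E, borel B -> first_intensity Pi B =
  (\int[v_ d]_(x in [set \val x | x in B]) (lambda / (1 - cnorm x ^+ 2) `^ (beta + 1))%:E)%E.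
Variable c : R.
Hypothesis c0 : 0 < c.
Hypothesis varPi : forall f : E -> C R,
  (forall U : set (C R), open U -> borel (f @^-1` U)) ->
  (\int[Pi]_X sum_nneg X (fun x => (cabs (f x) + cabs (f x) ^+ 2)%R) < +oo)%E ->
  (variance_C Pi (sum_complex ^~ f) <=
   c%:E * \int[Pi]_X sum_nneg X (fun x => (cabs (f x) ^+ 2)%R))%E.

Let var (g : V -> R) (M : R) : measurable_fun [set: V] g -> (forall x, A x -> `|g x| <= M) ->
  (\int[Pi]_X ((csum A (X : conf E) g - \int[vb d]_(x in A) (g x * dens x)) ^+ 2)%:E <=
   c%:E * \int[vb d]_(x in A) (g x ^+ 2 * dens x)%:E)%E.
Proof.
move=> mg gM.
exact: (csum_variance lambda0 intensity mA (regr_lt1 j) (@reg_regr i j) (dens_reg_lty ij) mg gM varPi).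
Qed.

Let w_le x : A x -> `|w s x| <= k4.
Proof. by move=> [x1 _]; rewrite ger0_norm ?weight_ge0// weight_le. Qed.

(** As [1 - |x|^2 <= 1], the second moment of the weights is dominated by that of the
    kernels. *)
Lemma weight_variance :
  (\int[Pi]_X ((csum A (X : conf E) (fun x => w s x) - cc) ^+ 2)%:E <=
   (c / bc)%:E * \sum_(i <= k < j) (regV alpha beta lambda z * (expR (- (s - beta)) ^+ 2) ^+ k)%:E)%E.
Proof.
have b0 := @bergman_const_gt0 R d d0 alpha alpha1.
have mean : \int[vb d]_(x in A) (w s x * dens x) = cc.
  have := region_mean_re (M := 1) (holo_cst (1 : C R)) (fun x _ => ltac:(by rewrite cabs1)).
  rewrite mul1r => <-; apply: eq_Rintegral => x _; by rewrite mulr1.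
have := var mw w_le; rewrite mean => h; apply: le_trans h _.
rewrite EFinM -muleA; apply: lee_wpmul2l; first by rewrite lee_fin ltW.
apply: le_trans (lee_wpmul2l _ (regV_le d0 alpha1 abeta lambda0 z1 bs ij)); last first.
  by rewrite lee_fin invr_ge0 ltW.
have mI : measurable_fun [set: V] (fun x : V => \1_A x * (w s x ^+ 2 *
    (bc / (1 - cnorm (x : 'rV[C R]_d) ^+ 2) `^ a) * dens x)).
  apply: measurable_funM; first exact: measurable_indic.
  apply: measurable_funM => //; apply: measurable_funM; first exact: measurable_funX.
  apply: measurable_funM; first exact: measurable_cst.
  apply: measurable_nninv; first by move=> x; exact: powR_ge0.
  apply: measurable_powRc; apply: measurable_funB; first exact: measurable_cst.
  by apply: measurable_funX; exact: measurable_cnorm.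
have I0 (x : V) : 0 <= \1_A x * (w s x ^+ 2 *
    (bc / (1 - cnorm (x : 'rV[C R]_d) ^+ 2) `^ a) * dens x).
  rewrite mulr_ge0// mulr_ge0 ?dens_ge0// mulr_ge0 ?sqr_ge0//.
  by rewrite divr_ge0 ?powR_ge0// ltW.
rewrite -ge0_integralZl_EFin//; last 3 first.
- by move=> x _; rewrite lee_fin.
- exact/measurable_EFinP.
- by rewrite invr_ge0 ltW.
rewrite [leLHS]integral_mkcond; apply: ge0_le_integral => //.
- by move=> x _; rewrite patchE; case: ifP => // _; rewrite lee_fin mulr_ge0 ?sqr_ge0 ?dens_ge0.
- apply/(measurable_restrictT _ mA); apply: measurable_funTS; apply/measurable_EFinP.
  by apply: measurable_funM => //; exact: measurable_funX.
- by apply: emeasurable_funM => //; exact/measurable_EFinP.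
move=> x _; rewrite patchE -EFinM; case: ifPn => xA; last first.
  by rewrite -[leLHS]/(0%E : \bar R) lee_fin; apply: mulr_ge0 => //; rewrite invr_ge0 ltW.
rewrite lee_fin indicE xA mul1r.
have x1 : cnorm (x : 'rV[C R]_d) < 1 by have [] := set_mem xA.
have x2 : 0 < 1 - cnorm (x : 'rV[C R]_d) ^+ 2 by rewrite lt1_sqr ?cnorm_ge0.
rewrite (_ : bc^-1 * _ = w s x ^+ 2 * ((1 - cnorm (x : 'rV[C R]_d) ^+ 2) `^ a)^-1 * dens x); last first.
  have bn : bc != 0 by rewrite gt_eqF.
  move: bn; move: bc ((_ `^ _)^-1) (w s x ^+ 2) (dens x) => u v p q un.
  by rewrite (_ : p * (u * v) * q = u * (p * v * q)) ?mulKf//; ring.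
rewrite ler_wpM2r ?dens_ge0//.
rewrite ler_peMr ?sqr_ge0// invf_ge1 ?powR_gt0//.
have e1 : (1 : R) `^ a = 1 by rewrite powR1.
rewrite -[leRHS]e1; apply: ge0_ler_powR; rewrite ?nnegrE ?(ltW x2)//; last by rewrite gerBl sqr_ge0.
exact/ltW/kexp_gt0.
Qed.

Let Phi (q : Om * V) : R :=
  ((csum A (q.1 : conf E) (rem s q.2) - cRe (kb q.2 z) * cc) ^+ 2 +
   (csum A (q.1 : conf E) (imm s q.2) - cIm (kb q.2 z) * cc) ^+ 2) * wt alpha q.2.

Let mPhi : measurable_fun [set: Om * V] Phi.
Proof.
have f2 := @measurable_snd _ _ Om V.
have [k1 k2] := mkb2 z.
apply: measurable_funM; last exact: (measurableT_comp (@measurable_wt R d alpha) f2).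
apply: measurable_funD; apply: measurable_funX; apply: measurable_funB.
- exact: (measurable_csum2 mA (regr_lt1 j) (@reg_regr i j) (g := fun x y => rem s y x) mrem).
- by apply: measurable_funM; [exact: (measurableT_comp k1 f2)|exact: measurable_cst].
- exact: (measurable_csum2 mA (regr_lt1 j) (@reg_regr i j) (g := fun x y => imm s y x) mimm).
- by apply: measurable_funM; [exact: (measurableT_comp k2 f2)|exact: measurable_cst].
Qed.

Let Phi0 q : 0 <= Phi q.
Proof. by rewrite mulr_ge0 ?wt_ge0// addr_ge0 ?sqr_ge0. Qed.

Definition kdev (X : Om) : \bar R :=
  sqnorm alpha (fun y => Lr s i j (X : conf E) y - toC cc * K y z).

Let kdevE X : kdev X = (\int[vb d]_y (Phi (X, y))%:E)%E.
Proof.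
apply: eq_integral => y _; rewrite /Phi /=.
have [y1|y1] := boolP (cnorm (y : 'rV[C R]_d) < 1); last by rewrite wt_out// !mulr0.
have -> : kb y z = K y z by rewrite /kb y1 z1.
rewrite LrE// sqr_cabs; move: (K y z) => k.
rewrite cReD cReN cImD cImN cReM cImM [cRe (toC _)]/= [cIm (toC _)]/=.
by rewrite !mul0r subr0 addr0 ![cc * _]mulrC.
Qed.

Lemma measurable_kdev : measurable_fun [set: Om] kdev.
Proof.
rewrite (_ : kdev = fun X => (\int[vb d]_y (Phi (X, y))%:E)%E); last by apply/funext.
have mF : measurable_fun [set: Om * V] (fun q => (Phi q)%:E) by exact/measurable_EFinP.
exact: (@measurable_fun_fubini_tonelli_F _ _ _ _ R (vb d) _ mF (fun q => ltac:(by rewrite lee_fin))).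
Qed.

Let var_pt (y : V) : cnorm (y : 'rV[C R]_d) < 1 -> (\int[Pi]_X (Phi (X, y))%:E <=
  c%:E * \int[vb d]_(x in A) ((w s x ^+ 2 * cabs (kb y x) ^+ 2 * dens x) * wt alpha y)%:E)%E.
Proof.
move=> y1.
have hK : holo (K ^~ y) by exact: holo_kernel.
have KM x : cnorm x < 1 -> cabs (K x y) <= Mb y by exact: kernel_bound.
have [m1 m2] := mkb1 y.
have mr : measurable_fun [set: V] (rem s y) by exact: measurable_funM.
have mi : measurable_fun [set: V] (imm s y) by exact: measurable_funM.
have k40 : 0 <= k4 by exact: powR_ge0.
have rM x : A x -> `|rem s y x| <= k4 * Mb y.
  move=> Ax; have [x1 _] := Ax; rewrite normrM ler_pM ?w_le//.
  by apply: le_trans (ler_cRe _) _; exact: kb_le.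
have iM x : A x -> `|imm s y x| <= k4 * Mb y.
  move=> Ax; have [x1 _] := Ax; rewrite normrM ler_pM ?w_le//.
  by apply: le_trans (ler_cIm _) _; exact: kb_le.
have Er : \int[vb d]_(x in A) (rem s y x * dens x) = cRe (kb y z) * cc.
  rewrite kbE// cReJ -(region_mean_re hK KM); apply: eq_Rintegral => x /set_mem[x1 _].
  by rewrite /rem kbE// cReJ.
have Ei : \int[vb d]_(x in A) (imm s y x * dens x) = cIm (kb y z) * cc.
  have hK' : holo (fun x => (-1) * K x y) by exact: holoM (holo_cst _) hK.
  have KM' x : cnorm x < 1 -> cabs (-1 * K x y) <= Mb y by move=> x1; rewrite mulN1r cabsN KM.
  have := region_mean_im hK' KM'; rewrite kbE// cImJ mulN1r cImN => <-.
  by apply: eq_Rintegral => x /set_mem[x1 _]; rewrite /imm kbE// cImJ mulN1r cImN.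
have v1 := var mr rM; have v2 := var mi iM; rewrite Er in v1; rewrite Ei in v2.
have ms (g : V -> R) m : measurable_fun [set: V] g ->
    measurable_fun [set: Om] (fun X : Om => ((csum A (X : conf E) g - m) ^+ 2)%:E).
  move=> mg; apply/measurable_EFinP; apply: measurable_funX; apply: measurable_funB => //.
  exact: (measurable_csum mA (regr_lt1 j) (@reg_regr i j)).
have q0 (g : V -> R) m X : (0 <= ((csum A (X : conf E) g - m) ^+ 2)%:E)%E by rewrite lee_fin sqr_ge0.
have wt0 := wt_ge0 alpha (y : 'rV[C R]_d).
have -> : (\int[Pi]_X (Phi (X, y))%:E = (wt alpha y)%:E *
    (\int[Pi]_X ((csum A (X : conf E) (rem s y) - cRe (kb y z) * cc) ^+ 2)%:E +
    \int[Pi]_X ((csum A (X : conf E) (imm s y) - cIm (kb y z) * cc) ^+ 2)%:E))%E.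
  rewrite -ge0_integralD//; [|exact: ms..].
  rewrite -ge0_integralZl_EFin//.
  - by apply: eq_integral => X _; rewrite -EFinD -EFinM mulrC.
  - by move=> X _; apply: adde_ge0; exact: q0.
  - by apply: emeasurable_funD; exact: ms.
have mJ (g : V -> R) : measurable_fun [set: V] g ->
    measurable_fun A (fun x : V => (g x ^+ 2 * dens x)%:E).
  move=> mg; apply: measurable_funTS; apply/measurable_EFinP.
  by apply: measurable_funM => //; exact: measurable_funX.
have J0 (g : V -> R) x : (0 <= (g x ^+ 2 * dens x)%:E)%E.
  by rewrite lee_fin mulr_ge0 ?sqr_ge0 ?dens_ge0.
have -> : (\int[vb d]_(x in A) ((w s x ^+ 2 * cabs (kb y x) ^+ 2 * dens x) * wt alpha y)%:E =
    (wt alpha y)%:E * (\int[vb d]_(x in A) (rem s y x ^+ 2 * dens x)%:E +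
      \int[vb d]_(x in A) (imm s y x ^+ 2 * dens x)%:E))%E.
  rewrite -ge0_integralD//; [|exact: mJ..].
  rewrite -ge0_integralZl_EFin//.
  - apply: eq_integral => x _; rewrite -EFinD -EFinM sqr_cabs; congr EFin.
    by rewrite /rem /imm; ring.
  - by move=> x _; apply: adde_ge0; exact: J0.
  - by apply: emeasurable_funD; exact: mJ.
rewrite muleCA; apply: lee_wpmul2l; first by rewrite lee_fin.
rewrite ge0_muleDr; [exact: leeD|by apply: integral_ge0 => x _; exact: J0..].
Qed.

(** Integrating the variance at [y] over the ball turns [|K(y, x)|^2] into [K(x, x)]. *)
Lemma kernel_variance :
  (\int[Pi]_X kdev X <=
   c%:E * \sum_(i <= k < j) (regV alpha beta lambda z * (expR (- (s - beta)) ^+ 2) ^+ k)%:E)%E.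
Proof.
have mF : measurable_fun [set: Om * V] (fun q => (Phi q)%:E) by exact/measurable_EFinP.
have F0 q : (0 <= (Phi q)%:E)%E by rewrite lee_fin.
rewrite (_ : (\int[Pi]_X kdev X = \int[Pi]_X \int[vb d]_y (Phi (X, y))%:E)%E); last first.
  by apply: eq_integral => X _; exact: kdevE.
rewrite (@fubini_tonelli _ _ _ _ _ Pi (vb d) _ mF F0).
pose Q (p : V * V) : R := \1_A p.2 * ((w s p.2 ^+ 2 * cabs (kb p.1 p.2) ^+ 2 * dens p.2) * wt alpha p.1).
have f1 := @measurable_fst _ _ V V; have f2 := @measurable_snd _ _ V V.
have mQ : measurable_fun [set: V * V] Q.
  apply: measurable_funM; first exact: (measurableT_comp (measurable_indic mA) f2).
  apply: measurable_funM; last exact: (measurableT_comp (@measurable_wt R d alpha) f1).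
  apply: measurable_funM; last exact: (measurableT_comp md f2).
  apply: measurable_funM; last exact: measurable_sqr_cabs cmeas_kb.
  by apply: measurable_funX; exact: (measurableT_comp mw f2).
have Q0 p : 0 <= Q p.
  by rewrite /Q mulr_ge0// mulr_ge0 ?wt_ge0// mulr_ge0 ?dens_ge0// mulr_ge0 ?sqr_ge0.
have mQE : measurable_fun [set: V * V] (fun p => (Q p)%:E) by exact/measurable_EFinP.
have Q0E p : (0 <= (Q p)%:E)%E by rewrite lee_fin.
have step (y : V) : (\int[Pi]_X (Phi (X, y))%:E <= c%:E * \int[vb d]_x (Q (y, x))%:E)%E.
  have -> : (\int[vb d]_x (Q (y, x))%:E =
      \int[vb d]_(x in A) ((w s x ^+ 2 * cabs (kb y x) ^+ 2 * dens x) * wt alpha y)%:E)%E.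
    rewrite [RHS]integral_mkcond; apply: eq_integral => x _; rewrite patchE /Q /= indicE.
    by case: ifP => _; rewrite ?mul1r ?mul0r.
  have [y1|y1] := boolP (cnorm (y : 'rV[C R]_d) < 1); first exact: var_pt.
  rewrite integral0_eq; last by move=> X _; rewrite /Phi wt_out// mulr0.
  rewrite mule_ge0// ?lee_fin ?(ltW c0)//; apply: integral_ge0 => x _.
  by rewrite lee_fin mulr_ge0 ?wt_ge0// mulr_ge0 ?dens_ge0// mulr_ge0 ?sqr_ge0.
have mQy : measurable_fun [set: V] (fun y : V => \int[vb d]_x (Q (y, x))%:E)%E.
  exact: (@measurable_fun_fubini_tonelli_F _ _ _ _ R (vb d) _ mQE Q0E).
apply: (@le_trans _ _ (\int[vb d]_y (c%:E * \int[vb d]_x (Q (y, x))%:E))%E).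
  apply: ge0_le_integral => //.
  - by move=> y _; apply: integral_ge0.
  - exact: (@measurable_fun_fubini_tonelli_G _ _ _ _ R Pi _ mF F0).
  - by apply: emeasurable_funM.
rewrite ge0_integralZl_EFin ?(ltW c0)//; last by move=> y _; apply: integral_ge0.
apply: lee_wpmul2l; first by rewrite lee_fin ltW.
rewrite (@fubini_tonelli _ _ _ _ _ (vb d) (vb d) _ mQE Q0E).
apply: le_trans (regV_le d0 alpha1 abeta lambda0 z1 bs ij).
rewrite le_eqVlt; apply/orP; left; apply/eqP; apply: eq_integral => x _.
have [xA|xA] := boolP (x \in A); last first.
  rewrite indicE (negbTE xA) mul0r; apply: integral0_eq => y _.
  by rewrite /Q indicE (negbTE xA) mul0r.
have x1 : cnorm (x : 'rV[C R]_d) < 1 by have [] := set_mem xA.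
rewrite indicE xA mul1r.
transitivity (\int[vb d]_y ((w s x ^+ 2 * dens x)%:E * (cabs (K y x) ^+ 2 * wt alpha y)%:E))%E.
  apply: eq_integral => y _; rewrite -EFinM /Q /= indicE xA mul1r; congr EFin.
  have [y1|y1] := boolP (cnorm (y : 'rV[C R]_d) < 1); last by rewrite wt_out// !mulr0.
  by rewrite /kb y1 x1; ring.
rewrite ge0_integralZl_EFin ?(mulr_ge0 (sqr_ge0 _) (dens_ge0 _ lambda0 _))//.
- have := sqnorm_kernel d0 alpha1 x1; rewrite /sqnorm => ->; rewrite -EFinM; congr EFin.
  by move: (_ / _) => u; ring.
- by move=> y _; rewrite lee_fin mulr_ge0 ?sqr_ge0 ?wt_ge0.
- exact: measurable_sqwt (bmeas_kernel alpha x1).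
Qed.

End Regions.

(** * Lower limits and sums over adjacent shells *)

Section LowerLimits.
Context {R : realType}.

Lemma limn_einf_ge (u : nat -> \bar R) (c : \bar R) M : (forall n, (M <= n)%N -> (c <= u n)%E) ->
  (c <= limn_einf u)%E.
Proof.
move=> uc; rewrite limn_einf_lim; apply: lime_ge; first exact: is_cvg_einfs.
exists M => // n /= Mn; apply: le_ereal_inf_tmp => _ [m /= nm <-].
by apply: uc; exact: leq_trans Mn nm.
Qed.

(** If the mean square errors of [p N], relative to the limit of [r N], are small along
    a subsequence, then the limit of [p N] is close to that of [r N]. *)
Lemma liminf_ratio (p r : nat -> R) (c e : R) : 0 < e -> 0 < c ->
  nondecreasing_seq p -> nondecreasing_seq r -> r @ \oo --> c ->
  (limn_einf (fun N => (((p N - r N) / c) ^+ 2)%:E) < (e ^+ 2)%:E)%E ->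
  (forall M, p M <= c * (1 + e)) /\
  (forall W, (forall N, p N <= W) -> c * (1 - e) <= W).
Proof.
move=> e0 c0 pm rm rc lt.
have rle N : r N <= c.
  by have := nondecreasing_cvgn_le rm (cvgP c rc) N; rewrite (cvg_lim _ rc).
have big M : (forall N, (M <= N)%N -> c * e <= `|p N - r N|) -> False.
  move=> H; move: lt; rewrite ltNge => /negP; apply; apply: (limn_einf_ge (M := M)) => N MN.
  rewrite lee_fin -[leRHS]real_normK ?num_real// normrM normfV (gtr0_norm c0).
  rewrite lerXn2r ?nnegrE ?divr_ge0 ?(ltW e0) ?(ltW c0)//.
  by rewrite ler_pdivlMr// mulrC; exact: H.
split=> [M|W pW]; rewrite leNgt; apply/negP => h.
  apply: (big M) => N MN; apply: le_trans (ler_norm _).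
  by have := pm _ _ MN; have := rle N; lra.
have d0 : 0 < c - W - c * e by lra.
have /cvgrPdist_lt /(_ _ d0) [M _ HM] := rc.
apply: (big M) => N MN; rewrite distrC; apply: le_trans (ler_norm _).
have := HM N MN; have := pW N; have := ler_norm (c - r N); lra.
Qed.

Context dT (T : measurableType dT) (mu : {measure set T -> \bar R}).

Lemma ae_fin_num (f : T -> \bar R) : measurable_fun setT f -> (forall x, (0 <= f x)%E) ->
  (\int[mu]_x f x < +oo)%E -> {ae mu, forall x, (f x < +oo)%E}.
Proof.
move=> mf f0 fi.
have ig : mu.-integrable setT f.
  by apply/integrableP; split => //; under eq_integral do rewrite gee0_abs//.
have := integrable_ae measurableT ig; apply: filterS => x /(_ I).
by rewrite ge0_fin_numE.
Qed.

(** Borel-Cantelli through the first moment. *)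
Lemma ae_limn_einf_cvg0 (D : nat -> nat -> T -> \bar R) (v : nat -> R) :
  (forall n N, measurable_fun setT (D n N)) -> (forall n N x, (0 <= D n N x)%E) ->
  (forall n, 0 <= v n) ->
  (forall n N, (\int[mu]_x D n N x <= (v n)%:E)%E) -> (\sum_(0 <= n <oo) (v n)%:E < +oo)%E ->
  {ae mu, forall x, (fun n => limn_einf (fun N => D n N x)) @ \oo --> 0%E}.
Proof.
move=> mD D0 v0 Dv sv.
pose Z n x := limn_einf (fun N => D n N x).
have Z0 n x : (0 <= Z n x)%E by apply: (limn_einf_ge (M := 0%N)).
have mZ n : measurable_fun setT (Z n).
  rewrite /Z /limn_einf; apply: measurableT_comp => //.
  apply: (measurable_fun_limn_esup (f := fun N x => (- D n N x)%E)) => N.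
  exact: measurableT_comp.
have iZ n : (\int[mu]_x Z n x <= (v n)%:E)%E.
  apply: le_trans (fatou mu measurableT (mD n) (fun N x _ => D0 n N x)) _.
  by apply: limn_einf_le => N; exact: Dv.
have : {ae mu, forall x, (\sum_(0 <= n <oo) Z n x < +oo)%E}.
  apply: ae_fin_num.
  - by apply: ge0_emeasurable_sum => [n x _ _|n _].
  - by move=> x; apply: nneseries_ge0.
  rewrite integral_nneseries//; apply: le_lt_trans sv; apply: lee_nneseries => // n _ _.
  by apply: integral_ge0.
apply: filterS => x sx.
apply: (@squeeze_cvge _ _ _ _ (cst 0%E) _ (fun n => \sum_(n <= k <oo) Z k x)%E).
- apply: nearW => n; rewrite Z0/=.
  rewrite (nneseries_split n 1)// addn1 big_nat1 leeDl//.
  by apply: nneseries_ge0.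
- exact: cvg_cst.
- exact: nneseries_tail_cvg.
Qed.

End LowerLimits.

Section RegionSums.
Context {R : realType} {d : nat} (z : 'rV[C R]_d).
Hypothesis z1 : cnorm z < 1.
Local Notation V := (@Cvec R d).
Local Notation E := (uball R d).
Local Notation reg := (reg z).
Implicit Types X : conf E.

Let preR i j : precompact ((\val : E -> V) @^-1` reg i j : set E).
Proof. by apply: (precompact_ball (regr_lt1 z1 j)) => x; exact: reg_regr. Qed.

Lemma csum_sub (A A' : set V) X (g : V -> R) : A' `<=` A ->
  precompact ((\val : E -> V) @^-1` A : set E) -> precompact ((\val : E -> V) @^-1` A' : set E) ->
  csum A X (fun x => \1_A' x * g x) = csum A' X g.
Proof.
move=> sA pA pA'.
rewrite /csum -(fsum_pts pA) => [|x ->]; last by rewrite mul0r.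
rewrite -(fsum_pts pA') => [|x ->]; last by rewrite mul0r.
rewrite (_ : (\val : E -> V) @^-1` A' = ((\val : E -> V) @^-1` A) `&` ((\val : E -> V) @^-1` A')); last first.
  by apply/seteqP; split => [x A'x|x []//]; split => //; exact: sA.
rewrite fsbig_mkcondr; apply: eq_fsbigr => x _.
have -> : (x \in (\val : E -> V) @^-1` A') = ((\val x : V) \in A').
  by apply/idP/idP => /set_mem h; exact/mem_set.
by rewrite indicE; case: ifP => _; rewrite ?mul1r ?mul0r ?mulr0.
Qed.

Lemma csum_regS N X (g : V -> R) :
  csum (reg 0 N.+1) X g = csum (reg 0 N) X g + csum (reg N N.+1) X g.
Proof.
have s1 : reg 0 N `<=` reg 0 N.+1.
  by move=> x [x1 /andP[a b]]; split => //; rewrite a (lt_trans b)// ltr_nat.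
have s2 : reg N N.+1 `<=` reg 0 N.+1.
  by move=> x [x1 /andP[a b]]; split => //; rewrite b (le_trans _ a).
rewrite -(csum_sub X g s1 (preR _ _) (preR _ _)) -(csum_sub X g s2 (preR _ _) (preR _ _)).
rewrite -(csumD _ X); apply: (eq_csum (regr_lt1 z1 N.+1) (@reg_regr _ _ _ z1 0 N.+1) X) => x [x1 /andP[a b]].
rewrite !indicE -mulrDl -natrD.
case: (ltP (dB z x) N%:R) => h.
  rewrite (mem_set (A := reg 0 N)); last by split => //; rewrite a h.
  rewrite (memNset (A := reg N N.+1)) ?mul1r// => -[_ /andP[a' _]].
  by have := le_lt_trans a' h; rewrite ltxx.
rewrite (memNset (A := reg 0 N)); last first.
  by move=> [_ /andP[_ b']]; have := le_lt_trans h b'; rewrite ltxx.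
by rewrite (mem_set (A := reg N N.+1)) ?mul1r//; split => //; rewrite h b.
Qed.

Lemma csum_reg_sum N X (g : V -> R) :
  csum (reg 0 N) X g = \sum_(k < N) csum (reg k k.+1) X g.
Proof.
elim: N => [|N IH]; last by rewrite csum_regS IH big_ord_recr.
rewrite big_ord0 /csum big_seq big1// => x xp.
have [_ /andP[a b]] := mem_pts (preR 0 0) xp.
by have := le_lt_trans a b; rewrite ltxx.
Qed.

Lemma shellE (zE : E) k : \val zE = z -> shell zE k = (\val : E -> V) @^-1` (reg k k.+1).
Proof.
move=> zv; apply/seteqP; split => x; rewrite /shell /= zv; last by move=> [].
by move=> h; split => //; have := valP x; rewrite inE.
Qed.

Lemma shell_sumE (zE : E) beta X s (F : 'rV[C R]_d -> C R) k : \val zE = z ->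
  shell_sum beta X s zE F k =
  \sum_(x <- pts (reg k k.+1) X) (X x)%:R * (toC (weight beta s z (\val x)) * F (\val x)).
Proof.
move=> zv; rewrite /shell_sum (shellE _ zv) zv; apply: (fsum_pts (preR _ _)) => x ->.
by rewrite mul0r.
Qed.

Lemma total_weight_cvg beta X s :
  (sum_nneg X (fun x => weight beta s z (\val x)) =
   \sum_(0 <= k <oo) (csum (reg k k.+1) X (fun x => weight beta s z x))%:E)%E.
Proof.
have g0 x : (0 <= ((X x)%:R * weight beta s z (\val x))%:E)%E.
  by rewrite lee_fin mulr_ge0// weight_ge0.
have w0 (x : V) : 0 <= weight beta s z x by exact: weight_ge0.
rewrite nneseries_esum; last by move=> k _; rewrite lee_fin (csum_ge0 _ X).
rewrite [X in _ = \esum_(_ in X) _](_ : _ = [set: nat]); last exact/seteqP.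
rewrite /sum_nneg.
have -> : [set: E] = \bigcup_(k in [set: nat]) ((\val : E -> V) @^-1` (reg k k.+1)).
  apply/seteqP; split => // x _.
  have x1 : cnorm (\val x) < 1 by have := valP x; rewrite inE.
  have m1 := mobius_lt1 z1 x1.
  have : (\bigcup_k sh k) (mobius z (\val x) : V) by rewrite sh_cover.
  case=> k _ hk; exists k; first by [].
  by apply: (iffRL (regE z1 k k.+1 (\val x : V))); split; [exact: x1|exact: hk].
rewrite esum_bigcupT//; last first.
  move=> i j _ _ [x [[_ /andP[i1 i2]] [_ /andP[j1 j2]]]].
  have := le_lt_trans i1 j2; have := le_lt_trans j1 i2.
  by rewrite !ltr_nat !ltnS => ji ij; apply/eqP; rewrite eqn_leq ij.
apply: eq_esum => k _; rewrite esum_mkcond.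
transitivity (\esum_(x in [set: E]) ((if x \in (\val : E -> V) @^-1` (reg k k.+1) then (X x)%:R * weight beta s z (\val x) else 0) : R)%:E)%E.
  by apply: eq_esum => x _; case: ifP.
rewrite (esum_pts (regr_lt1 z1 k.+1) (@reg_regr _ _ _ z1 k k.+1) (X := X)).
- congr EFin; rewrite /csum !big_seq; apply: eq_bigr => x xp; rewrite ifT//.
  by have h := mem_pts (preR k k.+1) xp; exact/mem_set.
- by move=> x; case: ifP => // _; rewrite mulr_ge0// weight_ge0.
- by move=> x nA; rewrite ifF//; apply/negbTE/negP => /set_mem.
- by move=> x ->; case: ifP; rewrite ?mul0r.
Qed.

End RegionSums.

(** * Convergence for a fixed configuration *)

Section NormTools.
Context {R : realType} {d : nat} (alpha : R).
Local Notation sqn := (sqnorm alpha).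
Local Notation nr := (nrm alpha).
Implicit Types f g h : 'rV[C R]_d -> C R.

Lemma nrmZ_fin (k : C R) f : bmeas f -> (sqn f < +oo)%E ->
  (sqn (fun y => (k * f y)%R) < +oo)%E /\ nr (fun y => k * f y) = cabs k * nr f.
Proof.
move=> mf ff; have E : sqn (fun y => (k * f y)%R) = ((cabs k * nr f) ^+ 2)%:E.
  by rewrite sqnormZ// (sqnormE ff) -EFinM exprMn.
split; first by rewrite E ltry.
by rewrite {1}/nrm E /= sqrtr_sqr ger0_norm// mulr_ge0 ?cabs_ge0 ?nrm_ge0.
Qed.

Lemma eq_sqnorm f g : (forall y, cnorm y < 1 -> f y = g y) -> sqn f = sqn g.
Proof.
move=> fg; apply: eq_integral => y _.
by have [y1|y1] := boolP (cnorm (y : 'rV[C R]_d) < 1); [rewrite fg|rewrite wt_out// !mulr0].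
Qed.

Lemma ipBr f g h : bmeas f -> bmeas g -> bmeas h -> (sqn f < +oo)%E -> (sqn g < +oo)%E ->
  (sqn h < +oo)%E -> ip alpha f (fun y => g y - h y) = ip alpha f g - ip alpha f h.
Proof.
move=> mf mg mh ff fg fh; rewrite /ip -cintB; [|exact: ip_integrable..].
congr cint; apply/funext => y; rewrite /on_ball; case: ifP => _; last by ring.
by rewrite conjB; ring.
Qed.

Lemma ipZr f g (r : R) : bmeas f -> bmeas g -> (sqn f < +oo)%E -> (sqn g < +oo)%E ->
  ip alpha f (fun y => toC r * g y) = toC r * ip alpha f g.
Proof.
move=> mf mg ff fg; rewrite /ip -cintZ; last exact: ip_integrable.
congr cint; apply/funext => y; rewrite /on_ball; case: ifP => _; last by ring.
by rewrite conjM toC_conj; ring.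
Qed.

Lemma ip_sumr I (r : seq I) f (k : I -> R) (F : I -> 'rV[C R]_d -> C R) :
  bmeas f -> (sqn f < +oo)%E -> (forall i, bmeas (F i)) -> (forall i, sqn (F i) < +oo)%E ->
  ip alpha f (fun y => \sum_(i <- r) toC (k i) * F i y) = \sum_(i <- r) toC (k i) * ip alpha f (F i).
Proof.
move=> mf ff mF fF.
have [_ E] := cint_sum r (fun i => toC (k i)) (fun i => ip_integrable mf (mF i) ff (fF i)).
rewrite -E; congr cint; apply/funext => y; rewrite /on_ball; case: ifP => _; last first.
  by rewrite !mul0r big1// => i _; rewrite mulr0.
have -> : (\sum_(i <- r) toC (k i) * F i y)^* = \sum_(i <- r) toC (k i) * (F i y)^*.
  rewrite (conj_sum r); apply: eq_bigr => i _; by rewrite conjM toC_conj.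
by rewrite mulr_sumr mulr_suml; apply: eq_bigr => i _; ring.
Qed.

Lemma cvg0_ereal (u : nat -> \bar R) : (forall n, (0 <= u n)%E) ->
  (forall e : R, 0 < e -> \forall n \near \oo, (u n <= e%:E)%E) -> u @ \oo --> 0%E.
Proof.
move=> u0 us; apply/fine_cvgP; split.
  apply: filterS (us 1 ltr01) => n h; rewrite ge0_fin_numE//.
  exact: le_lt_trans h (ltry _).
apply/cvgrPdist_lt => e e0; have e2 : 0 < e / 2 by rewrite divr_gt0.
apply: filterS (us _ e2) => n h; rewrite sub0r normrN /=.
have fn : u n \is a fin_num by rewrite ge0_fin_numE//; exact: le_lt_trans h (ltry _).
rewrite ger0_norm ?fine_ge0// -lte_fin fineK//; apply: le_lt_trans h _.
by rewrite lte_fin; lra.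
Qed.

Lemma ereal_cvg0_lt (u : nat -> \bar R) (e : R) : 0 < e -> u @ \oo --> 0%E ->
  \forall n \near \oo, (u n < e%:E)%E.
Proof.
move=> e0 /fine_cvgP[fu /cvgrPdist_lt /(_ e e0) h].
apply: filterS2 fu h => n fn; rewrite sub0r normrN /= => h.
by rewrite -(fineK fn) lte_fin (le_lt_trans (ler_norm _)).
Qed.

End NormTools.

Section FixedConfiguration.
Context {R : realType} {d : nat} (d0 : (0 < d)%N) (alpha beta lambda : R).
Hypotheses (alpha1 : -1 < alpha) (abeta : alpha + d%:R + 1 <= beta) (lambda0 : 0 < lambda).
Local Notation V := (@Cvec R d).
Local Notation E := (uball R d).
Local Notation K := (bergman_kernel alpha).
Local Notation sqn := (sqnorm alpha).
Local Notation nr := (nrm alpha).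
Variable (zE : E).
Local Notation z := (\val zE).

Let z1 : cnorm z < 1. Proof. by have := valP zE; rewrite inE. Qed.

Let b0 : 0 <= beta. Proof. exact: beta_ge0 alpha1 abeta. Qed.

Let mK : bmeas (K ^~ z) := bmeas_kernel alpha z1.
Let fK : (sqn (K ^~ z) < +oo)%E := sqnorm_kernel_lty d0 alpha1 z1.

Section OneExponent.
Variables (s : R) (bs : beta < s) (X : conf E).
Let s0 : 0 <= s. Proof. exact: le_trans b0 (ltW bs). Qed.
Local Notation c_ i j := (cw (d:=d) beta lambda s i j).
Local Notation L := (shell_kernel_sum beta X alpha s zE).
Local Notation T := (fun N y => \sum_(k < N) L k y).

Definition decay : R := expR (- (s - beta)).
Local Notation q := decay.

Lemma decay_gt0 : 0 < q. Proof. exact: expR_gt0. Qed.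
Lemma decay_lt1 : q < 1. Proof. by rewrite expR_lt1 oppr_lt0 subr_gt0. Qed.

(** The expected total weight. *)
Definition ctot : R := fine (\sum_(0 <= k <oo) (c_ k k.+1)%:E)%E.

Let low0 : 0 <= lambda * (radc (d:=d) (- (beta + 1)) * expR (- s)).
Proof.
have rc := @radc_gt0 R d (- (beta + 1)).
by rewrite mulr_ge0 ?(ltW lambda0)// mulr_ge0 ?(ltW rc)// expR_ge0.
Qed.

Let c0 k : 0 <= c_ k k.+1.
Proof.
apply: le_trans (cw_ge d0 beta lambda0 k s0).
by rewrite mulr_ge0 ?low0// exprn_ge0// expR_ge0.
Qed.

Let cB : R := lambda * radC (d:=d) (- (beta + 1)).
Let cB0 : 0 <= cB. Proof. by rewrite mulr_ge0 ?radC_ge0 ?ltW. Qed.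

Let c_le k : c_ k k.+1 <= cB * q ^+ k. Proof. exact: cw_le. Qed.

Let sum_c_lty : (\sum_(0 <= k <oo) (c_ k k.+1)%:E < +oo)%E.
Proof.
apply: le_lt_trans (le_trans _ (nneseries_geometric cB0 (ltW decay_gt0) decay_lt1)) (ltry _).
by apply: lee_nneseries => [k _ _|k _]; rewrite lee_fin ?c_le.
Qed.

Let ctotE : (\sum_(0 <= k <oo) (c_ k k.+1)%:E = ctot%:E)%E.
Proof. by rewrite /ctot fineK// ge0_fin_numE//; apply: nneseries_ge0 => k _ _; rewrite lee_fin. Qed.

Lemma cw_sum N : c_ 0 N = \sum_(k < N) c_ k k.+1.
Proof.
by apply: EFin_inj; rewrite (cwE d0 beta lambda s0 (leq0n N)) sumEFin big_mkord.
Qed.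

Lemma cw_nondecreasing : nondecreasing_seq (fun N => c_ 0 N).
Proof.
by apply/nondecreasing_seqP => N; rewrite !cw_sum big_ord_recr lerDl.
Qed.

Lemma cw_cvg : (fun N => c_ 0 N) @ \oo --> ctot.
Proof.
have h : (fun N => (\sum_(0 <= k < N) (c_ k k.+1)%:E)%E) @ \oo --> ctot%:E.
  by rewrite -ctotE; apply: is_cvg_nneseries => k _ _; rewrite lee_fin.
have [_ h2] := iffLR (fine_cvgP _ _) h.
have e : (fun N => c_ 0 N) = fine \o (fun N => (\sum_(0 <= k < N) (c_ k k.+1)%:E)%E).
  by apply/funext => N; rewrite /= sumEFin big_mkord cw_sum.
by rewrite e; exact: h2.
Qed.

(** The shells up to the [N]-th, with [q ^ N <= 1 / 2], already carry this much. *)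
Lemma ctot_ge : lambda * (radc (d:=d) (- (beta + 1)) * expR (- s)) / (2 * (1 - q)) <= ctot.
Proof.
set A := lambda * _; have A0 : 0 <= A := low0.
have q1 : 0 < 1 - q by rewrite subr_gt0 decay_lt1.
have [N hN] : exists N, q ^+ N <= 1 / 2.
  have : (fun N => q ^+ N) @ \oo --> (0 : R).
    by apply: cvg_expr; rewrite ger0_norm ?(ltW decay_gt0)// decay_lt1.
  move=> /cvgr0Pnorm_lt /(_ (1 / 2)) [|N _ /(_ N (leqnn _)) h]; first by rewrite divr_gt0.
  by exists N; apply: le_trans (ler_norm _) (ltW h).
apply: le_trans (_ : c_ 0 N <= _); last first.
  by have := nondecreasing_cvgn_le cw_nondecreasing (cvgP _ cw_cvg) N; rewrite (cvg_lim _ cw_cvg).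
rewrite cw_sum; apply: le_trans (_ : \sum_(k < N) A * q ^+ k <= _); last first.
  by apply: ler_sum => k _; exact: cw_ge.
rewrite -mulr_sumr; apply: ler_wpM2l => //.
have -> : \sum_(k < N) q ^+ k = (1 - q ^+ N) / (1 - q).
  have qn : 1 - q != 0 by rewrite gt_eqF.
  elim: (N) => [|m IH]; first by rewrite big_ord0 expr0 subrr mul0r.
  rewrite big_ord_recr /= IH exprS; move: q qn (q ^+ m) => t tn u.
  by field.
rewrite invfM ler_wpM2r ?invr_ge0 ?(ltW q1)//; lra.
Qed.

Lemma shell_kernelE k : L k = Lr alpha beta z s k k.+1 X.
Proof. by apply/funext => y; rewrite /shell_kernel_sum (shell_sumE z1 _ _ _ _ _ erefl). Qed.

Let val1 (x : E) : cnorm (\val x) < 1. Proof. by have := valP x; rewrite inE. Qed.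

Lemma shell_kernel_lin k : L k = fun y => \sum_(x <- pts (reg z k k.+1) X)
  toC ((X x)%:R * weight beta s z (\val x)) * K y (\val x).
Proof.
rewrite shell_kernelE; apply/funext => y; apply: eq_bigr => x _.
by rewrite -toC_nat mulrA -toCM.
Qed.

Let fKx (x : E) : (sqn (K ^~ (\val x)) < +oo)%E.
Proof. by apply: sqnorm_kernel_lty. Qed.

Lemma holo_shell k : holo (L k).
Proof.
rewrite shell_kernel_lin; apply: holo_sum => x.
by apply: holoM (holo_cst _) _; exact: holo_kernel.
Qed.

Let mL k : bmeas (L k). Proof. exact/bmeas_holo/holo_shell. Qed.

Lemma sqnorm_shell k : (sqn (L k) < +oo)%E.
Proof.
rewrite shell_kernel_lin.
have [] := nrm_sum (alpha := alpha) (pts (reg z k k.+1) X)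
  (fun x : E => bmeasZ (toC ((X x)%:R * weight beta s z (\val x))) (bmeas_kernel alpha (val1 x)))
  (fun x : E => proj1 (nrmZ_fin _ (bmeas_kernel alpha (val1 x)) (fKx x))).
by [].
Qed.

Lemma LrT N y : cnorm y < 1 -> T N y = Lr alpha beta z s 0 N X y.
Proof.
move=> y1; rewrite LrE//; apply: ceqP.
  rewrite cRe_sum [RHS]/= (csum_reg_sum z1); apply: eq_bigr => k _.
  by rewrite shell_kernelE LrE.
rewrite cIm_sum [RHS]/= (csum_reg_sum z1); apply: eq_bigr => k _.
by rewrite shell_kernelE LrE.
Qed.

Hypothesis F1 : (\sum_(0 <= k <oo)
  ((q ^- k)%:E * kdev alpha beta lambda z s k k.+1 (X : Conf E)) < +oo)%E.

(** The inequality [x <= q ^ k + q ^ -k * x ^ 2] trades the norm of a deviation for its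
    square. *)
Lemma shell_norm_sum : (\sum_(0 <= k <oo) A2norm alpha (L k) < +oo)%E.
Proof.
have q0 := decay_gt0.
have k0 k : (0 <= kdev alpha beta lambda z s k k.+1 (X : Conf E))%E by exact: sqnorm_ge0.
have t0 k : (0 <= (q ^- k)%:E * kdev alpha beta lambda z s k k.+1 (X : Conf E))%E.
  by rewrite mule_ge0// lee_fin invr_ge0 exprn_ge0// ltW.
pose B := 1 + cB * nr (K ^~ z).
have B0 : 0 <= B by rewrite addr_ge0// mulr_ge0// nrm_ge0.
apply: (@le_lt_trans _ _ (\sum_(0 <= k <oo) ((B * q ^+ k)%:E +
    (q ^- k)%:E * kdev alpha beta lambda z s k k.+1 (X : Conf E)))%E); last first.
  rewrite nneseriesD//.
    apply: lte_add_pinfty => //; apply: le_lt_trans (ltry _).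
    exact: nneseries_geometric B0 (ltW q0) decay_lt1.
  by move=> k _ _; rewrite lee_fin mulr_ge0// exprn_ge0// ltW.
apply: lee_nneseries => [k _ _|k _]; first exact: sqrte_ge0.
have qk : 0 < q ^+ k by rewrite exprn_gt0.
have kf : (kdev alpha beta lambda z s k k.+1 (X : Conf E) < +oo)%E.
  have := nneseries_term_lty t0 F1 k; rewrite !ltey; apply: contra => /eqP ->.
  by rewrite gt0_muley// lte_fin invr_gt0.
have mD : bmeas (fun y => L k y - toC (c_ k k.+1) * K y z) by apply: bmeasB => //; exact: bmeasZ.
have kE : kdev alpha beta lambda z s k k.+1 (X : Conf E) = sqn (fun y => (L k y - toC (c_ k k.+1) * K y z)%R).
  by rewrite /kdev shell_kernelE.
rewrite kE in kf *.
have [f2 n2] := nrmZ_fin (toC (c_ k k.+1)) mK fK.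
rewrite (A2norm_nrm (sqnorm_shell k)) (sqnormE kf) -EFinM -EFinD lee_fin.
have -> : nr (L k) = nr (fun y => (L k y - toC (c_ k k.+1) * K y z) + toC (c_ k k.+1) * K y z).
  by congr nrm; apply/funext => y; rewrite subrK.
apply: le_trans (nrmD mD (bmeasZ _ mK) kf f2) _; rewrite n2 cabs_toC ger0_norm//.
set x := nr (fun y => L k y - _); have x0 : 0 <= x by exact: nrm_ge0.
have xk : x <= q ^+ k + q ^- k * x ^+ 2.
  have := sqr_ge0 (q ^+ k - x) => h.
  rewrite -(ler_pM2l qk) mulrDr mulrA divff ?gt_eqF// mul1r.
  by nra.
have := ler_wpM2r (nrm_ge0 alpha (K ^~ z)) (c_le k); rewrite /B; lra.
Qed.

Let mT N : bmeas (T N). Proof. exact: bmeas_sum. Qed.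

Let fT N : (sqn (T N) < +oo)%E.
Proof.
by have [] := nrm_sum (alpha := alpha) (index_enum 'I_N) (fun k => mL k) (fun k => sqnorm_shell k).
Qed.

Lemma partial_sum_dev S : A2_series alpha L S -> [/\ holo S, (sqn S < +oo)%E,
  forall N, (sqn (fun y => (T N y - S y)%R) < +oo)%E &
  (fun N => nr (fun y => T N y - S y)) @ \oo --> 0].
Proof.
move=> [[hS fS] cS]; have {}hS := iffLR (holoP S) hS.
have mS := bmeas_holo hS; rewrite A2norm_lty in fS.
have fB N : (sqn (fun y => (T N y - S y)%R) < +oo)%E.
  have [f2 _] := nrmZ_fin (-1) mS fS.
  have := sqnormD_lty (mT N) (bmeasZ (-1) mS) (fT N) f2.
  by congr (_ < _)%E; congr sqnorm; apply/funext => u; rewrite mulN1r.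
split => //; move: cS.
rewrite (_ : (fun N : nat => A2norm alpha _) = (fun N => (nr (fun y => T N y - S y))%:E)).
  by move=> /fine_cvgP[].
by apply/funext => N; exact: A2norm_nrm (fB N).
Qed.

Local Notation kernel_dev :=
  (limn_einf (fun N => (ctot^-1 ^+ 2)%:E * kdev alpha beta lambda z s 0 N (X : Conf E))%E).

(** Partial sums converge pointwise as well, so Fatou's lemma passes the deviation of the
    truncations to the limit. *)
Lemma limit_deviation S : A2_series alpha L S ->
  (sqn (fun y => (toC ctot^-1 * (S y - toC ctot * K y z))%R) <= kernel_dev)%E.
Proof.
move=> SS; have [hS fS fB cN] := partial_sum_dev SS; have mS := bmeas_holo hS.
have hT N : holo (T N) by apply: holo_sum => k; exact: holo_shell.
have mD N : bmeas (fun y => T N y - toC (c_ 0 N) * K y z) by apply: bmeasB => //; exact: bmeasZ.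
pose F N y := toC ctot^-1 * (T N y - toC (c_ 0 N) * K y z).
have FE N : sqn (F N) = ((ctot^-1 ^+ 2)%:E * kdev alpha beta lambda z s 0 N (X : Conf E))%E.
  rewrite sqnormZ// cabs_toC real_normK ?num_real//; congr (_ * _)%E.
  by apply: eq_sqnorm => y y1; rewrite (LrT N y1).
under [X in limn_einf X]eq_fun do rewrite -FE.
apply: sqnorm_fatou; first by move=> N; exact: bmeasZ.
move=> y y1.
have cT : (fun N => T N y) @ \oo --> S y.
  apply/cvg_cabs; apply: (@squeeze_cvgr _ _ _ _ (cst 0) (fun N => nr (fun y => T N y - S y) * nr (K ^~ y))).
  - apply: nearW => N; rewrite cabs_ge0/=.
    apply: (eval_bound d0 alpha1 (f := fun y => T N y - S y)) => //.
    have := holoD (hT N) (holoM (holo_cst (-1)) hS).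
    by congr holo; apply/funext => u; rewrite mulN1r.
  - exact: cvg_cst.
  - by rewrite -(mul0r (nr (K ^~ y))); apply: cvgM => //; exact: cvg_cst.
have cc : (fun N => toC (c_ 0 N)) @ \oo --> toC ctot.
  apply/cvg_cabsP => e e0; have /cvgrPdist_lt /(_ e e0) := cw_cvg.
  by apply: filterS => N h; rewrite -toCB cabs_toC distrC.
apply: cvgM; first exact: cvg_cst.
have cK : (fun N => toC (c_ 0 N) * K y z) @ \oo --> toC ctot * K y z.
  by apply: cvgM; [exact: cc|exact: cvg_cst].
apply/cvg_cabsP => e e0; have e2 : 0 < e / 2 by rewrite divr_gt0.
apply: filterS2 (iffLR (cvg_cabsP _ _) cT _ e2) (iffLR (cvg_cabsP _ _) cK _ e2) => N a b.
rewrite (_ : _ - _ = (T N y - S y) + - (toC (c_ 0 N) * K y z - toC ctot * K y z)); last by ring.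
apply: le_lt_trans (cabsD _ _) _; rewrite cabsN [ltRHS](splitr e).
exact: ltrD.
Qed.

Lemma ctot_gt0 : 0 < ctot.
Proof.
have q1 : 0 < 1 - q by rewrite subr_gt0 decay_lt1.
have rc := @radc_gt0 R d (- (beta + 1)).
apply: lt_le_trans ctot_ge.
apply: divr_gt0; last by rewrite mulr_gt0.
by apply: mulr_gt0 => //; apply: mulr_gt0 => //; exact: expR_gt0.
Qed.

Local Notation W := (total_weight beta X s zE).
Local Notation weight_dev :=
  (limn_einf (fun N => (((csum (reg z 0 N) X (weight beta s z) - c_ 0 N) / ctot) ^+ 2)%:E)).

Lemma total_weight_bounds e : 0 < e -> (weight_dev < (e ^+ 2)%:E)%E ->
  ctot * (1 - e) <= W <= ctot * (1 + e).
Proof.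
move=> e0 G; have C0 := ctot_gt0.
have w0 (x : V) : 0 <= weight beta s z x by exact: weight_ge0.
pose p N := csum (reg z 0 N) X (weight beta s z).
have pS N : p N = \sum_(k < N) csum (reg z k k.+1) X (weight beta s z) by exact: csum_reg_sum.
have pm : nondecreasing_seq p.
  by apply/nondecreasing_seqP => N; rewrite (pS N.+1) (pS N) big_ord_recr/= lerDl (csum_ge0 _ X).
have [up lo] := liminf_ratio e0 C0 pm cw_nondecreasing cw_cvg G.
have tot := total_weight_cvg z1 beta X s.
have g0 k : (0 <= (csum (reg z k k.+1) X (weight beta s z))%:E)%E by rewrite lee_fin (csum_ge0 _ X).
have pE N : ((p N)%:E = \sum_(0 <= k < N) (csum (reg z k k.+1) X (weight beta s z))%:E)%E.
  by rewrite pS sumEFin big_mkord.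
have bound : (\sum_(0 <= k <oo) (csum (reg z k k.+1) X (weight beta s z))%:E <= (ctot * (1 + e))%:E)%E.
  apply: lime_le; first by apply: is_cvg_nneseries => *; exact: g0.
  by apply: nearW => N; rewrite -pE lee_fin up.
have WE : (W%:E = \sum_(0 <= k <oo) (csum (reg z k k.+1) X (weight beta s z))%:E)%E.
  rewrite /total_weight tot fineK// ge0_fin_numE; first exact: le_lt_trans bound (ltry _).
  by apply: nneseries_ge0 => *; exact: g0.
apply/andP; split; last by rewrite -lee_fin WE.
apply: lo => N; rewrite -lee_fin WE pE.
by apply: nneseries_lim_ge => *; exact: g0.
Qed.

(** Along infinitely many truncations, the normalized sums are within [e] of their
    expectations. *)
Definition small_deviation e : Prop :=
  [/\ 0 < e, e <= 1 / 2, (kernel_dev < (e ^+ 2)%:E)%E & (weight_dev < (e ^+ 2)%:E)%E].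

Lemma total_weight_ratio e : small_deviation e -> 0 < W /\ `|ctot / W - 1| <= 2 * e.
Proof.
move=> [e0 e1 _ G]; have C0 := ctot_gt0; have /andP[lo up] := total_weight_bounds e0 G.
have W0 : 0 < W by apply: lt_le_trans lo; rewrite mulr_gt0//; lra.
have Wn : W != 0 by rewrite gt_eqF.
split => //; rewrite -[X in _ - X](divff Wn) -mulrBl normrM normfV (gtr0_norm W0) ler_pdivrMr// ler_norml.
have h1 : 0 <= e * (W - ctot * (1 - e)) by apply: mulr_ge0; lra.
have h2 : 0 <= e * ctot * (1 / 2 - e) by apply: mulr_ge0; [apply: mulr_ge0; lra|lra].
by apply/andP; split; nra.
Qed.

Lemma average_deviation S (e : R) : A2_series alpha L S -> small_deviation e ->
  (sqn (fun y => (S y / toC W - K y z)%R) < +oo)%E /\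
  nr (fun y => S y / toC W - K y z) <= 2 * e * (1 + nr (K ^~ z)).
Proof.
move=> SS sd; have [W0 rW] := total_weight_ratio sd; have C0 := ctot_gt0.
have [e0 e1 L0 _] := sd; have [hS fS _ _] := partial_sum_dev SS; have mS := bmeas_holo hS.
pose D y := toC ctot^-1 * (S y - toC ctot * K y z).
have mD : bmeas D by apply: bmeasZ; apply: bmeasB => //; exact: bmeasZ.
have Dlt : (sqn D < (e ^+ 2)%:E)%E by apply: le_lt_trans (limit_deviation SS) L0.
have fD : (sqn D < +oo)%E by apply: lt_trans Dlt (ltry _).
have nD : nr D <= e.
  move: Dlt; rewrite (sqnormE fD) lte_fin => h; rewrite leNgt; apply/negP => h'.
  by have := nrm_ge0 alpha D; nra.
have [f1 n1] := nrmZ_fin (toC (ctot / W)) mD fD.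
have [f2 n2] := nrmZ_fin (toC (ctot / W - 1)) mK fK.
have -> : (fun y => S y / toC W - K y z) = (fun y => toC (ctot / W) * D y + toC (ctot / W - 1) * K y z).
  have Wn : toC W != 0 by rewrite toC_eq0 gt_eqF.
  have Cn : toC ctot != 0 by rewrite toC_eq0 gt_eqF.
  apply/funext => y; rewrite /D toCB toC_div toC1 toCV.
  move: (toC W) (toC ctot) Wn Cn (S y) (K y z) => w c wn cn a b.
  by field; rewrite wn cn.
split; first exact: sqnormD_lty (bmeasZ _ mD) (bmeasZ _ mK) f1 f2.
apply: le_trans (nrmD (bmeasZ _ mD) (bmeasZ _ mK) f1 f2) _.
rewrite n1 n2 !cabs_toC mulrDr mulr1; apply: lerD; last exact: (ler_wpM2r (nrm_ge0 _ _) rW).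
apply: ler_pM => //; first exact: nrm_ge0.
move: rW; rewrite ler_norml => /andP[a b].
have r0 : 0 <= ctot / W by rewrite divr_ge0// ltW.
rewrite (ger0_norm r0); have : 2 * e <= 1 by lra.
by move=> h; lra.
Qed.

(** Summing [f] over a shell is pairing it with the corresponding sum of kernels. *)
Lemma shell_sum_cvg f S : A2 alpha f -> A2_series alpha L S ->
  (fun N => \sum_(k < N) shell_sum beta X s zE f k) @ \oo --> ip alpha f S.
Proof.
move=> [df ff] SS; have hf := iffLR (holoP f) df; rewrite A2norm_lty in ff.
have mf := bmeas_holo hf; have [hS fS fB cN] := partial_sum_dev SS; have mS := bmeas_holo hS.
have shE k : shell_sum beta X s zE f k = ip alpha f (L k).
  rewrite shell_kernel_lin.
  rewrite (ip_sumr _ _ mf ff (fun x : E => bmeas_kernel alpha (val1 x)) fKx).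
  rewrite (shell_sumE z1 _ _ _ _ _ erefl); apply: eq_bigr => x _.
  by rewrite (reproducing d0 alpha1 hf ff (val1 x)) -toC_nat toCM mulrA.
have sumE N : \sum_(k < N) shell_sum beta X s zE f k = ip alpha f (T N).
  have := ip_sumr (index_enum 'I_N) (fun=> 1) mf ff (fun k : 'I_N => mL k) (fun k => sqnorm_shell k).
  under eq_bigr => k _ do rewrite toC1 mul1r -shE.
  move=> <-; congr ip; apply/funext => y; apply: eq_bigr => k _.
  by rewrite toC1 mul1r.
apply/cvg_cabs; apply: (@squeeze_cvgr _ _ _ _ (cst 0) (fun N => nr f * nr (fun y => T N y - S y))).
- apply: nearW => N; rewrite cabs_ge0/= sumE -ipBr//.
  by apply: cauchy_schwarz_ip => //; exact: bmeasB.
- exact: cvg_cst.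
- by rewrite -(mulr0 (nr f)); apply: cvgM => //; exact: cvg_cst.
Qed.

Lemma average_value f S (e : R) : A2 alpha f -> A2_series alpha L S -> small_deviation e ->
  cabs (ip alpha f S / toC W - f z) <= nr f * (2 * e * (1 + nr (K ^~ z))).
Proof.
move=> [df ff] SS sd; have hf := iffLR (holoP f) df; rewrite A2norm_lty in ff.
have mf := bmeas_holo hf; have [hS fS _ _] := partial_sum_dev SS; have mS := bmeas_holo hS.
have [fA nA] := average_deviation SS sd.
have [f1 _] := nrmZ_fin (toC W^-1) mS fS.
have mA : bmeas (fun y => toC W^-1 * S y) by exact: bmeasZ.
have aE : (fun y => S y / toC W - K y z) = (fun y => toC W^-1 * S y - K y z).
  by apply/funext => y; rewrite toCV mulrC.
have -> : ip alpha f S / toC W - f z = ip alpha f (fun y => S y / toC W - K y z).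
  rewrite aE (ipBr mf mA mK ff f1 fK) (ipZr _ mf mS ff fS).
  by rewrite (reproducing d0 alpha1 hf ff z1) toCV mulrC.
apply: le_trans (cauchy_schwarz_ip mf _ ff fA) _; first by rewrite aE; exact: bmeasB.
by apply: ler_wpM2l => //; exact: nrm_ge0.
Qed.

Lemma series_exists : exists S, A2_series alpha L S.
Proof. exact: (A2_complete d0 alpha1 holo_shell shell_norm_sum). Qed.

End OneExponent.

Section ManyExponents.
Variables (s : nat -> R) (bs : forall n, beta < s n) (X : conf E).
Local Notation L n := (shell_kernel_sum beta X alpha (s n) zE).
Local Notation W n := (total_weight beta X (s n) zE).
Hypothesis F1 : forall n, (\sum_(0 <= k <oo)
  ((decay (s n) ^- k)%:E * kdev alpha beta lambda z (s n) k k.+1 (X : Conf E)) < +oo)%E.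
Hypothesis F2 : (fun n => limn_einf (fun N =>
  (((ctot (s n))^-1 ^+ 2)%:E * kdev alpha beta lambda z (s n) 0 N (X : Conf E))%E)) @ \oo --> 0%E.
Hypothesis F3 : (fun n => limn_einf (fun N =>
  (((csum (reg z 0 N) X (weight beta (s n) z) - cw (d:=d) beta lambda (s n) 0 N) /
     ctot (s n)) ^+ 2)%:E)) @ \oo --> 0%E.

Lemma near_small_deviation e : 0 < e -> e <= 1 / 2 -> \forall n \near \oo, small_deviation (s n) X e.
Proof.
move=> e0 e1; have ee : 0 < e ^+ 2 by rewrite exprn_gt0.
apply: filterS2 (ereal_cvg0_lt ee F2) (ereal_cvg0_lt ee F3) => n a b.
by split.
Qed.

Lemma averages_converge :
  [/\ forall n, (\sum_(0 <= k <oo) A2norm alpha (L n k) < +oo)%E,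
      exists S : nat -> 'rV[C R]_d -> C R, (forall n, A2_series alpha (L n) (S n)) /\
        (fun n => A2norm alpha (fun y => S n y / toC (W n) - K y z)) @ \oo --> 0%E &
      forall f : 'rV[C R]_d -> C R, A2 alpha f -> exists S : nat -> C R,
        (forall n, (fun N : nat => \sum_(k < N) shell_sum beta X (s n) zE f k) @ \oo --> S n) /\
        (fun n => S n / toC (W n)) @ \oo --> f z].
Proof.
have ex n := series_exists (bs n) (F1 n).
pose S n := sval (cid (ex n)); have SS n : A2_series alpha (L n) (S n) by exact: svalP (cid (ex n)).
pose B := 1 + nr (K ^~ z); have B0 : 0 < B by rewrite ltr_pwDl// nrm_ge0.
have pick (e M : R) : 0 < e -> 0 < M -> exists2 e', 0 < e' <= 1 / 2 & e' * (2 * M) <= e.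
  move=> e0 M0; exists (Num.min (1 / 2) (e / (2 * M))).
    by rewrite lt_min ge_min lexx !divr_gt0 ?mulr_gt0.
  by rewrite -ler_pdivlMr ?mulr_gt0// ge_min lexx orbT.
split.
- by move=> n; exact: (shell_norm_sum (bs n) (F1 n)).
- exists S; split => //; apply: cvg0_ereal => [n|e e0]; first exact: sqrte_ge0.
  have [e' /andP[e'0 e'1] h] := pick e B e0 B0.
  apply: filterS (near_small_deviation e'0 e'1) => n sd.
  have [fA nA] := average_deviation (bs n) (SS n) sd.
  rewrite (A2norm_nrm fA) lee_fin; apply: le_trans nA _.
  by rewrite -/B; lra.
- move=> f Af; exists (fun n => ip alpha f (S n)); split.
    by move=> n; exact: (shell_sum_cvg Af (SS n)).
  apply/cvg_cabsP => e e0; have nf := nrm_ge0 alpha f.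
  have M0 : 0 < 1 + nr f * B by rewrite ltr_pwDl// mulr_ge0// ltW.
  have [e' /andP[e'0 e'1] h] := pick e _ e0 M0.
  apply: filterS (near_small_deviation e'0 e'1) => n sd.
  apply: le_lt_trans (average_value (bs n) Af (SS n) sd) _.
  by rewrite -/B; lra.
Qed.

End ManyExponents.

End FixedConfiguration.

(** * Almost every configuration *)

Section AlmostSure.
Context {R : realType} {d : nat} (d0 : (0 < d)%N) (alpha beta lambda : R).
Hypotheses (alpha1 : -1 < alpha) (abeta : alpha + d%:R + 1 <= beta) (lambda0 : 0 < lambda).
Local Notation V := (@Cvec R d).
Local Notation E := (uball R d).
Local Notation K := (bergman_kernel alpha).
Local Notation Om := (Conf (uball R d)).
Variable Pi : probability Om R.
Hypothesis intensity : forall B : set E, borel B -> first_intensity Pi B =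
  (\int[v_ d]_(z in [set \val x | x in B]) (lambda / (1 - cnorm z ^+ 2) `^ (beta + 1))%:E)%E.
Variable c : R.
Hypothesis c0 : 0 < c.
Hypothesis varPi : forall f : E -> C R,
  (forall U : set (C R), open U -> borel (f @^-1` U)) ->
  (\int[Pi]_X sum_nneg X (fun x => (cabs (f x) + cabs (f x) ^+ 2)%R) < +oo)%E ->
  (variance_C Pi (sum_complex ^~ f) <=
   c%:E * \int[Pi]_X sum_nneg X (fun x => (cabs (f x) ^+ 2)%R))%E.
Variable (zE : E).
Local Notation z := (\val zE).
Local Notation bc := (bergman_const (d:=d) alpha).

Let z1 : cnorm z < 1. Proof. by have := valP zE; rewrite inE. Qed.
Let b0 : 0 <= beta. Proof. exact: (beta_ge0 alpha1 abeta). Qed.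
Let Q := regV alpha beta lambda z.
Let Q0 : 0 <= Q. Proof. exact: (regV_ge0 d0 beta alpha1 lambda0 z). Qed.

(** The shells carry variance of order [q ^ 2k], so a factor [q ^ -k] is affordable. *)
Lemma ae_shell_deviation s : beta < s -> {ae Pi, forall X : Om,
  (\sum_(0 <= k <oo) ((decay beta s ^- k)%:E * kdev alpha beta lambda z s k k.+1 X) < +oo)%E}.
Proof.
move=> bs; set q := decay beta s.
have q0 : 0 < q by exact: decay_gt0.
have q1 : q < 1 by exact: decay_lt1.
have k0 k X : (0 <= kdev alpha beta lambda z s k k.+1 X)%E by exact: sqnorm_ge0.
have qk k : 0 <= q ^- k by rewrite invr_ge0 exprn_ge0// ltW.
have t0 k X : (0 <= (q ^- k)%:E * kdev alpha beta lambda z s k k.+1 X)%E by rewrite mule_ge0// lee_fin.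
have mk k : measurable_fun setT (kdev alpha beta lambda z s k k.+1).
  exact: (measurable_kdev alpha beta lambda z1 s (leqnSn k)).
have mt k : measurable_fun setT (fun X => ((q ^- k)%:E * kdev alpha beta lambda z s k k.+1 X)%E).
  by apply: emeasurable_funM; [exact: measurable_cst|exact: mk].
apply: ae_fin_num.
- by apply: ge0_emeasurable_sum => [k X _ _|k _]; [exact: t0|exact: mt].
- by move=> X; apply: nneseries_ge0 => k _ _; exact: t0.
rewrite integral_nneseries//.
have cQ0 : 0 <= c * Q by rewrite mulr_ge0// ltW.
apply: le_lt_trans (le_trans _ (nneseries_geometric cQ0 (ltW q0) q1)) (ltry _).
apply: lee_nneseries => [k _ _|k _]; first by apply: integral_ge0.
rewrite ge0_integralZl_EFin//.
have := kernel_variance d0 alpha1 abeta lambda0 z1 bs (leqnSn k) intensity c0 varPi.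
rewrite big_nat1 -EFinM => h.
apply: le_trans (lee_wpmul2l _ h) _; first by rewrite lee_fin.
rewrite -EFinM lee_fin -/(decay beta s) -/q -/Q -exprM mulnC exprM.
have qn : q ^+ k != 0 by rewrite expf_neq0// gt_eqF.
rewrite [leLHS](_ : _ = c * Q * q ^+ k)//.
by move: (q ^+ k) qn => t tn; field.
Qed.

Variables (s : nat -> R) (bs : forall n, beta < s n).
Hypothesis ss : (\sum_(0 <= n <oo) (s n - beta)%:E < +oo)%E.

Let smax : R := beta + fine (\sum_(0 <= n <oo) (s n - beta)%:E)%E.

Let s_le n : s n <= smax.
Proof.
have t0 k : (0 <= (s k - beta)%:E)%E by rewrite lee_fin subr_ge0 ltW.
have S0 : (0 <= \sum_(0 <= n <oo) (s n - beta)%:E)%E by apply: nneseries_ge0 => *; exact: t0.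
rewrite /smax -lerBlDl -lee_fin fineK ?ge0_fin_numE//.
apply: le_trans (_ : (\sum_(0 <= k < n.+1) (s k - beta)%:E <= _)%E).
  by rewrite big_nat_recr//= leeDr// sume_ge0.
by apply: nneseries_lim_ge => *; exact: t0.
Qed.

Let A0 : R := lambda * (radc (d:=d) (- (beta + 1)) * expR (- smax)).

Let A0_gt0 : 0 < A0.
Proof. by have rc := @radc_gt0 R d (- (beta + 1)); rewrite mulr_gt0// mulr_gt0// expR_gt0. Qed.

Local Notation C_ n := (ctot (d:=d) beta lambda (s n)).

(** As the exponent decreases to the critical one the expected total weight grows like the
    inverse of [1 - q], and its square beats the variance. *)
Lemma normalized_variance n N k (I : \bar R) : 0 <= k ->
  (I <= k%:E * \sum_(0 <= i < N) (Q * (expR (- (s n - beta)) ^+ 2) ^+ i)%:E)%E ->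
  ((((C_ n)^-1) ^+ 2)%:E * I <= (4 * k * Q / A0 ^+ 2 * (s n - beta))%:E)%E.
Proof.
move=> k0; rewrite -/(decay beta (s n)); set q := decay beta (s n) => hI.
have q0 : 0 < q by exact: decay_gt0.
have q1 : q < 1 by exact: decay_lt1.
have qs : 1 - q <= s n - beta.
  by have := expR_ge1Dx (- (s n - beta)); rewrite -/(decay beta (s n)) -/q; lra.
have A0p := A0_gt0; have sl := s_le n.
have Cge : A0 / (2 * (1 - q)) <= C_ n.
  apply: le_trans (ctot_ge d0 alpha1 abeta lambda0 (bs n)).
  rewrite -/q; apply: ler_wpM2r; first by rewrite invr_ge0 mulr_ge0// subr_ge0 ltW.
  apply: ler_wpM2l; first exact: ltW.
  apply: ler_wpM2l; first exact/ltW/radc_gt0.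
  by rewrite ler_expR lerN2.
have L0 : 0 < A0 / (2 * (1 - q)) by rewrite divr_gt0// mulr_gt0// subr_gt0.
have CV : (C_ n)^-1 <= 2 * (1 - q) / A0.
  rewrite -[leRHS]invrK invf_div lef_pV2//; exact: lt_le_trans L0 Cge.
have CV0 : 0 <= (C_ n)^-1 by rewrite invr_ge0 (le_trans _ Cge)// ltW.
have q2 : q ^+ 2 < 1 by rewrite expr_lt1// ltW.
have Ib : (I <= (k * (Q * (1 - q ^+ 2)^-1))%:E)%E.
  apply: le_trans hI _; rewrite sumEFin -EFinM lee_fin; apply: ler_wpM2l => //.
  rewrite -mulr_sumr; apply: ler_wpM2l => //.
  by apply: geometric_le => //; rewrite exprn_ge0// ltW.
apply: le_trans (lee_wpmul2l _ Ib) _; first by rewrite lee_fin exprn_ge0.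
rewrite -EFinM lee_fin.
have kQ : 0 <= k * Q by rewrite mulr_ge0.
have u0 : 0 < 1 - q by rewrite subr_gt0.
have step1 : (C_ n)^-1 ^+ 2 <= (2 * (1 - q) / A0) ^+ 2.
  by rewrite lerXn2r// nnegrE; exact: le_trans CV0 CV.
have step2 : (1 - q ^+ 2)^-1 <= (1 - q)^-1.
  by rewrite lef_pV2 ?posrE ?subr_gt0//; nra.
have v0 : 0 <= (1 - q ^+ 2)^-1 by rewrite invr_ge0 subr_ge0 ltW.
apply: le_trans (_ : (2 * (1 - q) / A0) ^+ 2 * (k * (Q * (1 - q)^-1)) <= _).
  apply: ler_pM => //; first by rewrite exprn_ge0.
    by rewrite mulr_ge0// mulr_ge0.
  by apply: ler_wpM2l => //; exact: ler_wpM2l.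
rewrite [leLHS](_ : _ = 4 * k * Q / A0 ^+ 2 * (1 - q)); last first.
  have un : 1 - q != 0 by rewrite gt_eqF.
  have An : A0 != 0 by rewrite gt_eqF.
  by move: (1 - q) un (A0) An => t tn w wn; field; rewrite ?tn ?wn.
by apply: ler_wpM2l => //; rewrite divr_ge0 ?exprn_ge0 ?(ltW A0p)// mulr_ge0// mulr_ge0.
Qed.

Lemma summable_rate k : 0 <= k ->
  (\sum_(0 <= n <oo) (4 * k * Q / A0 ^+ 2 * (s n - beta))%:E < +oo)%E.
Proof.
move=> k0; have r0 : 0 <= 4 * k * Q / A0 ^+ 2.
  by rewrite divr_ge0 ?exprn_ge0 ?(ltW A0_gt0)// mulr_ge0// mulr_ge0.
under eq_eseriesr do rewrite EFinM.
rewrite nneseriesZl//; last by move=> n _; rewrite lee_fin subr_ge0 ltW.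
by rewrite lte_mul_pinfty// lee_fin.
Qed.

Let rate_ge0 k n : 0 <= k -> 0 <= 4 * k * Q / A0 ^+ 2 * (s n - beta).
Proof.
move=> k0; rewrite mulr_ge0 ?subr_ge0 ?(ltW (bs n))//.
by rewrite divr_ge0 ?exprn_ge0 ?(ltW A0_gt0)// mulr_ge0// mulr_ge0.
Qed.

Lemma ae_kernel_deviation : {ae Pi, forall X : Om, (fun n => limn_einf (fun N =>
  (((C_ n)^-1 ^+ 2)%:E * kdev alpha beta lambda z (s n) 0 N X)%E)) @ \oo --> 0%E}.
Proof.
have k0 n N X : (0 <= kdev alpha beta lambda z (s n) 0 N X)%E by exact: sqnorm_ge0.
have mk n N : measurable_fun setT (kdev alpha beta lambda z (s n) 0 N).
  exact: (measurable_kdev alpha beta lambda z1 (s n) (leq0n N)).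
have C2 n : 0 <= (C_ n)^-1 ^+ 2 by exact: sqr_ge0.
apply: (ae_limn_einf_cvg0 (v := fun n => 4 * c * Q / A0 ^+ 2 * (s n - beta))).
- by move=> n N; apply: emeasurable_funM; [exact: measurable_cst|exact: mk].
- by move=> n N X; rewrite mule_ge0// lee_fin.
- by move=> n; apply: rate_ge0; exact: ltW.
- move=> n N; rewrite ge0_integralZl_EFin//.
  apply: (normalized_variance (N := N)); first exact: ltW.
  exact: (kernel_variance d0 alpha1 abeta lambda0 z1 (bs n) (leq0n N) intensity c0 varPi).
- by apply: summable_rate; exact: ltW.
Qed.

Lemma ae_weight_deviation : {ae Pi, forall X : Om, (fun n => limn_einf (fun N =>
  (((csum (reg z 0 N) X (weight beta (s n) z) - cw (d:=d) beta lambda (s n) 0 N) / C_ n) ^+ 2)%:E))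
  @ \oo --> 0%E}.
Proof.
have bc0 : 0 < bc by exact: bergman_const_gt0.
have cb0 : 0 <= c / bc by rewrite divr_ge0// ltW.
pose g n N (X : Om) := csum (reg z 0 N) X (weight beta (s n) z) - cw (d:=d) beta lambda (s n) 0 N.
have mg n N : measurable_fun setT (g n N).
  apply: measurable_funB; last exact: measurable_cst.
  apply: (measurable_csum _ _ (@reg_regr _ _ _ z1 0 N)).
  - exact: measurable_reg.
  - exact: regr_lt1.
  - exact: measurable_weight.
have mg2 n N : measurable_fun setT (fun X => ((g n N X) ^+ 2)%:E).
  by apply/measurable_EFinP; apply: measurable_funX.
apply: (ae_limn_einf_cvg0 (D := fun n N X => ((g n N X / C_ n) ^+ 2)%:E)
  (v := fun n => 4 * (c / bc) * Q / A0 ^+ 2 * (s n - beta))).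
- move=> n N; apply/measurable_EFinP; apply: measurable_funX.
  by apply: measurable_funM => //; exact: measurable_cst.
- by move=> n N X; rewrite lee_fin sqr_ge0.
- by move=> n; exact: rate_ge0.
- move=> n N.
  have -> : (\int[Pi]_X ((g n N X / C_ n) ^+ 2)%:E = ((C_ n)^-1 ^+ 2)%:E * \int[Pi]_X (g n N X ^+ 2)%:E)%E.
    rewrite -ge0_integralZl_EFin//; last 2 first.
    - by move=> X _; rewrite lee_fin sqr_ge0.
    - exact: sqr_ge0.
    by apply: eq_integral => X _; rewrite -EFinM exprMn mulrC.
  apply: (normalized_variance (N := N)) => //.
  exact: (weight_variance d0 alpha1 abeta lambda0 z1 (bs n) (leq0n N) intensity c0 varPi).
- exact: summable_rate.
Qed.

Lemma ae_averages_converge : {ae Pi, forall X : Om,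
  [/\ forall n, (\sum_(0 <= k <oo) A2norm alpha (shell_kernel_sum beta X alpha (s n) zE k) < +oo)%E,
      exists S : nat -> 'rV[C R]_d -> C R,
        (forall n, A2_series alpha (shell_kernel_sum beta X alpha (s n) zE) (S n)) /\
        (fun n => A2norm alpha (fun y =>
           S n y / toC (total_weight beta X (s n) zE) - K y z)) @ \oo --> 0%E &
      forall f : 'rV[C R]_d -> C R, A2 alpha f -> exists S : nat -> C R,
        (forall n, (fun N : nat => \sum_(k < N) shell_sum beta X (s n) zE f k) @ \oo --> S n) /\
        (fun n => S n / toC (total_weight beta X (s n) zE)) @ \oo --> f z]}.
Proof.
have F1 := ae_foralln (fun n => ae_shell_deviation (bs n)).
apply: filterS3 F1 ae_kernel_deviation ae_weight_deviation => X f1 f2 f3.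
exact: (averages_converge d0 alpha1 abeta lambda0 bs f1 f2 f3).
Qed.

End AlmostSure.

Theorem theorem5p3 (R : realType) (d : nat) (alpha beta lambda : R)
    (D : set (uball R d)) (s : nat -> R)
    (Pi : probability (Conf (uball R d)) R) :
  (1 <= d)%N -> -1 < alpha -> alpha + d%:R + 1 <= beta -> 0 < lambda ->
  countable D -> dense D ->
  (forall n, beta < s n) ->
  (\sum_(0 <= n <oo) (s n - beta)%:E < +oo)%E ->
  small_variance Pi ->
  (forall B : set (uball R d), borel B ->
    first_intensity Pi B =
    (\int[v_ d]_(z in [set \val x | x in B])
      (lambda / (1 - cnorm z ^+ 2) `^ (beta + 1))%:E)%E) ->
  {ae Pi, forall X : Conf (uball R d),
    [/\ forall n z, D z ->
          (\sum_(0 <= k <oo) A2norm alpha (shell_kernel_sum beta X alpha (s n) z k)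
             < +oo)%E,
        forall z, D z -> exists S : nat -> 'rV[C R]_d -> C R,
          (forall n,
             A2_series alpha (shell_kernel_sum beta X alpha (s n) z) (S n)) /\
          (fun n => A2norm alpha (fun y =>
             S n y / toC (total_weight beta X (s n) z) -
             bergman_kernel alpha y (\val z))) @ \oo --> 0%E &
        forall f : 'rV[C R]_d -> C R, A2 alpha f -> forall z, D z ->
          exists S : nat -> C R,
            (forall n, (fun N : nat =>
               \sum_(k < N) shell_sum beta X (s n) z f k) @ \oo --> S n) /\
            (fun n => S n / toC (total_weight beta X (s n) z)) @ \oo -->
              f (\val z)]}.

Proof.
move=> d0 alpha1 abeta lambda0 cD _ bs ss [c c0 varPi] intensity.
have base z := ae_averages_converge d0 alpha1 abeta lambda0 intensity c0 varPi z bs ss.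
have /countable_injP[r rI] := cD.
pose P X z := [/\ forall n,
    (\sum_(0 <= k <oo) A2norm alpha (shell_kernel_sum beta X alpha (s n) z k) < +oo)%E,
    exists S : nat -> 'rV[C R]_d -> C R,
      (forall n, A2_series alpha (shell_kernel_sum beta X alpha (s n) z) (S n)) /\
      (fun n => A2norm alpha (fun y =>
         S n y / toC (total_weight beta X (s n) z) - bergman_kernel alpha y (\val z))) @ \oo --> 0%E &
    forall f : 'rV[C R]_d -> C R, A2 alpha f -> exists S : nat -> C R,
      (forall n, (fun N : nat => \sum_(k < N) shell_sum beta X (s n) z f k) @ \oo --> S n) /\
      (fun n => S n / toC (total_weight beta X (s n) z)) @ \oo --> f (\val z)].
(* Enumerating the countable set turns the exceptional sets into a sequence. *)
have key k : {ae Pi, forall X : Conf (uball R d), forall z, D z -> r z = k -> P X z}.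
  have [[z [Dz rz]]|no] := pselect (exists z, D z /\ r z = k).
    apply: filterS (base z) => X PX z' Dz' rz'.
    have <- : z = z' by apply: rI; rewrite ?inE// rz rz'.
    exact: PX.
  by apply: aeW => X z Dz rz; case: no; exists z.
apply: filterS (ae_foralln key) => X H.
by split=> [n z Dz|z Dz|f Af z Dz]; have [h1 h2 h3] := H _ z Dz erefl; [exact: h1|exact: h2|exact: h3].
Qed.
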